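(* Fix $\alpha>0$. For every positive integer $d$ (large enough that $\lfloor \alpha d^2\rfloor\geq 1$), let $W_d$ be a $(d^2,\lfloor \alpha d^2 \rfloor)$-Wishart matrix (real or complex), and let $Y_d=W_d^\Gamma$ be the partial transposition of $W_d$. Then, for every $\varepsilon > 0$, \[ \lim_{d \to \infty} \mathbf{P} \left( \left| \lambda_{\max}(Y_d) - \left(1+\frac{2}{\sqrt{\alpha}}\right) \right| > \varepsilon \right) = 0 ,\] \[ \lim_{d \to \infty} \mathbf{P} \left( \left| \lambda_{\min}(Y_d) - \left(1-\frac{2}{\sqrt{\alpha}}\right) \right| > \varepsilon \right) = 0 .\]
   Context: A $(n,p)$-Wishart matrix is a random $n\times n$ matrix $W=\frac1p GG^\dagger$, where $G$ is an $n\times p$ matrix with independent $N(0,1)$ entries, either all real or all complex. A complex $N(0,1)$ variable has independent real and imaginary parts, each real $N(0,\frac12)$. The result is asserted in both the real and the complex case. For $n=d^2$, an $n\times n$ matrix $A$ is viewed as a $d\times d$ block matrix with $d\times d$ blocks, with entries $A_{i,j}^{k,l}$ ($i,j,k,l\in\{1,\dots,d\}$): $i$ is the block row index, $j$ the block column index, $k$ the row index and $l$ the column index inside block $(i,j)$. The partial transposition $A^\Gamma$ is obtained by transposing each block: $(A^\Gamma)_{i,j}^{k,l}=A_{i,j}^{l,k}$. $\lambda_{\min}(A)$ and $\lambda_{\max}(A)$ denote the smallest and largest eigenvalues of a Hermitian matrix $A$. *)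

(* Defs.v *)
From HB Require Import structures.
From mathcomp Require Import all_boot all_order all_algebra.
From mathcomp Require Import complex.
From mathcomp Require Import all_classical all_reals all_analysis.

Set Implicit Arguments.
Unset Strict Implicit.
Unset Printing Implicit Defensive.

Import Order.TTheory GRing.Theory Num.Theory.
Import numFieldNormedType.Exports.

Local Open Scope classical_set_scope.
Local Open Scope ring_scope.
Local Open Scope complex_scope.
Local Open Scope sesquilinear_scope.

Section Independence.
Context {R : realType} {dT dE : measure_display}.
Context {T : measurableType dT} {E : measurableType dE}.

Definition mutually_independent (P : probability T R) (I : finType)
    (X : I -> T -> E) : Prop :=
  forall (J : {set I}) (B : I -> set E), (forall i, measurable (B i)) ->
    (P (\bigcap_(i in [set` J]) (X i @^-1` B i)) =
     \prod_(i in J) P (X i @^-1` B i))%E.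

End Independence.

Section Gaussian.
Context {R : realType} {dT : measure_display} {T : measurableType dT}.

(* The library's [normal_prob m s] takes the standard deviation [s]. *)
Definition is_normal (P : probability T R) (m variance : R) (X : T -> R) : Prop :=
  measurable_fun [set: T] X /\
  forall B : set R, measurable B ->
    P (X @^-1` B) = normal_prob m (Num.sqrt variance) B.

Definition is_complex_normal (P : probability T R) (Z : T -> R[i]) : Prop :=
  [/\ is_normal P 0 (1 / 2) (fun w => complex.Re (Z w)),
      is_normal P 0 (1 / 2) (fun w => complex.Im (Z w)) &
      mutually_independent P
        (fun (b : bool) w => if b then complex.Re (Z w) else complex.Im (Z w))].

Definition real_gaussian_matrix (P : probability T R) (n p : nat)
    (G : T -> 'M[R]_(n, p)) : Prop :=
  (forall i j, is_normal P 0 1 (fun w => G w i j)) /\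
  mutually_independent P (fun (ij : 'I_n * 'I_p) w => G w ij.1 ij.2).

(* [R[i]] carries no sigma-algebra in the library: independence of the complex
   entries is expressed in the product Borel space [R * R]. *)
Definition complex_gaussian_matrix (P : probability T R) (n p : nat)
    (G : T -> 'M[R[i]]_(n, p)) : Prop :=
  (forall i j, is_complex_normal P (fun w => G w i j)) /\
  mutually_independent P (fun (ij : 'I_n * 'I_p) w =>
    (complex.Re (G w ij.1 ij.2), complex.Im (G w ij.1 ij.2))).

Variant entry_kind := RealEntries | ComplexEntries.

Definition gaussian_matrix (k : entry_kind) (P : probability T R) (n p : nat)
    (G : T -> 'M[R[i]]_(n, p)) : Prop :=
  match k with
  | RealEntries => exists2 G0 : T -> 'M[R]_(n, p), real_gaussian_matrix P G0 &
      forall w, G w = map_mx (real_complex R) (G0 w)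
  | ComplexEntries => complex_gaussian_matrix P G
  end.

Definition is_wishart (k : entry_kind) (P : probability T R) (n p : nat)
    (W : T -> 'M[R[i]]_n) : Prop :=
  exists2 G : T -> 'M[R[i]]_(n, p), gaussian_matrix k P G &
    forall w, W w = p%:R^-1 *: (G w *m (G w)^t*).

End Gaussian.

Section PartialTransposition.
Variables (K : Type) (d : nat).

(* [mxvec_index i k] is the index [i * d + k]: position [k] inside block [i]. *)
Definition block_entry (A : 'M[K]_(d * d)) (i j k l : 'I_d) : K :=
  A (mxvec_index i k) (mxvec_index j l).

Definition block_index (r : 'I_(d * d)) : 'I_d * 'I_d :=
  enum_val (cast_ord (esym (mxvec_cast d d)) r).

Definition partial_transpose (A : 'M[K]_(d * d)) : 'M[K]_(d * d) :=
  \matrix_(r, s) block_entry A (block_index r).1 (block_index s).1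
                               (block_index s).2 (block_index r).2.

Lemma mxvec_indexK (i k : 'I_d) : block_index (mxvec_index i k) = (i, k).
Proof. by rewrite /block_index /mxvec_index cast_ordK enum_rankK. Qed.

Lemma val_mxvec_index (i k : 'I_d) : mxvec_index i k = (i * d + k)%N :> nat.
Proof.
rewrite /mxvec_index /= /enum_rank enum_rank_in.unlock insubdK; last first.
  by rewrite -[_ \in _]/(_ < _)%N cardE index_mem mem_enum.
rewrite enumT unlock /=.
have -> : prod_enum 'I_d 'I_d = [seq (x, y) | x <- enum 'I_d, y <- enum 'I_d].
  by [].
have H (s : seq 'I_d) : i \in s ->
    index (i, k) [seq (x, y) | x <- s, y <- enum 'I_d] = (index i s * d + k)%N.
  elim: s => //= x s IH; rewrite inE eq_sym index_cat size_map size_enum_ord.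
  have [-> _|xi /= /IH ->] := eqVneq x i.
    rewrite map_f ?mem_enum // index_map ?index_enum_ord //.
    by move=> y z [].
  rewrite ifN; last by apply/mapP => -[y _ [/esym/eqP]]; rewrite (negPf xi).
  by rewrite mulSn addnA.
by rewrite H ?mem_enum // index_enum_ord.
Qed.

Lemma partial_transposeE (A : 'M[K]_(d * d)) (i j k l : 'I_d) :
  block_entry (partial_transpose A) i j k l = block_entry A i j l k.
Proof. by rewrite {1}/block_entry mxE !mxvec_indexK. Qed.

End PartialTransposition.

Lemma partial_transpose_hermitian (R : realType) (d : nat)
    (A : 'M[R[i]]_(d * d)) :
  A \is hermsymmx -> partial_transpose A \is hermsymmx.
Proof.
move=> /is_hermitianmxP; rewrite expr0 scale1r => AA.
apply/is_hermitianmxP; rewrite expr0 scale1r; apply/matrixP => r s.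
by rewrite !mxE /block_entry {1}AA !mxE.
Qed.

Lemma wishart_hermitian (R : realType) (dT : measure_display)
    (T : measurableType dT) (k : entry_kind) (P : probability T R) (n p : nat)
    (W : T -> 'M[R[i]]_n) (w : T) : is_wishart k P p W -> W w \is hermsymmx.
Proof.
case=> G _ ->; apply/is_hermitianmxP; rewrite expr0 scale1r.
rewrite linearZ /= map_mxZ trmx_mul map_mxM fmorphV rmorph_nat.
by rewrite [in RHS]trmxCK.
Qed.

Section ExtremeEigenvalues.
Variables (R : realType) (n : nat).
Implicit Type A : 'M[R[i]]_n.

(* For Hermitian [A] with [n > 0], this set is finite and nonempty, so that its
   supremum and infimum are attained; see [lambda_maxP] and [lambda_minP]. *)
Definition spectrum A : set R := [set x : R | eigenvalue A x%:C].

Definition lambda_max A : R := sup (spectrum A).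
Definition lambda_min A : R := inf (spectrum A).

Lemma hermitian_eigenvalue_real A (a : R[i]) :
  A \is hermsymmx -> eigenvalue A a -> a = (complex.Re a)%:C.
Proof.
move=> /is_hermitianmxP; rewrite expr0 scale1r => AA /eigenvalueP[u uA u0].
have uu0 : (u *m u^t*) 0 0 != 0.
  apply: contra u0 => /eqP; rewrite mxE => uu0; apply/eqP/rowP => j; rewrite mxE.
  have H (i : 'I_n) : true -> 0 <= u 0 i * (u^t*) i 0.
    by move=> _; rewrite !mxE mul_conjC_ge0.
  have /(_ j isT)/eqP := psumr_eq0P H uu0.
  by rewrite !mxE mul_conjC_eq0 => /eqP.
have E1 : u *m A *m u^t* = a *: (u *m u^t*) by rewrite uA scalemxAl.
have E2 : u *m A *m u^t* = Num.conj a *: (u *m u^t*).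
  rewrite -mulmxA {1}AA -map_mxM -trmx_mul uA.
  by rewrite linearZ /= map_mxZ -scalemxAr.
have /(congr1 (fun M : 'M[R[i]]_1 => M 0 0)) :
  a *: (u *m u^t*) = Num.conj a *: (u *m u^t*).
  by rewrite -E1 E2.
rewrite ![in LHS]mxE ![in RHS]mxE => /(mulIf _) aE.
rewrite RRe_real //; apply/CrealP; apply/esym/aE.
by move: uu0; rewrite mxE.
Qed.

Lemma spectrum_seq A : (0 < n)%N -> A \is hermsymmx ->
  exists2 s : seq R, s != [::] & forall x, spectrum A x <-> x \in s.
Proof.
move=> n0 hA; have [r rE] := closed_field_poly_normal (char_poly A).
have rP a : eigenvalue A a = (a \in r).
  rewrite eigenvalue_root_char rE rootZ ?root_prod_XsubC //.
  by rewrite lead_coef_eq0 monic_neq0 // char_poly_monic.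
exists (map (@complex.Re R) r).
  have [a] := eigenvalue_closed A n0.
  by rewrite rP; case: (r).
move=> x; split => [|/mapP[a ar ->]]; rewrite /spectrum /= ?rP.
  by move=> xr; apply/mapP; exists x%:C.
by rewrite -(hermitian_eigenvalue_real hA) ?rP.
Qed.

Lemma lambda_maxP A : (0 < n)%N -> A \is hermsymmx ->
  eigenvalue A (lambda_max A)%:C /\
  (forall x : R, eigenvalue A x%:C -> x <= lambda_max A).
Proof.
move=> n0 hA; have [s s0 sP] := spectrum_seq n0 hA.
have [m ms mP] : exists2 m, m \in s & forall x, x \in s -> x <= m.
  elim: (s) s0 => // x [|y t] IH _.
    by exists x => [|z]; rewrite inE ?eqxx // => /eqP ->.
  have [//|m mt mP] := IH; have [xm|mx] := leP x m.
    exists m => [|z]; first by rewrite inE mt orbT.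
    by rewrite inE => /predU1P[-> //|/mP].
  exists x => [|z]; first by rewrite mem_head.
  by rewrite inE => /predU1P[-> //|/mP zm]; rewrite (le_trans zm) ?ltW.
have ubm : ubound (spectrum A) m by move=> x /sP/mP.
suff -> : lambda_max A = m by split=> [|x xA]; [exact/sP | exact: ubm].
apply/eqP; rewrite eq_le; apply/andP; split.
  by apply: ge_sup => //; exists m; exact/sP.
by apply: ub_le_sup; [exists m | exact/sP].
Qed.

Lemma lambda_minP A : (0 < n)%N -> A \is hermsymmx ->
  eigenvalue A (lambda_min A)%:C /\
  (forall x : R, eigenvalue A x%:C -> lambda_min A <= x).
Proof.
move=> n0 hA; have [s s0 sP] := spectrum_seq n0 hA.
have [m ms mP] : exists2 m, m \in s & forall x, x \in s -> m <= x.
  elim: (s) s0 => // x [|y t] IH _.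
    by exists x => [|z]; rewrite inE ?eqxx // => /eqP ->.
  have [//|m mt mP] := IH; have [mx|xm] := leP m x.
    exists m => [|z]; first by rewrite inE mt orbT.
    by rewrite inE => /predU1P[-> //|/mP].
  exists x => [|z]; first by rewrite mem_head.
  by rewrite inE => /predU1P[-> //|/mP mz]; rewrite (le_trans _ mz) ?ltW.
have lbm : lbound (spectrum A) m by move=> x /sP/mP.
suff -> : lambda_min A = m by split=> [|x xA]; [exact/sP | exact: lbm].
apply/eqP; rewrite eq_le; apply/andP; split.
  by apply: ge_inf; [exists m | exact/sP].
by apply: lb_le_inf => //; exists m; exact/sP.
Qed.

End ExtremeEigenvalues.

(* Main.v *)
Require Import Defs.
From HB Require Import structures.
From mathcomp Require Import all_boot all_order all_algebra.
From mathcomp Require Import complex.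
From mathcomp Require Import all_classical all_reals all_analysis.
From mathcomp Require Import measurable_realfun.
From mathcomp Require Import zify ring lra.
Set Implicit Arguments. Unset Strict Implicit. Unset Printing Implicit Defensive.
Import Order.TTheory GRing.Theory Num.Theory.
Import numFieldNormedType.Exports.
Local Open Scope classical_set_scope.
Local Open Scope ring_scope.
Local Open Scope complex_scope.
Local Open Scope sesquilinear_scope.

                                     

(** Put n = d^2 and p = floor(alpha d^2). Up to a sign [sgn], the matrix (p / sqrt(p n)) (Y - 1),
    where Y is the partial transpose, is a sum of p independent centred Hermitian matrices Z_k, one
    for each column v of the Gaussian matrix: Z_k is [sgn] / sqrt(p n) times the partial transpose
    of the rank-one matrix of v, minus the identity. Two facts about a single Z_k carry the proof. -
    Its entries are far from independent, but their covariance is exactly that of a Wigner matrix,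
    GUE in the complex and GOE in the real case. This is Wick's formula ([wick4]) combined with the
    fact that the exchange of half indices is injective on pairs ([ExC_colZZ]). - Acting on row
    vectors reshaped as d x d matrices, the partial transpose of a rank-one matrix amounts to two
    multiplications by v reshaped as a d x d matrix. Its norm is therefore at most the squared norm
    of a Gaussian d x d matrix, which exceeds a slightly larger power than d only with tiny
    probability ([opb_partial_transpose], [netb_prob]). So the norm of Z_k is barely larger than
    1/d, and its cube is negligible against 1/p: second-order perturbation theory suffices.

    The partial sums S_j then evolve like a matrix Brownian motion, whose limit law at time t = j/p
    is the semicircle of variance t. Fix u0 > 1 and follow the resolvent A of S_j at the moving
    point u_j = u0 + t / u0, a characteristic of the Burgers equation of the semicircle flow. Write
    X_q = tr(A^q) / n. Averaging the expansion [resolvent_expand] over the next column gives X_1 the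
    drift X_2 (X_1 - 1/u0) / p, so X_1 stays close to 1/u0; X_2 obeys a Riccati inequality and stays
    below an explicit solution; and X_q, for a large fixed q, grows at most by a factor 1 + O(1/p)
    per step. The three controls support each other and are gathered in one Lyapunov functional
    ([lyap], [lyapunov_step]). While it is at most 1 one has X_q <= n, hence the norm of A is at
    most n^(2/q), a small power of d, and a step much shorter than the inverse of that norm cannot
    push an eigenvalue across the barrier u_j. Stopping the process when the functional exceeds 1 or
    a column is too large, and applying Gronwall, one finds that failure has vanishing probability
    ([barrier_prob]).

    At the final time all eigenvalues lie below u0 + 1/u0, and the normalised resolvent trace at
    that point is close to 1/u0. With u0 near 1 this bounds the top eigenvalue by 2 + o(1). For the
    lower bound, two values of u0 near 1 are compared: the points u0 + 1/u0 are then at distance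
    O(h^2) while the resolvent traces differ by order h, which is impossible if the spectrum stays
    below 2 - del ([edge_lower]). Finally p / sqrt(p n) tends to sqrt(alpha), so the edge 2 becomes
    1 + 2 / sqrt(alpha) for Y; the sign -1 gives the smallest eigenvalue ([wishart_edge]). *)

Section MatrixBounds.
Variable C : numClosedFieldType.

(** * Traces, quadratic forms and operator-norm bounds *)

Lemma trmxC_mul m n p (A : 'M[C]_(m, n)) (B : 'M[C]_(n, p)) :
  (A *m B)^t* = B^t* *m A^t*.
Proof. by rewrite trmx_mul map_mxM. Qed.

Lemma trmxC_add m n (A B : 'M[C]_(m, n)) : (A + B)^t* = A^t* + B^t*.
Proof. by rewrite linearD map_mxD. Qed.

Lemma trmxC_exp n (A : 'M[C]_n) k : (A ^+ k)^t* = A^t* ^+ k.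
Proof.
elim: k => [|k IH]; first by rewrite !expr0 trmx1 map_mx1.
by rewrite exprS exprSr -IH trmxC_mul.
Qed.

Lemma mxtraceE2 m n (A B : 'M[C]_(m, n)) :
  \tr (A *m B^t*) = \sum_i \sum_j A i j * (B i j)^*.
Proof. by apply: eq_bigr => i _; rewrite mxE; apply: eq_bigr => j _; rewrite !mxE. Qed.

Lemma mxtrace_mulCt_ge0 m n (A : 'M[C]_(m, n)) : 0 <= \tr (A *m A^t*).
Proof.
by rewrite mxtraceE2; apply: sumr_ge0 => i _; apply: sumr_ge0 => j _; rewrite mul_conjC_ge0.
Qed.

Lemma mxtrace_dotmx m n (A B : 'M[C]_(m, n)) :
  \tr (A *m B^t*) = dotmx (mxvec A) (mxvec B).
Proof.
rewrite mxtraceE2 dotmxE mxE (reindex _ (curry_mxvec_bij _ _)) /= pair_bigA /=.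
by apply: eq_bigr => -[i j] _; rewrite !mxE /= !mxvecE.
Qed.

Lemma mxtrace_CauchySchwarz m n (A B : 'M[C]_(m, n)) :
  `|\tr (A *m B^t*)| ^+ 2 <= \tr (A *m A^t*) * \tr (B *m B^t*).
Proof. by rewrite !mxtrace_dotmx; exact: (CauchySchwarz (@dotmx C _) _ _).1. Qed.

Definition qform n (A : 'M[C]_n) (v : 'rV[C]_n) : C := (v *m A *m v^t*) 0 0.
Definition sqn n (v : 'rV[C]_n) : C := (v *m v^t*) 0 0.

Lemma sqn_ge0 n (v : 'rV[C]_n) : 0 <= sqn v.
Proof.
by rewrite /sqn mxE sumr_ge0 // => i _; rewrite !mxE mul_conjC_ge0.
Qed.

Lemma sqnE n (v : 'rV[C]_n) : sqn v = \sum_i `|v 0 i| ^+ 2.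
Proof. by rewrite /sqn mxE; apply: eq_bigr => i _; rewrite !mxE normCK. Qed.

Lemma sqn_eq0 n (v : 'rV[C]_n) : sqn v = 0 -> v = 0.
Proof.
move=> v0; apply/rowP => i; rewrite mxE; apply/eqP.
have H (j : 'I_n) : true -> 0 <= `|v 0 j| ^+ 2 by rewrite exprn_ge0.
have := psumr_eq0P H; rewrite -sqnE => /(_ v0 i isT)/eqP.
by rewrite expf_eq0 normr_eq0.
Qed.

Lemma sqnZ n (c : C) (v : 'rV[C]_n) : sqn (c *: v) = `|c| ^+ 2 * sqn v.
Proof. by rewrite !sqnE mulr_sumr; apply: eq_bigr => i _; rewrite mxE normrM exprMn. Qed.

Lemma dot_CauchySchwarz n (v w : 'rV[C]_n) :
  `|(v *m w^t*) 0 0| ^+ 2 <= sqn v * sqn w.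
Proof.
by have := mxtrace_CauchySchwarz v w; rewrite /mxtrace !big_ord1.
Qed.

Lemma sqn_triangle n (v w : 'rV[C]_n) (a b : C) : 0 <= a -> 0 <= b ->
  sqn v <= a ^+ 2 -> sqn w <= b ^+ 2 -> sqn (v + w) <= (a + b) ^+ 2.
Proof.
move=> a0 b0 va wb.
have sE (u : 'rV[C]_n) : sqn u = dotmx u u by rewrite dotmxE.
have sq u c : 0 <= c -> sqn u <= c ^+ 2 -> sqrtC (sqn u) <= c.
  move=> c0 uc; rewrite -(@ler_pXn2r _ 2) ?nnegrE ?sqrtC_ge0 ?sqn_ge0 //.
  by rewrite sqrtCK.
rewrite -[leLHS]sqrtCK ler_pXn2r ?nnegrE ?sqrtC_ge0 ?sqn_ge0 ?addr_ge0 //.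
have : sqrtC (dotmx (v + w) (v + w)) <= sqrtC (dotmx v v) + sqrtC (dotmx w w).
  exact: (triangle_lerif (@dotmx C n) v w).1.
by rewrite -!sE => /le_trans; apply; apply: lerD; exact: sq.
Qed.

                                                                             
(** Operator norm at most [c] for the action on row vectors; [c] lives in [C] because [sqn] does. *)
Definition opb n (c : C) (A : 'M[C]_n) :=
  0 <= c /\ forall v : 'rV[C]_n, sqn (v *m A) <= c ^+ 2 * sqn v.

Lemma opb_le n (a b : C) (A : 'M[C]_n) : a <= b -> opb a A -> opb b A.
Proof.
move=> ab [a0 H]; split; first exact: le_trans ab.
move=> v; apply: le_trans (H v) _; apply: ler_wpM2r; first exact: sqn_ge0.
by rewrite ler_pXn2r ?nnegrE // (le_trans a0).
Qed.

Lemma opbM n (a b : C) (A B : 'M[C]_n) : opb a A -> opb b B -> opb (a * b) (A * B).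
Proof.
move=> [a0 HA] [b0 HB]; split; first exact: mulr_ge0.
move=> v; rewrite mulmxA; apply: le_trans (HB _) _.
rewrite exprMn [_ * b ^+ 2]mulrC -[leRHS]mulrA; apply: ler_wpM2l => //.
by rewrite exprn_ge0.
Qed.

Lemma opb1 n : opb 1 (1 : 'M[C]_n).
Proof. by split=> // v; rewrite mulmx1 expr1n mul1r. Qed.

Lemma opbX n (a : C) (A : 'M[C]_n) k : opb a A -> opb (a ^+ k) (A ^+ k).
Proof.
by move=> HA; elim: k => [|k IH]; [exact: opb1 | rewrite !exprS; exact: opbM].
Qed.

Lemma opb_scalar n (a : C) : opb `|a| (a%:M : 'M[C]_n).
Proof. by split=> // v; rewrite mul_mx_scalar sqnZ. Qed.

Lemma opbZ n (a c : C) (A : 'M[C]_n) : opb a A -> opb (`|c| * a) (c *: A).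
Proof.
move=> HA; have := opbM (opb_scalar n c) HA.
by rewrite -mul_scalar_mx.
Qed.

Lemma opbN n (a : C) (A : 'M[C]_n) : opb a A -> opb a (- A).
Proof. by move=> /(opbZ (-1)); rewrite normrN1 mul1r scaleN1r. Qed.

Lemma opbD n (a b : C) (A B : 'M[C]_n) : opb a A -> opb b B -> opb (a + b) (A + B).
Proof.
move=> [a0 HA] [b0 HB]; split; first exact: addr_ge0.
move=> v; rewrite mulmxDr -[sqn v]sqrtCK -exprMn mulrDl; apply: sqn_triangle.
- by rewrite mulr_ge0 ?sqrtC_ge0 ?sqn_ge0.
- by rewrite mulr_ge0 ?sqrtC_ge0 ?sqn_ge0.
- by rewrite exprMn sqrtCK.
- by rewrite exprMn sqrtCK.
Qed.

Lemma opb_qform n (c : C) (A : 'M[C]_n) v : opb c A -> `|qform A v| <= c * sqn v.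
Proof.
move=> [c0 HA]; rewrite -(@ler_pXn2r _ 2) ?nnegrE ?mulr_ge0 ?sqn_ge0 //.
apply: le_trans (dot_CauchySchwarz _ _) _.
by rewrite exprMn [sqn v ^+ 2]expr2 mulrA; apply: ler_wpM2r => //; exact: sqn_ge0.
Qed.

Lemma mxtrace_qform m n (X : 'M[C]_(m, n)) (M : 'M[C]_n) :
  \tr (X *m M *m X^t*) = \sum_i qform M (row i X).
Proof.
apply: eq_bigr => i _; rewrite /qform -row_mul !mxE.
by apply: eq_bigr => j _; rewrite !mxE.
Qed.

Lemma mxtrace_sqn m n (X : 'M[C]_(m, n)) : \tr (X *m X^t*) = \sum_i sqn (row i X).
Proof.
rewrite -[X in \tr (X *m _)]mulmx1 mxtrace_qform; apply: eq_bigr => i _.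
by rewrite /qform mulmx1.
Qed.

Lemma mxtrace_opb m n (c : C) (X : 'M[C]_(m, n)) (M : 'M[C]_n) : opb c M ->
  `|\tr (X *m M *m X^t*)| <= c * \tr (X *m X^t*).
Proof.
move=> HM; rewrite mxtrace_qform mxtrace_sqn mulr_sumr.
apply: le_trans (ler_norm_sum _ _ _) _; apply: ler_sum => i _; exact: opb_qform.
Qed.

Lemma mxtrace_opb1 n (c : C) (M : 'M[C]_n) : opb c M -> `|\tr M| <= c * n%:R.
Proof.
by move/(mxtrace_opb (1%:M : 'M[C]_n)); rewrite trmx1 map_mx1 !mulmx1 mul1mx mxtrace1.
Qed.

Lemma qformB n (A B : 'M[C]_n) v : qform (A - B) v = qform A v - qform B v.
Proof. by rewrite /qform mulmxBr mulmxBl !mxE. Qed.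

Lemma qformZ n c (A : 'M[C]_n) v : qform (c *: A) v = c * qform A v.
Proof. by rewrite /qform -scalemxAr -scalemxAl mxE. Qed.

(** * Positivity, dyadic Schatten norms and Hölder's inequality for traces of words *)

Definition psd n (A : 'M[C]_n) := forall v : 'rV[C]_n, 0 <= qform A v.

Lemma psd_mxtrace m n (X : 'M[C]_(m, n)) (M : 'M[C]_n) : psd M ->
  0 <= \tr (X *m M *m X^t*).
Proof. by move=> H; rewrite mxtrace_qform sumr_ge0. Qed.

                                                                              
(** With Q = 2^(k+1), this is the Q-th power of the Schatten norm of exponent Q. Only dyadic
    exponents occur, so that Hölder's inequality follows from Cauchy-Schwarz by repeated
    doubling. *)
Definition schat n k (X : 'M[C]_n) : C := \tr ((X^t* * X) ^+ (2 ^ k)).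

Lemma mxtrace_mulr n (A B : 'M[C]_n) : \tr (A * B) = \tr (B * A).
Proof. exact: mxtrace_mulC. Qed.

Lemma mxtrace_expr_mulC n (A B : 'M[C]_n) k : \tr ((A * B) ^+ k.+1) = \tr ((B * A) ^+ k.+1).
Proof.
have -> : (A * B) ^+ k.+1 = A * ((B * A) ^+ k * B).
  elim: k => [|k IH]; first by rewrite expr1 expr0 mul1r.
  by rewrite exprS IH exprS !mulrA.
by rewrite mxtrace_mulr -mulrA -exprSr.
Qed.

Lemma schatC n k (X : 'M[C]_n) : schat k (X^t*) = schat k X.
Proof.
rewrite /schat trmxCK; have : (0 < 2 ^ k)%N by rewrite expn_gt0.
by case: (2 ^ k)%N => // m _; rewrite mxtrace_expr_mulC.
Qed.

Lemma trmxC_mulCt n (X : 'M[C]_n) : (X^t* * X)^t* = X^t* * X.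
Proof. by rewrite trmxC_mul trmxCK. Qed.

Lemma schat_herm n k (A : 'M[C]_n) : A^t* = A -> schat k A = \tr (A ^+ (2 ^ k.+1)).
Proof. by move=> hA; rewrite /schat hA -expr2 -exprM -expnS. Qed.

Lemma schatS n k (X : 'M[C]_n) : schat k.+1 X = schat k (X^t* * X).
Proof. by rewrite [RHS]schat_herm // trmxC_mulCt. Qed.

Lemma schat_ge0 n k (X : 'M[C]_n) : 0 <= schat k X.
Proof.
elim: k X => [|k IH] X; last by rewrite schatS.
by rewrite /schat expr1 mxtrace_mulr mxtrace_mulCt_ge0.
Qed.

Lemma schat0_mxtrace n (A B : 'M[C]_n) : `|\tr (A * B)| ^+ 2 <= schat 0 A * schat 0 B.
Proof.
rewrite -{1}[B]trmxCK; apply: le_trans (mxtrace_CauchySchwarz _ _) _.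
rewrite -[schat 0 A]schatC.
by rewrite /schat !expr1 !trmxCK.
Qed.

(** The two bounds are proved by one strong induction. The trace bound at level [k] comes from the
    product bound at lower levels; the product bound at level k+1 is the trace bound at level [k]
    for the product of the Gram matrices of [X] and of the adjoint of [Y], followed by the product
    bound at level [k]. *)
Lemma schat_mxtrace_mul n k : (forall X Y : 'M[C]_n, schat k (X * Y) ^+ 2 <= schat k.+1 X * schat k.+1 Y)
  /\ (forall M : 'M[C]_n, `|\tr (M ^+ (2 ^ k.+1))| <= schat k M).
Proof.
elim/ltn_ind: k => k IH.
(* Each use of the product bound on a square halves the power of [M] and raises the index of [schat]
   by one. *)
have HX i (M : 'M[C]_n) : (i <= k)%N -> schat 0 (M ^+ (2 ^ i)) <= schat i M.
  move=> ik; suff H j : (j <= i)%N ->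
      schat 0 (M ^+ (2 ^ i)) ^+ (2 ^ j) <= schat j (M ^+ (2 ^ (i - j))) ^+ (2 ^ j).
    have := H i (leqnn i); rewrite subnn expn0 expr1.
    by rewrite ler_pXn2r ?nnegrE ?schat_ge0 // expn_gt0.
  elim: j => [|j IHj] ji; first by rewrite subn0 !expn0 !expr1.
  rewrite expnS mulnC !exprM.
  have jk : (j < k)%N by apply: leq_trans ji ik.
  apply: (@le_trans _ _ ((schat j (M ^+ (2 ^ (i - j))) ^+ (2 ^ j)) ^+ 2)).
    by rewrite ler_pXn2r ?nnegrE ?exprn_ge0 ?schat_ge0 // IHj // ltnW.
  rewrite -!exprM mulnC !exprM; rewrite ler_pXn2r ?nnegrE ?exprn_ge0 ?schat_ge0 ?expn_gt0 //.
  have -> : (2 ^ (i - j) = 2 ^ (i - j.+1) + 2 ^ (i - j.+1))%N.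
    by rewrite addnn -mul2n -expnS subnSK.
  by rewrite exprD [leRHS]expr2; exact: (IH _ jk).1.
have W (M : 'M[C]_n) : `|\tr (M ^+ (2 ^ k.+1))| <= schat k M.
  rewrite expnS mul2n -addnn exprD -(@ler_pXn2r _ 2) ?nnegrE ?schat_ge0 //.
  apply: le_trans (schat0_mxtrace _ _) _.
  by rewrite expr2; apply: ler_pM; rewrite ?schat_ge0 //; exact: HX.
split=> // X Y; case: k IH HX W => [|k] IH HX W.
  have -> : schat 0 (X * Y) = `|\tr ((X^t* * X) * (Y * Y^t*))|.
    rewrite -[LHS]ger0_norm ?schat_ge0 // /schat expr1 trmxC_mul.
    by congr `|_|; rewrite -!mulmxE -!mulmxA mxtrace_mulC -!mulmxA.
  apply: le_trans (schat0_mxtrace _ _) _.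
  rewrite -[in leRHS](schatC 1 Y) !schatS.
  by rewrite trmxCK.
have -> : schat k.+1 (X * Y) = `|\tr (((X^t* * X) * (Y * Y^t*)) ^+ (2 ^ k.+1))|.
  rewrite -[LHS]ger0_norm ?schat_ge0 // /schat trmxC_mul.
  have : (0 < 2 ^ k.+1)%N by rewrite expn_gt0.
  case: (2 ^ k.+1)%N => // m _; rewrite -mulmxE.
  congr `|_|; rewrite -!mulmxA mulmxE mxtrace_expr_mulC.
  by rewrite -!mulmxE !mulmxA.
apply: (@le_trans _ _ (schat k ((X^t* * X) * (Y * Y^t*)) ^+ 2)).
  by rewrite ler_pXn2r ?nnegrE ?schat_ge0 //; exact: (IH k _).2.
apply: le_trans ((IH k _).1 _ _) _ => //.
by rewrite -(schatC k.+2 Y) (schatS k.+1 X) (schatS k.+1 (Y^t*)) trmxCK.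
Qed.

(** Cut the word in the middle, split the two halves with the product bound of [schat_mxtrace_mul],
    and recurse. *)
Lemma schat_word n k j (s : seq 'M[C]_n) : size s = (2 ^ j)%N ->
  schat k (\prod_(A <- s) A) ^+ (2 ^ j) <= \prod_(A <- s) schat (k + j) A.
Proof.
elim: j k s => [|j IH] k s sj.
  case: s sj => [|A [|]] //= _; rewrite !big_cons !big_nil !mulr1 expr1 addn0 //.
have st : size (take (2 ^ j) s) = (2 ^ j)%N.
  by rewrite size_take sj expnS mul2n -addnn -[ltnLHS]add0n ltn_add2r expn_gt0.
have sd : size (drop (2 ^ j) s) = (2 ^ j)%N.
  by rewrite size_drop sj expnS mul2n -addnn addnK.
rewrite -[s](cat_take_drop (2 ^ j)) !big_cat /=.
rewrite expnS exprM.
apply: (@le_trans _ _ ((schat k.+1 (\prod_(A <- take (2 ^ j) s) A) *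
    schat k.+1 (\prod_(A <- drop (2 ^ j) s) A)) ^+ (2 ^ j))).
  rewrite ler_pXn2r ?nnegrE ?mulr_ge0 ?exprn_ge0 ?schat_ge0 ?expn_gt0 //.
  exact: (schat_mxtrace_mul n k).1.
rewrite exprMn addnS -addSn; apply: ler_pM; rewrite ?exprn_ge0 ?schat_ge0 //; exact: IH.
Qed.

Lemma mxtrace_word n j (s : seq 'M[C]_n) : size s = (2 ^ j.+1)%N ->
  `|\tr (\prod_(A <- s) A)| ^+ (2 ^ j.+1) <= \prod_(A <- s) schat j A.
Proof.
move=> sj.
have st : size (take (2 ^ j) s) = (2 ^ j)%N.
  by rewrite size_take sj expnS mul2n -addnn -[ltnLHS]add0n ltn_add2r expn_gt0.
have sd : size (drop (2 ^ j) s) = (2 ^ j)%N.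
  by rewrite size_drop sj expnS mul2n -addnn addnK.
rewrite -[s](cat_take_drop (2 ^ j)) !big_cat /= expnS exprM.
apply: (@le_trans _ _ ((schat 0 (\prod_(A <- take (2 ^ j) s) A) *
    schat 0 (\prod_(A <- drop (2 ^ j) s) A)) ^+ (2 ^ j))).
  rewrite ler_pXn2r ?nnegrE ?mulr_ge0 ?exprn_ge0 ?schat_ge0 ?expn_gt0 //.
  exact: schat0_mxtrace.
by rewrite exprMn; apply: ler_pM; rewrite ?exprn_ge0 ?schat_ge0 //; exact: schat_word.
Qed.

                                                                                       
(** With Q = 2^(j+1): the Schatten norm of exponent Q is at most [c] times t^(1/Q). The weight [c]
    is relative to a reference [t], later the trace of [A ^+ Q], so that a word of Q letters has
    trace at most [t] times the product of its weights. *)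
Definition wb n j (t c : C) (A : 'M[C]_n) := 0 <= c /\ schat j A <= c ^+ (2 ^ j.+1) * t.

Lemma mxtrace_word_wb n j (t : C) (s : seq ('M[C]_n * C)) : 0 <= t ->
  size s = (2 ^ j.+1)%N -> (forall x, x \in s -> wb j t x.2 x.1) ->
  `|\tr (\prod_(x <- s) x.1)| <= (\prod_(x <- s) x.2) * t.
Proof.
move=> t0 ss H; have c0 x : x \in s -> 0 <= x.2 by move=> /H[].
have p0 : 0 <= \prod_(x <- s) x.2.
  by rewrite big_seq; apply: prodr_ge0 => x /c0.
rewrite -(@ler_pXn2r _ (2 ^ j.+1)) ?nnegrE ?mulr_ge0 ?expn_gt0 //.
have := @mxtrace_word n j [seq x.1 | x <- s]; rewrite size_map => /(_ ss).
rewrite !big_map => /le_trans; apply.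
have -> : (\prod_(x <- s) x.2 * t) ^+ (2 ^ j.+1) =
    \prod_(x <- s) (x.2 ^+ (2 ^ j.+1) * t).
  by rewrite big_split /= prodrXl big_const_seq count_predT iter_mulr_1 ss exprMn.
rewrite big_seq [leRHS]big_seq.
apply: ler_prod => x xs; rewrite schat_ge0 /=; exact: (H x xs).2.
Qed.

(** Monotonicity of Schatten norms without functional calculus. For Gram matrices [A] and [B] with A
    <= c B, testing the order gives tr(A^m) <= c tr(A^(m-1) B); Hölder bounds the m-th power of the
    right-hand trace by tr(A^m)^(m-1) tr(B^m), and one divides. *)
Lemma schat_psd_le n j (c : C) (X Y : 'M[C]_n) : 0 <= c ->
  psd (c *: (X^t* * X) - Y^t* * Y) ->
  schat j Y <= c ^+ (2 ^ j) * schat j X.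
Proof.
move=> c0 H; set A := Y^t* * Y; set B := X^t* * X.
case: j => [|j].
  rewrite /schat !expr1 -/A -/B -subr_ge0.
  have := psd_mxtrace (1%:M : 'M[C]_n) H.
  by rewrite trmx1 map_mx1 mulmx1 mul1mx linearB linearZ.
have hA : A^t* = A by rewrite trmxC_mulCt.
have hB : B^t* = B by rewrite trmxC_mulCt.
set m := (2 ^ j.+1)%N; set a := schat j.+1 Y; set b := schat j.+1 X.
have a0 : 0 <= a by exact: schat_ge0.
have b0 : 0 <= b by exact: schat_ge0.
have mE : m = (2 ^ j - 1).*2.+2.
  rewrite /m expnS mul2n; have : (0 < 2 ^ j)%N by rewrite expn_gt0.
  by case: (2 ^ j)%N => // q _; rewrite subn1 doubleS.
have aE : a = \tr (A ^+ m) by [].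
(* [m.-1] is odd, so [A ^+ m.-1] is itself the Gram matrix of [Y * A ^+ (2 ^ j - 1)], against which
   the positive difference is tested. *)
have ale : a <= c * \tr (A ^+ m.-1 * B).
  have E M : \tr ((Y * A ^+ (2 ^ j - 1)) *m M *m (Y * A ^+ (2 ^ j - 1))^t*) =
      \tr (A ^+ m.-1 * M).
    rewrite mxtrace_mulC trmxC_mul trmxC_exp hA !mulmxE; congr (\tr _).
    rewrite !mulrA -[_ * Y^t* * Y]mulrA -/A -exprSr -exprD; congr (A ^+ _ * M).
    by rewrite mE -addnn.
  have := psd_mxtrace (Y * A ^+ (2 ^ j - 1)) H; rewrite E mulrBr linearB /=.
  by rewrite -!mulmxE -scalemxAr linearZ /= !mulmxE -exprSr -/A -/B subr_ge0 aE prednK // mE.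
have := @mxtrace_word n j (rcons (nseq m.-1 A) B).
rewrite size_rcons size_nseq prednK ?expn_gt0 // => /(_ erefl).
rewrite !big_rcons /= !big_nseq !iter_mulr_1 -/m.
rewrite (schat_herm _ hA) (schat_herm _ hB) -/m -aE => hol.
have [a00|an0] := eqVneq a 0; first by rewrite a00 mulr_ge0 ?exprn_ge0.
have agt0 : 0 < a by rewrite lt_neqAle eq_sym an0.
have m0 : (0 < m)%N by rewrite expn_gt0.
rewrite -(ler_pM2l (exprn_gt0 m.-1 agt0)) -exprSr prednK //.
rewrite mulrCA.
apply: (@le_trans _ _ ((c * `|\tr (A ^+ m.-1 * B)|) ^+ m)); last first.
  by rewrite exprMn ler_wpM2l ?exprn_ge0.
rewrite ler_pXn2r ?nnegrE ?mulr_ge0 //.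
apply: (@le_trans _ _ `|c * \tr (A ^+ m.-1 * B)|); last by rewrite normrM (ger0_norm c0).
by rewrite ger0_norm // (le_trans a0 ale).
Qed.

Lemma schat_idealr n j (c : C) (X Y : 'M[C]_n) : opb c (Y^t*) ->
  schat j (Y * X) <= c ^+ (2 ^ j.+1) * schat j X.
Proof.
move=> [c0 H]; rewrite expnS exprM; apply: schat_psd_le; first by rewrite exprn_ge0.
move=> v; have qE (M : 'M[C]_n) : qform (M^t* * M) v = sqn (v *m M^t*).
  by rewrite /sqn /qform trmxC_mul trmxCK -!mulmxE !mulmxA.
rewrite qformB qformZ subr_ge0 !qE trmxC_mul mulmxA; exact: H.
Qed.

Lemma wb_mul n j (t a c : C) (X Y : 'M[C]_n) : opb c (Y^t*) -> wb j t a X -> wb j t (c * a) (Y * X).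
Proof.
move=> HY [a0 HX]; split; first by rewrite mulr_ge0 // HY.1.
apply: le_trans (schat_idealr _ _ HY) _.
by rewrite exprMn -mulrA ler_wpM2l // exprn_ge0 // HY.1.
Qed.

End MatrixBounds.

Lemma exprB_expand (T : pzRingType) (A B : T) q :
  B ^+ q = A ^+ q + \sum_(i < q) B ^+ i * (B - A) * A ^+ (q - 1 - i).
Proof.
elim: q => [|q IH]; first by rewrite big_ord0 addr0.
rewrite big_ord_recr /= subSS subn0 subnn expr0 mulr1 exprSr.
have -> : B ^+ q * B = B ^+ q * A + B ^+ q * (B - A) by rewrite -mulrDr addrC subrK.
rewrite {1}IH mulrDl -exprSr -addrA mulr_suml; congr (_ + (_ + _)).
apply: eq_bigr => i _.
by rewrite -mulrA -exprSr -subnDA add1n subnSK.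
Qed.

(** * Second-order expansion of the trace of a power of a perturbed resolvent *)

Section ResolventExpansion.
Variables (C : numClosedFieldType) (n : nat).
Variables (A B W : 'M[C]_n) (K kap : C).
Hypotheses (hA : A^t* = A) (hB : B^t* = B) (hW : W^t* = W).
Hypothesis BE : B = A + B * W * A.
Hypotheses (oA : opb K A) (oB : opb (2 * K) B) (oW : opb kap W).
Variable e : C.
Hypothesis eE : e = 2 * K * kap.
Hypothesis e1 : e <= 1.

Let K0 : 0 <= K. Proof. by case: oA. Qed.
Let kap0 : 0 <= kap. Proof. by case: oW. Qed.
Let e0 : 0 <= e. Proof. by rewrite eE !mulr_ge0. Qed.
Let Kkap : K * kap <= e.
Proof. by rewrite eE -mulrA ler_peMl ?mulr_ge0 ?ler1n. Qed.

Let D := B - A.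
Let DE : D = B * W * A. Proof. by rewrite /D {1}BE addrC addKr. Qed.
Let D1 := A * W * A.
Let D' := D - D1.
Let D'E : D' = B * W * A * W * A.
Proof. by rewrite /D' DE /D1 -!mulrA -mulrBl -/D DE !mulrA. Qed.

(** The part of order at most two in [W] of tr(B^q), for B = A + AWA + AWAWA + ... In the third term
    both factors [W] come from the same factor [B]; in the double sum they come from the factors at
    positions k < i. *)
Definition resolvent_main q : C :=
  \tr (A ^+ q) + q%:R * \tr (A ^+ q.+1 * W) + q%:R * \tr (A ^+ q.+1 * W * A * W) +
  \sum_(i < q) \sum_(k < i) \tr (A ^+ (q + 1 - i + k) * W * A ^+ (i + 1 - k) * W).

Let oBWAWAW : opb (e ^+ 3) (B * W * A * W * A * W).
Proof.
have := opbM (opbM (opbM (opbM (opbM oB oW) oA) oW) oA) oW.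
apply: opb_le.
have -> : 2 * K * kap * K * kap * K * kap = e * ((K * kap) * (K * kap)) by rewrite eE; ring.
have -> : e ^+ 3 = e * (e * e) by ring.
by apply: ler_wpM2l => //; apply: ler_pM; rewrite ?mulr_ge0.
Qed.

Let first_order q : (0 < q)%N ->
  \tr (A ^+ (q - 1) * D) = \tr (A ^+ q.+1 * W) + \tr (A ^+ q.+1 * W * A * W) +
     \tr (A ^+ q * (B * W * A * W * A * W)).
Proof.
move=> q0; have -> : D = A * W * A + A * W * A * W * A + B * W * A * W * A * W * A.
  rewrite -addrA -[_ + B * W * A * W * A * W * A](_ : B * W * A * W * A = _).
    by rewrite -D'E /D' /D1 addrC subrK.
  by rewrite {1}BE !mulrDl.
have T M : \tr (A ^+ (q - 1) * (M * A)) = \tr (A ^+ q * M).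
  by rewrite mulrA mxtrace_mulr mulrA -exprS subn1 prednK.
by rewrite !mulrDr !linearD /= !T !mulrA -!exprSr.
Qed.

(** The exponent 1 is not of the form 2^(j+1), and no Hölder inequality is needed: the remainder is
    a single cubic term, bounded by operator norm times [n]. *)
Lemma resolvent_expand1 : `|\tr B - resolvent_main 1| <= e ^+ 3 * K * n%:R.
Proof.
have := @first_order 1 isT; rewrite subnn expr0 mul1r expr1 => E.
rewrite /resolvent_main big_ord_recl !big_ord0 !addr0 !mul1r expr1.
have -> : \tr B = \tr A + \tr D by rewrite -linearD /= /D addrC subrK.
rewrite E [X in `|X|](_ : _ = \tr (A * (B * W * A * W * A * W))); last by ring.
by apply: mxtrace_opb1; rewrite mulrC; apply: opbM.
Qed.

Section Dyadic.
Variable j : nat.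
Let Q := (2 ^ j.+1)%N.
Let t := \tr (A ^+ Q).
Let tE : t = schat j A. Proof. by rewrite schat_herm. Qed.
Let t0 : 0 <= t. Proof. by rewrite tE schat_ge0. Qed.

Let wb_le c c' (X : 'M[C]_n) : c <= c' -> wb j t c X -> wb j t c' X.
Proof.
move=> cc [c0 H]; split; first exact: le_trans cc.
apply: le_trans H _; apply: ler_wpM2r => //.
by rewrite ler_pXn2r ?nnegrE ?expn_gt0 // (le_trans c0).
Qed.

Let wA : wb j t 1 A. Proof. by split; rewrite // expr1n mul1r tE. Qed.

Let wM c (M : 'M[C]_n) : opb c (M^t*) -> wb j t c (M * A).
Proof. by move=> /wb_mul/(_ wA); rewrite mulr1. Qed.

Let wD : wb j t e D.
Proof.
rewrite DE; apply: wM; rewrite trmxC_mul hW hB.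
by have := opbM oW oB; apply: opb_le; rewrite eE mulrC.
Qed.

Let wB : wb j t 2 B.
Proof.
rewrite BE -[X in X + _]mul1r -mulrDl.
apply: wb_le (_ : wb j t (1 + e) _); first by rewrite [_ + e]addrC -lerBrDr -[2]/(1 + 1)addrK.
apply: wM; rewrite trmxC_add trmx1 map_mx1; apply: opbD; first exact: opb1.
rewrite trmxC_mul hW hB.
by have := opbM oW oB; apply: opb_le; rewrite eE mulrC.
Qed.

Let wD1 : wb j t e D1.
Proof.
apply: wM; rewrite trmxC_mul hW hA.
by have := opbM oW oA; apply: opb_le; rewrite mulrC.
Qed.

Let wD' : wb j t (e ^+ 2) D'.
Proof.
rewrite D'E; apply: wM; rewrite !trmxC_mul hW hB hA.
have := opbM oW (opbM oA (opbM oW oB)); apply: opb_le.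
have -> : kap * (K * (kap * (2 * K))) = (K * kap) * e by rewrite eE; ring.
by rewrite expr2 ler_wpM2r.
Qed.

Let Q0 : (0 < Q)%N. Proof. by rewrite expn_gt0. Qed.

Let second_word X Y x y a b c : wb j t x X -> wb j t y Y -> (a + b + c + 2 = Q)%N ->
  `|\tr (A ^+ a * X * A ^+ b * Y * A ^+ c)| <= x * y * t.
Proof.
move=> wX wY sQ.
pose s := nseq a (A, 1 : C) ++ (X, x) :: nseq b (A, 1 : C) ++ (Y, y) :: nseq c (A, 1 : C).
have ss : size s = Q.
  by rewrite /s !(size_cat, size_nseq) /= !(size_cat, size_nseq) /= size_nseq; lia.
have ws z : z \in s -> wb j t z.2 z.1.
  rewrite !(mem_cat, inE, mem_nseq).
  by move=> /orP[/andP[_ /eqP->]|/orP[/eqP->|/orP[/andP[_ /eqP->]|/orP[/eqP->|/andP[_ /eqP->]]]]].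
have := mxtrace_word_wb t0 ss ws.
rewrite /s; do ?rewrite !(big_cat, big_cons) /=; rewrite !big_nseq !iter_mulr_1.
by rewrite !expr1n !mul1r mulr1 !mulrA.
Qed.

Let third_word a b c d : (a + b + c + d + 3 = Q)%N ->
  `|\tr (B ^+ a * D * A ^+ b * D * A ^+ c * D * A ^+ d)| <= 2 ^+ Q * e ^+ 3 * t.
Proof.
move=> s4; pose s := nseq a (B, 2 : C) ++ (D, e) :: nseq b (A, 1 : C) ++ (D, e) :: nseq c (A, 1 : C)
  ++ (D, e) :: nseq d (A, 1 : C).
have ss : size s = Q by rewrite /s !(size_cat, size_nseq) /= !(size_cat, size_nseq) /= !(size_cat, size_nseq) /= size_nseq; lia.
have ws z : z \in s -> wb j t z.2 z.1.
  rewrite !(mem_cat, inE, mem_nseq).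
  by move=> /orP[/andP[_ /eqP->]|/orP[/eqP->|/orP[/andP[_ /eqP->]|/orP[/eqP->|
      /orP[/andP[_ /eqP->]|/orP[/eqP->|/andP[_ /eqP->]]]]]]].
have := mxtrace_word_wb t0 ss ws.
rewrite /s; do ?rewrite !(big_cat, big_cons) /=; rewrite !big_nseq !iter_mulr_1.
rewrite !expr1n !mul1r mulr1 !mulrA => /le_trans; apply.
apply: ler_wpM2r => //.
rewrite [leLHS](_ : _ = 2 ^+ a * e ^+ 3); last by rewrite /=; ring.
rewrite [leRHS](_ : _ = 2 ^+ Q * e ^+ 3); last by ring.
apply: ler_wpM2r; first by rewrite exprn_ge0.
by rewrite ler_weXn2l ?ler1n //; lia.
Qed.

Let second_order i k : (k < i)%N -> (i < Q)%N ->
  `|\tr (A ^+ k * D * A ^+ (i - 1 - k) * D * A ^+ (Q - 1 - i)) -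
    \tr (A ^+ (Q + 1 - i + k) * W * A ^+ (i + 1 - k) * W)| <= 2 * e ^+ 3 * t.
Proof.
move=> ki iQ; have s : (k + (i - 1 - k) + (Q - 1 - i) + 2 = Q)%N by lia.
have -> : \tr (A ^+ (Q + 1 - i + k) * W * A ^+ (i + 1 - k) * W) =
    \tr (A ^+ k * D1 * A ^+ (i - 1 - k) * D1 * A ^+ (Q - 1 - i)).
  have -> : A ^+ k * D1 * A ^+ (i - 1 - k) * D1 * A ^+ (Q - 1 - i) =
      A ^+ (k + 1) * W * A ^+ (i + 1 - k) * W * A ^+ (Q - 1 - i + 1).
    have -> : (i + 1 - k = 1 + (i - 1 - k) + 1)%N by lia.
    rewrite [X in X * W * _ * _ * _]exprD [_ ^+ (Q - 1 - i + 1)]exprD.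
    rewrite [X in _ * X * W * _]exprD [X in _ * (X * _) * W * _]exprD !expr1.
    rewrite -[A ^+ (Q - 1 - i) * A]exprSr exprS /D1 !mulrA //.
  rewrite [RHS]mxtrace_mulr !mulrA -exprD.
  by have -> : (Q - 1 - i + 1 + (k + 1) = Q + 1 - i + k)%N by lia.
rewrite -linearB /=.
have -> : A ^+ k * D * A ^+ (i - 1 - k) * D * A ^+ (Q - 1 - i) -
    A ^+ k * D1 * A ^+ (i - 1 - k) * D1 * A ^+ (Q - 1 - i) =
    A ^+ k * D' * A ^+ (i - 1 - k) * D * A ^+ (Q - 1 - i) +
    A ^+ k * D1 * A ^+ (i - 1 - k) * D' * A ^+ (Q - 1 - i).
  have H (X Y P1 P2 P3 : 'M[C]_n) : P1 * X * P2 * X * P3 - P1 * Y * P2 * Y * P3 =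
      P1 * (X - Y) * P2 * X * P3 + P1 * Y * P2 * (X - Y) * P3.
    by rewrite !(mulrBr, mulrBl) addrA subrK.
  exact: H.
rewrite linearD /=; apply: le_trans (ler_normD _ _) _.
rewrite [leRHS](_ : _ = e ^+ 3 * t + e ^+ 3 * t); last by ring.
apply: lerD.
  by apply: le_trans (second_word wD' wD s) _; rewrite -exprSr.
by apply: le_trans (second_word wD1 wD' s) _; rewrite -exprS.
Qed.

Definition resolvent_const (q : nat) : C := q%:R + 2 * q%:R ^+ 2 + 2 ^+ q * q%:R ^+ 3.

(** Three uses of the telescoping [exprB_expand] leave words with three letters [D], each of weight
    [e]. In words with two letters [D], replacing [D] by its linear part [A * W * A] costs [e ^+ 2]
    for that letter and [e] for the other. Hölder for words bounds everything by a multiple of [t],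
    the unperturbed trace itself; a bound by [n] would not let the estimate for a high power
    close. *)
Lemma resolvent_expand : `|\tr (B ^+ Q) - resolvent_main Q| <= resolvent_const Q * e ^+ 3 * t.
Proof.
have E1 : \tr (B ^+ Q) = t + \sum_(i < Q) \tr (B ^+ i * D * A ^+ (Q - 1 - i)).
  by rewrite (exprB_expand A B Q) linearD raddf_sum.
have E2 (i : nat) : \tr (B ^+ i * D * A ^+ (Q - 1 - i)) = \tr (A ^+ i * D * A ^+ (Q - 1 - i)) +
   \sum_(k < i) \tr (B ^+ k * D * A ^+ (i - 1 - k) * D * A ^+ (Q - 1 - i)).
  rewrite (exprB_expand A B i) -/D !mulrDl linearD /= !mulr_suml raddf_sum; congr (_ + _).
have E3 (i k : nat) : \tr (B ^+ k * D * A ^+ (i - 1 - k) * D * A ^+ (Q - 1 - i)) =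
   \tr (A ^+ k * D * A ^+ (i - 1 - k) * D * A ^+ (Q - 1 - i)) +
   \sum_(l < k) \tr (B ^+ l * D * A ^+ (k - 1 - l) * D * A ^+ (i - 1 - k) * D * A ^+ (Q - 1 - i)).
  by rewrite (exprB_expand A B k) -/D !mulrDl linearD /= !mulr_suml raddf_sum.
have E4 : \sum_(i < Q) \tr (A ^+ i * D * A ^+ (Q - 1 - i)) = Q%:R * \tr (A ^+ (Q - 1) * D).
  rewrite (eq_bigr (fun=> \tr (A ^+ (Q - 1) * D))) ?sumr_const ?card_ord ?mulr_natl // => i _.
  have iQ : (i < Q)%N := ltn_ord i.
  rewrite mxtrace_mulr mulrA -exprD.
  by have -> : (Q - 1 - i + i = Q - 1)%N by lia.
have -> : \tr (B ^+ Q) - resolvent_main Q =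
   Q%:R * \tr (A ^+ Q * (B * W * A * W * A * W)) +
   \sum_(i < Q) \sum_(k < i) (\tr (A ^+ k * D * A ^+ (i - 1 - k) * D * A ^+ (Q - 1 - i)) -
      \tr (A ^+ (Q + 1 - i + k) * W * A ^+ (i + 1 - k) * W)) +
   \sum_(i < Q) \sum_(k < i) \sum_(l < k)
     \tr (B ^+ l * D * A ^+ (k - 1 - l) * D * A ^+ (i - 1 - k) * D * A ^+ (Q - 1 - i)).
  rewrite E1 (eq_bigr _ (fun (i : 'I_Q) _ => E2 i)) big_split /= E4 first_order //.
  rewrite (eq_bigr _ (fun (i : 'I_Q) _ => eq_bigr _ (fun (k : 'I_i) _ => E3 i k))).
  rewrite (eq_bigr _ (fun (i : 'I_Q) _ => big_split _ _ _ _ _)) big_split /=.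
  rewrite (eq_bigr (P := xpredT) (F1 := fun i : 'I_Q => \sum_(k < i) (_ - _)) _
    (fun (i : 'I_Q) _ => sumrB _ _ _ _)) sumrB /=.
  rewrite /resolvent_main -/t; ring.
have two0 : 0 <= 2 ^+ Q * e ^+ 3 * t :> C by rewrite !mulr_ge0 ?exprn_ge0.
have ord_le q (F : 'I_q -> C) (c : C) : 0 <= c -> (q <= Q)%N ->
    (forall i, `|F i| <= c) -> `|\sum_(i < q) F i| <= Q%:R * c.
  move=> c0 qQ H; apply: le_trans (ler_norm_sum _ _ _) _.
  apply: (@le_trans _ _ (\sum_(i < q) c)); first by apply: ler_sum => i _; exact: H.
  by rewrite sumr_const card_ord -[leLHS]mulr_natl ler_wpM2r // ler_nat.
apply: le_trans (ler_normD _ _) _; apply: le_trans (lerD (ler_normD _ _) (lexx _)) _.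
rewrite /resolvent_const ![in leRHS]mulrDl; apply: lerD; first apply: lerD.
- rewrite normrM normr_nat -[leRHS]mulrA; apply: ler_wpM2l => //.
  have -> : A ^+ Q = A ^+ (2 ^ j) * A ^+ (2 ^ j) by rewrite -exprD addnn -mul2n -expnS.
  rewrite -mulrA mxtrace_mulr.
  have := mxtrace_opb (A ^+ (2 ^ j)) oBWAWAW; rewrite trmxC_exp hA !mulmxE.
  by rewrite -exprD addnn -mul2n -expnS.
- rewrite [leRHS](_ : _ = Q%:R * (Q%:R * (2 * e ^+ 3 * t))); last by ring.
  apply: (ord_le) => //; first by rewrite !mulr_ge0 ?exprn_ge0.
  move=> i; have iQ : (i < Q)%N := ltn_ord i.
  apply: (ord_le) => [||k]; [by rewrite !mulr_ge0 ?exprn_ge0 | exact: ltnW |].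
  exact: second_order.
- rewrite [leRHS](_ : _ = Q%:R * (Q%:R * (Q%:R * (2 ^+ Q * e ^+ 3 * t)))); last by ring.
  apply: (ord_le) => //; first by rewrite !mulr_ge0 ?exprn_ge0.
  move=> i; have iQ : (i < Q)%N := ltn_ord i.
  apply: (ord_le) => [||k]; [by rewrite mulr_ge0 | exact: ltnW |].
  have ki : (k < i)%N := ltn_ord k.
  apply: (ord_le) => // [|l]; first by apply: ltnW; apply: ltn_trans iQ.
  have lk : (l < k)%N := ltn_ord l.
  by apply: third_word; lia.
Qed.

End Dyadic.
End ResolventExpansion.

Lemma conjC_realc (R : rcfType) (x : R) : Num.conj (x%:C : R[i]) = x%:C.
Proof. by rewrite conj_Creal // realE -[0]/(0%:C) !lecR -realE num_real. Qed.

Lemma norm_realc (R : rcfType) (x : R) : `|x%:C : R[i]| = `|x|%:C.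
Proof. by rewrite normc_def /= expr0n addr0 sqrtr_sqr. Qed.

(** * Spectral decomposition of Hermitian matrices and of their resolvents *)

Section SpectralDecomposition.
Variables (C : numClosedFieldType) (n : nat).
Implicit Types (S P : 'M[C]_n) (D : 'rV[C]_n).

(** Row-vector convention: the rows of [P] are the eigenvectors, so [v *m P^t*] lists the
    coordinates of [v]. *)
Definition specd S P D :=
  [/\ P *m P^t* = 1%:M, P^t* *m P = 1%:M & S = P^t* *m diag_mx D *m P].

Section Decomposition.
Variables (S P : 'M[C]_n) (D : 'rV[C]_n).
Hypothesis HS : specd S P D.

Let P1 : P *m P^t* = 1%:M. Proof. by case: HS. Qed.
Let P2 : P^t* *m P = 1%:M. Proof. by case: HS. Qed.
Let SE : S = P^t* *m diag_mx D *m P. Proof. by case: HS. Qed.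

Lemma specd_sqn (v : 'rV_n) : sqn v = sqn (v *m P^t*).
Proof. by rewrite /sqn trmxC_mul trmxCK -mulmxA (mulmxA _ P) P2 mul1mx. Qed.

Lemma specd_mul (v : 'rV_n) i : (v *m S *m P^t*) 0 i = D 0 i * (v *m P^t*) 0 i.
Proof. by rewrite SE -!mulmxA P1 mulmx1 mulmxA mul_mx_diag mxE mulrC. Qed.

Lemma specd_eigen i : eigenvalue S (D 0 i).
Proof.
apply/eigenvalueP; exists (row i P).
  rewrite SE !mulmxA -!row_mul P1 mul1mx.
  by apply/rowP => k; rewrite mul_diag_mx !mxE.
apply/eqP => P0; have := congr1 (fun M : 'M[C]_n => M i i) P1.
rewrite mxE big1 ?mxE ?eqxx => [/eqP|k _]; first by rewrite eq_sym oner_eq0.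
by have /rowP/(_ k) := P0; rewrite !mxE => ->; rewrite mul0r.
Qed.

Lemma specd_eigenP (x : C) : eigenvalue S x -> exists i, x = D 0 i.
Proof.
move=> /eigenvalueP[v vS v0].
have w0 : v *m P^t* != 0.
  by apply: contra v0 => /eqP w0; rewrite -[v]mulmx1 -P2 mulmxA w0 mul0mx eqxx.
have [i wi] : exists i, (v *m P^t*) 0 i != 0.
  apply/existsP; apply: contraNT w0; rewrite negb_exists => /forallP w0.
  by apply/eqP/rowP => i; have := w0 i; rewrite negbK => /eqP ->; rewrite mxE.
by exists i; have := specd_mul v i; rewrite vS -scalemxAl mxE => /(mulIf _)->.
Qed.

Lemma specd_qform (v : 'rV_n) : qform S v = \sum_i D 0 i * `|(v *m P^t*) 0 i| ^+ 2.
Proof.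
rewrite /qform -[v in v^t*]mulmx1 -P2 (mulmxA v) trmxC_mul mulmxA mxE.
by apply: eq_bigr => i _; rewrite specd_mul !mxE normCK mulrA.
Qed.

Lemma specd_exp q : specd (S ^+ q) P (\row_i (D 0 i ^+ q)).
Proof.
split=> //; elim: q => [|q IH].
  rewrite expr0 (_ : diag_mx _ = 1%:M) ?mulmx1 ?P2 //.
  by apply/matrixP => i j; rewrite !mxE expr0.
rewrite exprS IH {1}SE -mulmxE -!mulmxA; congr (_ *m _).
rewrite (mulmxA P) P1 mul1mx mulmxA mul_diag_mx; congr (_ *m _).
apply/matrixP => i j; rewrite !mxE exprS.
by case: eqP => _; rewrite ?mulr1n ?mulr0n ?mulr0.
Qed.

Lemma specd_tr : \tr S = \sum_i D 0 i.
Proof. by rewrite SE mxtrace_mulC mulmxA P1 mul1mx mxtrace_diag. Qed.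

Lemma specd_shift (u : C) : specd (u%:M - S) P (\row_i (u - D 0 i)).
Proof.
split=> //.
have -> : u%:M = P^t* *m diag_mx (const_mx u) *m P.
  by rewrite diag_const_mx mul_mx_scalar -scalemxAl P2 scalemx1.
rewrite {1}SE -mulmxBl -mulmxBr; congr (_ *m _ *m _); apply/matrixP => i j.
by rewrite !mxE mulrnBl.
Qed.

Lemma specd_inv : (forall i, D 0 i != 0) ->
  (S \in unitmx) /\ specd (invmx S) P (\row_i (D 0 i)^-1).
Proof.
move=> D0; pose M := P^t* *m diag_mx (\row_i (D 0 i)^-1) *m P.
have E : S *m M = 1%:M.
  rewrite SE /M -!mulmxA (mulmxA P) P1 mul1mx (mulmxA (diag_mx _)) mul_diag_mx.
  rewrite [X in X *m P](_ : _ = 1%:M) ?mul1mx ?P2 //.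
  apply/matrixP => i j; rewrite !mxE; case: eqP => [->|_]; last by rewrite !mulr0n mulr0.
  by rewrite !mulr1n mulfV.
have [uu ->] : S \in unitmx /\ invmx S = M.
  have uu := (mulmx1_unit E).1; split=> //.
  by rewrite -[LHS]mulmx1 -E mulmxA mulVmx // mul1mx.
by split.
Qed.

End Decomposition.

Lemma specd_resolvent S P D (u : C) : specd S P D -> (forall i, u != D 0 i) ->
  (u%:M - S \in unitmx) /\ specd (invmx (u%:M - S)) P (\row_i (u - D 0 i)^-1).
Proof.
move=> HS uD; have := specd_inv (specd_shift HS u).
rewrite (_ : \row_i _ = \row_i (u - D 0 i)^-1); last by apply/rowP => i; rewrite !mxE.
by apply => i; rewrite mxE subr_eq0.
Qed.

Lemma herm_specd S : S^t* = S ->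
  exists P D, specd S P D /\ forall i, D 0 i \is Num.real.
Proof.
move=> hS; have hS' : S \is hermsymmx by apply/is_hermitianmxP; rewrite expr0 scale1r hS.
have /orthomx_spectralP E := hermitian_normalmx hS'.
have rD := hermitian_spectral_diag_real hS'.
have uP := spectral_unitarymx S.
exists (spectralmx S), (spectral_diag S); split; last by move=> i; exact: (mxOverP rD).
have E1 : spectralmx S *m (spectralmx S)^t* = 1%:M by apply/unitarymxP.
by split; [exact: E1 | exact: mulmx1C | rewrite -(invmx_unitary uP) [LHS]E].
Qed.

End SpectralDecomposition.

Section Spectral.
Variables (R : rcfType) (n : nat).
Local Notation C := R[i].
Implicit Types (S P : 'M[C]_n) (l : 'I_n -> R).

Definition hermd S P l := specd S P (\row_i (l i)%:C).

Lemma herm_hermd S : S^t* = S -> exists P l, hermd S P l.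
Proof.
move=> /herm_specd[P [D [HS rD]]].
exists P, (fun i => complex.Re (D 0 i)); rewrite /hermd.
rewrite (_ : \row_i _ = D) //; apply/rowP => i.
by rewrite mxE RRe_real.
Qed.

Section Decomposition.
Variables (S P : 'M[C]_n) (l : 'I_n -> R).
Hypothesis HS : hermd S P l.

Lemma hermd_eigen i : eigenvalue S (l i)%:C.
Proof. by have := specd_eigen HS i; rewrite mxE. Qed.

Lemma hermd_eigenP (x : C) : eigenvalue S x -> exists i, x = (l i)%:C.
Proof. by move=> /(specd_eigenP HS)[i ->]; exists i; rewrite mxE. Qed.

Lemma hermd_opb (c : R) : 0 <= c -> (forall i, `|l i| <= c) -> opb c%:C S.
Proof.
move=> c0 lc; split=> [|v]; first by rewrite ler0c.
rewrite (specd_sqn HS) (specd_sqn HS v) !sqnE mulr_sumr; apply: ler_sum => i _.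
rewrite (specd_mul HS) mxE normrM exprMn ler_wpM2r ?exprn_ge0 //.
by rewrite norm_realc ler_pXn2r ?nnegrE ?ler0c // lecR.
Qed.

Lemma hermd_qform_ge (c : R) (v : 'rV_n) : (forall i, c <= l i) -> c%:C * sqn v <= qform S v.
Proof.
move=> cl; rewrite (specd_qform HS) (specd_sqn HS) sqnE mulr_sumr; apply: ler_sum => i _.
by rewrite [(\row_i _) 0 i]mxE ler_wpM2r ?exprn_ge0 // lecR.
Qed.

Lemma hermd_tr q : \tr (S ^+ q) = (\sum_i l i ^+ q)%:C.
Proof.
rewrite (specd_tr (specd_exp HS q)) rmorph_sum.
by apply: eq_bigr => i _; rewrite !mxE rmorphXn.
Qed.

Lemma hermd_shift (u : R) : hermd (u%:C%:M - S) P (fun i => u - l i).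
Proof.
have E : \row_i (u - l i)%:C = \row_i (u%:C - (\row_i (l i)%:C) 0 i).
  by apply/rowP => i; rewrite !mxE rmorphB.
by rewrite /hermd E; exact: specd_shift HS u%:C.
Qed.

Lemma hermd_resolvent (u : R) : (forall i, u != l i) ->
  (u%:C%:M - S \in unitmx) /\ hermd (invmx (u%:C%:M - S)) P (fun i => (u - l i)^-1).
Proof.
move=> ul.
have E : \row_i ((u - l i)^-1)%:C = \row_i (u%:C - (\row_i (l i)%:C) 0 i)^-1.
  by apply/rowP => i; rewrite !mxE fmorphV rmorphB.
rewrite /hermd E; apply: (specd_resolvent HS) => i.
by rewrite mxE; apply: contra (ul i) => /eqP/complexI ->.
Qed.

End Decomposition.

Lemma hermd_herm S P l : hermd S P l -> S^t* = S.
Proof.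
move=> [P1 P2 SE]; rewrite SE !trmxC_mul trmxCK mulmxA.
suff -> : (diag_mx (\row_i (l i)%:C))^t* = diag_mx (\row_i (l i)%:C) by [].
apply/matrixP => i j; rewrite !mxE eq_sym; case: eqP => [->|_].
  by rewrite !mulr1n conjC_realc.
by rewrite !mulr0n conjC0.
Qed.

(** The gap between [u] and the spectrum of [S] is at least 1/K and a perturbation of norm at most
    1/(2K) uses up at most half of it. Thus the eigenvalues of [S'] remain below [u'] and the new
    resolvent has norm at most 2K. The identity for [B] is the resolvent identity. *)
Lemma resolvent_step (S W S' : 'M[C]_n) (u u' K kap : R) (P : 'M[C]_n) l :
  hermd S P l -> (forall i, 0 < u - l i) -> (forall i, (u - l i)^-1 <= K) -> 0 < K ->
  W^t* = W -> opb kap%:C W -> 2 * K * kap <= 1 ->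
  u'%:C%:M - S' = u%:C%:M - S - W ->
  let A := invmx (u%:C%:M - S) in let B := invmx (u'%:C%:M - S') in
  [/\ exists P' l', hermd S' P' l' /\ (forall i, 0 < u' - l' i),
      B = A + B * W * A, opb K%:C A & opb (2 * K)%:C B].
Proof.
move=> HS ul lK K0 hW oW Kk uE A B.
have lK' i : K^-1 <= u - l i by rewrite -[leRHS]invrK lef_pV2 ?posrE ?invr_gt0.
have ul0 i : u != l i by rewrite -subr_eq0 gt_eqF.
have [unitA HA] := hermd_resolvent HS ul0.
have oA : opb K%:C A.
  apply: (hermd_opb HA); first exact: ltW.
  by move=> i; rewrite ger0_norm // invr_ge0 ltW.
have hS' : S'^t* = S'.
  have S'E : S' = u'%:C%:M - (u%:C%:M - S - W) by rewrite -uE subKr.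
  rewrite S'E !(linearB, map_mxB) /= !tr_scalar_mx !map_scalar_mx /= !conjC_realc.
  by rewrite (hermd_herm HS) hW.
have [P' [l' HS']] := herm_hermd hS'.
have K2 : (2 * K)^-1 <= K^-1 - kap.
  rewrite invfM lerBrDr -lerBrDl -[X in _ <= X - _]mul1r -mulrBl.
  rewrite (_ : 1 - 2^-1 = 2^-1); last by field.
  by rewrite -invfM -[leRHS]mul1r ler_pdivlMr ?mulr_gt0 // mulrC.
(* The quadratic form of [u' - S'] is evaluated on an eigenvector of [S'], once exactly and once
   through [u - S - W]. *)
have l'K i : (2 * K)^-1 <= u' - l' i.
  have /eigenvalueP[v vS v0] := hermd_eigen HS' i.
  have v1 : 0 < sqn v.
    by rewrite lt_neqAle sqn_ge0 andbT eq_sym; apply: contra v0 => /eqP/sqn_eq0 ->.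
  have E1 : qform (u'%:C%:M - S') v = (u' - l' i)%:C * sqn v.
    rewrite qformB rmorphB mulrBl /qform mul_mx_scalar -scalemxAl mxE; congr (_ - _).
    by rewrite vS -scalemxAl mxE.
  have E2 : qform (u'%:C%:M - S') v >= (K^-1 - kap)%:C * sqn v.
    rewrite uE qformB rmorphB mulrBl lerB //.
      have HB := hermd_shift HS u.
      exact: (hermd_qform_ge HB).
    apply: le_trans (opb_qform _ oW).
    rewrite real_ler_norm //.
    have : (qform W v)^* = qform W v.
      have E : (v *m W *m v^t*)^t* = v *m W *m v^t* by rewrite !trmxC_mul trmxCK hW mulmxA.
      by rewrite /qform -[in RHS]E [RHS]mxE [X in _ = Num.conj X]mxE.
    by move/CrealP.
  move: E2; rewrite E1 ler_pM2r // lecR; exact: le_trans.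
have ul' i : 0 < u' - l' i.
  by apply: lt_le_trans (l'K i); rewrite invr_gt0 mulr_gt0.
have ul0' i : u' != l' i by rewrite -subr_eq0 gt_eqF.
have [unitB HB] := hermd_resolvent HS' ul0'.
split=> //.
- by exists P', l'.
- rewrite /B -!mulmxE.
  have -> : W = (u%:C%:M - S) - (u'%:C%:M - S') by rewrite uE opprB addrC subrK.
  by rewrite mulmxBr mulmxBl mulVmx // mul1mx -mulmxA mulmxV // mulmx1 [RHS]addrC subrK.
- apply: (hermd_opb HB); first by rewrite mulr_ge0 // ltW.
  move=> i; rewrite ger0_norm; last by rewrite invr_ge0 ltW.
  by rewrite -[leRHS]invrK lef_pV2 ?posrE ?invr_gt0 ?mulr_gt0.
Qed.

End Spectral.

                                                                   

(** * Independence of disjoint groups of variables, and Tonelli's theorem for groups *)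

Section Groups.
Context {R : realType} {dT dE : measure_display}.
Context {T : measurableType dT} {E : measurableType dE}.
Variables (P : probability T R) (I : finType) (X : I -> T -> E).
Hypothesis mX : forall i, measurable_fun [set: T] (X i).
Hypothesis iX : mutually_independent P X.

(** The pi-system generating the sigma-algebra of the variables in [J]. *)
Definition cylinders (J : {set I}) : set (set T) :=
  [set A | exists2 B : I -> set E, (forall i, measurable (B i)) &
     A = \bigcap_(i in [set` J]) (X i @^-1` B i)].

Lemma cylinders_setI J : setI_closed (cylinders J).
Proof.
move=> _ _ [B mB ->] [B' mB' ->]; exists (fun i => B i `&` B' i).
  by move=> i; exact: measurableI.
by rewrite -bigcapI; apply: eq_bigcapr => i _; rewrite preimage_setI.
Qed.

Lemma cylinders_setT J : cylinders J setT.
Proof.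
exists (fun=> setT); first by move=> i; exact: measurableT.
by apply/seteqP; split=> // x _ i _.
Qed.

Lemma cylinders_measurable J : cylinders J `<=` measurable.
Proof.
move=> _ [B mB ->]; apply: fin_bigcap_measurable; first exact: finite_finset.
by move=> i _; rewrite -[_ @^-1` _]setTI; exact: mX.
Qed.

Lemma cylinders_sub J A : <<s cylinders J >> A -> measurable A.
Proof. exact: (smallest_sub (@sigma_algebra_measurable _ T) (@cylinders_measurable J)). Qed.

Lemma cylinders_indep (J K : {set I}) A B :
  (forall i, i \in J -> i \notin K) -> cylinders J A -> cylinders K B ->
  (P (A `&` B) = P A * P B)%E.
Proof.
move=> JK [A' mA ->] [B' mB ->].
pose D i := if i \in J then A' i else B' i.
have mD i : measurable (D i) by rewrite /D; case: ifP.
have EJ : \bigcap_(i in [set` J]) (X i @^-1` A' i) = \bigcap_(i in [set` J]) (X i @^-1` D i).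
  by apply: eq_bigcapr => i /= iJ; rewrite /D iJ.
have EK : \bigcap_(i in [set` K]) (X i @^-1` B' i) = \bigcap_(i in [set` K]) (X i @^-1` D i).
  apply: eq_bigcapr => i /= iK; rewrite /D ifN //.
  by apply/negP => iJ; move: (JK i iJ); rewrite iK.
rewrite EJ EK -bigcap_setU.
have -> : [set` J] `|` [set` K] = [set` (J :|: K)%SET].
  by apply/seteqP; split => i /=; rewrite inE => /orP.
rewrite !iX // (eq_bigl [in [predU J & K]]); last by move=> i; rewrite !inE.
rewrite bigU //= disjoint_subset.
by apply/fintype.subsetP => i /JK; rewrite inE.
Qed.

(** For fixed [B], the finite measures sending [A] to P(A & B) and to P(A) P(B) agree on the
    pi-system of cylinders, hence on the generated sigma-algebra. This is done for one group, then
    for the other. *)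
Lemma sigma_indep (J K : {set I}) A B : (forall i, i \in J -> i \notin K) -> <<s cylinders J >> A ->
  <<s cylinders K >> B -> (P (A `&` B) = P A * P B)%E.
Proof.
move=> JK sA sB.
have key (J' K' : {set I}) (A' B' : set T) : measurable B' ->
   (forall C, cylinders J' C -> (P (C `&` B') = P C * P B')%E) ->
   <<s cylinders J' >> A' -> (P (A' `&` B') = P A' * P B')%E.
  move=> mB H sA'.
  have PB0 : 0 <= fine (P B') by rewrite fine_ge0.
  have PBE : ((fine (P B'))%:E = P B')%E by rewrite fineK // fin_num_measure.
  pose m2 : {measure set T -> \bar R} := mscale (NngNum PB0) P.
  pose m1 : {measure set T -> \bar R} := mrestr P mB.
  have m2E C : (m2 C = P C * P B')%E by rewrite /m2 /= /mscale /= PBE muleC.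
  have m1E C : m1 C = P (C `&` B') by [].
  have cov : \bigcup_(k : nat) [set: T] = setT by rewrite bigcup_const //; exists 0%N.
  have fin (k : nat) : (m1 [set: T] < +oo)%E.
    by rewrite m1E setTI ltey_eq fin_num_measure.
  have eqm C : cylinders J' C -> m1 C = m2 C by move=> CJ; rewrite m1E m2E H.
  have U := g_sigma_algebra_measure_unique _ (@cylinders_measurable J') (fun=> setT)
     (fun=> cylinders_setT J') cov m1 m2 (@cylinders_setI J') eqm fin.
  by rewrite -m1E -m2E; exact: U.
apply: (key J K) => //; first exact: cylinders_sub sB.
move=> C CJ; rewrite setIC muleC; apply: (key K J) => //.
  exact: cylinders_measurable CJ.
by move=> D DK; rewrite setIC muleC; exact: cylinders_indep CJ DK.
Qed.

End Groups.

Section DoubleIntegral.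
Context {R : realType} {d d1 d2 : measure_display}.
Context {T : measurableType d} {T1 : measurableType d1} {T2 : measurableType d2}.
Variables (P : probability T R) (f1 : {mfun T >-> T1}) (f2 : {mfun T >-> T2}).
Hypothesis indep : forall A B, measurable A -> measurable B ->
  (P (f1 @^-1` A `&` f2 @^-1` B) = P (f1 @^-1` A) * P (f2 @^-1` B))%E.
Variable F : (T1 * T2)%type -> \bar R.
Hypothesis mF : measurable_fun setT F.
Hypothesis F0 : forall x, (0 <= F x)%E.

Let f12 : T -> (T1 * T2)%type := fun w => (f1 w, f2 w).
Let mf12 : measurable_fun setT f12.
Proof. by apply/measurable_fun_pairP; split; exact: measurable_funP. Qed.
Let f12_mixin := isMeasurableFun.Build _ _ _ _ _ mf12.
Let f12' : {mfun T >-> (T1 * T2)%type} := HB.pack f12 f12_mixin.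

Lemma measurable_inner_integral :
  measurable_fun setT (fun x => \int[distribution P f2]_y F (x, y))%E.
Proof. exact: measurable_fun_fubini_tonelli_F. Qed.

Lemma double_integral :
  (\int[P]_w F (f1 w, f2 w) = \int[P]_w \int[P]_w' F (f1 w, f2 w'))%E.
Proof.
transitivity (\int[distribution P f12']_z F z)%E.
  by rewrite ge0_integral_pushforward // preimage_setT.
transitivity (\int[(distribution P f1) \x (distribution P f2)]_z F z)%E.
  have U := @product_measure_unique _ _ _ _ _ (distribution P f1) (distribution P f2)
    (distribution P f12') (fun A B mA mB => indep mA mB).
  by apply: eq_measure_integral => A mA _; rewrite -U.
rewrite fubini_tonelli1 // /fubini_F ge0_integral_pushforward //; last 2 first.
- exact: measurable_inner_integral.
- by move=> x _; exact: integral_ge0.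
rewrite preimage_setT; apply: eq_integral => w _ /=.
rewrite ge0_integral_pushforward ?preimage_setT //.
exact/measurableT_comp/pair1_measurable.
Qed.

End DoubleIntegral.

Section GroupsIntegral.
Context {R : realType} {dT dE : measure_display}.
Context {T : measurableType dT} {E : measurableType dE}.
Variables (P : probability T R) (I : finType) (X : I -> T -> E).
Hypothesis mX : forall i, measurable_fun [set: T] (X i).
Hypothesis iX : mutually_independent P X.

                                                                   
(** The points of [T] with the sigma-algebra generated by the variables in [J]: a measurable
    function on it depends on that group only. The identity maps into [sigT J] and [sigT K] are then
    independent random variables when the groups are disjoint. *)
Definition sigT (J : {set I}) := g_sigma_algebraType (cylinders X J).

Definition sigT_id (J : {set I}) : T -> sigT J := fun w => w.

Lemma measurable_sigT_id J : measurable_fun [set: T] (sigT_id J).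
Proof. move=> _ A mA; rewrite setTI. exact: (cylinders_sub mX (J := J) mA). Qed.

Lemma measurable_sigT (J : {set I}) i : i \in J -> measurable_fun [set: sigT J] (X i : sigT J -> E).
Proof.
move=> iJ _ A mA; rewrite setTI; apply: sub_sigma_algebra.
exists (fun j => if j == i then A else setT); first by move=> j; case: ifP.
apply/seteqP; split=> [w Aw j jJ|w /(_ i iJ)] /=; last by rewrite eqxx.
by case: eqP => [->|].
Qed.

(** Conditioning on group [J]: the variables of group [K] may be resampled independently. *)
Lemma double_integral_groups (J K : {set I}) (F : (sigT J * sigT K)%type -> \bar R) :
  (forall i, i \in J -> i \notin K) ->
  measurable_fun setT F -> (forall x, 0 <= F x)%E ->
  (\int[P]_w F (w, w) = \int[P]_w \int[P]_w' F (w, w'))%E.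
Proof.
move=> JK mF F0.
pose mJ := isMeasurableFun.Build _ _ _ _ _ (@measurable_sigT_id J).
pose mK := isMeasurableFun.Build _ _ _ _ _ (@measurable_sigT_id K).
pose fJ : {mfun T >-> sigT J} := HB.pack (sigT_id J) mJ.
pose fK : {mfun T >-> sigT K} := HB.pack (sigT_id K) mK.
apply: (@double_integral _ _ _ _ _ _ _ P fJ fK) => //.
move=> A B mA mB; exact: (sigma_indep mX iX JK).
Qed.

End GroupsIntegral.

(** * Gaussian expectations through the density *)

Section Density.
Context {R : realType} {d : measure_display} {T : measurableType d}.
Variables (mu nu : {measure set T -> \bar R}) (g : T -> R).
Hypothesis mg : measurable_fun setT g.
Hypothesis g0 : forall x, 0 <= g x.
Hypothesis nuE : forall A, measurable A -> (nu A = \int[mu]_(x in A) (g x)%:E)%E.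

Import HBNNSimple.

Let density_nnsfun (f : {nnsfun T >-> R}) :
  (\int[nu]_x (f x)%:E = \int[mu]_x (f x * g x)%:E)%E.
Proof.
under [LHS]eq_integral do rewrite fimfunE -fsumEFin//.
rewrite [LHS]ge0_integral_fsum//; last 2 first.
  - by move=> r; exact/measurable_EFinP/measurableT_comp.
  - by move=> n x _; rewrite EFinM nnfun_muleindic_ge0.
under [RHS]eq_integral.
  move=> x xD; rewrite EFinM fimfunE -fsumEFin// ge0_mule_fsuml; last first.
    by move=> r; rewrite EFinM nnfun_muleindic_ge0.
  over.
rewrite [RHS]ge0_integral_fsum//; last 2 first.
  - move=> r; apply: emeasurable_funM; last exact/measurable_EFinP.
    by apply/measurable_EFinP; apply/measurableT_comp.
  - move=> n x _; apply: mule_ge0; last by rewrite lee_fin.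
    by rewrite EFinM nnfun_muleindic_ge0.
apply: eq_fsbigr => r _.
have [r0|r0] := ltP r 0.
  rewrite preimage_nnfun0 // indic0 /=; under eq_integral do rewrite mulr0.
  by under [RHS]eq_integral do rewrite mulr0 mul0e; rewrite !integral0.
rewrite integralZl_indic_nnsfun //= integral_indic // setIT nuE //.
under [RHS]eq_integral do rewrite EFinM -muleA.
rewrite ge0_integralZl ?lee_fin //; first last.
- by move=> x _; rewrite mule_ge0 ?lee_fin.
- by apply: emeasurable_funM; apply/measurable_EFinP => //; exact: measurable_indic.
congr (_ * _)%E; rewrite integral_mkcond; apply: eq_integral => x _.
rewrite patchE indicE; case: ifPn => xr; first by rewrite mul1e.
by rewrite mul0e.
Qed.

Lemma integral_density (f : T -> R) : measurable_fun setT f -> (forall x, 0 <= f x) ->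
  (\int[nu]_x (f x)%:E = \int[mu]_x (f x * g x)%:E)%E.
Proof.
move=> mf f0.
have mf' : measurable_fun [set: T] (EFin \o f) by exact/measurable_EFinP.
pose f_ := nnsfun_approx measurableT mf'.
have cf x : (EFin \o f_ ^~ x) n @[n --> \oo] --> (f x)%:E.
  by apply: cvg_nnsfun_approx => // y _; rewrite lee_fin.
transitivity (lim (\int[nu]_x (f_ n x)%:E @[n --> \oo])%E).
  rewrite -monotone_convergence//=.
  - by apply: eq_integral => x _; apply/esym/cvg_lim => //; exact: cf.
  - by move=> n; exact/measurable_EFinP/measurable_funTS.
  - by move=> n x _; rewrite lee_fin.
  - by move=> x _ a b ab; rewrite lee_fin; exact/lefP/nd_nnsfun_approx.
transitivity (lim (\int[mu]_x (f_ n x * g x)%:E @[n --> \oo])%E).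
  by apply: congr_lim; apply/funext => n; exact: density_nnsfun.
rewrite -monotone_convergence//=.
- apply: eq_integral => x _; apply/cvg_lim => //.
  under eq_fun do rewrite EFinM.
  by rewrite EFinM; apply: cvgeZr => //; exact: cf.
- by move=> n; apply/measurable_EFinP; apply: measurable_funM.
- by move=> n x _; rewrite lee_fin mulr_ge0.
- move=> x _ a b ab; rewrite lee_fin ler_wpM2r //; exact/lefP/nd_nnsfun_approx.
Qed.

End Density.

Section NormalExpectation.
Context {R : realType} {d : measure_display} {T : measurableType d}.
Variables (P : probability T R) (v : R) (X : T -> R).
Hypothesis v0 : 0 < v.
Hypothesis NX : is_normal P 0 v X.
Let mu := @lebesgue_measure R.
Let s := Num.sqrt v.
Let s2 : s ^+ 2 = v. Proof. by rewrite sqr_sqrtr // ltW. Qed.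
Let s0 : s != 0. Proof. by rewrite sqrtr_eq0 -ltNge. Qed.
Let mX : measurable_fun setT (X : T -> measurableTypeR R). Proof. by case: NX. Qed.
Let X_mixin := isMeasurableFun.Build _ _ _ _ _ mX.
Let X' : {mfun T >-> measurableTypeR R} := HB.pack X X_mixin.

Lemma normal_integral (f : R -> R) : measurable_fun setT f -> (forall x, 0 <= f x) ->
  (\int[P]_w (f (X w))%:E = \int[mu]_x
  (f x * normal_pdf 0 s x)%:E)%E.
Proof.
move=> mf f0; have mf' : measurable_fun setT (EFin \o f) by exact/measurable_EFinP.
transitivity (\int[pushforward P X']_x (f x)%:E)%E.
  rewrite ge0_integral_pushforward ?preimage_setT //.
  by move=> x _; rewrite lee_fin.
transitivity (\int[normal_prob 0 s]_x (f x)%:E)%E.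
  by apply: eq_measure_integral => A mA _; exact: (NX.2 A mA).
apply: (integral_density (mu := mu) (nu := normal_prob 0 s) (g := normal_pdf 0 s)) => //.
- exact: measurable_normal_pdf.
- by move=> x; exact: normal_pdf_ge0.
Qed.

Lemma normal_mgf (t : R) : (\int[P]_w (expR (t * X w))%:E = (expR (t ^+ 2 * v / 2))%:E)%E.
Proof.
rewrite (normal_integral (f := fun x => expR (t * x))); last by move=> x; exact: expR_ge0.
  (* Completing the square: the exponential tilt moves the mean to [t * v]. *)
  transitivity (\int[mu]_x ((expR (t ^+ 2 * v / 2))%:E * (normal_pdf (t * v) s x)%:E))%E.
    apply: eq_integral => x _; rewrite -EFinM; congr EFin.
    rewrite !normal_pdfE // /normal_fun mulrCA [RHS]mulrCA; congr (_ * _).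
    rewrite -!expRD s2; congr expR; rewrite -mulr_natl; field.
    by rewrite gt_eqF.
  rewrite ge0_integralZl ?lee_fin ?expR_ge0 //.
  - by rewrite integral_normal_pdf mule1.
  - by apply/measurable_EFinP; exact: measurable_normal_pdf.
  - by move=> x _; rewrite lee_fin normal_pdf_ge0.
by apply: measurableT_comp => //; apply: measurable_funM.
Qed.

Lemma normal_sq_mgf (l : R) : 0 < 1 + 2 * l * v ->
  (\int[P]_w (expR (- l * X w ^+ 2))%:E = ((Num.sqrt (1 + 2 * l * v))^-1)%:E)%E.
Proof.
move=> lv.
rewrite (normal_integral (f := fun x => expR (- l * x ^+ 2))); last by move=> x; exact: expR_ge0.
  (* The tilt by exp(- l x^2) changes the variance to [v']; [l] may be negative, and will be in
     [normal_moment_even]. *)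
  pose v' := v / (1 + 2 * l * v).
  have v'0 : 0 < v' by rewrite divr_gt0.
  have s'2 : Num.sqrt v' ^+ 2 = v' by rewrite sqr_sqrtr // ltW.
  have s'0 : Num.sqrt v' != 0 by rewrite sqrtr_eq0 -ltNge.
  transitivity (\int[mu]_x (((Num.sqrt (1 + 2 * l * v))^-1)%:E * (normal_pdf 0 (Num.sqrt v') x)%:E))%E.
    apply: eq_integral => x _; rewrite -EFinM; congr EFin.
    rewrite !normal_pdfE // /normal_fun mulrCA [RHS]mulrA -expRD s2 s'2; congr (_ * expR _).
      rewrite /normal_peak s2 s'2 -invfM; congr (_^-1); rewrite -sqrtrM ?ltW //.
      congr Num.sqrt; rewrite /v' !mulr2n; field.
      by rewrite gt_eqF.
    rewrite /v' !subr0 !mulr2n; field.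
    by rewrite (gt_eqF lv) (gt_eqF (addr_gt0 v0 v0)).
  rewrite ge0_integralZl ?lee_fin ?invr_ge0 ?sqrtr_ge0 //.
  - by rewrite integral_normal_pdf mule1.
  - by apply/measurable_EFinP; exact: measurable_normal_pdf.
  - by move=> x _; rewrite lee_fin normal_pdf_ge0.
by apply: measurableT_comp => //; apply: measurable_funM => //; exact: measurable_funX.
Qed.

Lemma normal_sym (f : R -> R) : measurable_fun setT f -> (forall x, 0 <= f x) ->
  (\int[P]_w (f (- X w))%:E = \int[P]_w (f (X w))%:E)%E.
Proof.
move=> mf f0; rewrite (normal_integral mf f0).
have mfN : measurable_fun setT (fun x : R => f (- x)) by exact: measurableT_comp.
rewrite (normal_integral mfN); last by move=> x; exact: f0.
have mo : measurable_fun setT (-%R : measurableTypeR R -> measurableTypeR R).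
  exact: oppr_measurable.
transitivity (\int[pushforward mu (-%R : measurableTypeR R -> measurableTypeR R)]_x (f x * normal_pdf 0 s x)%:E)%E.
  have mh : measurable_fun setT (fun x : measurableTypeR R => (f x * normal_pdf 0 s x)%:E).
    by apply/measurable_EFinP; apply: measurable_funM => //; exact: measurable_normal_pdf.
  have h0 : {in [set: measurableTypeR R], forall x, (0 <= (f x * normal_pdf 0 s x)%:E)%E}.
    by move=> x _; rewrite lee_fin mulr_ge0 // normal_pdf_ge0.
  rewrite (ge0_integral_pushforward mo (@lebesgue_measure R) measurableT mh h0) preimage_setT.
  apply: eq_integral => x _ /=; congr (_ * _)%:E.
  by rewrite !normal_pdfE // /normal_fun !subr0 sqrrN.
by apply: eq_measure_integral => A mA _; exact: lebesgue_measureN.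
Qed.

End NormalExpectation.

(** * Real expectations and Gaussian moments *)

Section Expectation.
Context {R : realType} {d : measure_display} {T : measurableType d}.
Variable P : probability T R.
Implicit Types f g : T -> R.

Definition itg f := P.-integrable setT (fun w => (f w)%:E).
(** [fine] turns an infinite integral into 0, whence the integrability hypotheses in the linear
    rules below. *)
Definition Ex f : R := fine (\int[P]_w (f w)%:E)%E.

Lemma itg_measurable f : itg f -> measurable_fun setT f.
Proof. by move=> /(measurable_int P)/measurable_EFinP. Qed.

Lemma ExE f : itg f -> (\int[P]_w (f w)%:E = (Ex f)%:E)%E.
Proof. by move=> If; rewrite /Ex fineK //; exact: integrable_fin_num. Qed.

Lemma eq_Ex f g : (forall w, f w = g w) -> Ex f = Ex g.
Proof. by move=> fg; congr fine; apply: eq_integral => w _; rewrite fg. Qed.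

Lemma eq_itg f g : (forall w, f w = g w) -> itg f -> itg g.
Proof. by move=> /funext ->. Qed.

Lemma itg_cst c : itg (fun=> c).
Proof. exact: finite_measure_integrable_cst. Qed.

Lemma itgD f g : itg f -> itg g -> itg (fun w => f w + g w).
Proof. by move=> If Ig; exact: (integrableD measurableT If Ig). Qed.

Lemma itgZ c f : itg f -> itg (fun w => c * f w).
Proof. by move=> If; exact: (integrableZl measurableT c If). Qed.

Lemma itgN f : itg f -> itg (fun w => - f w).
Proof. by move=> /(itgZ (-1)); apply: eq_itg => w; rewrite mulN1r. Qed.

Lemma itgB f g : itg f -> itg g -> itg (fun w => f w - g w).
Proof. by move=> If /itgN Ig; exact: itgD. Qed.

Lemma itg_sum (I : Type) (s : seq I) (Q : pred I) (F : I -> T -> R) :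
  (forall i, Q i -> itg (F i)) -> itg (fun w => \sum_(i <- s | Q i) F i w).
Proof.
move=> H; elim: s => [|i s IH].
  by apply: eq_itg (itg_cst 0) => w; rewrite big_nil.
apply: (@eq_itg (fun w => (if Q i then F i w else 0) + \sum_(i <- s | Q i) F i w)).
  by move=> w; rewrite big_cons; case: ifP => // _; rewrite add0r.
by apply: itgD => //; case: (boolP (Q i)) => Qi; [exact: H | exact: itg_cst].
Qed.

Lemma itg_le f g : measurable_fun setT f -> (forall w, `|f w| <= g w) -> itg g -> itg f.
Proof.
move=> mf fg Ig; apply: (le_integrable measurableT _ _ Ig) => [|w _ /=].
  exact/measurable_EFinP.
by rewrite lee_fin (le_trans (fg w)) // ler_norm.
Qed.

Lemma itg_fin f : measurable_fun setT f -> (forall w, 0 <= f w) ->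
  (\int[P]_w (f w)%:E < +oo)%E -> itg f.
Proof.
move=> mf f0 ff; apply/integrableP; split; first exact/measurable_EFinP.
by rewrite (eq_integral (fun w => (f w)%:E)) // => w _; rewrite gee0_abs // lee_fin.
Qed.

Lemma ExD f g : itg f -> itg g -> Ex (fun w => f w + g w) = Ex f + Ex g.
Proof.
move=> If Ig; apply: EFin_inj; rewrite EFinD -!ExE //; last exact: itgD.
by rewrite -(integralD measurableT If Ig).
Qed.

Lemma ExZ c f : itg f -> Ex (fun w => c * f w) = c * Ex f.
Proof.
move=> If; apply: EFin_inj; rewrite EFinM -!ExE //; last exact: itgZ.
by rewrite -(integralZl measurableT If).
Qed.

Lemma ExN f : itg f -> Ex (fun w => - f w) = - Ex f.
Proof. by move=> If; rewrite -mulN1r -ExZ //; apply: eq_Ex => w; rewrite mulN1r. Qed.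

Lemma ExB f g : itg f -> itg g -> Ex (fun w => f w - g w) = Ex f - Ex g.
Proof. by move=> If Ig; rewrite ExD ?ExN //; exact: itgN. Qed.

Lemma Ex_cst c : Ex (fun=> c) = c.
Proof. by rewrite /Ex integral_cst //= probability_setT mule1. Qed.

Lemma Ex_sum (I : Type) (s : seq I) (Q : pred I) (F : I -> T -> R) :
  (forall i, Q i -> itg (F i)) ->
  Ex (fun w => \sum_(i <- s | Q i) F i w) = \sum_(i <- s | Q i) Ex (F i).
Proof.
move=> H; elim: s => [|i s IH].
  by rewrite big_nil -[RHS](Ex_cst 0); apply: eq_Ex => w; rewrite big_nil.
rewrite big_cons -IH; case: ifP => Qi; last by apply: eq_Ex => w; rewrite big_cons Qi.
rewrite -ExD; [|exact: H|exact: itg_sum].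
by apply: eq_Ex => w; rewrite big_cons Qi.
Qed.

Lemma Ex_ge0 f : (forall w, 0 <= f w) -> 0 <= Ex f.
Proof. by move=> f0; apply: fine_ge0; apply: integral_ge0 => w _; rewrite lee_fin. Qed.

Lemma Ex_le f g : itg f -> itg g -> (forall w, f w <= g w) -> Ex f <= Ex g.
Proof.
move=> If Ig fg; rewrite -subr_ge0 -ExB //; apply: Ex_ge0 => w.
by rewrite subr_ge0.
Qed.

Lemma itg_norm f : itg f -> itg (fun w => `|f w|).
Proof.
move=> If; apply: itg_le (integrable_norm If) => [|w]; last by rewrite normr_id.
by apply: measurableT_comp => //; exact: itg_measurable.
Qed.

Lemma Ex_norm f : itg f -> `|Ex f| <= Ex (fun w => `|f w|).
Proof.
move=> If; have In := itg_norm If; rewrite ler_norml -ExN //; apply/andP; split.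
  by apply: Ex_le => //; [exact: itgN | move=> w; rewrite lerNl -normrN ler_norm].
by apply: Ex_le => // w; exact: ler_norm.
Qed.

End Expectation.

(** Alternating Taylor bounds, each obtained from the previous one by integrating the sign of the
    derivative. They feed the identification of the second and fourth moments. *)
Lemma expR_neg_le (R : realType) (a : R) : 0 <= a ->
  1 - a + a ^+ 2 / 2 - a ^+ 3 / 6 <= expR (- a) <= 1 - a + a ^+ 2 / 2.
Proof.
have key (f g : R -> R) (b : R) : (forall x : R, is_derive x 1 f (g x)) ->
    (forall x, 0 <= x -> 0 <= g x) -> 0 <= b -> f 0 <= f b.
  move=> df g0 b0.
  have drf (x : R) : derivable f x 1 by case: (df x).
  have cf (x : R) : {for x, continuous f}.
    by apply: differentiable_continuous; apply/derivable1_diffP.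
  apply: (@ger0_derive1_le_cc R f 0 b) => //.
  - move=> x; rewrite in_itv /= => /andP[x0 _].
    by rewrite derive1E; case: (df x) => _ ->; rewrite g0 // ltW.
  - by apply: continuous_subspaceT => x; exact: cf.
  - by rewrite in_itv /= lexx.
  - by rewrite in_itv /= b0 lexx.
move=> a0.
pose f x := (1 - x + x ^+ 2 / 2 - expR (- x) : R).
pose f' x := (- 1 + x + expR (- x) : R).
pose g x := (expR (- x) - (1 - x + x ^+ 2 / 2 - x ^+ 3 / 6) : R).
have df (x : R) : is_derive x 1 f (f' x).
  rewrite /f /f'; apply: is_derive_eq; rewrite /GRing.scale /= !mulr1.
  by field.
have f0 x : 0 <= x -> 0 <= f x.
  have f00 : f 0 = 0 by rewrite /f oppr0 expR0; ring.
  move=> x0; have := @key f f' x df _ x0; rewrite f00.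
  by apply=> y y0; rewrite /f'; have := @expR_ge1Dx R (- y); lra.
have dg (x : R) : is_derive x 1 g (f x).
  rewrite /g /f; apply: is_derive_eq; rewrite /GRing.scale /= !mulr1.
  by field.
have g0 : 0 <= g a.
  have g00 : g 0 = 0 by rewrite /g oppr0 expR0; ring.
  by have := @key g f a dg f0 a0; rewrite g00.
have fa := f0 _ a0; rewrite /f /g in fa g0.
by apply/andP; split; lra.
Qed.

Section NormalMoments.
Context {R : realType} {d : measure_display} {T : measurableType d}.
Variables (P : probability T R) (v : R) (X : T -> R).
Hypothesis v0 : 0 < v.
Hypothesis NX : is_normal P 0 v X.
Let mX : measurable_fun setT X. Proof. by case: NX. Qed.

Let mXk k : measurable_fun setT (fun w => X w ^+ k).
Proof. exact: measurable_funX. Qed.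

Let vn0 : v != 0. Proof. by rewrite gt_eqF. Qed.

(** x^k <= k! exp(x) at x = X^2 / (4 v), whose exponential has expectation sqrt(2) <= 2. The bound
    is crude, but only its finiteness and a fixed constant matter. *)
Lemma normal_moment_even k :
  itg P (fun w => X w ^+ (2 * k)) /\ Ex P (fun w => X w ^+ (2 * k)) <= k`!%:R * (4 * v) ^+ k * 2.
Proof.
pose l := - (4 * v)^-1.
have lv : 1 + 2 * l * v = 2^-1 by rewrite /l; field.
have l0 : 0 < 1 + 2 * l * v by rewrite lv invr_gt0.
pose g w := expR (- l * X w ^+ 2).
have mg : measurable_fun setT g.
  by apply: measurableT_comp => //; apply: measurable_funM => //; exact: mXk.
have Ig : (\int[P]_w (g w)%:E = ((Num.sqrt (2^-1))^-1)%:E)%E.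
  by rewrite (normal_sq_mgf v0 NX l0) lv.
have itg_g : itg P g.
  by apply: itg_fin => // [w|]; [exact: expR_ge0 | rewrite Ig ltry].
have Exg : Ex P g <= 2.
  rewrite /Ex Ig /= sqrtrV // invrK.
  by rewrite -[leRHS]ger0_norm // -sqrtr_sqr ler_wsqrtr // expr2; lra.
have le w : X w ^+ (2 * k) <= k`!%:R * (4 * v) ^+ k * g w.
  have a0 : 0 <= - l * X w ^+ 2 by rewrite /l opprK mulr_ge0 ?sqr_ge0 // invr_ge0 mulr_ge0 // ltW.
  have : (- l * X w ^+ 2) ^+ k <= k`!%:R * g w.
    case: k => [|k].
      by rewrite !expr0 fact0 mul1r -[leLHS]expR0 ler_expR.
    have := expR_ge1Dxn k a0; rewrite -/(g w) => H.
    rewrite [leRHS]mulrC -ler_pdivrMr ?ltr0n ?fact_gt0 //; apply: le_trans _ H.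
    by rewrite lerDr.
  have -> : X w ^+ (2 * k) = (4 * v) ^+ k * (- l * X w ^+ 2) ^+ k.
    rewrite exprM -exprMn; congr (_ ^+ k); rewrite /l; field => //.
  move=> H; rewrite [leRHS](_ : _ = (4 * v) ^+ k * (k`!%:R * g w)); last by ring.
  by apply: ler_wpM2l => //; rewrite exprn_ge0 // mulr_ge0 // ltW.
have I : itg P (fun w => X w ^+ (2 * k)).
  apply: itg_le (itgZ (k`!%:R * (4 * v) ^+ k) itg_g) => // w.
  by rewrite ger0_norm // exprM exprn_ge0 // sqr_ge0.
split=> //; apply: le_trans (Ex_le I (itgZ (k`!%:R * (4 * v) ^+ k) itg_g) le) _.
rewrite ExZ //; apply: ler_wpM2l => //.
by rewrite mulr_ge0 // exprn_ge0 // mulr_ge0 // ltW.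
Qed.

Lemma normal_moment_itg k : itg P (fun w => X w ^+ k).
Proof.
apply: itg_le (itgD (itg_cst P 1) (normal_moment_even k).1) => // w.
rewrite mulnC exprM; set a := X w ^+ k.
by rewrite ler_norml; apply/andP; split; nra.
Qed.

Lemma normal_moment_odd k : odd k -> Ex P (fun w => X w ^+ k) = 0.
Proof.
move=> ok; pose h (x : R) := 1 + x ^+ (2 * k) + x ^+ k.
have mh : measurable_fun setT h.
  apply: measurable_funD; first apply: measurable_funD => //; exact: measurable_funX.
have h0 x : 0 <= h x.
  by rewrite /h mulnC exprM; set a := x ^+ k; nra.
have I2 := (normal_moment_even k).1; have Ik := normal_moment_itg k.
have E : Ex P (fun w => h (- X w)) = Ex P (fun w => h (X w)).
  by rewrite /Ex (normal_sym v0 NX mh h0).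
have I1 := itgD (itg_cst P 1) I2.
have E1 : Ex P (fun w => h (X w)) = Ex P (fun w => 1 + X w ^+ (2 * k)) + Ex P (fun w => X w ^+ k).
  by rewrite -ExD.
have E2 : Ex P (fun w => h (- X w)) = Ex P (fun w => 1 + X w ^+ (2 * k)) - Ex P (fun w => X w ^+ k).
  rewrite -ExB //; apply: eq_Ex => w; rewrite /h !exprM sqrrN [X in _ + X]exprNn.
  by rewrite -signr_odd ok expr1 mulN1r.
by move: E; rewrite E1 E2; lra.
Qed.

(** Uniqueness of Taylor coefficients, in a form that needs no derivative: divide by [l], let [l] be
    small, and repeat. *)
Lemma taylor2_eq0 (a b c : R) : (forall l, 0 < l <= 1 -> `|l * a + l ^+ 2 * b| <= c * l ^+ 3) ->
  a = 0 /\ b = 0.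
Proof.
have small (x e : R) : 0 <= e -> (forall l, 0 < l <= 1 -> `|x| <= l * e) -> x = 0.
  move=> e0 H; apply/normr0_eq0/eqP; rewrite eq_le normr_ge0 andbT leNgt; apply/negP => x0.
  have l0 : 0 < `|x| / (2 * e + `|x|) by rewrite divr_gt0 //; lra.
  have l1 : `|x| / (2 * e + `|x|) <= 1 by rewrite ler_pdivrMr; lra.
  have := H _ (introT andP (conj l0 l1)).
  by rewrite mulrAC ler_pdivlMr; [nra | lra].
move=> H; have c0 : 0 <= c.
  have := H 1; rewrite lexx ltr01 => /(_ isT); rewrite !expr1n mulr1; exact: le_trans.
have H1 l : 0 < l <= 1 -> `|a + l * b| <= c * l ^+ 2.
  move=> l01; have := H l l01; case/andP: l01 => l0 l1.
  have -> : l * a + l ^+ 2 * b = l * (a + l * b) by ring.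
  rewrite normrM gtr0_norm // (_ : c * l ^+ 3 = l * (c * l ^+ 2)); last by ring.
  by rewrite ler_pM2l.
have a0 : a = 0.
  apply: (small a (`|b| + c)); first by rewrite addr_ge0.
  move=> l l01; have := H1 l l01; case/andP: l01 => l0 l1.
  have -> : `|a| <= l * (`|b| + c) = (`|a| <= l * `|b| + l * c) by rewrite mulrDr.
  move=> H2; have : `|a| <= `|a + l * b| + l * `|b|.
    rewrite -{2}(gtr0_norm l0) -normrM -{1}[a](addrK (l * b)).
    by rewrite (le_trans (ler_normB _ _)).
  have cl : c * l ^+ 2 <= l * c by rewrite expr2 mulrA [l * c]mulrC ler_piMr // mulr_ge0 // ltW.
  by lra.
split=> //; apply: (small b c) => // l l01; have := H1 l l01; case/andP: l01 => l0 l1.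
rewrite a0 add0r normrM gtr0_norm // (_ : c * l ^+ 2 = l * (l * c)); last by ring.
by rewrite ler_pM2l.
Qed.

(** The moments are read off the Laplace transform of X^2. By [normal_sq_mgf] it equals (1 + 2 l
    v)^(-1/2); by [expR_neg_le] it is 1 - l E X^2 + l^2 E X^4 / 2 up to O(l^3). Comparing the
    expansions gives both moments. *)
Lemma normal_moment24 : Ex P (fun w => X w ^+ 2) = v /\ Ex P (fun w => X w ^+ 4) = 3 * v ^+ 2.
Proof.
set A := Ex P (fun w => X w ^+ 2); set B := Ex P (fun w => X w ^+ 4).
set D := Ex P (fun w => X w ^+ 6).
have I2 : itg P (fun w => X w ^+ 2) by exact: normal_moment_itg.
have I4 : itg P (fun w => X w ^+ 4) by exact: normal_moment_itg.
have I6 : itg P (fun w => X w ^+ 6) by exact: normal_moment_itg.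
have D0 : 0 <= D by apply: Ex_ge0 => w; rewrite (exprM _ 2 3) exprn_ge0 // sqr_ge0.
suff [a0 b0] : A - v = 0 /\ (3 * v ^+ 2 - B) / 2 = 0.
  by split; lra.
apply: (@taylor2_eq0 _ _ (D / 6 + 5 / 2 * v ^+ 3)) => l /andP[l0 l1].
pose r := Num.sqrt (1 + 2 * l * v).
have lv0 : 0 < 1 + 2 * l * v by rewrite addr_gt0 // !mulr_gt0.
have r2 : r ^+ 2 = 1 + 2 * l * v by rewrite sqr_sqrtr // ltW.
have r1 : 1 <= r by rewrite -[leLHS]sqrtr1 ler_wsqrtr // lerDl !mulr_ge0 // ltW.
pose g w := expR (- l * X w ^+ 2).
have Ig : (\int[P]_w (g w)%:E = (r^-1)%:E)%E by rewrite (normal_sq_mgf v0 NX lv0).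
have itg_g : itg P g.
  apply: itg_fin => [|w|]; [|exact: expR_ge0 | by rewrite Ig ltry].
  by apply: measurableT_comp => //; apply: measurable_funM => //; exact: mXk.
have Exg : Ex P g = r^-1 by rewrite /Ex Ig.
have J2 := itgZ l I2; have J4 := itgZ (l ^+ 2 / 2) I4; have J6 := itgZ (l ^+ 3 / 6) I6.
have J0 := itg_cst P 1.
have JU := itgD (itgB J0 J2) J4; have JL := itgB JU J6.
have bnd w : 1 - l * X w ^+ 2 + l ^+ 2 / 2 * X w ^+ 4 - l ^+ 3 / 6 * X w ^+ 6 <= g w
    <= 1 - l * X w ^+ 2 + l ^+ 2 / 2 * X w ^+ 4.
  have a0 : 0 <= l * X w ^+ 2 by rewrite mulr_ge0 ?sqr_ge0 // ltW.
  have := expR_neg_le a0; rewrite -mulNr -/(g w).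
  rewrite (_ : (l * X w ^+ 2) ^+ 2 / 2 = l ^+ 2 / 2 * X w ^+ 4); last by field.
  by rewrite (_ : (l * X w ^+ 2) ^+ 3 / 6 = l ^+ 3 / 6 * X w ^+ 6); last by field.
have U : r^-1 <= 1 - l * A + l ^+ 2 / 2 * B.
  rewrite -Exg; apply: le_trans (Ex_le itg_g JU _) _; first by move=> w; case/andP: (bnd w).
  by rewrite (ExD (itgB J0 J2) J4) (ExB J0 J2) (ExZ _ I2) (ExZ _ I4) Ex_cst.
have L : 1 - l * A + l ^+ 2 / 2 * B - l ^+ 3 / 6 * D <= r^-1.
  rewrite -Exg; apply: le_trans _ (Ex_le JL itg_g _); last by move=> w; case/andP: (bnd w).
  rewrite (ExB JU J6) (ExD (itgB J0 J2) J4) (ExB J0 J2) (ExZ _ I2) (ExZ _ I4) (ExZ _ I6).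
  by rewrite Ex_cst.
(* In the variable [r] the Taylor bounds on the inverse square root become polynomial inequalities,
   with factors (r - 1)^3 and (r - 1)^4. *)
have lvE : l * v = (r ^+ 2 - 1) / 2 by rewrite r2; field.
have r0 : 0 < r by rewrite (lt_le_trans _ r1).
have rU : r^-1 <= 1 - l * v + 3 / 2 * (l * v) ^+ 2.
  rewrite -[leLHS]mul1r ler_pdivrMr // lvE -subr_ge0.
  rewrite (_ : _ - 1 = (r - 1) ^+ 3 * (3 * r ^+ 2 + 9 * r + 8) / 8); last by field.
  by rewrite divr_ge0 // mulr_ge0 ?exprn_ge0 ?subr_ge0 //; nra.
have rL : 1 - l * v + 3 / 2 * (l * v) ^+ 2 - 5 / 2 * (l * v) ^+ 3 <= r^-1.
  rewrite -[leRHS]mul1r ler_pdivlMr // lvE -subr_ge0.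
  rewrite (_ : 1 - _ = (r - 1) ^+ 4 * (5 * r ^+ 3 + 20 * r ^+ 2 + 29 * r + 16) / 16); last by field.
  by rewrite divr_ge0 // mulr_ge0 ?exprn_ge0 ?subr_ge0 // !addr_ge0 // ?mulr_ge0 ?exprn_ge0 // ltW.
rewrite ler_norml; rewrite !exprMn in rU rL.
have l30 : 0 <= l ^+ 3 * v ^+ 3 by rewrite mulr_ge0 ?exprn_ge0 // ltW.
have l31 : 0 <= l ^+ 3 * D by rewrite mulr_ge0 // exprn_ge0 // ltW.
by apply/andP; split; lra.
Qed.

End NormalMoments.

(** * Products of independent variables, and complex-valued expectations *)

Section IndependentProducts.
Context {R : realType} {dT dE : measure_display}.
Context {T : measurableType dT} {E : measurableType dE}.
Variables (P : probability T R) (I : finType) (X : I -> T -> E).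
Hypothesis mX : forall i, measurable_fun [set: T] (X i).
Hypothesis iX : mutually_independent P X.

Definition smeas (J : {set I}) (f : T -> R) := measurable_fun setT (f : sigT X J -> R).

Lemma smeas_measurable J f : smeas J f -> measurable_fun setT f.
Proof.
move=> mf _ A mA; have := mf measurableT A mA.
by rewrite !setTI; exact: (cylinders_sub mX (J := J)).
Qed.

Variables J K : {set I}.
Hypothesis JK : forall i, i \in J -> i \notin K.

Lemma integral_mul_ge0 (f g : T -> R) : smeas J f -> smeas K g ->
  (forall w, 0 <= f w) -> (forall w, 0 <= g w) ->
  (\int[P]_w (f w * g w)%:E = \int[P]_w (f w)%:E * \int[P]_w (g w)%:E)%E.
Proof.
move=> mf mg f0 g0.
pose F (x : (sigT X J * sigT X K)%type) := ((f x.1 * g x.2)%:E : \bar R).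
have mF : measurable_fun setT F.
  apply/measurable_EFinP; apply: measurable_funM.
  - by apply: (measurableT_comp mf); exact: measurable_fst.
  - by apply: (measurableT_comp mg); exact: measurable_snd.
have F0 x : (0 <= F x)%E by rewrite lee_fin mulr_ge0.
have -> : (\int[P]_w (f w * g w)%:E = \int[P]_w F (w, w))%E by [].
rewrite (double_integral_groups mX iX JK mF F0).
transitivity (\int[P]_w ((f w)%:E * \int[P]_w' (g w')%:E))%E.
  apply: eq_integral => w _; rewrite /F /=.
  under eq_integral do rewrite EFinM.
  rewrite ge0_integralZl ?lee_fin //; first exact/measurable_EFinP/(smeas_measurable mg).
  by move=> x _; rewrite lee_fin.
rewrite ge0_integralZr //.
- exact/measurable_EFinP/(smeas_measurable mf).
- by move=> x _; rewrite lee_fin.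
- by apply: integral_ge0 => w _; rewrite lee_fin.
Qed.

Let Ex_mul_ge0 (f g : T -> R) : smeas J f -> smeas K g ->
  (forall w, 0 <= f w) -> (forall w, 0 <= g w) -> itg P f -> itg P g ->
  itg P (fun w => f w * g w) /\ Ex P (fun w => f w * g w) = Ex P f * Ex P g.
Proof.
move=> mf mg f0 g0 If Ig; have := integral_mul_ge0 mf mg f0 g0.
rewrite (ExE If) (ExE Ig) -EFinM => E1; split; last by rewrite {1}/Ex E1.
apply: itg_fin; last by rewrite E1 ltry.
  by apply: measurable_funM; [exact: smeas_measurable mf | exact: smeas_measurable mg].
by move=> w; rewrite mulr_ge0.
Qed.

Lemma Ex_mul (f g : T -> R) : smeas J f -> smeas K g -> itg P f -> itg P g ->
  itg P (fun w => f w * g w) /\ Ex P (fun w => f w * g w) = Ex P f * Ex P g.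
Proof.
move=> mf mg If Ig.
pose pos (h : T -> R) w := 2^-1 * (`|h w| + h w).
pose neg (h : T -> R) w := 2^-1 * (`|h w| - h w).
have mpos L h : smeas L h -> smeas L (pos h).
  move=> mh; apply: measurable_funM => //; apply: measurable_funD => //.
  exact: measurableT_comp.
have mneg L h : smeas L h -> smeas L (neg h).
  move=> mh; apply: measurable_funM => //; apply: measurable_funB => //.
  exact: measurableT_comp.
have pos0 h w : 0 <= pos h w by rewrite mulr_ge0 // -lerBlDr sub0r -normrN ler_norm.
have neg0 h w : 0 <= neg h w by rewrite mulr_ge0 // subr_ge0 ler_norm.
have Ipos h : itg P h -> itg P (pos h) by move=> Ih; apply/itgZ/itgD => //; exact: itg_norm.
have Ineg h : itg P h -> itg P (neg h) by move=> Ih; apply/itgZ/itgB => //; exact: itg_norm.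
have hE h w : h w = pos h w - neg h w by rewrite /pos /neg; field.
have [I1 E1] := Ex_mul_ge0 (mpos _ _ mf) (mpos _ _ mg) (pos0 f) (pos0 g) (Ipos _ If) (Ipos _ Ig).
have [I2 E2] := Ex_mul_ge0 (mpos _ _ mf) (mneg _ _ mg) (pos0 f) (neg0 g) (Ipos _ If) (Ineg _ Ig).
have [I3 E3] := Ex_mul_ge0 (mneg _ _ mf) (mpos _ _ mg) (neg0 f) (pos0 g) (Ineg _ If) (Ipos _ Ig).
have [I4 E4] := Ex_mul_ge0 (mneg _ _ mf) (mneg _ _ mg) (neg0 f) (neg0 g) (Ineg _ If) (Ineg _ Ig).
have fgE w : (pos f w * pos g w + neg f w * neg g w) -
    (pos f w * neg g w + neg f w * pos g w) = f w * g w.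
  by rewrite (hE f w) (hE g w); ring.
have If' : Ex P f = Ex P (pos f) - Ex P (neg f).
  by rewrite -ExB; [exact: eq_Ex | exact: Ipos | exact: Ineg].
have Ig' : Ex P g = Ex P (pos g) - Ex P (neg g).
  by rewrite -ExB; [exact: eq_Ex | exact: Ipos | exact: Ineg].
split; first by apply: eq_itg fgE _; apply: itgB; exact: itgD.
rewrite -(eq_Ex P fgE) ExB ?ExD //; [|exact: itgD|exact: itgD].
by rewrite E1 E2 E3 E4 If' Ig'; ring.
Qed.

End IndependentProducts.

Section ComplexExpectation.
Context {R : realType} {d : measure_display} {T : measurableType d}.
Variable P : probability T R.
Local Notation C := R[i].
Implicit Types f g : T -> C.

Definition citg f := itg P (fun w => complex.Re (f w)) /\ itg P (fun w => complex.Im (f w)).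
Definition ExC f : C := Ex P (fun w => complex.Re (f w)) +i* Ex P (fun w => complex.Im (f w)).

Lemma eq_ExC f g : (forall w, f w = g w) -> ExC f = ExC g.
Proof. by move=> /funext ->. Qed.

Lemma eq_citg f g : (forall w, f w = g w) -> citg f -> citg g.
Proof. by move=> /funext ->. Qed.

Lemma citg_cst c : citg (fun=> c).
Proof. by split; exact: itg_cst. Qed.

Lemma ExC_cst c : ExC (fun=> c) = c.
Proof. by rewrite /ExC !Ex_cst; case: c. Qed.

Lemma citgD f g : citg f -> citg g -> citg (fun w => f w + g w).
Proof.
move=> [f1 f2] [g1 g2]; split.
  by apply: eq_itg (itgD f1 g1) => w; rewrite raddfD.
by apply: eq_itg (itgD f2 g2) => w; rewrite raddfD.
Qed.

Lemma ExCD f g : citg f -> citg g -> ExC (fun w => f w + g w) = ExC f + ExC g.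
Proof.
move=> [f1 f2] [g1 g2]; rewrite /ExC; apply/eqP; rewrite eq_complex /=.
by rewrite -!ExD //; apply/andP; split; apply/eqP; apply: eq_Ex => w; rewrite raddfD.
Qed.

Lemma Re_mulc (a b : C) : complex.Re (a * b) = complex.Re a * complex.Re b - complex.Im a * complex.Im b.
Proof. by case: a; case: b. Qed.

Lemma Im_mulc (a b : C) : complex.Im (a * b) = complex.Re a * complex.Im b + complex.Im a * complex.Re b.
Proof. by case: a; case: b. Qed.

Lemma citgZ c f : citg f -> citg (fun w => c * f w).
Proof.
move=> [f1 f2]; split.
  by apply: eq_itg (itgB (itgZ (complex.Re c) f1) (itgZ (complex.Im c) f2)) => w; rewrite Re_mulc.
by apply: eq_itg (itgD (itgZ (complex.Re c) f2) (itgZ (complex.Im c) f1)) => w; rewrite Im_mulc.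
Qed.

Lemma ExCZ c f : citg f -> ExC (fun w => c * f w) = c * ExC f.
Proof.
move=> [f1 f2]; apply/eqP; rewrite eq_complex Re_mulc Im_mulc /=; apply/andP; split; apply/eqP.
  rewrite -!ExZ // -ExB; [|exact: itgZ|exact: itgZ].
  by apply: eq_Ex => w; rewrite Re_mulc.
rewrite -!ExZ // -ExD; [|exact: itgZ|exact: itgZ].
by apply: eq_Ex => w; rewrite Im_mulc.
Qed.

Lemma citg_sum (I : Type) (s : seq I) (Q : pred I) (F : I -> T -> C) :
  (forall i, Q i -> citg (F i)) -> citg (fun w => \sum_(i <- s | Q i) F i w).
Proof.
move=> H; split.
  by apply: eq_itg (itg_sum s (fun i Qi => (H i Qi).1)) => w; rewrite raddf_sum.
by apply: eq_itg (itg_sum s (fun i Qi => (H i Qi).2)) => w; rewrite raddf_sum.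
Qed.

Lemma ExC_sum (I : Type) (s : seq I) (Q : pred I) (F : I -> T -> C) :
  (forall i, Q i -> citg (F i)) ->
  ExC (fun w => \sum_(i <- s | Q i) F i w) = \sum_(i <- s | Q i) ExC (F i).
Proof.
move=> H; apply/eqP; rewrite eq_complex /= !raddf_sum /=.
rewrite -!Ex_sum; [|by move=> i /H[]|by move=> i /H[]].
by apply/andP; split; apply/eqP; apply: eq_Ex => w; rewrite raddf_sum.
Qed.

Lemma citg_conj f : citg f -> citg (fun w => Num.conj (f w)).
Proof.
move=> [f1 f2]; split; first by apply: eq_itg f1 => w; case: (f w).
by apply: eq_itg (itgN f2) => w; case: (f w).
Qed.

Lemma ExC_conj f : citg f -> ExC (fun w => Num.conj (f w)) = Num.conj (ExC f).
Proof.
move=> [f1 f2]; rewrite /ExC /=; congr (_ +i* _); first by apply: eq_Ex => w; case: (f w).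
by rewrite -ExN //; apply: eq_Ex => w; case: (f w).
Qed.

End ComplexExpectation.

Section ComplexMeasurable.
Context {R : realType} {d : measure_display} {T : measurableType d}.
Local Notation C := R[i].
Implicit Types f g : T -> C.

Definition cmeas f := measurable_fun setT (fun w => complex.Re (f w)) /\
  measurable_fun setT (fun w => complex.Im (f w)).

(** The squared modulus as an element of [R] rather than of [R[i]]. *)
Definition nsq (z : C) : R := complex.Re z ^+ 2 + complex.Im z ^+ 2.

Lemma nsq_ge0 z : 0 <= nsq z.
Proof. by rewrite addr_ge0 ?sqr_ge0. Qed.

Lemma nsqM a b : nsq (a * b) = nsq a * nsq b.
Proof. by rewrite /nsq Re_mulc Im_mulc; ring. Qed.

Lemma nsq_conj a : nsq (Num.conj a) = nsq a.
Proof. by case: a => x y; rewrite /nsq /= sqrrN. Qed.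

Lemma mul_conjC_nsq a : a * Num.conj a = (nsq a)%:C.
Proof. by case: a => x y; apply/eqP; rewrite eq_complex /nsq /=; apply/andP; split; apply/eqP; ring. Qed.

Lemma eq_cmeas f g : (forall w, f w = g w) -> cmeas f -> cmeas g.
Proof. by move=> /funext ->. Qed.

Lemma cmeas_cst c : cmeas (fun=> c).
Proof. by split; exact: measurable_cst. Qed.

Lemma cmeas_real (f : T -> R) : measurable_fun setT f -> cmeas (fun w => (f w)%:C).
Proof. by move=> mf; split=> //; exact: measurable_cst. Qed.

Lemma cmeasD f g : cmeas f -> cmeas g -> cmeas (fun w => f w + g w).
Proof.
move=> [f1 f2] [g1 g2]; split.
  under eq_fun do rewrite raddfD; exact: measurable_funD.
under eq_fun do rewrite raddfD; exact: measurable_funD.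
Qed.

Lemma cmeasM f g : cmeas f -> cmeas g -> cmeas (fun w => f w * g w).
Proof.
move=> [f1 f2] [g1 g2]; split.
  by under eq_fun do rewrite Re_mulc; apply: measurable_funB; exact: measurable_funM.
by under eq_fun do rewrite Im_mulc; apply: measurable_funD; exact: measurable_funM.
Qed.

Lemma Re_conjC (z : C) : complex.Re (Num.conj z) = complex.Re z.
Proof. by case: z. Qed.

Lemma Im_conjC (z : C) : complex.Im (Num.conj z) = - complex.Im z.
Proof. by case: z. Qed.

Lemma cmeas_conj f : cmeas f -> cmeas (fun w => Num.conj (f w)).
Proof.
move=> [f1 f2]; split; first by under eq_fun do rewrite Re_conjC.
by under eq_fun do rewrite Im_conjC; exact: measurableT_comp.
Qed.

Lemma cmeas_sum (I : Type) (s : seq I) (Q : pred I) (F : I -> T -> C) :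
  (forall i, cmeas (F i)) -> cmeas (fun w => \sum_(i <- s | Q i) F i w).
Proof.
move=> H; elim: s => [|i s IH].
  by apply: eq_cmeas (cmeas_cst 0) => w; rewrite big_nil.
apply: (@eq_cmeas (fun w => (if Q i then F i w else 0) + \sum_(i <- s | Q i) F i w)).
  by move=> w; rewrite big_cons; case: ifP => // _; rewrite add0r.
by apply: cmeasD => //; case: (Q i) => //; exact: cmeas_cst.
Qed.

Lemma cmeas_prod (I : Type) (s : seq I) (Q : pred I) (F : I -> T -> C) :
  (forall i, cmeas (F i)) -> cmeas (fun w => \prod_(i <- s | Q i) F i w).
Proof.
move=> H; elim: s => [|i s IH].
  by apply: eq_cmeas (cmeas_cst 1) => w; rewrite big_nil.
apply: (@eq_cmeas (fun w => (if Q i then F i w else 1) * \prod_(i <- s | Q i) F i w)).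
  by move=> w; rewrite big_cons; case: ifP => // _; rewrite mul1r.
by apply: cmeasM => //; case: (Q i) => //; exact: cmeas_cst.
Qed.

Lemma measurable_nsq f : cmeas f -> measurable_fun setT (fun w => nsq (f w)).
Proof. by move=> [f1 f2]; apply: measurable_funD; exact: measurable_funX. Qed.

End ComplexMeasurable.

(** * Domination by the squared modulus, and the moment data of one matrix entry *)

Lemma citg_nsq {R : realType} {d : measure_display} {T : measurableType d}
  (P : probability T R) (f : T -> R[i]) (g : T -> R) :
  cmeas f -> itg P g -> (forall w, nsq (f w) <= g w) -> citg P f.
Proof.
move=> [f1 f2] Ig fg; have I1 := itgD (itg_cst P 1) Ig.
split; apply: itg_le I1 => // w; have := fg w; rewrite /nsq => H; rewrite ler_norml.
  by have := sqr_ge0 (complex.Im (f w)); set x := complex.Re _ in H *; nra.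
by have := sqr_ge0 (complex.Re (f w)); set x := complex.Im _ in H *; nra.
Qed.

                                                                                    
(** Everything that the argument uses about one entry, common to the two kinds: [kap] is E z^2,
    equal to 1 for real and 0 for complex entries. The moments up to order four give the covariance
    of a column matrix, the eighth moment serves truncation, and the sub-Gaussian bounds on both
    parts serve the norm estimate. The constant 24 * 2^10 is what [normal_moment_even] yields in the
    complex case. *)
Record entry_ok {R : realType} {d : measure_display} {T : measurableType d}
  (P : probability T R) (kap : R) (z : T -> R[i]) : Prop := EntryOk {
  eo_meas : cmeas z;
  eo_itg : forall k, itg P (fun w => nsq (z w) ^+ k);
  eo_1 : ExC P z = 0;
  eo_2 : ExC P (fun w => z w * z w) = kap%:C;
  eo_11 : ExC P (fun w => z w * Num.conj (z w)) = 1;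
  eo_22 : ExC P (fun w => (z w * Num.conj (z w)) * (z w * Num.conj (z w))) = (2 + kap)%:C;
  eo_8 : Ex P (fun w => nsq (z w) ^+ 4) <= 24 * 2 ^+ 10;
  eo_mgf1 : forall t : R, (\int[P]_w (expR (t * complex.Re (z w)))%:E <= (expR (t ^+ 2 / 2))%:E)%E;
  eo_mgf2 : forall t : R, (\int[P]_w (expR (t * complex.Im (z w)))%:E <= (expR (t ^+ 2 / 2))%:E)%E
}.

Lemma expr_add_le (R : realDomainType) (a b : R) k : 0 <= a -> 0 <= b ->
  (a + b) ^+ k <= 2 ^+ k * (a ^+ k + b ^+ k).
Proof.
move=> a0 b0; have [ab|/ltW ab] := leP a b.
  have H : a + b <= 2 * b by rewrite mulr_natl mulr2n lerD2r.
  apply: (@le_trans _ _ ((2 * b) ^+ k)).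
    by apply: lerXn2r => //; rewrite nnegrE ?addr_ge0 ?mulr_ge0.
  by rewrite exprMn ler_wpM2l ?exprn_ge0 // lerDr exprn_ge0.
have H : a + b <= 2 * a by rewrite mulr_natl mulr2n lerD2l.
apply: (@le_trans _ _ ((2 * a) ^+ k)).
  by apply: lerXn2r => //; rewrite nnegrE ?addr_ge0 ?mulr_ge0.
by rewrite exprMn ler_wpM2l ?exprn_ge0 // lerDl exprn_ge0.
Qed.

Section EntryKinds.
Context {R : realType} {d : measure_display} {T : measurableType d}.
Variable P : probability T R.

Lemma real_entry_ok (y : T -> R) : is_normal P 0 1 y -> entry_ok P 1 (fun w => (y w)%:C).
Proof.
move=> Ny; have [my _] := Ny.
have I k := normal_moment_itg ltr01 Ny k.
have [E2 E4] := normal_moment24 ltr01 Ny.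
have E1 := normal_moment_odd ltr01 Ny (k := 1) isT.
have nE w : nsq (y w)%:C = y w ^+ 2 by rewrite /nsq /= expr0n addr0.
have mulE w : (y w)%:C * Num.conj (y w)%:C = (y w ^+ 2)%:C by rewrite mul_conjC_nsq nE.
have ExR (f : T -> R) : ExC P (fun w => (f w)%:C) = (Ex P f)%:C.
  by rewrite /ExC /= Ex_cst.
split.
- exact: cmeas_real.
- by move=> k; apply: eq_itg (I (2 * k)%N) => w; rewrite nE exprM.
- by rewrite ExR; congr (_%:C); rewrite -[RHS]E1; apply: eq_Ex => w; rewrite expr1.
- rewrite (eq_ExC P (g := fun w => (y w ^+ 2)%:C)) ?ExR ?E2 // => w.
  by rewrite -rmorphM expr2.
- by rewrite (eq_ExC P (g := fun w => (y w ^+ 2)%:C)) ?ExR ?E2.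
- rewrite (eq_ExC P (g := fun w => (y w ^+ 4)%:C)) ?ExR ?E4 => [|w].
    by rewrite expr1n mulr1; congr (_%:C); ring.
  by rewrite mulE -rmorphM -exprD.
- rewrite (eq_Ex P (g := fun w => y w ^+ (2 * 4))) => [|w]; last by rewrite nE exprM.
  apply: le_trans (normal_moment_even ltr01 Ny 4).2 _.
  by rewrite mulr1 !factS fact0; lra.
- by move=> t; rewrite (normal_mgf ltr01 Ny) mulr1.
- move=> t /=; under eq_integral do rewrite mulr0 expR0.
  rewrite integral_cst //= probability_setT mule1 lee_fin -[leLHS]expR0 ler_expR.
  by rewrite mulr_ge0 ?sqr_ge0.
Qed.

Lemma complex_entry_ok (z : T -> R[i]) : is_complex_normal P z -> entry_ok P 0 z.
Proof.
move=> [N1 N2 ind]; have [m1 _] := N1; have [m2 _] := N2.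
have h0 : 0 < 1 / 2 :> R by lra.
pose X (b : bool) w := if b then complex.Re (z w) else complex.Im (z w).
have mX b : measurable_fun setT (X b) by case: b.
have smX b k : smeas X [set b]%SET (fun w => X b w ^+ k).
  by apply: measurable_funX; apply: measurable_sigT; rewrite inE.
have JK i : i \in [set true]%SET -> i \notin [set false]%SET by rewrite !inE; case: i.
have I1 k := normal_moment_itg h0 N1 k.
have I2 k := normal_moment_itg h0 N2 k.
have mul k l := Ex_mul mX ind JK (smX true k) (smX false l) (I1 k) (I2 l).
have [E12 E14] := normal_moment24 h0 N1; have [E22 E24] := normal_moment24 h0 N2.
have E11 := normal_moment_odd h0 N1 (k := 1) isT.
have E21 := normal_moment_odd h0 N2 (k := 1) isT.
have cm : cmeas z by [].
have nn k w : nsq (z w) ^+ k <= 2 ^+ k * (complex.Re (z w) ^+ (2 * k) + complex.Im (z w) ^+ (2 * k)).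
  by rewrite !exprM; apply: expr_add_le; exact: sqr_ge0.
have In k := itgZ (2 ^+ k) (itgD (I1 (2 * k)%N) (I2 (2 * k)%N)).
have mn : measurable_fun setT (fun w => nsq (z w)) by exact: measurable_nsq.
have ni k : itg P (fun w => nsq (z w) ^+ k).
  apply: itg_le (In k); first exact: measurable_funX.
  by move=> w; rewrite ger0_norm ?exprn_ge0 ?nsq_ge0.
have ExR (f : T -> R) : ExC P (fun w => (f w)%:C) = (Ex P f)%:C.
  by rewrite /ExC /= Ex_cst.
split=> //.
- rewrite /ExC; apply/eqP; rewrite eq_complex /=; apply/andP; split; apply/eqP.
    by rewrite -[RHS]E11; apply: eq_Ex => w; rewrite expr1.
  by rewrite -[RHS]E21; apply: eq_Ex => w; rewrite expr1.
- rewrite /ExC; apply/eqP; rewrite eq_complex /=; apply/andP; split; apply/eqP.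
    rewrite (eq_Ex P (g := fun w => complex.Re (z w) ^+ 2 - complex.Im (z w) ^+ 2)); last first.
      by move=> w; rewrite Re_mulc !expr2.
    by rewrite ExB // E12 E22 subrr.
  rewrite (eq_Ex P (g := fun w => 2 * (X true w ^+ 1 * X false w ^+ 1))); last first.
    by move=> w; rewrite Im_mulc /X; ring.
  by rewrite ExZ ?(mul 1%N 1%N).2 ?E11 ?mul0r ?mulr0 //; exact: (mul 1%N 1%N).1.
- rewrite (eq_ExC P (g := fun w => (nsq (z w))%:C)) ?ExR; last by move=> w; rewrite mul_conjC_nsq.
  by rewrite /nsq ExD // E12 E22; congr (_%:C); field.
- rewrite (eq_ExC P (g := fun w => (nsq (z w) ^+ 2)%:C)) ?ExR; last first.
    by move=> w; rewrite mul_conjC_nsq -rmorphM expr2.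
  rewrite (eq_Ex P (g := fun w => (complex.Re (z w) ^+ 4 + complex.Im (z w) ^+ 4) +
      2 * (X true w ^+ 2 * X false w ^+ 2))); last first.
    by move=> w; rewrite /nsq /X; ring.
  have M := mul 2%N 2%N.
  rewrite ExD; [|exact: itgD|exact/itgZ/M.1].
  by rewrite ExD // ExZ ?M.1 // M.2 E14 E24 E12 E22; congr (_%:C); field.
- apply: le_trans (Ex_le (ni 4%N) (In 4%N) (nn 4%N)) _.
  rewrite ExZ ?ExD //; last exact: itgD.
  have B1 := (normal_moment_even h0 N1 4).2; have B2 := (normal_moment_even h0 N2 4).2.
  have h4 : 4 * (1 / 2) = 2 :> R by field.
  by move: B1 B2; rewrite h4 !factS fact0; lra.
- move=> t; rewrite (normal_mgf h0 N1) lee_fin ler_expR; have := sqr_ge0 t; lra.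
- move=> t; rewrite (normal_mgf h0 N2) lee_fin ler_expR; have := sqr_ge0 t; lra.
Qed.

End EntryKinds.

Definition kind_kap (R : realType) (k : entry_kind) : R :=
  match k with RealEntries => 1 | ComplexEntries => 0 end.

(** Real matrices are treated as complex ones with zero imaginary part; independence of the pairs of
    coordinates is pulled back along x -> (x, 0). *)
Lemma gaussian_matrix_entries (R : realType) (d : measure_display) (T : measurableType d)
  (k : entry_kind) (P : probability T R) (n p : nat) (G : T -> 'M[R[i]]_(n, p)) :
  gaussian_matrix k P G ->
  (forall ij : 'I_n * 'I_p, entry_ok P (kind_kap R k) (fun w => G w ij.1 ij.2)) /\
  mutually_independent P (fun (ij : 'I_n * 'I_p) w =>
    (complex.Re (G w ij.1 ij.2), complex.Im (G w ij.1 ij.2))).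
Proof.
case: k => /= [[G0 [N0 I0] GE]|[N I]]; last by split=> // ij; exact: complex_entry_ok.
have E ij w : G w ij.1 ij.2 = (G0 w ij.1 ij.2)%:C by rewrite GE mxE.
split=> [ij|J B mB].
  have := real_entry_ok (N0 ij.1 ij.2).
  by congr (entry_ok _ _ _); apply/funext => w; rewrite E.
pose B' ij := [set x : R | B ij (x, 0)].
have mB' ij : measurable (B' ij).
  have mp : measurable_fun setT (fun x : R => (x, 0 : R)).
    apply/measurable_fun_pairP; split; first exact: measurable_id.
    exact: measurable_cst.
  by have := mp measurableT _ (mB ij); rewrite setTI.
have BE ij : (fun w => (complex.Re (G w ij.1 ij.2), complex.Im (G w ij.1 ij.2))) @^-1` B ij =
    (fun w => G0 w ij.1 ij.2) @^-1` B' ij.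
  by apply/seteqP; split=> w /=; rewrite E.
have := I0 J B' mB'; under eq_bigcapr do rewrite -BE.
by under eq_bigr do rewrite -BE.
Qed.

(** * Wick's formula up to order four for independent entries *)

Section Family.
Context {R : realType} {d : measure_display} {T : measurableType d}.
Local Notation C := R[i].
Variables (P : probability T R) (kap : R) (I : finType) (g : I -> T -> C).
Hypothesis gok : forall e, entry_ok P kap (g e).
Definition pairX (e : I) (w : T) : (R * R)%type := (complex.Re (g e w), complex.Im (g e w)).
Hypothesis gind : mutually_independent P pairX.

Lemma measurable_pairX e : measurable_fun setT (pairX e).
Proof. by apply/measurable_fun_pairP; split; case: (eo_meas (gok e)). Qed.

Definition csm (J : {set I}) (f : T -> C) := cmeas (f : sigT pairX J -> C).

Lemma csm_g (J : {set I}) e : e \in J -> csm J (g e).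
Proof.
move=> eJ; have := @measurable_sigT _ _ _ _ _ pairX J e eJ.
by move=> /measurable_fun_pairP[].
Qed.

Lemma ExC_mul (J K : {set I}) (f h : T -> C) : (forall i, i \in J -> i \notin K) ->
  csm J f -> csm K h -> citg P f -> citg P h ->
  citg P (fun w => f w * h w) /\ ExC P (fun w => f w * h w) = ExC P f * ExC P h.
Proof.
move=> JK [mf1 mf2] [mh1 mh2] [f1 f2] [h1 h2].
have [I1 E1] := Ex_mul measurable_pairX gind JK mf1 mh1 f1 h1.
have [I2 E2] := Ex_mul measurable_pairX gind JK mf1 mh2 f1 h2.
have [I3 E3] := Ex_mul measurable_pairX gind JK mf2 mh1 f2 h1.
have [I4 E4] := Ex_mul measurable_pairX gind JK mf2 mh2 f2 h2.
split; first split.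
- by apply: eq_itg (itgB I1 I4) => w; rewrite Re_mulc.
- by apply: eq_itg (itgD I2 I3) => w; rewrite Im_mulc.
apply/eqP; rewrite eq_complex Re_mulc Im_mulc /= -E1 -E2 -E3 -E4 -ExB // -ExD //.
by apply/andP; split; apply/eqP; apply: eq_Ex => w; rewrite ?Re_mulc ?Im_mulc.
Qed.

Lemma nsq4_le (x y z t : R) : 0 <= x -> 0 <= y -> 0 <= z -> 0 <= t ->
  x * y * (z * t) <= x ^+ 4 + y ^+ 4 + (z ^+ 4 + t ^+ 4).
Proof.
move=> x0 y0 z0 t0.
have A (a b : R) : a * b <= a ^+ 2 + b ^+ 2 by nra.
have A4 (a b : R) : (a * b) ^+ 2 <= a ^+ 4 + b ^+ 4.
  by rewrite exprMn; apply: le_trans (A _ _) _; rewrite -!exprM.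
by apply: le_trans (A _ _) _; apply: lerD; exact: A4.
Qed.

Let itg4 a b c e : itg P (fun w => nsq (g a w) ^+ 4 + nsq (g b w) ^+ 4 +
  (nsq (g c w) ^+ 4 + nsq (g e w) ^+ 4)).
Proof. by apply: itgD; apply: itgD; exact: (eo_itg (gok _)). Qed.

Lemma citg_word4 (f1 f2 f3 f4 : T -> C) a b c e : cmeas f1 -> cmeas f2 -> cmeas f3 -> cmeas f4 ->
  (forall w, nsq (f1 w) = nsq (g a w)) -> (forall w, nsq (f2 w) = nsq (g b w)) ->
  (forall w, nsq (f3 w) = nsq (g c w)) -> (forall w, nsq (f4 w) = nsq (g e w)) ->
  citg P (fun w => f1 w * f2 w * (f3 w * f4 w)).
Proof.
move=> m1 m2 m3 m4 n1 n2 n3 n4; apply: citg_nsq (itg4 a b c e) _.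
  by apply: cmeasM; exact: cmeasM.
by move=> w; rewrite !nsqM n1 n2 n3 n4; apply: nsq4_le; exact: nsq_ge0.
Qed.

Let mg e : cmeas (g e). Proof. exact: (eo_meas (gok e)). Qed.
Let mgc e : cmeas (fun w => Num.conj (g e w)). Proof. exact: cmeas_conj. Qed.

Lemma citg_g e : citg P (g e).
Proof. by apply: citg_nsq (eo_itg (gok e) 1) _ => // w; rewrite expr1. Qed.

Lemma citg_gc e : citg P (fun w => Num.conj (g e w)).
Proof. exact/citg_conj/citg_g. Qed.

Lemma citg_word2 (f1 f2 : T -> C) a b : cmeas f1 -> cmeas f2 ->
  (forall w, nsq (f1 w) = nsq (g a w)) -> (forall w, nsq (f2 w) = nsq (g b w)) ->
  citg P (fun w => f1 w * f2 w).
Proof.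
move=> m1 m2 n1 n2.
apply: citg_nsq (itgD (eo_itg (gok a) 2) (eo_itg (gok b) 2)) _; first exact: cmeasM.
by move=> w; rewrite nsqM n1 n2; set x := nsq _; set y := nsq _; nra.
Qed.

Lemma citg_word3 (f1 f2 f3 : T -> C) a b c : cmeas f1 -> cmeas f2 -> cmeas f3 ->
  (forall w, nsq (f1 w) = nsq (g a w)) -> (forall w, nsq (f2 w) = nsq (g b w)) ->
  (forall w, nsq (f3 w) = nsq (g c w)) ->
  citg P (fun w => f1 w * f2 w * f3 w).
Proof.
move=> m1 m2 m3 n1 n2 n3.
have I1 := itgD (itgD (eo_itg (gok a) 4) (eo_itg (gok b) 4)) (itgD (eo_itg (gok c) 4) (itg_cst P 1)).
apply: citg_nsq I1 _; first by apply: cmeasM => //; exact: cmeasM.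
move=> w; rewrite !nsqM n1 n2 n3.
have := @nsq4_le (nsq (g a w)) (nsq (g b w)) (nsq (g c w)) 1 (nsq_ge0 _) (nsq_ge0 _) (nsq_ge0 _) ler01.
by rewrite !mulr1 expr1n.
Qed.

Let ExC_gc0 e : ExC P (fun w => Num.conj (g e w)) = 0.
Proof. by rewrite ExC_conj ?(eo_1 (gok e)) ?conjC0 //; exact: citg_g. Qed.

Let isolated (f h : T -> C) e (K : {set I}) : e \notin K -> csm [set e]%SET f -> csm K h ->
  citg P f -> citg P h -> ExC P f = 0 -> ExC P (fun w => f w * h w) = 0.
Proof.
move=> eK mf mh If Ih f0.
have JK i : i \in [set e]%SET -> i \notin K by rewrite inE => /eqP ->.
by rewrite (ExC_mul JK mf mh If Ih).2 f0 mul0r.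
Qed.

Let cs e : csm [set e]%SET (g e). Proof. by apply: csm_g; rewrite inE. Qed.
Let csc e : csm [set e]%SET (fun w => Num.conj (g e w)). Proof. exact: (cmeas_conj (cs e)). Qed.

Lemma wick2 a b : ExC P (fun w => g a w * Num.conj (g b w)) = (a == b)%:R.
Proof.
case: eqVneq => [->|ab]; first exact: (eo_11 (gok b)).
by apply: (isolated (e := a) (K := [set b]%SET)); rewrite ?inE // ?(eo_1 (gok a)) //;
  [exact: citg_g | exact: citg_gc].
Qed.

Hypothesis kap2 : kap * kap = kap.

(** If some index occurs alone, independence and the vanishing mean kill the expectation; otherwise
    the indices form two pairs or all coincide. The pairing of the unconjugated factors contributes
    E z^2 times its conjugate, that is kap^2, equal to [kap]. When all indices agree the three
    pairings add up to 2 + kap, which is [eo_22]. *)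
Lemma wick4 a b c e :
  ExC P (fun w => g a w * Num.conj (g b w) * (g c w * Num.conj (g e w))) =
  ((a == b) && (c == e))%:R + ((a == e) && (b == c))%:R + kap%:C * ((a == c) && (b == e))%:R.
Proof.
have sing (f h : T -> C) x (K : {set I}) : x \notin K -> csm [set x]%SET f -> csm K h ->
   citg P f -> citg P h -> ExC P f = 0 ->
   (forall w, g a w * Num.conj (g b w) * (g c w * Num.conj (g e w)) = f w * h w) ->
   ExC P (fun w => g a w * Num.conj (g b w) * (g c w * Num.conj (g e w))) = 0.
  move=> xK mf mh If Ih f0 E; rewrite (eq_ExC P (g := fun w => f w * h w)) //.
  exact: (isolated xK mf mh If Ih f0).
have pair (f h : T -> C) x y : x != y -> csm [set x]%SET f -> csm [set y]%SET h ->
   citg P f -> citg P h ->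
   (forall w, g a w * Num.conj (g b w) * (g c w * Num.conj (g e w)) = f w * h w) ->
   ExC P (fun w => g a w * Num.conj (g b w) * (g c w * Num.conj (g e w))) = ExC P f * ExC P h.
  move=> xy mf mh If Ih E; rewrite (eq_ExC P (g := fun w => f w * h w)) //.
  apply: (ExC_mul (J := [set x]%SET) (K := [set y]%SET) _ mf mh If Ih).2 => i.
  by rewrite !inE => /eqP ->.
have I3 x y z (J : {set I}) : x \in J -> y \in J -> z \in J ->
    csm J (fun w => g x w * Num.conj (g y w) * g z w) /\
    citg P (fun w => g x w * Num.conj (g y w) * g z w).
  move=> xJ yJ zJ; split.
    by apply: cmeasM; [apply: cmeasM; [|apply: cmeas_conj]|]; exact: csm_g.
  by apply: (@citg_word3 _ _ _ x y z) => // w; rewrite nsq_conj.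
have I3c x y z (J : {set I}) : x \in J -> y \in J -> z \in J ->
    csm J (fun w => Num.conj (g x w) * g y w * Num.conj (g z w)) /\
    citg P (fun w => Num.conj (g x w) * g y w * Num.conj (g z w)).
  move=> xJ yJ zJ; split.
    by apply: cmeasM; [apply: cmeasM; [apply: cmeas_conj|]|apply: cmeas_conj]; exact: csm_g.
  by apply: (@citg_word3 _ _ _ x y z) => // w; rewrite nsq_conj.
have iso_c x y z t (K : {set I}) : t \notin K -> x \in K -> y \in K -> z \in K ->
   (forall w, g a w * Num.conj (g b w) * (g c w * Num.conj (g e w)) =
     Num.conj (g t w) * (g x w * Num.conj (g y w) * g z w)) ->
   ExC P (fun w => g a w * Num.conj (g b w) * (g c w * Num.conj (g e w))) = 0.
  move=> tK xK yK zK E; have [m3 i3] := I3 x y z K xK yK zK.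
  exact: (sing _ _ _ _ tK (csc t) m3 (citg_gc t) i3 (ExC_gc0 t) E).
have iso_g x y z t (K : {set I}) : t \notin K -> x \in K -> y \in K -> z \in K ->
   (forall w, g a w * Num.conj (g b w) * (g c w * Num.conj (g e w)) =
     g t w * (Num.conj (g x w) * g y w * Num.conj (g z w))) ->
   ExC P (fun w => g a w * Num.conj (g b w) * (g c w * Num.conj (g e w))) = 0.
  move=> tK xK yK zK E; have [m3 i3] := I3c x y z K xK yK zK.
  exact: (sing _ _ _ _ tK (cs t) m3 (citg_g t) i3 (eo_1 (gok t)) E).
have c11 x : citg P (fun w => g x w * Num.conj (g x w)).
  by apply: (@citg_word2 _ _ x x) => // w; rewrite nsq_conj.
have m11 x : csm [set x]%SET (fun w => g x w * Num.conj (g x w)).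
  exact: cmeasM (cs x) (csc x).
have memI (x y z : I) : [/\ x \in [set x; y; z]%SET, y \in [set x; y; z]%SET & z \in [set x; y; z]%SET].
  by rewrite !inE !eqxx !orbT.
have neqs x y : x != y -> ((x == y) = false) * ((y == x) = false).
  by move=> xy; rewrite [y == x]eq_sym (negPf xy).
case: (altP (a =P b)) => [ab|/neqs ab].
  subst b; case: (altP (c =P e)) => [ce|/[dup] ce /neqs ce'].
    subst e; case: (altP (a =P c)) => [ac|/[dup] ac /neqs ac'].
      subst c; rewrite ?eqxx (eo_22 (gok a)) /= mulr1 -[2%:R]/(1 + 1).
      by apply/eqP; rewrite eq_complex /= !addr0 !eqxx.
    rewrite (pair _ _ a c ac (m11 a) (m11 c) (c11 a) (c11 c)) //.
    by rewrite !(eo_11 (gok _)) ?ac' /= mulr1 addr0 mulr0 addr0.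
  case: (altP (a =P e)) => [ae|/[dup] ae /neqs ae'].
    subst e; rewrite ?ce' /= mulr0 !addr0.
    have [aK _ _] := memI a a a.
    apply: (iso_g a a a c [set a; a; a]%SET) => //; first by rewrite !inE !negb_or ce.
    by move=> w; ring.
  rewrite /= ?andbF /= mulr0 !addr0.
  have [aK _ cK] := memI a a c.
  apply: (iso_c a a c e [set a; a; c]%SET) => //.
    by rewrite !inE !negb_or ![e == _]eq_sym ae ce.
  by move=> w; ring.
case: (altP (a =P e)) => [ae|/[dup] ae /neqs ae'].
  subst e; case: (altP (b =P c)) => [bc|/[dup] bc /neqs bc'].
    subst c; rewrite ?ab /= mulr0 addr0 add0r.
    rewrite (pair _ _ a b _ (m11 a) (m11 b) (c11 a) (c11 b)) ?ab //.
      by rewrite !(eo_11 (gok _)) mulr1.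
    by move=> w; ring.
  rewrite ?ab /= andbF mulr0 !addr0.
  have [aK cK _] := memI a c a.
  apply: (iso_c a a c b [set a; c; a]%SET) => //.
    by rewrite !inE !negb_or bc !ab.
  by move=> w; ring.
case: (altP (a =P c)) => [ac|/[dup] ac /neqs ac'].
  subst c; case: (altP (b =P e)) => [be|/[dup] be /neqs be'].
    subst e; rewrite /= mulr1 !add0r.
    have i2 : citg P (fun w => g a w * g a w) by apply: (@citg_word2 _ _ a a).
    have i2' : citg P (fun w => g b w * g b w) by apply: (@citg_word2 _ _ b b).
    have m2 : csm [set a]%SET (fun w => g a w * g a w) by exact: cmeasM (cs a) (cs a).
    have m2' : csm [set b]%SET (fun w => Num.conj (g b w * g b w)).
      exact: cmeas_conj (cmeasM (cs b) (cs b)).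
    rewrite (pair _ _ a b _ m2 m2' i2 (citg_conj i2')) ?ab //.
      rewrite (eo_2 (gok a)) (ExC_conj i2') (eo_2 (gok b)).
      rewrite -[in RHS]kap2 rmorphM; congr (_ * _).
      by apply/eqP; rewrite eq_complex /= oppr0 !eqxx.
    by move=> w; rewrite rmorphM; ring.
  rewrite /= mulr0 !addr0.
  have [aK eK _] := memI a e a.
  apply: (iso_c a e a b [set a; e; a]%SET) => //.
    by rewrite !inE !negb_or be !ab.
  by move=> w; ring.
rewrite /= mulr0 !addr0.
have [bK cK eK] := memI b c e.
apply: (iso_g b c e a [set b; c; e]%SET) => //.
  by rewrite !inE !negb_or ab ac ae.
by move=> w; ring.
Qed.

Lemma mgf_sum (h : C -> R) (t : I -> R) (s : seq I) : uniq s ->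
  (forall e (J : {set I}), e \in J -> measurable_fun setT (fun w : sigT pairX J => h (g e w))) ->
  (forall e (x : R), (\int[P]_w (expR (x * h (g e w)))%:E <= (expR (x ^+ 2 / 2))%:E)%E) ->
  (\int[P]_w (expR (\sum_(e <- s) t e * h (g e w)))%:E <= (expR (\sum_(e <- s) t e ^+ 2 / 2))%:E)%E.
Proof.
move=> + mh H; elim: s => [_|e s IH /= /andP[es us]].
  under eq_integral do rewrite big_nil expR0.
  by rewrite big_nil expR0 integral_cst //= probability_setT mule1.
under eq_integral do rewrite big_cons expRD.
pose J := [set e]%SET; pose K := [set x in s]%SET.
have JK i : i \in J -> i \notin K by rewrite !inE => /eqP ->.
have m1 : smeas pairX J (fun w => expR (t e * h (g e w))).
  apply: measurableT_comp => //; apply: measurable_funM => //.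
  by apply: mh; rewrite inE.
have m2 : smeas pairX K (fun w => expR (\sum_(x <- s) t x * h (g x w))).
  apply: measurableT_comp => //.
  have E (w : T) : \sum_(x <- s) t x * h (g x w) =
      \sum_(x <- s) (if x \in s then t x * h (g x w) else 0).
    by apply: eq_big_seq => x ->.
  rewrite (funext E).
  apply: measurable_sum => x; case xs: (x \in s); last exact: measurable_cst.
  by apply: measurable_funM => //; apply: mh; rewrite inE.
rewrite (integral_mul_ge0 measurable_pairX gind JK m1 m2); last 2 first.
- by move=> w; exact: expR_ge0.
- by move=> w; exact: expR_ge0.
rewrite big_cons expRD EFinM; apply: lee_pmul => //.
- by apply: integral_ge0 => w _; rewrite lee_fin expR_ge0.
- by apply: integral_ge0 => w _; rewrite lee_fin expR_ge0.
- exact: IH.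
Qed.

End Family.

                                     

(** * Bounding the norm of a d x d matrix by its values on a finite grid *)

Section Net.
Variables (R : realType) (d : nat).
Hypothesis d0 : (0 < d)%N.
Implicit Types (x y : 'I_d -> R) (A : 'I_d -> 'I_d -> R).

Definition bil A x y : R := \sum_i \sum_k x i * y k * A i k.
Definition ssq x : R := \sum_i x i ^+ 2.
(** Integer points with coordinates between -4d and 4d. Divided by 4d they form a net of the unit
    ball, and there are (8d+1)^d of them. *)
Definition grid (f : {ffun 'I_d -> 'I_(8 * d + 1)}) (i : 'I_d) : R := (f i)%:R - (4 * d)%:R.

Lemma ssq_ge0 x : 0 <= ssq x.
Proof. by apply: sumr_ge0 => i _; exact: sqr_ge0. Qed.

Lemma ssqZ c x : ssq (fun i => c * x i) = c ^+ 2 * ssq x.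
Proof. by rewrite /ssq mulr_sumr; apply: eq_bigr => i _; rewrite exprMn. Qed.

Lemma bilDl A x x' y : bil A (fun i => x i + x' i) y = bil A x y + bil A x' y.
Proof.
rewrite /bil -big_split; apply: eq_bigr => i _; rewrite -big_split; apply: eq_bigr => k _ /=.
by rewrite !mulrDl.
Qed.

Lemma bilDr A x y y' : bil A x (fun i => y i + y' i) = bil A x y + bil A x y'.
Proof.
rewrite /bil -big_split; apply: eq_bigr => i _; rewrite -big_split; apply: eq_bigr => k _ /=.
by rewrite mulrDr mulrDl.
Qed.

Lemma bilZl A c x y : bil A (fun i => c * x i) y = c * bil A x y.
Proof.
rewrite /bil mulr_sumr; apply: eq_bigr => i _; rewrite mulr_sumr; apply: eq_bigr => k _ /=.
by rewrite !mulrA.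
Qed.

Lemma bilZr A c x y : bil A x (fun i => c * y i) = c * bil A x y.
Proof.
rewrite /bil mulr_sumr; apply: eq_bigr => i _; rewrite mulr_sumr; apply: eq_bigr => k _ /=.
by ring.
Qed.

Lemma ssq_coord x i : ssq x <= 1 -> `|x i| <= 1.
Proof.
move=> x1; rewrite -(@ler_pXn2r _ 2) ?nnegrE // expr1n real_normK ?num_real //.
apply: le_trans x1; rewrite /ssq (bigD1 i) //= lerDl.
by apply: sumr_ge0 => j _; exact: sqr_ge0.
Qed.

Let D : R := (4 * d)%:R.
Let D0 : 0 < D. Proof. by rewrite ltr0n muln_gt0. Qed.

                                                                
(** Rounding of 4d t towards zero, shifted by 4d to be a natural number; rounding towards zero keeps
    the rounded vector inside the ball. *)
Let rnd (t : R) : nat :=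
  if 0 <= t then (4 * d + Num.truncn (D * t))%N else (4 * d - Num.truncn (- (D * t)))%N.

Let rndP (t : R) : `|t| <= 1 -> [/\ (rnd t < 8 * d + 1)%N,
  ((rnd t)%:R - D) ^+ 2 <= (D * t) ^+ 2 & (t - D^-1 * ((rnd t)%:R - D)) ^+ 2 <= D^-1 ^+ 2].
Proof.
move=> t1; have key (s : R) : 0 <= s -> s <= D -> (Num.truncn s <= 4 * d)%N /\
    0 <= s - (Num.truncn s)%:R <= 1.
  move=> s0 sD; have /andP[h1 h2] := truncn_itv s0; split.
    by rewrite -(ler_nat R); apply: le_trans h1 _.
  by rewrite subr_ge0 h1 /= lerBlDl; move: h2; rewrite -natr1 => /ltW.
have E (u : R) : t - D^-1 * u = D^-1 * (D * t - u).
  by rewrite mulrBr mulrA mulVf ?mul1r // gt_eqF.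
have sq (u : R) : `|u| <= 1 -> (D^-1 * u) ^+ 2 <= D^-1 ^+ 2.
  move=> u1; rewrite exprMn ler_piMr ?sqr_ge0 // -[leLHS]real_normK ?num_real //.
  by rewrite exprn_ile1.
rewrite /rnd; case: ifPn => t0.
  have Dt0 : 0 <= D * t by rewrite mulr_ge0 // ltW.
  have DtD : D * t <= D by apply: ler_piMr; [exact: ltW | exact: le_trans (ler_norm _) t1].
  have [h1 /andP[h2 h3]] := key _ Dt0 DtD.
  have -> : (4 * d + Num.truncn (D * t))%:R - D = (Num.truncn (D * t))%:R.
    by rewrite natrD addrC addKr.
  split; first by lia.
    by rewrite lerXn2r ?nnegrE // -subr_ge0.
  by rewrite E sq // ger0_norm.
rewrite -ltNge in t0.
have Dt0 : 0 <= - (D * t) by rewrite -mulrN; apply: mulr_ge0; rewrite ?oppr_ge0; exact: ltW.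
have DtD : - (D * t) <= D.
  by rewrite -mulrN; apply: ler_piMr; [exact: ltW | rewrite (le_trans (ler_norm _)) ?normrN].
have [h1 /andP[h2 h3]] := key _ Dt0 DtD.
have -> : (4 * d - Num.truncn (- (D * t)))%:R - D = - (Num.truncn (- (D * t)))%:R.
  by rewrite natrB // addrAC subrr add0r.
split; first by lia.
  by rewrite sqrrN -[leRHS]sqrrN lerXn2r ?nnegrE // -subr_ge0.
rewrite E sq // opprK -normrN opprD ger0_norm //.
Qed.

Let round_vec x : ssq x <= 1 -> exists f : {ffun 'I_d -> 'I_(8 * d + 1)},
  ssq (grid f) <= D ^+ 2 * ssq x /\
  ssq (fun i => x i - D^-1 * grid f i) <= 4^-1 ^+ 2.
Proof.
move=> x1; have c i := rndP (ssq_coord i x1).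
exists [ffun i => Ordinal (let: And3 h _ _ := c i in h)].
have gE i : grid [ffun i => Ordinal (let: And3 h _ _ := c i in h)] i = (rnd (x i))%:R - D.
  by rewrite /grid ffunE.
split.
  rewrite /ssq mulr_sumr; apply: ler_sum => i _; rewrite gE -exprMn.
  by case: (c i).
apply: (@le_trans _ _ (\sum_(i < d) D^-1 ^+ 2)).
  by apply: ler_sum => i _; rewrite gE; case: (c i).
rewrite sumr_const card_ord -[_ *+ d]mulr_natl.
have dR : 1 <= d%:R :> R by rewrite ler1n.
have -> : d%:R * D^-1 ^+ 2 = 4^-1 ^+ 2 * (d%:R)^-1.
  by rewrite /D natrM; field; rewrite pnatr_eq0 -lt0n.
by rewrite ler_piMr ?sqr_ge0 // invf_le1 // (lt_le_trans ltr01).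
Qed.

(** Each of the [d] coordinates is off by at most 1/(4d), so the rounding error has norm at most
    1/4. Hence any bound B on the unit ball improves to tau + B/2, and iterating from the crude
    bound [B0] converges to 2 tau. *)
Lemma net_bil A tau : 0 <= tau ->
  (forall f f', ssq (grid f) <= D ^+ 2 -> ssq (grid f') <= D ^+ 2 ->
    `|bil A (grid f) (grid f')| <= D ^+ 2 * tau) ->
  forall x y, ssq x <= 1 -> ssq y <= 1 -> `|bil A x y| <= 2 * tau.
Proof.
move=> tau0 H.
pose N B := forall x y, ssq x <= 1 -> ssq y <= 1 -> `|bil A x y| <= B.
pose B0 := \sum_i \sum_k `|A i k|.
have B00 : 0 <= B0 by apply: sumr_ge0 => i _; apply: sumr_ge0.
have N0 : N B0.
  move=> x y x1 y1; apply: le_trans (ler_norm_sum _ _ _) _; apply: ler_sum => i _.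
  apply: le_trans (ler_norm_sum _ _ _) _; apply: ler_sum => k _.
  rewrite !normrM ler_piMl // mulr_ile1 //; exact: ssq_coord.
have step B : N B -> N (tau + B / 2).
  move=> NB x y x1 y1.
  have [f [f1 f2]] := round_vec x1; have [f' [f1' f2']] := round_vec y1.
  pose x0 i := D^-1 * grid f i; pose y0 i := D^-1 * grid f' i.
  have DD : D^-1 ^+ 2 * D ^+ 2 = 1 by rewrite -exprMn mulVf ?expr1n // gt_eqF.
  have g1 : ssq (grid f) <= D ^+ 2 by apply: le_trans f1 _; rewrite ler_piMr ?sqr_ge0.
  have g1' : ssq (grid f') <= D ^+ 2 by apply: le_trans f1' _; rewrite ler_piMr ?sqr_ge0.
  have x01 : ssq x0 <= 1.
    rewrite ssqZ; apply: (@le_trans _ _ (D^-1 ^+ 2 * D ^+ 2)); last by rewrite DD.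
    by rewrite ler_wpM2l ?sqr_ge0.
  have b0 : `|bil A x0 y0| <= tau.
    rewrite /x0 /y0 bilZl bilZr mulrA -expr2 normrM ger0_norm ?sqr_ge0 //.
    rewrite (_ : tau = D^-1 ^+ 2 * (D ^+ 2 * tau)); last by rewrite mulrA DD mul1r.
    by rewrite ler_wpM2l ?sqr_ge0 // H.
  pose r i := x i - x0 i; pose r' i := y i - y0 i.
  have quarter z : ssq z <= 4^-1 ^+ 2 -> ssq (fun i => 4 * z i) <= 1.
    by rewrite ssqZ => hz; move: hz; rewrite !expr2; set q := ssq z; lra.
  have b1 : `|bil A r y| <= B / 4.
    have := NB _ y (quarter r f2) y1; rewrite bilZl normrM ger0_norm //.
    by set q := `|_|; lra.
  have b2 : `|bil A x0 r'| <= B / 4.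
    have := NB x0 _ x01 (quarter r' f2'); rewrite bilZr normrM ger0_norm //.
    by set q := `|_|; lra.
  have -> : bil A x y = bil A x0 y0 + bil A x0 r' + bil A r y.
    rewrite -bilDr.
    have -> : (fun i => y0 i + r' i) = y by apply/funext => i; rewrite /r' addrC subrK.
    by rewrite -bilDl; congr (bil A _ _); apply/funext => i; rewrite /r addrC subrK.
  by have := ler_normD (bil A x0 y0 + bil A x0 r') (bil A r y);
    have := ler_normD (bil A x0 y0) (bil A x0 r'); lra.
have iter k : N (2 * tau + B0 / 2 ^+ k).
  elim: k => [|k IH].
    by move=> x y x1 y1; rewrite expr0 divr1; have := N0 x y x1 y1; lra.
  have := step _ IH; rewrite (_ : tau + _ = 2 * tau + B0 / 2 ^+ k.+1) //.
  by rewrite exprS; field; rewrite expf_neq0 // pnatr_eq0.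
move=> x y x1 y1; rewrite leNgt; apply/negP => lt.
pose e := `|bil A x y| - 2 * tau; have e0 : 0 < e by rewrite subr_gt0.
pose k := Num.truncn (B0 / e).
have := iter k x y x1 y1; apply/negP; rewrite -ltNge -ltrBrDl -/e.
rewrite ltr_pdivrMr ?exprn_gt0 // -ltr_pdivrMl // mulrC.
apply: (@lt_le_trans _ _ (k.+1)%:R); first exact: truncnS_gt.
by rewrite -natrX ler_nat; exact: ltn_expl.
Qed.

End Net.

Lemma sqr_norm_nsq (R : realType) (z : R[i]) : `|z| ^+ 2 = (nsq z)%:C.
Proof. by rewrite normCK mul_conjC_nsq. Qed.

Section BilinearBound.
Variables (R : realType) (d : nat).
Implicit Types (x y : 'I_d -> R) (A : 'I_d -> 'I_d -> R).

(** Operator norm at most [c] for a real matrix, in homogeneous form; the absolute value is omitted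
    because [x] may be replaced by its opposite. *)
Definition bilb (c : R) A := forall x y, bil A x y <= c * Num.sqrt (ssq x) * Num.sqrt (ssq y).

Lemma bilbT c A : bilb c A -> bilb c (fun i k => A k i).
Proof.
move=> H x y; have -> : bil (fun i k => A k i) x y = bil A y x.
  rewrite /bil exchange_big; apply: eq_bigr => i _; apply: eq_bigr => k _ /=.
  by rewrite [x k * _]mulrC.
by rewrite mulrAC.
Qed.

Lemma bilbN c A : bilb c A -> bilb c (fun i k => - A i k).
Proof.
move=> H x y; have -> : bil (fun i k => - A i k) x y = bil A (fun i => -1 * x i) y.
  rewrite /bil; apply: eq_bigr => i _; apply: eq_bigr => k _ /=; ring.
by apply: le_trans (H _ _) _; rewrite ssqZ sqrrN expr1n mul1r.
Qed.

Lemma bilb_net (tau : R) A : (0 < d)%N -> 0 <= tau ->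
  (forall f f' : {ffun 'I_d -> 'I_(8 * d + 1)},
     ssq (grid R f) <= (4 * d)%:R ^+ 2 -> ssq (grid R f') <= (4 * d)%:R ^+ 2 ->
    `|bil A (grid R f) (grid R f')| <= (4 * d)%:R ^+ 2 * tau) -> bilb (2 * tau) A.
Proof.
move=> d0 tau0 /(net_bil d0 tau0) H x y.
have z0 (z : 'I_d -> R) : ssq z <= 0 -> forall i, z i = 0.
  move=> hz i; have hs (k : 'I_d) : true -> 0 <= z k ^+ 2 by move=> _; exact: sqr_ge0.
  have /(psumr_eq0P hs)/(_ i isT)/eqP : ssq z = 0 by apply/eqP; rewrite eq_le hz ssq_ge0.
  by rewrite sqrf_eq0 => /eqP.
have [x0|x0] := leP (ssq x) 0.
  rewrite /bil big1 ?mulr_ge0 ?sqrtr_ge0 // => i _.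
  by rewrite big1 // => k _; rewrite z0 // !mul0r.
have [y0|y0] := leP (ssq y) 0.
  rewrite /bil big1 ?mulr_ge0 ?sqrtr_ge0 // => i _.
  by rewrite big1 // => k _; rewrite (z0 y) // mulr0 mul0r.
have nz (z : 'I_d -> R) : 0 < ssq z -> 0 < Num.sqrt (ssq z) by rewrite sqrtr_gt0.
have un (z : 'I_d -> R) : 0 < ssq z -> ssq (fun i => (Num.sqrt (ssq z))^-1 * z i) <= 1.
  by move=> hz; rewrite ssqZ exprVn sqr_sqrtr ?ssq_ge0 // mulVf ?gt_eqF.
have := H _ _ (un _ x0) (un _ y0); rewrite bilZl bilZr => /(le_trans (ler_norm _)).
rewrite mulrA -invfM ler_pdivrMl ?mulr_gt0 ?nz //.
by set a := Num.sqrt _; set b := Num.sqrt _; rewrite (_ : a * b * (2 * tau) = 2 * tau * a * b) //; ring.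
Qed.

Lemma bilb_ssq (c : R) A x : 0 <= c -> bilb c A ->
  ssq (fun k => \sum_i x i * A i k) <= c ^+ 2 * ssq x.
Proof.
move=> c0 H; set w := fun k => _.
have E : ssq w = bil A x w.
  rewrite /bil exchange_big; apply: eq_bigr => k _ /=.
  by rewrite expr2 {2}/w mulr_sumr; apply: eq_bigr => i _; ring.
have := H x w; rewrite -E.
have sw : ssq w = Num.sqrt (ssq w) ^+ 2 by rewrite sqr_sqrtr ?ssq_ge0.
have sx : ssq x = Num.sqrt (ssq x) ^+ 2 by rewrite sqr_sqrtr ?ssq_ge0.
rewrite {1 3}sw sx; set a := Num.sqrt (ssq w); set b := Num.sqrt (_ ^+ 2).
have -> : b = Num.sqrt (ssq x) by rewrite /b -sx.
set e := Num.sqrt (ssq x).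
have a0 : 0 <= a by exact: sqrtr_ge0.
have e0 : 0 <= e by exact: sqrtr_ge0.
rewrite -exprMn => h; rewrite ler_sqr ?nnegrE ?mulr_ge0 //.
have [a1|a1] := leP a 0; first by rewrite (le_trans a1) ?mulr_ge0.
by move: h; rewrite expr2 ler_pM2r.
Qed.

End BilinearBound.

Section ComplexBound.
Variables (R : realType) (d : nat).
Local Notation C := R[i].
Variables (G : 'I_d -> 'I_d -> C) (c : R).
Hypothesis c0 : 0 <= c.
Hypothesis HR : bilb c (fun i k => complex.Re (G i k)).
Hypothesis HI : bilb c (fun i k => complex.Im (G i k)).

Lemma bilb_nsq (v : 'I_d -> C) :
  \sum_k nsq (\sum_i v i * G i k) <= 4 * c ^+ 2 * \sum_i nsq (v i).
Proof.
pose a i := complex.Re (v i); pose b i := complex.Im (v i).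
pose L (x : 'I_d -> R) (A : 'I_d -> 'I_d -> R) k := \sum_i x i * A i k.
pose A i k := complex.Re (G i k); pose B i k := complex.Im (G i k).
have ReS k : complex.Re (\sum_i v i * G i k) = L a A k - L b B k.
  by rewrite raddf_sum /L -sumrB; apply: eq_bigr => i _; rewrite /= Re_mulc.
have ImS k : complex.Im (\sum_i v i * G i k) = L a B k + L b A k.
  by rewrite raddf_sum /L -big_split; apply: eq_bigr => i _; rewrite /= Im_mulc.
apply: (@le_trans _ _ (2 * (ssq (L a A) + ssq (L b B) + ssq (L a B) + ssq (L b A)))).
  rewrite /ssq -!big_split /= mulr_sumr; apply: ler_sum => k _.
  rewrite /nsq ReS ImS; set x := L a A k; set y := L b B k; set z := L a B k; set t := L b A k.
  have : 0 <= (x + y) ^+ 2 + (z - t) ^+ 2 by rewrite addr_ge0 ?sqr_ge0.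
  rewrite !expr2; lra.
have -> : \sum_i nsq (v i) = ssq a + ssq b by rewrite /ssq -big_split.
have := bilb_ssq a c0 HR; have := bilb_ssq b c0 HR.
have := bilb_ssq a c0 HI; have := bilb_ssq b c0 HI; rewrite -/(L a A) -/(L a B) -/(L b A) -/(L b B).
by set s1 := ssq _; set s2 := ssq a; set s3 := ssq b; lra.
Qed.

End ComplexBound.

(** * The partial transpose of a rank-one matrix *)

Section PartialTransposeBound.
Variables (R : realType) (d : nat).
Local Notation C := R[i].

                                                                                    
                                                        
(** Reshape [v] and [u] as d x d matrices G and U. The partial transpose sends U to the product of
    the transpose of U G' with G, where G' is the adjoint of G, so its norm is at most the square of
    that of G. Real and imaginary parts bounded by [c] give norm at most 2c for G, whence 4 c^2. *)
Lemma opb_partial_transpose (v : 'rV[C]_(d * d)) (c : R) : 0 <= c ->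
  bilb c (fun i k => complex.Re (v 0 (mxvec_index i k))) ->
  bilb c (fun i k => complex.Im (v 0 (mxvec_index i k))) ->
  opb (4 * c ^+ 2)%:C (\matrix_(r, s) (v 0 (mxvec_index (block_index r).1 (block_index s).2) *
    Num.conj (v 0 (mxvec_index (block_index s).1 (block_index r).2)))).
Proof.
move=> c0 HR HI; split; first by rewrite ler0c mulr_ge0 ?sqr_ge0.
move=> u; pose G i k := v 0 (mxvec_index i k).
pose H i k := Num.conj (G k i).
have HR' : bilb c (fun i k => complex.Re (H i k)).
  have := bilbT HR; congr bilb; apply/funext => i; apply/funext => k.
  by rewrite /H Re_conjC.
have HI' : bilb c (fun i k => complex.Im (H i k)).
  have := bilbN (bilbT HI); congr bilb; apply/funext => i; apply/funext => k.
  by rewrite /H Im_conjC.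
have sqnR (t : 'rV[C]_(d * d)) : sqn t = (\sum_i \sum_k nsq (t 0 (mxvec_index i k)))%:C.
  rewrite sqnE (reindex _ (curry_mxvec_bij _ _)) /= pair_bigA /= rmorph_sum.
  by apply: eq_bigr => -[i k] _; rewrite sqr_norm_nsq.
rewrite !sqnR -rmorphXn -rmorphM lecR /=.
pose U i b := \sum_k u 0 (mxvec_index i k) * H k b.
set M := (\matrix_(r, s) _).
(* The inner sum over [k] is the multiplication by the adjoint of G, the outer sum over [i] the
   multiplication by G. *)
have E a b : (u *m M) 0 (mxvec_index a b) = \sum_i U i a * G i b.
  transitivity (\sum_i \sum_k u 0 (mxvec_index i k) * H k a * G i b).
    rewrite mxE (reindex _ (curry_mxvec_bij _ _)) /= pair_bigA /=; apply: eq_bigr => -[i k] _.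
    by rewrite mxE !mxvec_indexK /= /H /G; ring.
  by apply: eq_bigr => i _; rewrite /U mulr_suml.
apply: (@le_trans _ _ (\sum_a 4 * c ^+ 2 * \sum_i nsq (U i a))).
  apply: ler_sum => a _; under eq_bigr do rewrite E.
  exact: (bilb_nsq (G := G) c0 HR HI (fun i => U i a)).
rewrite -mulr_sumr exchange_big /=.
apply: (@le_trans _ _ (4 * c ^+ 2 * \sum_i (4 * c ^+ 2 * \sum_k nsq (u 0 (mxvec_index i k))))).
  apply: ler_wpM2l; first by rewrite mulr_ge0 ?sqr_ge0.
  by apply: ler_sum => i _; exact: (bilb_nsq c0 HR' HI').
by rewrite -mulr_sumr mulrA -expr2.
Qed.

End PartialTransposeBound.

Lemma measurable_forallb (d : measure_display) (T : measurableType d) (J : finType)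
  (b : J -> T -> bool) : (forall j, measurable_fun setT (b j)) ->
  measurable_fun setT (fun w => [forall j, b j w]).
Proof.
move=> mb; rewrite (_ : (fun w => _) = (fun w => \big[andb/true]_(j <- enum J) b j w)); last first.
  apply/funext => w; rewrite big_all; apply/forallP/allP => [H j _|H j]; first exact: H.
  by apply: H; rewrite mem_enum.
elim: (enum J) => [|j s IH].
  by under eq_fun do rewrite big_nil; exact: measurable_cst.
by under eq_fun do rewrite big_cons; apply: measurable_and.
Qed.

(** * A column has moderate norm except with tiny probability *)

Section NormEvent.
Context {R : realType} {dT : measure_display} {T : measurableType dT}.
Local Notation C := R[i].
Variables (P : probability T R) (kap : R) (d p : nat).
Variable (g : 'I_(d * d) * 'I_p -> T -> C).
Hypothesis gok : forall e, entry_ok P kap (g e).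
Hypothesis gind : mutually_independent P (pairX g).
Variables (c : 'I_p) (tau : R).
Hypothesis tau0 : 0 <= tau.
Local Notation F := {ffun 'I_d -> 'I_(8 * d + 1)}.
Local Notation D := ((4 * d)%:R : R).

Definition small_grid (f : F) : bool := ssq (grid R f) <= D ^+ 2.

Definition colbil (h : C -> R) (f f' : F) (w : T) : R :=
  bil (fun i k => h (g (mxvec_index i k, c) w)) (grid R f) (grid R f').

(** The event that the column [c], reshaped as a d x d matrix, is bounded on the grid. It is a
    finite conjunction, hence measurable, and it involves the entries of column [c] only. *)
Definition netb (w : T) : bool :=
  [forall f : F, [forall f' : F, (small_grid f && small_grid f') ==>
    ((`|colbil (@complex.Re R) f f' w| <= D ^+ 2 * tau) &&
     (`|colbil (@complex.Im R) f f' w| <= D ^+ 2 * tau))]].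

Lemma netb_opb w : (0 < d)%N -> netb w ->
  opb (16 * tau ^+ 2)%:C (\matrix_(r, s)
    (g (mxvec_index (block_index r).1 (block_index s).2, c) w *
     Num.conj (g (mxvec_index (block_index s).1 (block_index r).2, c) w))).
Proof.
move=> d0 /forallP N.
have H (h : C -> R) : (forall f f', small_grid f -> small_grid f' ->
    `|colbil h f f' w| <= D ^+ 2 * tau) ->
    bilb (2 * tau) (fun i k => h ((\row_r g (r, c) w) 0 (mxvec_index i k))).
  move=> H; apply: bilb_net => // f f' sf sf'; have := H f f' sf sf'.
  by rewrite /colbil; under [in X in _ -> X]eq_fun2 do rewrite mxE.
have := @opb_partial_transpose _ _ (\row_r g (r, c) w) (2 * tau).
rewrite (_ : 4 * (2 * tau) ^+ 2 = 16 * tau ^+ 2); last by ring.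
rewrite (_ : (\matrix_(r, s) _) = (\matrix_(r, s)
    (g (mxvec_index (block_index r).1 (block_index s).2, c) w *
     Num.conj (g (mxvec_index (block_index s).1 (block_index r).2, c) w)))); last first.
  by apply/matrixP => r s; rewrite !mxE.
apply; first by rewrite mulr_ge0.
  by apply: H => f f' sf sf'; have /forallP/(_ f') := N f; rewrite sf sf' => /andP[].
by apply: H => f f' sf sf'; have /forallP/(_ f') := N f; rewrite sf sf' => /andP[].
Qed.

Section Measurable.
Variable (dS : measure_display) (S : measurableType dS) (pr : S -> T).
Hypothesis mg : forall r, cmeas (fun w => g (r, c) (pr w)).

Lemma measurable_colbil (h : C -> R) f f' :
  (forall r, measurable_fun setT (fun w => h (g (r, c) (pr w)))) ->
  measurable_fun setT (fun w => colbil h f f' (pr w)).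
Proof.
move=> mh; rewrite /colbil /bil; apply: measurable_sum => i; apply: measurable_sum => k.
by apply: measurable_funM => //; exact: measurable_cst.
Qed.

Lemma measurable_netb : measurable_fun setT (fun w => netb (pr w)).
Proof.
apply: measurable_forallb => f; apply: measurable_forallb => f'.
case: (_ && _); last by exact: measurable_cst.
rewrite /=; apply: measurable_and; apply: measurable_fun_ler; try exact: measurable_cst.
- by apply: measurableT_comp => //; apply: measurable_colbil => r; case: (mg r).
- by apply: measurableT_comp => //; apply: measurable_colbil => r; case: (mg r).
Qed.
End Measurable.

Lemma measurable_netbT : measurable_fun setT netb.
Proof. by apply: (@measurable_netb _ _ id) => r; exact: (eo_meas (gok _)). Qed.

Definition grid_coef (f f' : F) (z : 'I_(d * d) * 'I_p) : R :=
  grid R f (block_index z.1).1 * grid R f' (block_index z.1).2.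

Let col_seq := [seq (r, c) | r <- enum 'I_(d * d)].

Let big_col_seq (f : 'I_(d * d) * 'I_p -> R) :
  \sum_(z <- col_seq) f z = \sum_(i < d) \sum_(k < d) f (mxvec_index i k, c).
Proof.
rewrite big_map big_enum /= (reindex _ (curry_mxvec_bij _ _)) /= pair_bigA /=.
by apply: eq_bigr => -[i k] _.
Qed.

Lemma colbil_mgf (h : C -> R) (f f' : F) (a : R) :
  (forall e (J : {set 'I_(d * d) * 'I_p}), e \in J ->
     measurable_fun setT (fun w : sigT (pairX g) J => h (g e w))) ->
  (forall e (x : R), (\int[P]_w (expR (x * h (g e w)))%:E <= (expR (x ^+ 2 / 2))%:E)%E) ->
  (\int[P]_w (expR (a * colbil h f f' w))%:E <=
   (expR (a ^+ 2 * (ssq (grid R f) * ssq (grid R f')) / 2))%:E)%E.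
Proof.
move=> mh H.
have us : uniq col_seq by rewrite map_inj_uniq ?enum_uniq // => r r' [].
have := mgf_sum gok gind (fun z => a * grid_coef f f' z) us mh H.
rewrite big_col_seq.
have -> : \sum_(i < d) \sum_(k < d) (a * grid_coef f f' (mxvec_index i k, c)) ^+ 2 / 2 =
    a ^+ 2 * (ssq (grid R f) * ssq (grid R f')) / 2.
  rewrite /ssq mulr_suml mulr_sumr mulr_suml; apply: eq_bigr => i _.
  rewrite !mulr_sumr mulr_suml; apply: eq_bigr => k _.
  by rewrite /grid_coef mxvec_indexK /=; ring.
under [X in (X <= _)%E -> _]eq_integral => w _.
  rewrite big_col_seq (_ : \sum_(i < d) _ = a * colbil h f f' w); last first.
    rewrite /colbil /bil mulr_sumr; apply: eq_bigr => i _; rewrite mulr_sumr.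
    by apply: eq_bigr => k _; rewrite /grid_coef mxvec_indexK /= -mulrA.
  over.
by [].
Qed.

(** The Chernoff weight: for the right sign [s] it is at least 1 as soon as the bilinear form
    exceeds D^2 tau in absolute value. *)
Let bnd (h : C -> R) (f f' : F) (s : R) w : R :=
  expR (- tau ^+ 2) * expR (s * (tau / D ^+ 2) * colbil h f f' w).

Lemma Ex_grid (h : C -> R) (f f' : F) (s : R) : (0 < d)%N -> s ^+ 2 = 1 ->
  (forall e (J : {set 'I_(d * d) * 'I_p}), e \in J ->
     measurable_fun setT (fun w : sigT (pairX g) J => h (g e w))) ->
  (forall r, measurable_fun setT (fun w => h (g (r, c) w))) ->
  (forall e (x : R), (\int[P]_w (expR (x * h (g e w)))%:E <= (expR (x ^+ 2 / 2))%:E)%E) ->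
  small_grid f -> small_grid f' ->
  itg P (bnd h f f' s) /\ Ex P (bnd h f f' s) <= expR (- tau ^+ 2 / 2).
Proof.
move=> d0 s1 mh mh' H sf sf'.
have D0 : 0 < D by rewrite ltr0n muln_gt0.
set a := s * (tau / D ^+ 2).
have mc : measurable_fun setT (fun w => expR (a * colbil h f f' w)).
  apply: measurableT_comp => //; apply: measurable_funM => //.
  exact: (@measurable_colbil _ _ id).
have I1 : itg P (fun w => expR (a * colbil h f f' w)).
  apply: itg_fin => //.
  by apply: le_lt_trans (colbil_mgf f f' a mh H) _; rewrite ltry.
split; first exact: itgZ.
rewrite /bnd ExZ //.
have := colbil_mgf f f' a mh H; rewrite ExE // lee_fin => h1.
apply: (@le_trans _ _ (expR (- tau ^+ 2) * expR (tau ^+ 2 / 2))).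
  apply: ler_wpM2l; first exact: expR_ge0.
  apply: le_trans h1 _; rewrite ler_expR ler_pM2r ?invr_gt0 //.
  rewrite /a exprMn s1 mul1r exprMn exprVn -mulrA ler_piMr ?sqr_ge0 //.
  rewrite ler_pdivrMl ?exprn_gt0 // mulr1 expr2; apply: ler_pM => //; exact: ssq_ge0.
by rewrite -expRD ler_expR; lra.
Qed.

(** Union bound over pairs of grid points, two signs and the real and imaginary parts, whence the
    factor 4. On [small_grid] the form has variance proxy at most D^4, and the Chernoff parameter
    tau / D^2 gives exp(- tau^2 + tau^2 / 2). *)
Lemma netb_prob : (0 < d)%N ->
  Ex P (fun w => (~~ netb w)%:R) <= 4 * ((8 * d + 1)%:R ^+ d) ^+ 2 * expR (- tau ^+ 2 / 2).
Proof.
move=> d0; have D0 : 0 < D by rewrite ltr0n muln_gt0.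
have mR e (J : {set 'I_(d * d) * 'I_p}) : e \in J ->
     measurable_fun setT (fun w : sigT (pairX g) J => complex.Re (g e w)).
  by move=> eJ; have [] := csm_g g eJ.
have mI e (J : {set 'I_(d * d) * 'I_p}) : e \in J ->
     measurable_fun setT (fun w : sigT (pairX g) J => complex.Im (g e w)).
  by move=> eJ; have [] := csm_g g eJ.
have mR' r : measurable_fun setT (fun w => complex.Re (g (r, c) w)).
  by have [] := eo_meas (gok (r, c)).
have mI' r : measurable_fun setT (fun w => complex.Im (g (r, c) w)).
  by have [] := eo_meas (gok (r, c)).
pose four f f' w := bnd (@complex.Re R) f f' 1 w + bnd (@complex.Re R) f f' (-1) w +
  (bnd (@complex.Im R) f f' 1 w + bnd (@complex.Im R) f f' (-1) w).
have four_ge0 f f' w : 0 <= four f f' w.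
  by rewrite !addr_ge0 // mulr_ge0 ?expR_ge0.
have s1 : (1 : R) ^+ 2 = 1 by rewrite expr1n.
have s2 : (-1 : R) ^+ 2 = 1 by rewrite sqrrN expr1n.
have E4 f f' : small_grid f && small_grid f' ->
    itg P (four f f') /\ Ex P (four f f') <= 4 * expR (- tau ^+ 2 / 2).
  move=> /andP[sf sf'].
  have [i1 h1] := Ex_grid d0 s1 mR mR' (fun e => eo_mgf1 (gok e)) sf sf'.
  have [i2 h2] := Ex_grid d0 s2 mR mR' (fun e => eo_mgf1 (gok e)) sf sf'.
  have [i3 h3] := Ex_grid d0 s1 mI mI' (fun e => eo_mgf2 (gok e)) sf sf'.
  have [i4 h4] := Ex_grid d0 s2 mI mI' (fun e => eo_mgf2 (gok e)) sf sf'.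
  have i12 := itgD i1 i2; have i34 := itgD i3 i4.
  split; first exact: (itgD i12 i34).
  rewrite /four (ExD i12 i34) (ExD i1 i2) (ExD i3 i4).
  apply: le_trans (lerD (lerD h1 h2) (lerD h3 h4)) _; set e := expR _.
  by rewrite (_ : 4 * e = e + e + (e + e)) //; ring.
have key h f f' w : D ^+ 2 * tau < `|colbil h f f' w| ->
    1 <= bnd h f f' 1 w + bnd h f f' (-1) w.
  move=> lt; have b0 s : 0 <= bnd h f f' s w by rewrite mulr_ge0 ?expR_ge0.
  have one (s : R) : D ^+ 2 * tau <= s * colbil h f f' w -> 1 <= bnd h f f' s w.
    move=> le; rewrite /bnd -expRD -[X in X <= _]expR0 ler_expR addrC subr_ge0.
    rewrite [s * (tau / D ^+ 2)]mulrC -[X in _ <= X]mulrA.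
    apply: le_trans (ler_wpM2l _ le); last by rewrite divr_ge0 ?sqr_ge0.
    by rewrite mulrA divfK ?expr2 // mulf_neq0 // gt_eqF.
  move: lt; have [c0|c0] := leP 0 (colbil h f f' w).
    rewrite ger0_norm // => lt; apply: (@le_trans _ _ (bnd h f f' 1 w)); last by rewrite lerDl.
    by apply: one; rewrite mul1r ltW.
  rewrite ltr0_norm // => lt; apply: (@le_trans _ _ (bnd h f f' (-1) w)); last by rewrite lerDr.
  by apply: one; rewrite mulN1r ltW.
pose tot w := \sum_(q : F * F | small_grid q.1 && small_grid q.2) four q.1 q.2 w.
have Itot : itg P tot by apply: itg_sum => q sq; exact: (E4 _ _ sq).1.
apply: (@le_trans _ _ (Ex P tot)).
  apply: Ex_le => //.
    apply: (itg_le _ _ (itg_cst P 1)) => [|w]; last by case: netb; rewrite ?normr0 ?normr1.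
    rewrite (_ : (fun w => _) = (fun w => if netb w then 0 else 1)); last first.
      by apply/funext => w; case: netb.
    by apply: measurable_fun_ifT => //; exact: measurable_netbT.
  move=> w; case: (boolP (netb w)) => [_|] /=.
    by apply: sumr_ge0 => q _; exact: four_ge0.
  rewrite negb_forall => /existsP[f]; rewrite negb_forall => /existsP[f'].
  rewrite negb_imply => /andP[sq nb].
  rewrite /tot (bigD1 (f, f')) //=; apply: (@le_trans _ _ (four f f' w)); last first.
    by rewrite lerDl; apply: sumr_ge0 => q _; exact: four_ge0.
  have b0 h s : 0 <= bnd h f f' s w by rewrite mulr_ge0 ?expR_ge0.
  move: nb; rewrite negb_and -!ltNge => /orP[] /key h1; rewrite (le_trans h1) //.
    by rewrite lerDl addr_ge0.
  by rewrite lerDr addr_ge0.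
rewrite /tot Ex_sum; last by move=> q sq; exact: (E4 _ _ sq).1.
apply: (@le_trans _ _ (\sum_(q : F * F) 4 * expR (- tau ^+ 2 / 2))).
  rewrite big_mkcond /=; apply: ler_sum => q _; case: ifP => sq; first exact: (E4 _ _ sq).2.
  by rewrite mulr_ge0 ?expR_ge0.
rewrite sumr_const card_prod card_ffun !card_ord -[_ *+ _]mulr_natl.
by rewrite natrM natrX expr2 mulrCA mulrA.
Qed.
End NormEvent.

                                          

(** * Power sums of eigenvalues and traces in an eigenbasis *)

Section PowerSums.
Variables (R : realType) (n : nat) (r : 'I_n -> R).
Hypothesis r0 : forall i, 0 <= r i.
Definition psum q : R := \sum_i r i ^+ q.

Lemma psum_ge0 q : 0 <= psum q.
Proof. by apply: sumr_ge0 => i _; rewrite exprn_ge0. Qed.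

Lemma psumS_le K q : (forall i, r i <= K) -> psum q.+1 <= K * psum q.
Proof.
move=> rK; rewrite /psum mulr_sumr; apply: ler_sum => i _.
by rewrite exprS ler_wpM2r ?exprn_ge0.
Qed.

Lemma mul_expr_le (x y : R) a b : 0 <= x -> 0 <= y -> x ^+ a * y ^+ b <= x ^+ (a + b) + y ^+ (a + b).
Proof.
move=> x0 y0; have [xy|yx] := leP x y.
  apply: (@le_trans _ _ (y ^+ (a + b))); last by rewrite lerDr exprn_ge0.
  by rewrite exprD ler_wpM2r ?exprn_ge0 // lerXn2r ?nnegrE.
apply: (@le_trans _ _ (x ^+ (a + b))); last by rewrite lerDl exprn_ge0.
by rewrite exprD ler_wpM2l ?exprn_ge0 // lerXn2r ?nnegrE // ltW.
Qed.

(** Chebyshev's sum inequality with weights r_i^2: after symmetrising, each term contains (x^a -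
    y^a)(x^b - y^b) >= 0. *)
Lemma psum_mul_le a b : psum (2 + a) * psum (2 + b) <= psum 2 * psum (2 + (a + b)).
Proof.
have E x y : psum x * psum y = \sum_i \sum_j r i ^+ x * r j ^+ y.
  by rewrite /psum mulr_suml; apply: eq_bigr => i _; rewrite mulr_sumr.
have sym x y : psum x * psum y = 2^-1 * \sum_i \sum_j (r i ^+ x * r j ^+ y + r j ^+ x * r i ^+ y).
  under [in RHS]eq_bigr do rewrite big_split /=.
  rewrite big_split /= -E [X in _ + X]exchange_big /= -E.
  by set t := psum x * psum y; lra.
rewrite !sym ler_pM2l ?invr_gt0 //; apply: ler_sum => i _; apply: ler_sum => j _.
rewrite !exprD; set x := r i; set y := r j; rewrite -subr_ge0.
have -> : x ^+ 2 * (y ^+ 2 * (y ^+ a * y ^+ b)) + y ^+ 2 * (x ^+ 2 * (x ^+ a * x ^+ b)) -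
  (x ^+ 2 * x ^+ a * (y ^+ 2 * y ^+ b) + y ^+ 2 * y ^+ a * (x ^+ 2 * x ^+ b)) =
  (x ^+ 2 * y ^+ 2) * ((x ^+ a - y ^+ a) * (x ^+ b - y ^+ b)) by ring.
apply: mulr_ge0; first by rewrite mulr_ge0 ?sqr_ge0.
have x0 : 0 <= x by exact: r0.
have y0 : 0 <= y by exact: r0.
have [xy|yx] := leP x y.
  by rewrite mulr_le0 // subr_le0 lerXn2r ?nnegrE.
by rewrite mulr_ge0 // subr_ge0 lerXn2r ?nnegrE // ltW.
Qed.

(** A Schur test: x^a y^b is at most x^(a+b) + y^(a+b), and rows and columns of [m] are summed
    separately. *)
Lemma weighted_psum_le a b (m : 'I_n -> 'I_n -> R) (c : R) : (forall i j, 0 <= m i j) ->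
  (forall i, \sum_j m i j <= c) -> (forall j, \sum_i m i j <= c) ->
  \sum_i \sum_j r i ^+ a * r j ^+ b * m i j <= 2 * c * psum (a + b).
Proof.
move=> m0 mr mc.
apply: (@le_trans _ _ (\sum_i \sum_j (r i ^+ (a + b) * m i j + r j ^+ (a + b) * m i j))).
  apply: ler_sum => i _; apply: ler_sum => j _; rewrite -mulrDl ler_wpM2r //.
  exact: mul_expr_le.
under eq_bigr do rewrite big_split /=.
rewrite big_split /= [X in _ + X]exchange_big /= -mulrA mulrDl mul1r mulrC /psum !mulr_suml.
by apply: lerD; apply: ler_sum => i _; rewrite -mulr_sumr ler_wpM2l ?exprn_ge0.
Qed.

End PowerSums.

Section EigenbasisTraces.
Variables (C : numClosedFieldType) (n : nat).
Implicit Types (A P W M : 'M[C]_n) (D : 'rV[C]_n).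

Lemma mxtrace_diag2 D D' M M' :
  \tr (diag_mx D *m M *m diag_mx D' *m M') = \sum_i \sum_j D 0 i * D' 0 j * (M i j * M' j i).
Proof.
apply: eq_bigr => i _; rewrite mxE; apply: eq_bigr => j _.
by rewrite mul_mx_diag mxE mul_diag_mx mxE; ring.
Qed.

Lemma specd_tr2 A P D W a b : specd A P D ->
  \tr (A ^+ a * W * A ^+ b * W) =
  \sum_i \sum_j D 0 i ^+ a * D 0 j ^+ b * ((P *m W *m P^t*) i j * (P *m W *m P^t*) j i).
Proof.
move=> sA; have [_ _ ->] := specd_exp sA a; have [_ _ ->] := specd_exp sA b.
rewrite -!mulmxE.
have -> : forall X Y, P^t* *m X *m P *m W *m (P^t* *m Y *m P) *m W =
    P^t* *m (X *m (P *m W *m P^t*) *m Y *m (P *m W)) by move=> X Y; rewrite !mulmxA.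
rewrite mxtrace_mulC -[X in \tr X]mulmxA mxtrace_diag2.
by apply: eq_bigr => i _; apply: eq_bigr => j _; rewrite !mxE.
Qed.

Lemma specd_trT A P D a b : specd A P D ->
  \tr (A ^+ a *m (A ^+ b)^T) =
  \sum_i \sum_j D 0 i ^+ a * D 0 j ^+ b * ((P *m P^T) i j * ((P *m P^T)^t*) j i).
Proof.
move=> sA; have [_ _ ->] := specd_exp sA a; have [_ _ ->] := specd_exp sA b.
rewrite !trmx_mul tr_diag_mx.
have -> : forall X Y, P^t* *m X *m P *m (P^T *m (Y *m P^t*^T)) =
    P^t* *m (X *m (P *m P^T) *m Y *m P^t*^T) by move=> X Y; rewrite !mulmxA.
rewrite mxtrace_mulC -[X in \tr X]mulmxA.
have -> : P^t*^T *m P^t* = (P *m P^T)^t* by rewrite trmxC_mul trmxK map_trmx trmxK.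
rewrite mxtrace_diag2.
apply: eq_bigr => i _; apply: eq_bigr => j _; rewrite [in LHS](mxE _ _ 0 i) [in LHS](mxE _ _ 0 j).
by rewrite trmx_mul.
Qed.

Lemma specd_tr1 A P D W a : specd A P D ->
  \tr (A ^+ a * W) = \sum_i D 0 i ^+ a * (P *m W *m P^t*) i i.
Proof.
move=> sA; have [_ _ ->] := specd_exp sA a; rewrite -!mulmxE -!mulmxA mxtrace_mulC -!mulmxA.
by apply: eq_bigr => i _; rewrite mul_diag_mx !mxE.
Qed.

End EigenbasisTraces.

Section HermitianTraces.
Variables (R : realType) (n : nat).
Local Notation C := R[i].
Variables (A P : 'M[C]_n) (r : 'I_n -> R).
Hypothesis hA : hermd A P r.
Hypothesis r0 : forall i, 0 <= r i.

Let PP : P *m P^t* = 1%:M. Proof. by case: hA. Qed.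
Let PP' : P^t* *m P = 1%:M. Proof. by case: hA. Qed.

Definition emx (W : 'M[C]_n) : 'M[C]_n := P *m W *m P^t*.

Lemma emx_herm W : W^t* = W -> (emx W)^t* = emx W.
Proof. by move=> hW; rewrite /emx !trmxC_mul trmxCK hW mulmxA. Qed.

Lemma emx_nsq W i j : W^t* = W -> emx W i j * emx W j i = (nsq (emx W i j))%:C.
Proof.
move=> hW; rewrite -mul_conjC_nsq; congr (_ * _).
by rewrite -[in LHS](emx_herm hW) !mxE.
Qed.

Lemma emx_nsqC W i j : W^t* = W -> nsq (emx W i j) = nsq (emx W j i).
Proof. by move=> hW; rewrite -[in LHS](emx_herm hW) !mxE nsq_conj. Qed.

Lemma herm_tr2 W a b : W^t* = W -> \tr (A ^+ a * W * A ^+ b * W) =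
  (\sum_i \sum_j r i ^+ a * r j ^+ b * nsq (emx W i j))%:C.
Proof.
move=> hW; rewrite (specd_tr2 W a b hA) rmorph_sum; apply: eq_bigr => i _.
rewrite rmorph_sum; apply: eq_bigr => j _.
by rewrite -!/(emx W) emx_nsq // [(\row__ _) 0 i]mxE [(\row__ _) 0 j]mxE !rmorphM !rmorphXn.
Qed.

Lemma sum_nsq_row (M : 'M[C]_n) i : (\sum_j nsq (M i j))%:C = sqn (row i M).
Proof.
rewrite sqnE rmorph_sum /=; apply: eq_bigr => j _.
by rewrite -sqr_norm_nsq [row _ _ _ _]mxE.
Qed.

Lemma emx_row W (c : R) i : opb c%:C W -> \sum_j nsq (emx W i j) <= c ^+ 2.
Proof.
move=> [c0 oW]; rewrite -lecR sum_nsq_row /emx row_mul row_mul -(specd_sqn hA).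
apply: le_trans (oW _) _; rewrite (specd_sqn hA) -row_mul PP.
rewrite rmorphXn -[X in _ <= X]mulr1 ler_wpM2l ?exprn_ge0 //.
rewrite -sum_nsq_row -[1]/((1 : R)%:C) lecR (bigD1 i) //= big1 ?addr0; last first.
  by move=> j ji; rewrite mxE eq_sym (negPf ji) /nsq /= !expr0n addr0.
by rewrite mxE eqxx /nsq /= expr1n expr0n addr0.
Qed.

Lemma herm_tr2_ge0 W a b : 0 <= \sum_i \sum_j r i ^+ a * r j ^+ b * nsq (emx W i j).
Proof.
by apply: sumr_ge0 => i _; apply: sumr_ge0 => j _; rewrite !mulr_ge0 ?exprn_ge0 ?nsq_ge0.
Qed.

Lemma herm_tr2_opb W (c : R) a b : W^t* = W -> opb c%:C W ->
  \sum_i \sum_j r i ^+ a * r j ^+ b * nsq (emx W i j) <= 2 * c ^+ 2 * psum r (a + b).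
Proof.
move=> hW oW; apply: weighted_psum_le => //; first by move=> i j; exact: nsq_ge0.
  by move=> i; exact: emx_row.
by move=> j; under eq_bigr do rewrite emx_nsqC //; exact: emx_row.
Qed.

Lemma herm_trW2 W : W^t* = W -> \tr (W * W) = (\sum_i \sum_j nsq (emx W i j))%:C.
Proof.
move=> hW; have := herm_tr2 0 0 hW; rewrite !expr0 mul1r mulr1 => ->.
by congr (_%:C); apply: eq_bigr => i _; apply: eq_bigr => j _; rewrite !expr0 !mul1r.
Qed.

Lemma herm_tr2_le W (K : R) a b : (forall i, r i <= K) -> W^t* = W ->
  (\sum_i \sum_j r i ^+ a * r j ^+ b * nsq (emx W i j))%:C <= (K ^+ (a + b))%:C * \tr (W * W).
Proof.
move=> rK hW; rewrite herm_trW2 // -rmorphM lecR mulr_sumr; apply: ler_sum => i _.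
rewrite mulr_sumr; apply: ler_sum => j _; rewrite ler_wpM2r ?nsq_ge0 // exprD.
apply: ler_pM; rewrite ?exprn_ge0 //; rewrite lerXn2r ?nnegrE // (le_trans (r0 i)) //.
Qed.

(** [u], the product of [P] with its plain transpose, is unitary, so the squared moduli of its
    entries form a doubly stochastic matrix, to which [weighted_psum_le] applies. This shows that
    the transposed trace in the GOE covariance is of lower order than the product of traces. *)
Lemma herm_trT a b : exists2 x : R, \tr (A ^+ a *m (A ^+ b)^T) = x%:C & 0 <= x <= 2 * psum r (a + b).
Proof.
pose u := P *m P^T.
have uu : u *m u^t* = 1%:M.
  rewrite /u trmxC_mul mulmxA -[P *m P^T *m _]mulmxA.
  have -> : P^T *m (P^T)^t* = (P^t* *m P)^T by rewrite trmx_mul -map_trmx.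
  by rewrite PP' trmx1 mulmx1 PP.
have uu' : u^t* *m u = 1%:M by apply/mulmx1C.
have row1 (M : 'M[C]_n) i : M *m M^t* = 1%:M -> \sum_j nsq (M i j) = 1.
  move=> MM; have : (M *m M^t*) i i = 1 by rewrite MM mxE eqxx.
  rewrite mxE => h; apply: (@complexI R); rewrite [RHS]rmorph1 -h rmorph_sum /=.
  by apply: eq_bigr => j _; rewrite -mul_conjC_nsq !mxE.
exists (\sum_i \sum_j r i ^+ a * r j ^+ b * nsq (u i j)).
  rewrite (specd_trT a b hA) rmorph_sum; apply: eq_bigr => i _.
  rewrite rmorph_sum; apply: eq_bigr => j _.
  rewrite -/u [(\row__ _) 0 i]mxE [(\row__ _) 0 j]mxE !rmorphM !rmorphXn /=; congr (_ * _).
  by rewrite -mul_conjC_nsq; congr (_ * _); rewrite mxE mxE.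
apply/andP; split.
  by apply: sumr_ge0 => i _; apply: sumr_ge0 => j _; rewrite !mulr_ge0 ?exprn_ge0 ?nsq_ge0.
rewrite -[2]mulr1; apply: weighted_psum_le => //; first by move=> i j; exact: nsq_ge0.
  by move=> i; rewrite row1.
move=> j; rewrite -(row1 (u^t*) j); last by rewrite trmxCK.
by apply: ler_sum => i _; rewrite !mxE nsq_conj.
Qed.

Lemma herm_tr1_opb W (c : R) a : opb c%:C W -> `|\tr (A ^+ a * W)| <= (c * psum r a)%:C.
Proof.
move=> oW; rewrite (specd_tr1 W a hA); apply: le_trans (ler_norm_sum _ _ _) _.
rewrite /psum mulr_sumr rmorph_sum; apply: ler_sum => i _.
rewrite [(\row__ _) 0 i]mxE normrM.
have -> : `|(r i)%:C ^+ a| = (r i ^+ a)%:C.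
  by rewrite -rmorphXn norm_realc ger0_norm // exprn_ge0.
rewrite [X in X <= _]mulrC rmorphM /=.
apply: ler_wpM2r; first by rewrite ler0c exprn_ge0.
have -> : (P *m W *m P^t*) i i = qform W (row i P).
  by rewrite /qform -row_mul !mxE; apply: eq_bigr => j _; rewrite !mxE.
apply: le_trans (opb_qform _ oW) _; rewrite (specd_sqn hA) -row_mul PP.
rewrite (_ : sqn _ = 1) ?mulr1 //.
rewrite -sum_nsq_row (bigD1 i) //= big1 ?addr0; last first.
  by move=> j ji; rewrite mxE eq_sym (negPf ji) /nsq /= !expr0n addr0.
by rewrite mxE eqxx /nsq /= expr1n expr0n addr0.
Qed.

Lemma herm_tr1_real W a : W^t* = W -> complex.Im (\tr (A ^+ a * W)) = 0.
Proof.
move=> hW; rewrite (specd_tr1 W a hA) raddf_sum /= big1 // => i _.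
rewrite [(\row__ _) 0 i]mxE -rmorphXn Im_mulc /= mul0r addr0.
have : emx W i i = Num.conj (emx W i i) by rewrite -[in LHS](emx_herm hW) !mxE.
move/(congr1 (@complex.Im R)); rewrite Im_conjC -/(emx W) => h.
have E : complex.Im (emx W i i) = 0 by lra.
by rewrite E mulr0.
Qed.

End HermitianTraces.

Lemma opb_frob (C : numClosedFieldType) n (W : 'M[C]_n) (c : C) : 0 <= c ->
  \tr (W *m W^t*) <= c ^+ 2 -> opb c W.
Proof.
move=> c0 h; split => // v; rewrite mulrC.
rewrite sqnE; apply: (@le_trans _ _ (\sum_j sqn v * \sum_i `|W i j| ^+ 2)).
  apply: ler_sum => j _; have := dot_CauchySchwarz v ((col j W)^t*).
  rewrite trmxCK; congr (`|_| ^+ 2 <= _ * _).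
    by rewrite !mxE; apply: eq_bigr => i _; rewrite !mxE.
  by rewrite sqnE; apply: eq_bigr => i _; rewrite !mxE norm_conjC.
rewrite -mulr_sumr; apply: ler_wpM2l; first exact: sqn_ge0.
apply: le_trans h; rewrite mxtraceE2 exchange_big /=.
by apply: ler_sum => i _; apply: ler_sum => j _; rewrite -normCK.
Qed.

(** * The centred matrix of one column and its Wigner covariance *)

Section ColumnMatrix.
Context {R : realType} {dT : measure_display} {T : measurableType dT}.
Local Notation C := R[i].
Variables (P : probability T R) (kap : R) (d p : nat).
Variable (g : 'I_(d * d) * 'I_p -> T -> C).
Hypothesis gok : forall e, entry_ok P kap (g e).
Hypothesis gind : mutually_independent P (pairX g).
Hypothesis kap2 : kap * kap = kap.
Variables (c : 'I_p) (sc : R).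
Local Notation I := 'I_(d * d).

(** Takes the block index of [x] and the inner index of [y]: the entry (x, y) of the partial
    transpose of the rank-one matrix of v is v at [swap_index x y] times the conjugate of v at
    [swap_index y x]. *)
Definition swap_index (x y : I) : I := mxvec_index (block_index x).1 (block_index y).2.

Lemma block_index_inj : injective (@block_index d).
Proof. by move=> x y /enum_val_inj/cast_ord_inj. Qed.

Lemma swap_index_eq x y a b : (swap_index x y == swap_index a b) =
  ((block_index x).1 == (block_index a).1) && ((block_index y).2 == (block_index b).2).
Proof.
apply/eqP/andP => [/(congr1 (@block_index d))|[/eqP h1 /eqP h2]].
  by rewrite !mxvec_indexK => -[-> ->].
by rewrite /swap_index h1 h2.
Qed.

(** Sending (x, y) to ([swap_index x y], [swap_index y x]) is injective. This is the combinatorial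
    reason for the Wigner covariance. *)
Lemma swap_index_eq2 x y a b :
  (swap_index x y == swap_index a b) && (swap_index y x == swap_index b a) =
  (x == a) && (y == b).
Proof.
rewrite !swap_index_eq -!(inj_eq block_index_inj).
case: (block_index x) => x1 x2; case: (block_index y) => y1 y2.
case: (block_index a) => a1 a2; case: (block_index b) => b1 b2; rewrite !xpair_eqE /=.
by do 4!case: (_ == _).
Qed.

Lemma swap_index_diag x y : (swap_index x y == swap_index y x) = (x == y).
Proof.
have := swap_index_eq2 x y y x; rewrite [swap_index y x == _]eq_sym andbb => ->.
by rewrite [y == x]eq_sym andbb.
Qed.

Definition ptm (w : T) : 'M[C]_(d * d) :=
  \matrix_(x, y) (g (swap_index x y, c) w * Num.conj (g (swap_index y x, c) w)).

Definition colZ (w : T) : 'M[C]_(d * d) := sc%:C *: (ptm w - 1%:M).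

Lemma ptm_herm w : (ptm w)^t* = ptm w.
Proof. by apply/matrixP => x y; rewrite !mxE rmorphM /= conjCK mulrC. Qed.

Lemma colZ_herm w : (colZ w)^t* = colZ w.
Proof.
rewrite /colZ linearZ /= map_mxZ linearB /= map_mxB ptm_herm trmx1 map_mx1.
by rewrite conjC_realc.
Qed.

Lemma colZE w x y : colZ w x y =
  sc%:C * (g (swap_index x y, c) w * Num.conj (g (swap_index y x, c) w) - (x == y)%:R).
Proof. by rewrite !mxE. Qed.

Lemma cmeas_colZ (dS : measure_display) (S : measurableType dS) (pr : S -> T) x y :
  (forall r, cmeas (fun w => g (r, c) (pr w))) -> cmeas (fun w => colZ (pr w) x y).
Proof.
move=> mg; apply: (eq_cmeas (f := fun w => sc%:C * (g (swap_index x y, c) (pr w) *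
    Num.conj (g (swap_index y x, c) (pr w)) + - (x == y)%:R))).
  by move=> w; rewrite colZE.
apply: cmeasM; first exact: cmeas_cst.
apply: cmeasD; last exact: cmeas_cst.
by apply: cmeasM => //; exact: cmeas_conj.
Qed.

Let mg e : cmeas (g e). Proof. exact: (eo_meas (gok e)). Qed.
Let mgc e : cmeas (fun w => Num.conj (g e w)). Proof. exact: cmeas_conj. Qed.

Let gg x y w := g (swap_index x y, c) w * Num.conj (g (swap_index y x, c) w).

Let citg_gg x y : citg P (gg x y).
Proof.
by apply: (citg_word2 gok (a := (swap_index x y, c)) (b := (swap_index y x, c))) => // w;
  rewrite nsq_conj.
Qed.

Let citg_gggg x y a b : citg P (fun w => gg x y w * gg a b w).
Proof.
by apply: (citg_word4 gok (a := (swap_index x y, c)) (b := (swap_index y x, c))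
  (c := (swap_index a b, c)) (e := (swap_index b a, c))) => // w; rewrite nsq_conj.
Qed.

Let ExC_gg x y : ExC P (gg x y) = (x == y)%:R.
Proof. by rewrite /gg (wick2 gok gind) xpair_eqE eqxx andbT swap_index_diag. Qed.

Let ExC_gggg x y a b : ExC P (fun w => gg x y w * gg a b w) =
  ((x == y) && (a == b))%:R + ((x == b) && (y == a))%:R + kap%:C * ((x == a) && (y == b))%:R.
Proof.
rewrite /gg (wick4 gok gind kap2) !xpair_eqE eqxx !andbT !swap_index_diag.
by rewrite !swap_index_eq2.
Qed.

Lemma citg_colZ x y : citg P (fun w => colZ w x y).
Proof.
apply: (eq_citg (f := fun w => sc%:C * (gg x y w + - (x == y)%:R))).
  by move=> w; rewrite colZE.
by apply: citgZ; apply: citgD => //; exact: citg_cst.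
Qed.

Lemma ExC_colZ x y : ExC P (fun w => colZ w x y) = 0.
Proof.
rewrite (eq_ExC P (g := fun w => sc%:C * (gg x y w + - (x == y)%:R))); last first.
  by move=> w; rewrite colZE.
rewrite ExCZ; last by apply: citgD => //; exact: citg_cst.
rewrite ExCD //; last exact: citg_cst.
by rewrite ExC_gg ExC_cst subrr mulr0.
Qed.

Let colZZE w x y a b : colZ w x y * colZ w a b = (sc ^+ 2)%:C * (gg x y w * gg a b w +
  (- (a == b)%:R) * gg x y w + (- (x == y)%:R) * gg a b w + (x == y)%:R * (a == b)%:R).
Proof. by rewrite !colZE /gg rmorphXn /=; ring. Qed.

Let citg_colZZ_aux x y a b : citg P (fun w => gg x y w * gg a b w +
  (- (a == b)%:R) * gg x y w + (- (x == y)%:R) * gg a b w).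
Proof. by apply: citgD; [apply: citgD => //|]; exact: citgZ. Qed.

Lemma citg_colZZ x y a b : citg P (fun w => colZ w x y * colZ w a b).
Proof.
apply: (eq_citg (f := fun w => (sc ^+ 2)%:C * (gg x y w * gg a b w +
  (- (a == b)%:R) * gg x y w + (- (x == y)%:R) * gg a b w + (x == y)%:R * (a == b)%:R))).
  by move=> w; rewrite colZZE.
apply: citgZ; apply: citgD; last exact: citg_cst; exact: citg_colZZ_aux.
Qed.

(** Of the three Wick pairings one is removed by centring and, by [swap_index_eq2], the other two
    become the deltas of a Wigner matrix: GUE for [kap] = 0, GOE for [kap] = 1. The semicircle law
    originates here. *)
Lemma ExC_colZZ x y a b : ExC P (fun w => colZ w x y * colZ w a b) =
  (sc ^+ 2)%:C * (((x == b) && (y == a))%:R + kap%:C * ((x == a) && (y == b))%:R).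
Proof.
rewrite (eq_ExC P (g := fun w => (sc ^+ 2)%:C * (gg x y w * gg a b w +
  (- (a == b)%:R) * gg x y w + (- (x == y)%:R) * gg a b w + (x == y)%:R * (a == b)%:R)));
  last by move=> w; rewrite colZZE.
rewrite ExCZ; last first.
  apply: citgD; last exact: citg_cst; exact: citg_colZZ_aux.
rewrite ExCD; [|exact: citg_colZZ_aux|exact: citg_cst].
rewrite ExCD; [|by apply: citgD => //; exact: citgZ|exact: citgZ].
rewrite ExCD; [|by []|exact: citgZ].
rewrite (ExCZ _ (citg_gg x y)) (ExCZ _ (citg_gg a b)) ExC_gggg !ExC_gg ExC_cst -!mulnb !natrM; ring.
Qed.

Section Traces.
Variables (M M' : 'M[C]_(d * d)).

Let trE w : \tr (M * colZ w) = \sum_x \sum_y M x y * colZ w y x.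
Proof. by apply: eq_bigr => x _; rewrite mxE. Qed.

Lemma citg_trZ : citg P (fun w => \tr (M * colZ w)).
Proof.
apply: (eq_citg (f := fun w => \sum_x \sum_y M x y * colZ w y x)); first by move=> w; rewrite trE.
by apply: citg_sum => x _; apply: citg_sum => y _; apply: citgZ; exact: citg_colZ.
Qed.

Lemma ExC_trZ : ExC P (fun w => \tr (M * colZ w)) = 0.
Proof.
rewrite (eq_ExC P (g := fun w => \sum_x \sum_y M x y * colZ w y x)); last by move=> w; rewrite trE.
rewrite ExC_sum; last by move=> x _; apply: citg_sum => y _; apply: citgZ; exact: citg_colZ.
rewrite big1 // => x _; rewrite ExC_sum; last by move=> y _; apply: citgZ; exact: citg_colZ.
by rewrite big1 // => y _; rewrite ExCZ ?ExC_colZ ?mulr0 //; exact: citg_colZ.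
Qed.

Let quad (K : I -> I -> I -> I -> C) w :=
  \sum_x \sum_y \sum_a \sum_b K x y a b * (colZ w y x * colZ w b a).

Let citg_quad K : citg P (quad K).
Proof.
by apply: citg_sum => x _; apply: citg_sum => y _; apply: citg_sum => a _; apply: citg_sum => b _;
  apply: citgZ; exact: citg_colZZ.
Qed.

Let ExC_quad K : ExC P (quad K) = (sc ^+ 2)%:C * (\sum_x \sum_y K x y y x + kap%:C * \sum_x \sum_y K x y x y).
Proof.
have i1 x y a b : citg P (fun w => K x y a b * (colZ w y x * colZ w b a)).
  by apply: citgZ; exact: citg_colZZ.
have i2 x y a : citg P (fun w => \sum_b K x y a b * (colZ w y x * colZ w b a)).
  by apply: citg_sum => b _; exact: i1.
have i3 x y : citg P (fun w => \sum_a \sum_b K x y a b * (colZ w y x * colZ w b a)).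
  by apply: citg_sum => a _; exact: i2.
rewrite /quad ExC_sum; last by move=> x _; apply: citg_sum => y _; exact: i3.
rewrite !mulr_sumr -big_split mulr_sumr; apply: eq_bigr => x _ /=.
rewrite ExC_sum; last by move=> y _; exact: i3.
rewrite mulr_sumr -big_split mulr_sumr; apply: eq_bigr => y _ /=.
rewrite ExC_sum; last by move=> a _; exact: i2.
pose v a b := (sc ^+ 2)%:C * (((y == a) && (x == b))%:R * K x y a b +
   kap%:C * (((y == b) && (x == a))%:R * K x y a b)).
transitivity (\sum_a \sum_b v a b).
  apply: eq_bigr => a _; rewrite ExC_sum; last by move=> b _; exact: i1.
  apply: eq_bigr => b _; rewrite ExCZ ?ExC_colZZ; last exact: citg_colZZ.
  by rewrite /v; ring.
have delta (x0 y0 : I) (f : I -> I -> C) :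
    \sum_a \sum_b ((x0 == a) && (y0 == b))%:R * f a b = f x0 y0.
  rewrite (bigD1 x0) //= [X in _ + X]big1 ?addr0; last first.
    by move=> a ax; apply: big1 => b _; rewrite eq_sym (negPf ax) mul0r.
  rewrite (bigD1 y0) //= big1 ?addr0 ?eqxx ?mul1r // => b by0.
  by rewrite [y0 == b]eq_sym (negPf by0) andbF mul0r.
rewrite /v; under eq_bigr do rewrite -mulr_sumr big_split /=.
rewrite -mulr_sumr big_split /= delta; congr (_ * (_ + _)).
under eq_bigr do rewrite -mulr_sumr.
rewrite -mulr_sumr exchange_big /= ; congr (_ * _).
exact: (delta y x (fun a b => K x y b a)).
Qed.

Lemma trZZ : citg P (fun w => \tr (M * colZ w * M' * colZ w)) /\
  ExC P (fun w => \tr (M * colZ w * M' * colZ w)) =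
  (sc ^+ 2)%:C * (\tr M * \tr M' + kap%:C * \tr (M *m M'^T)).
Proof.
pose K x y a b : C := M x b * M' a y.
have E w : quad K w = \tr (M * colZ w * M' * colZ w).
  apply: eq_bigr => x _; rewrite [RHS]mxE; apply: eq_bigr => y _.
  rewrite [(_ * M') x y]mxE mulr_suml; apply: eq_bigr => a _.
  by rewrite [(M * colZ w) x a]mxE !mulr_suml; apply: eq_bigr => b _; rewrite /K; ring.
split; first by apply: (eq_citg (f := quad K)).
rewrite -(eq_ExC P E) ExC_quad; congr (_ * (_ + _ * _)).
  by rewrite /mxtrace mulr_suml; apply: eq_bigr => x _; rewrite mulr_sumr.
by apply: eq_bigr => x _; rewrite mxE; apply: eq_bigr => y _; rewrite mxE.
Qed.

Lemma trZ_sqr : citg P (fun w => \tr (M * colZ w) ^+ 2) /\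
  ExC P (fun w => \tr (M * colZ w) ^+ 2) =
  (sc ^+ 2)%:C * (\tr (M * M) + kap%:C * \tr (M *m M^T)).
Proof.
pose K x y a b : C := M x y * M a b.
have E w : quad K w = \tr (M * colZ w) ^+ 2.
  rewrite expr2 trE mulr_suml; apply: eq_bigr => x _; rewrite mulr_suml; apply: eq_bigr => y _.
  rewrite mulr_sumr; apply: eq_bigr => a _; rewrite mulr_sumr; apply: eq_bigr => b _.
  by rewrite /K; ring.
split; first by apply: (eq_citg (f := quad K)).
rewrite -(eq_ExC P E) ExC_quad; congr (_ * (_ + _ * _)).
  by apply: eq_bigr => x _; rewrite mxE.
by apply: eq_bigr => x _; rewrite mxE; apply: eq_bigr => y _; rewrite mxE.
Qed.
End Traces.

Lemma colZ_opb w (tau : R) : (0 < d)%N -> 0 <= tau -> netb g c tau w ->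
  opb (`|sc| * (16 * tau ^+ 2 + 1))%:C (colZ w).
Proof.
move=> d0 tau0 /(netb_opb tau0 d0) H; rewrite rmorphM /= -norm_realc.
apply: opbZ; rewrite rmorphD; apply: opbD; first exact: H.
by apply: opbN; exact: opb1.
Qed.

Definition trZ2 w : R := complex.Re (\tr (colZ w * colZ w)).

Lemma trZ2E w : trZ2 w = \sum_x \sum_y nsq (colZ w x y).
Proof.
rewrite /trZ2; have -> : \tr (colZ w * colZ w) = (\sum_x \sum_y nsq (colZ w x y))%:C.
  rewrite rmorph_sum; apply: eq_bigr => x _; rewrite mxE rmorph_sum; apply: eq_bigr => y _ /=.
  by rewrite -mul_conjC_nsq; congr (_ * _); rewrite -[in LHS](colZ_herm w) mxE mxE.
by [].
Qed.

Lemma trZ2_ge0 w : 0 <= trZ2 w.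
Proof. by rewrite trZ2E; apply: sumr_ge0 => x _; apply: sumr_ge0 => y _; exact: nsq_ge0. Qed.

Lemma nsqB_le (a b : C) : nsq (a - b) <= 2 * (nsq a + nsq b).
Proof.
case: a b => [a1 a2] [b1 b2]; rewrite /nsq /=.
have : 0 <= (a1 + b1) ^+ 2 + (a2 + b2) ^+ 2 by rewrite addr_ge0 ?sqr_ge0.
by rewrite !expr2; lra.
Qed.

Let G w := \sum_x \sum_y (nsq (g (swap_index x y, c) w) ^+ 2 +
  nsq (g (swap_index y x, c) w) ^+ 2 + 1).

Let trZ2_le w : trZ2 w <= 2 * sc ^+ 2 * G w.
Proof.
rewrite trZ2E /G mulr_sumr; apply: ler_sum => x _; rewrite mulr_sumr; apply: ler_sum => y _.
rewrite colZE nsqM.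
have -> : nsq sc%:C = sc ^+ 2 by rewrite /nsq /= expr0n addr0.
rewrite -mulrA mulrCA; apply: ler_wpM2l; first exact: sqr_ge0.
apply: le_trans (nsqB_le _ _) _; rewrite ler_pM2l // nsqM nsq_conj.
apply: lerD.
  set a := nsq _; set b := nsq _; have : 0 <= (a - b) ^+ 2 by exact: sqr_ge0.
  have : 0 <= (a + b) ^+ 2 by exact: sqr_ge0.
  by rewrite !expr2; lra.
by case: (x == y); rewrite /nsq /= ?expr1n ?expr0n /= ?addr0.
Qed.

(** On the complement of [b] each |z|^4 is at most (L + |z|^8 / L) / 2. Only the probability [pi]
    and the eighth moment are needed, and the free parameter [L] will be chosen so that both parts
    are small. *)
Lemma trZ2_trunc (b : T -> bool) (pi L : R) : measurable_fun setT b -> 0 < L ->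
  Ex P (fun w => (~~ b w)%:R) <= pi ->
  [/\ itg P (fun w => (~~ b w)%:R * trZ2 w),
      itg P (fun w => (~~ b w)%:R) &
      Ex P (fun w => (~~ b w)%:R * trZ2 w) <=
      2 * sc ^+ 2 * (d%:R ^+ 4 * (L * pi + 24 * 2 ^+ 10 / L + pi))].
Proof.
move=> mb L0 hpi.
have mbR : measurable_fun setT (fun w => (~~ b w)%:R : R).
  rewrite (_ : (fun w => _) = (fun w => if b w then 0 else 1)); last first.
    by apply/funext => w; case: (b w).
  exact: measurable_fun_ifT.
have Ib : itg P (fun w => (~~ b w)%:R : R).
  by apply: (itg_le mbR _ (itg_cst P 1)) => w; case: (b w); rewrite ?normr0 ?normr1.
pose q e w := 2^-1 * (L * (~~ b w)%:R + L^-1 * nsq (g e w) ^+ 4).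
have Iq e : itg P (q e).
  by apply: itgZ; apply: itgD; apply: itgZ => //; exact: (eo_itg (gok e)).
have Eq e : Ex P (q e) <= 2^-1 * (L * pi + 24 * 2 ^+ 10 / L).
  rewrite /q ExZ; last by apply: itgD; apply: itgZ => //; exact: (eo_itg (gok e)).
  rewrite ler_pM2l ?invr_gt0 // ExD; [|exact: itgZ|by apply: itgZ; exact: (eo_itg (gok e))].
  rewrite !ExZ //; last exact: (eo_itg (gok e)).
  apply: lerD; first by rewrite ler_pM2l.
  by rewrite mulrC ler_pM2r ?invr_gt0 //; exact: (eo_8 (gok e)).
have q_le e w : (~~ b w)%:R * nsq (g e w) ^+ 2 <= q e w.
  rewrite /q; case: (b w) => /=.
    by rewrite mul0r mulr0 add0r !mulr_ge0 ?invr_ge0 ?exprn_ge0 ?nsq_ge0 // ltW.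
  rewrite mul1r mulr1; set a := nsq _; have : 0 <= L^-1 * (L - a ^+ 2) ^+ 2.
    by rewrite mulr_ge0 ?sqr_ge0 // invr_ge0 ltW.
  have -> : L^-1 * (L - a ^+ 2) ^+ 2 = L - 2 * a ^+ 2 + L^-1 * a ^+ 4.
    by field; rewrite gt_eqF.
  by set z := a ^+ 2; set t := L^-1 * _; lra.
pose H w := \sum_(x : I) \sum_(y : I) (q (swap_index x y, c) w + q (swap_index y x, c) w + (~~ b w)%:R).
have IH1 x y : itg P (fun w => q (swap_index x y, c) w + q (swap_index y x, c) w + (~~ b w)%:R).
  by apply: itgD => //; exact: itgD.
have IH2 x : itg P (fun w => \sum_(y : I) (q (swap_index x y, c) w + q (swap_index y x, c) w + (~~ b w)%:R)).
  by apply: itg_sum => y _; exact: IH1.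
have IH : itg P H by apply: itg_sum => x _; exact: IH2.
have EH : Ex P H <= d%:R ^+ 4 * (L * pi + 24 * 2 ^+ 10 / L + pi).
  rewrite /H Ex_sum //; apply: (@le_trans _ _ (\sum_(x : I) \sum_(y : I) (L * pi + 24 * 2 ^+ 10 / L + pi))).
    apply: ler_sum => x _; rewrite Ex_sum //; apply: ler_sum => y _.
    rewrite ExD //; last exact: itgD.
    rewrite ExD //; apply: lerD => //.
    apply: le_trans (lerD (Eq _) (Eq _)) _.
    by set z := L * pi + _; rewrite (_ : 2^-1 * z + 2^-1 * z = z) //; lra.
  rewrite !sumr_const card_ord -mulrnA -[X in X <= _]mulr_natl.
  by rewrite (_ : (d * d * (d * d))%:R = d%:R ^+ 4) // -natrX !expnS expn0 muln1 !mulnA.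
have bnd w : (~~ b w)%:R * trZ2 w <= 2 * sc ^+ 2 * H w.
  apply: (@le_trans _ _ ((~~ b w)%:R * (2 * sc ^+ 2 * G w))).
    by apply: ler_wpM2l; [case: (b w) | exact: trZ2_le].
  rewrite mulrCA; apply: ler_wpM2l; first by rewrite mulr_ge0 ?sqr_ge0.
  rewrite /G /H mulr_sumr; apply: ler_sum => x _; rewrite mulr_sumr; apply: ler_sum => y _.
  by rewrite !mulrDr mulr1; apply: lerD => //; apply: lerD; exact: q_le.
have mtr : measurable_fun setT trZ2.
  rewrite (_ : trZ2 = (fun w => \sum_x \sum_y nsq (colZ w x y))); last first.
    by apply/funext => w; exact: trZ2E.
  apply: measurable_sum => x; apply: measurable_sum => y; apply: measurable_nsq.
  by apply: (cmeas_colZ (pr := id)) => r; exact: mg.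
have Itr : itg P (fun w => (~~ b w)%:R * trZ2 w).
  apply: (itg_le _ _ (itgZ (2 * sc ^+ 2) IH)); first exact: measurable_funM.
  move=> w; rewrite ger0_norm ?bnd //; apply: mulr_ge0; [by case: (b w)|exact: trZ2_ge0].
split=> //; apply: le_trans (Ex_le Itr (itgZ (2 * sc ^+ 2) IH) bnd) _.
by rewrite ExZ //; apply: ler_wpM2l => //; rewrite mulr_ge0 ?sqr_ge0.
Qed.
End ColumnMatrix.

Lemma trmxC_scalar (R : rcfType) n (a : R) : ((a%:C)%:M : 'M[R[i]]_n)^t* = (a%:C)%:M.
Proof. by rewrite tr_scalar_mx map_scalar_mx /= conjC_realc. Qed.

Lemma trmxC_sub (C : numClosedFieldType) m n (A B : 'M[C]_(m, n)) : (A - B)^t* = A^t* - B^t*.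
Proof. by rewrite linearB map_mxB. Qed.

Lemma complexE (R : rcfType) (z : R[i]) : complex.Im z = 0 -> z = (complex.Re z)%:C.
Proof. by case: z => a b /= ->. Qed.

Lemma ler_norm_complexRe (R : rcfType) (z : R[i]) (b : R) : `|z| <= b%:C -> `|complex.Re z| <= b.
Proof. by move=> h; rewrite -lecR; apply: le_trans h; exact: normc_ge_Re. Qed.

Lemma complex_ge0_Re (R : rcfType) (z : R[i]) : 0 <= z -> 0 <= complex.Re z.
Proof. by rewrite lecE => /andP[]. Qed.

Lemma drift_exponents q i k : (k < i)%N -> (i < q)%N -> [/\ (q + 1 - i + k + (i + 1 - k) = q.+2)%N,
  (q + 1 - i + k = 2 + (q - 1 - i + k))%N, (i + 1 - k = 2 + (i - 1 - k))%N &
  (q = 2 + ((q - 1 - i + k) + (i - 1 - k)))%N].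
Proof. by move=> ki iq; split; lia. Qed.

(** * One-step drift of resolvent traces under a random increment with Wigner covariance *)

Section Drift.
Context {R : realType} {dT : measure_display} {T : measurableType dT}.
Local Notation C := R[i].
Variables (P : probability T R) (n : nat) (Z : T -> 'M[C]_n) (N : T -> bool).
Variables (kap p nu kz phi K u : R).
Hypotheses (n0 : (0 < n)%N) (p1 : 1 <= p) (phi0 : 0 <= phi) (phi1 : phi <= 1).
Hypotheses (kap0 : 0 <= kap) (kap1 : kap <= 1) (K1 : 1 <= K) (kz0 : 0 <= kz).
Hypothesis hZ : forall w, (Z w)^t* = Z w.
Hypothesis mN : measurable_fun setT N.
Hypothesis EZ : forall M, citg P (fun w => \tr (M * Z w)) /\ ExC P (fun w => \tr (M * Z w)) = 0.
Hypothesis EZZ : forall M M', citg P (fun w => \tr (M * Z w * M' * Z w)) /\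
  ExC P (fun w => \tr (M * Z w * M' * Z w)) =
  ((p * n%:R)^-1)%:C * (\tr M * \tr M' + kap%:C * \tr (M *m M'^T)).
Hypothesis EZ2 : forall M, citg P (fun w => \tr (M * Z w) ^+ 2) /\
  ExC P (fun w => \tr (M * Z w) ^+ 2) =
  ((p * n%:R)^-1)%:C * (\tr (M * M) + kap%:C * \tr (M *m M^T)).
Hypothesis NZ : forall w, N w -> opb kz%:C (Z w).
Local Notation trz w := (complex.Re (\tr (Z w * Z w))).
Hypothesis Itrz : itg P (fun w => (~~ N w)%:R * trz w).
Hypothesis IN : itg P (fun w => (~~ N w)%:R).
Hypothesis Etrz : Ex P (fun w => (~~ N w)%:R * trz w) <= nu.
Hypothesis EN : Ex P (fun w => (~~ N w)%:R) <= nu.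

Variables (S Pm : 'M[C]_n) (l : 'I_n -> R).
Hypothesis hS : hermd S Pm l.
Hypothesis hl : forall i, 0 < u - l i.
Hypothesis hK : forall i, (u - l i)^-1 <= K.

Let a := phi / p.
Let kw := kz + a.
Let e := 2 * K * kw.
Hypothesis e1 : e <= 1.

Let p0 : 0 < p. Proof. exact: lt_le_trans p1. Qed.
Let a0 : 0 <= a. Proof. by rewrite divr_ge0 // ltW. Qed.
Let a1 : a <= 1. Proof. by rewrite ler_pdivrMr // mul1r (le_trans phi1). Qed.
Let nR : 0 < n%:R :> R. Proof. by rewrite ltr0n. Qed.
Let nn0 : (n%:R : R) != 0. Proof. by rewrite gt_eqF. Qed.
Let K0 : 0 <= K. Proof. exact: le_trans K1. Qed.
Let kw0 : 0 <= kw. Proof. by rewrite addr_ge0. Qed.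
Let e0 : 0 <= e. Proof. by rewrite !mulr_ge0. Qed.
Let nu0 : 0 <= nu.
Proof. by apply: le_trans EN; apply: Ex_ge0 => w; case: (N w). Qed.

Let r i := (u - l i)^-1.
Let r0 i : 0 <= r i. Proof. by rewrite invr_ge0 ltW. Qed.
Let A := invmx (u%:C%:M - S).
Let hA : hermd A Pm r.
Proof.
have ul i : u != l i by rewrite -subr_eq0 gt_eqF.
by have [] := hermd_resolvent hS ul.
Qed.
Let hA' : A^t* = A. Proof. exact: hermd_herm hA. Qed.

Definition driftW (w : T) : 'M[C]_n := Z w - (a%:C)%:M.
Definition nextR (w : T) : 'M[C]_n := invmx ((u + a)%:C%:M - (S + Z w)).
Let W := driftW.
Let B := nextR.

(** Normalised trace of the q-th power of the resolvent. [Xq'] is the same quantity after [Z w] has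
    been added and the barrier has advanced by a = phi / p. *)
Definition Xq q : R := psum r q / n%:R.
Definition Xq' q w : R := complex.Re (\tr (B w ^+ q)) / n%:R.

Let hW w : (W w)^t* = W w.
Proof. by rewrite trmxC_sub hZ trmxC_scalar. Qed.

Let oW w : N w -> opb kw%:C (W w).
Proof.
move=> Nw; rewrite rmorphD; apply: opbD; first exact: NZ.
apply: opbN; have := opb_scalar n (a%:C); apply: opb_le.
by rewrite norm_realc ger0_norm.
Qed.

Let Xq_ge0 q : 0 <= Xq q.
Proof. by rewrite divr_ge0 ?psum_ge0 // ltW. Qed.

Let XqS q : Xq q.+1 <= K * Xq q.
Proof. by rewrite mulrA ler_pM2r ?invr_gt0 //; apply: psumS_le. Qed.

(** The trace of A^b W A^c W, written in the eigenbasis of [A] so that its sign is visible. [Lq] and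
    [Qq] are the parts of the expansion of [Xq' q] that are linear and quadratic in [W]. *)
Definition D2 (b c : nat) w : R := \sum_i \sum_j r i ^+ b * r j ^+ c * nsq (emx Pm (W w) i j).
Definition Lq q w : R := q%:R * complex.Re (\tr (A ^+ q.+1 * W w)) / n%:R.
Definition Qq q w : R := (q%:R * D2 q.+1 1 w +
  \sum_(i < q) \sum_(k < i) D2 (q + 1 - i + k) (i + 1 - k) w) / n%:R.

Lemma D2_ge0 b c w : 0 <= D2 b c w.
Proof. exact: herm_tr2_ge0. Qed.

Lemma D2E b c w : \tr (A ^+ b * W w * A ^+ c * W w) = (D2 b c w)%:C.
Proof. exact: (herm_tr2 hA). Qed.

Lemma Qq_ge0 q w : 0 <= Qq q w.
Proof.
apply: divr_ge0; last exact: ltW.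
apply: addr_ge0; first by rewrite mulr_ge0 // D2_ge0.
by apply: sumr_ge0 => i _; apply: sumr_ge0 => k _; exact: D2_ge0.
Qed.

                                                                                    
                           
Let count_le q (f : nat -> nat -> R) (m : R) : 0 <= m ->
  (forall i k, (k < i)%N -> (i < q)%N -> f i k <= m) ->
  q%:R * m + \sum_(i < q) \sum_(k < i) f i k <= q%:R ^+ 2 * (2 * m).
Proof.
move=> m0 H; have : \sum_(i < q) \sum_(k < i) f i k <= \sum_(i < q) \sum_(k < q) m.
  apply: ler_sum => i _; rewrite (big_ord_widen q (fun k => f i k)) ?(ltnW (ltn_ord i)) //.
  rewrite big_mkcond; apply: ler_sum => k _; case: ifP => // ki; exact: H.
rewrite !sumr_const !card_ord -mulrnA -[X in _ <= X -> _]mulr_natl natrM => h.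
have : q%:R * m <= q%:R * q%:R * m.
  apply: ler_wpM2r => //; rewrite -natrM ler_nat; case: (q) => // k; exact: leq_pmull.
rewrite expr2; move: h; set s := \sum_(i < q) _; set x := q%:R * q%:R; set y := q%:R * m.
by rewrite mulrCA; set z := x * m; lra.
Qed.

Lemma Qq_le q w : N w -> Qq q w <= q%:R ^+ 2 * (4 * kw ^+ 2) * Xq q.+2.
Proof.
move=> Nw; rewrite /Qq ler_pdivrMr // /Xq -!mulrA mulVf // mulr1.
have DD b c : (b + c = q.+2)%N -> D2 b c w <= 2 * kw ^+ 2 * psum r q.+2.
  by move=> <-; apply: (herm_tr2_opb hA) => //; exact: oW.
apply: le_trans (_ : _ <= q%:R * (2 * kw ^+ 2 * psum r q.+2) +
   \sum_(i < q) \sum_(k < i) D2 (q + 1 - i + k) (i + 1 - k) w) _.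
  by rewrite lerD2r ler_wpM2l // DD // addn1.
rewrite [X in _ <= X](_ : _ = q%:R ^+ 2 * (2 * (2 * kw ^+ 2 * psum r q.+2))); last by ring.
apply: (count_le (f := fun i k => D2 (q + 1 - i + k) (i + 1 - k) w)).
  by rewrite !mulr_ge0 ?psum_ge0 ?sqr_ge0.
by move=> i k ki iq; apply: DD; have [] := drift_exponents ki iq.
Qed.

Let trA q : \tr (A ^+ q) = (psum r q)%:C. Proof. exact: (hermd_tr hA). Qed.

Let mainE q w : resolvent_main A (W w) q = (n%:R * (Xq q + Lq q w + Qq q w))%:C.
Proof.
have -> : n%:R * (Xq q + Lq q w + Qq q w) = psum r q + q%:R * complex.Re (\tr (A ^+ q.+1 * W w)) +
    q%:R * D2 q.+1 1 w + \sum_(i < q) \sum_(k < i) D2 (q + 1 - i + k) (i + 1 - k) w.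
  rewrite /Xq /Lq /Qq; set s := \sum_(i < q) _; set t := complex.Re _; set v := D2 _ _ _.
  by field.
rewrite /resolvent_main trA (complexE (herm_tr1_real hA _ (hW w))).
have := D2E q.+1 1 w; rewrite expr1 => ->.
rewrite !rmorphD !rmorphM !rmorph_nat /=; congr (_ + _).
rewrite rmorph_sum; apply: eq_bigr => i _; rewrite rmorph_sum; apply: eq_bigr => k _.
by rewrite D2E.
Qed.

Let stepN w : N w -> [/\ exists P' l', hermd (S + Z w) P' l' /\ (forall i, 0 < u + a - l' i),
      B w = A + B w * W w * A, opb K%:C A & opb (2 * K)%:C (B w)].
Proof.
move=> Nw; have := @resolvent_step R n S (W w) (S + Z w) u (u + a) K kw Pm l hS hl hK.
move=> /(_ (lt_le_trans ltr01 K1) (hW w) (oW Nw) e1); apply.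
rewrite /W /driftW rmorphD raddfD /= !opprD opprK !addrA [RHS]addrAC; congr (_ - _).
by rewrite [RHS]addrAC.
Qed.

Let hB w : N w -> (B w)^t* = B w.
Proof.
move=> /stepN[[P' [l' [h' h0]]] _ _ _].
have ul i : u + a != l' i by rewrite -subr_eq0 gt_eqF.
by have [_ /hermd_herm] := hermd_resolvent h' ul.
Qed.

Lemma nextR_pos w : N w -> exists P' l', hermd (S + Z w) P' l' /\ (forall i, 0 < u + a - l' i).
Proof. by move=> /stepN[]. Qed.

Let eC : e%:C = 2 * K%:C * kw%:C. Proof. by rewrite /e !rmorphM rmorph_nat. Qed.
Let eC1 : e%:C <= 1. Proof. by rewrite -[1]/((1 : R)%:C) lecR. Qed.
Let KC : (2 * K)%:C = 2 * K%:C. Proof. by rewrite rmorphM rmorph_nat. Qed.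

Let expand_aux q w (b : R) : `|\tr (B w ^+ q) - resolvent_main A (W w) q| <= (n%:R * b)%:C ->
  `|Xq' q w - Xq q - Lq q w - Qq q w| <= b.
Proof.
rewrite mainE => /ler_norm_complexRe.
rewrite raddfB /= => h.
have -> : Xq' q w - Xq q - Lq q w - Qq q w =
   n%:R^-1 * (complex.Re (\tr (B w ^+ q)) - n%:R * (Xq q + Lq q w + Qq q w)).
  by rewrite /Xq'; field.
by rewrite normrM ger0_norm ?invr_ge0 ?ler0n // ler_pdivrMl.
Qed.

Lemma expand1 w : N w -> `|Xq' 1 w - Xq 1 - Lq 1 w - Qq 1 w| <= e ^+ 3 * K.
Proof.
move=> Nw; have [_ BE oA oB] := stepN Nw; rewrite KC in oB.
apply: expand_aux; have := resolvent_expand1 BE oA oB (oW Nw) eC.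
rewrite expr1 => /le_trans; apply; rewrite -(rmorph_nat (real_complex R) n) -rmorphXn -!rmorphM /= lecR.
by rewrite mulrC.
Qed.

Definition expand_const q : R := q%:R + 2 * q%:R ^+ 2 + 2 ^+ q * q%:R ^+ 3.

Lemma expandQ j q w : q = (2 ^ j.+1)%N -> N w ->
  `|Xq' q w - Xq q - Lq q w - Qq q w| <= expand_const q * e ^+ 3 * Xq q.
Proof.
move=> qE Nw; subst q; have [_ BE oA oB] := stepN Nw; rewrite KC in oB.
have h := resolvent_expand hA' (hB Nw) (hW w) BE oA oB (oW Nw) eC eC1 j.
apply: expand_aux; apply: le_trans h _; move: (2 ^ j.+1)%N => q.
have -> : resolvent_const C q = (expand_const q)%:C.
  by rewrite /resolvent_const /expand_const !rmorphD !rmorphM !rmorphXn !rmorph_nat.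
rewrite (trA q) -rmorphXn -!rmorphM /=.
rewrite lecR /Xq; set c := expand_const q; set s := psum r q; set f := e ^+ 3.
by rewrite (_ : n%:R * _ = c * f * s) //; field.
Qed.

Let trW M w : \tr (M * W w) = \tr (M * Z w) - a%:C * \tr M.
Proof.
rewrite /W /driftW mulrBr raddfB /=; congr (_ - _).
by rewrite -mulmxE mul_mx_scalar linearZ.
Qed.

Let Ex_ReZ M : itg P (fun w => complex.Re (\tr (M * Z w))) /\
  Ex P (fun w => complex.Re (\tr (M * Z w))) = 0.
Proof.
have [i1 e2] := EZ M; split; first exact: i1.1.
by have := congr1 (@complex.Re R) e2.
Qed.

Let LqE q w : Lq q w = q%:R / n%:R * complex.Re (\tr (A ^+ q.+1 * Z w)) - q%:R * a * Xq q.+1.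
Proof.
rewrite /Lq trW trA -rmorphM raddfB /= /Xq; set t := complex.Re _.
by set z := psum r _; field.
Qed.

Lemma Ex_Lq q : itg P (Lq q) /\ Ex P (Lq q) = - (q%:R * a * Xq q.+1).
Proof.
have [i1 e2] := Ex_ReZ (A ^+ q.+1).
have i3 := itgZ (q%:R / n%:R) i1.
split; first by apply: eq_itg (itgB i3 (itg_cst P (q%:R * a * Xq q.+1))) => w; rewrite LqE.
rewrite (eq_Ex P (LqE q)) ExB //; last exact: itg_cst.
by rewrite (ExZ _ i1) e2 mulr0 Ex_cst sub0r.
Qed.

(** Relative error of the mean quadratic terms: the transposed trace, bounded by [herm_trT], and the
    square of the barrier advance. *)
Let delta := 2 / (p * n%:R) + a ^+ 2.

Let D2Z b c w : D2 b c w = complex.Re (\tr (A ^+ b * Z w * A ^+ c * Z w)) -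
  2 * a * complex.Re (\tr (A ^+ (b + c) * Z w)) + a ^+ 2 * psum r (b + c).
Proof.
have := D2E b c w; rewrite trW => /(congr1 (@complex.Re R)) /= <-.
have E1 : A ^+ b * W w * A ^+ c = A ^+ b * Z w * A ^+ c - a%:C *: A ^+ (b + c).
  rewrite /W /driftW mulrBr mulrBl exprD; congr (_ - _).
  by rewrite -!mulmxE mul_mx_scalar scalemxAl.
have E2 : \tr (A ^+ b * W w * A ^+ c) = \tr (A ^+ (b + c) * Z w) - a%:C * \tr (A ^+ (b + c)).
  rewrite E1 raddfB /= linearZ /=; congr (_ - _).
  by rewrite -mulrA mxtrace_mulr -mulrA -exprD mxtrace_mulr addnC.
have E3 : \tr (a%:C *: A ^+ (b + c) * Z w) = a%:C * \tr (A ^+ (b + c) * Z w).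
  by rewrite -!mulmxE -scalemxAl mxtraceZ.
rewrite E2 E1 mulrBl [\tr (_ - _)]raddfB /= E3 trA.
have := herm_tr1_real hA (b + c) (hZ w); set t := \tr (A ^+ (b + c) * Z w) => tI.
have tE := complexE tI; set y := complex.Re t in tE *; set s := psum r _.
rewrite (_ : a%:C * t = (a * y)%:C); last by rewrite tE -rmorphM.
rewrite (_ : a%:C * (t - _) = (a * (y - a * s))%:C); last by rewrite tE -rmorphM -rmorphB -rmorphM.
by rewrite !raddfB /=; set z := complex.Re (\tr _); ring.
Qed.

Lemma Ex_D2 b c : itg P (D2 b c) /\
  (psum r b * psum r c / (p * n%:R) <= Ex P (D2 b c) <=
   psum r b * psum r c / (p * n%:R) + delta * psum r (b + c)).
Proof.
have [i1 e1'] := EZZ (A ^+ b) (A ^+ c); have [i2 e2] := Ex_ReZ (A ^+ (b + c)).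
have [x xE /andP[x0 x2]] := herm_trT hA r0 b c.
have I1 := itgB i1.1 (itgZ (2 * a) i2).
have I2 := itgD I1 (itg_cst P (a ^+ 2 * psum r (b + c))).
split; first by apply: eq_itg I2 => w; rewrite D2Z.
have -> : Ex P (D2 b c) = (p * n%:R)^-1 * (psum r b * psum r c + kap * x) + a ^+ 2 * psum r (b + c).
  rewrite (eq_Ex P (D2Z b c)) (ExD I1 (itg_cst P _)) (ExB i1.1 (itgZ (2 * a) i2)).
  rewrite (ExZ _ i2) e2 mulr0 subr0 Ex_cst; congr (_ + _).
  have := congr1 (@complex.Re R) e1'; rewrite !trA xE -!rmorphM -rmorphD -rmorphM /= => h.
  exact: h.
have pn0 : 0 < p * n%:R by rewrite mulr_gt0.
have s0 := psum_ge0 r0 (b + c).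
have kx : 0 <= kap * x by rewrite mulr_ge0.
have kx2 : kap * x <= 2 * psum r (b + c) by apply: le_trans x2; rewrite ler_piMl.
move: (psum_ge0 r0 b) (psum_ge0 r0 c) kx kx2 s0; set P1 := psum r b; set P2 := psum r c.
set P3 := psum r _; set y := kap * x => _ _ y0 y1 P30.
have i0 : 0 <= (p * n%:R)^-1 by rewrite invr_ge0 ltW.
rewrite [P1 * P2 / _]mulrC mulrDr /delta; apply/andP; split.
  by rewrite -addrA lerDl; apply: addr_ge0; apply: mulr_ge0 => //; exact: sqr_ge0.
rewrite -addrA lerD2l mulrDl lerD2r [2 / _]mulrC -mulrA.
by apply: ler_wpM2l.
Qed.

(** The leading part of the mean of [Qq]. For q = 1 it is X_2 X_1 / p, and with the barrier term -
    phi X_2 / p the drift is X_2 (X_1 - phi) / p. For q = 2 it is (2 X_3 X_1 + X_2^2) / p, leaving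
    X_2^2 / p plus a multiple of X_3 (X_1 - phi). *)
Definition Q0 q : R := (q%:R * (Xq q.+1 * Xq 1) +
  \sum_(i < q) \sum_(k < i) Xq (q + 1 - i + k) * Xq (i + 1 - k)) / p.

Lemma Ex_Qq q : itg P (Qq q) /\ (Q0 q <= Ex P (Qq q) <= Q0 q + q%:R ^+ 2 * (2 * delta) * Xq q.+2).
Proof.
have I2 (i : nat) : itg P (fun w => \sum_(k < i) D2 (q + 1 - i + k) (i + 1 - k) w).
  by apply: itg_sum => k _; exact: (Ex_D2 _ _).1.
have I3 : itg P (fun w => \sum_(i < q) \sum_(k < i) D2 (q + 1 - i + k) (i + 1 - k) w).
  by apply: itg_sum => i _; exact: I2.
have I1 := itgZ q%:R (Ex_D2 q.+1 1).1.
have I4 := itgZ n%:R^-1 (itgD I1 I3).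
have E w : Qq q w = n%:R^-1 * (q%:R * D2 q.+1 1 w +
    \sum_(i < q) \sum_(k < i) D2 (q + 1 - i + k) (i + 1 - k) w) by rewrite mulrC.
split; first by apply: eq_itg I4 => w; rewrite E.
have ES : Ex P (fun w => \sum_(i < q) \sum_(k < i) D2 (q + 1 - i + k) (i + 1 - k) w) =
    \sum_(i < q) \sum_(k < i) Ex P (D2 (q + 1 - i + k) (i + 1 - k)).
  rewrite Ex_sum; last by move=> i _; exact: I2.
  by apply: eq_bigr => i _; rewrite Ex_sum // => k _; exact: (Ex_D2 _ _).1.
rewrite (eq_Ex P E) (ExZ _ (itgD I1 I3)) (ExD I1 I3) (ExZ _ (Ex_D2 q.+1 1).1) ES.
have XX b c : psum r b * psum r c / (p * n%:R) = n%:R * (p^-1 * (Xq b * Xq c)).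
  by rewrite /Xq; field; rewrite nn0 gt_eqF.
have EX b c : n%:R * (p^-1 * (Xq b * Xq c)) <= Ex P (D2 b c) <=
    n%:R * (p^-1 * (Xq b * Xq c) + delta * Xq (b + c)).
  have [_ /andP[h1 h2]] := Ex_D2 b c; rewrite -XX h1 mulrDr -XX /=.
  by rewrite (_ : n%:R * (delta * Xq _) = delta * psum r (b + c)) // /Xq; field.
apply/andP; split.
  rewrite ler_pdivlMl // /Q0 mulrDl mulrDr; apply: lerD.
    have /andP[h _] := EX q.+1 1%N; apply: le_trans (ler_wpM2l (ler0n R q) h).
    by rewrite le_eqVlt; apply/orP; left; apply/eqP; ring.
  rewrite mulr_suml mulr_sumr; apply: ler_sum => i _.
  rewrite mulr_suml mulr_sumr; apply: ler_sum => k _.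
  by have /andP[h _] := EX (q + 1 - i + k)%N (i + 1 - k)%N; rewrite [_ / p]mulrC.
rewrite ler_pdivrMl // /Q0 mulrDl.
pose m := delta * Xq q.+2.
have d0 : 0 <= delta by rewrite addr_ge0 ?sqr_ge0 // divr_ge0 ?mulr_ge0 ?ltW.
have m0 : 0 <= m by rewrite mulr_ge0.
have -> : q%:R ^+ 2 * (2 * delta) * Xq q.+2 = q%:R ^+ 2 * (2 * m) by rewrite /m; ring.
have cnt := count_le (f := fun _ _ => m) m0 (fun i k _ _ => lexx m).
apply: le_trans (_ : _ <= n%:R * (q%:R * (Xq q.+1 * Xq 1) / p +
   (\sum_(i < q) \sum_(k < i) Xq (q + 1 - i + k) * Xq (i + 1 - k)) / p +
   (q%:R * m + \sum_(i < q) \sum_(k < i) m))) _; last first.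
  by rewrite ler_pM2l // lerD2l; exact: cnt.
rewrite addrACA mulrDr; apply: lerD.
  have /andP[_ h] := EX q.+1 1%N; apply: le_trans (ler_wpM2l (ler0n R q) h) _.
  by rewrite addn1 -/m le_eqVlt; apply/orP; left; apply/eqP; ring.
rewrite mulr_suml -big_split mulr_sumr; apply: ler_sum => i _ /=.
rewrite mulr_suml -big_split mulr_sumr; apply: ler_sum => k _ /=.
have /andP[_ h] := EX (q + 1 - i + k)%N (i + 1 - k)%N; apply: le_trans h _.
have [-> _ _ _] := drift_exponents (ltn_ord k) (ltn_ord i).
by rewrite -/m [_ / p]mulrC.
Qed.

(** By [psum_mul_le] every product in the double sum is at most X_2 X_q, so the growth is linear in
    X_q. *)
Lemma Q0_le q : (2 <= q)%N -> Q0 q <= (q%:R * (Xq q.+1 * Xq 1) + q%:R ^+ 2 * (Xq 2 * Xq q)) / p.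
Proof.
move=> q2; rewrite /Q0 ler_pM2r ?invr_gt0 // lerD2l.
have m0 : 0 <= Xq 2 * Xq q by rewrite mulr_ge0.
have : \sum_(i < q) \sum_(k < i) Xq (q + 1 - i + k) * Xq (i + 1 - k) <=
   \sum_(i < q) \sum_(k < q) (Xq 2 * Xq q).
  apply: ler_sum => i _.
  rewrite (big_ord_widen q (fun k => Xq (q + 1 - i + k) * Xq (i + 1 - k))) ?(ltnW (ltn_ord i)) //.
  rewrite big_mkcond; apply: ler_sum => k _; case: ifP => // ki.
  have iq := ltn_ord i; move: ki iq; move: (nat_of_ord i) (nat_of_ord k) => {i k} i k ki iq.
  have [_ -> -> qE] := drift_exponents ki iq.
  have -> : Xq q = Xq (2 + ((q - 1 - i + k) + (i - 1 - k))) by rewrite -qE.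
  rewrite /Xq !mulf_div ler_pM2r ?invr_gt0 ?mulr_gt0 //; exact: psum_mul_le.
by rewrite !sumr_const !card_ord -mulrnA -[X in _ <= X -> _]mulr_natl natrM expr2.
Qed.

(** The fluctuation of the linear part has variance of order 1/(p n^2) times a resolvent power; even
    over [p] steps this adds up to order 1/n^2. *)
Lemma Ex_Lq2 q : itg P (fun w => Lq q w ^+ 2) /\
  Ex P (fun w => Lq q w ^+ 2) <= q%:R ^+ 2 * (3 / (p * n%:R ^+ 2) * Xq (q.+1 + q.+1) + a ^+ 2 * Xq q.+1 ^+ 2).
Proof.
pose t w := complex.Re (\tr (A ^+ q.+1 * Z w)).
have [i1 e1'] := EZ2 (A ^+ q.+1); have [i2 e2] := Ex_ReZ (A ^+ q.+1).
have tt w : t w ^+ 2 = complex.Re (\tr (A ^+ q.+1 * Z w) ^+ 2).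
  by rewrite [in RHS](complexE (herm_tr1_real hA _ (hZ w))) -rmorphXn.
have I1 : itg P (fun w => t w ^+ 2) by apply: eq_itg i1.1 => w; rewrite tt.
have [x xE /andP[x0 x2]] := herm_trT hA r0 q.+1 q.+1.
have Et : Ex P (fun w => t w ^+ 2) = (p * n%:R)^-1 * (psum r (q.+1 + q.+1) + kap * x).
  rewrite (eq_Ex P tt); have := congr1 (@complex.Re R) e1'.
  rewrite -exprD trA xE -!rmorphM -rmorphD -rmorphM /= => h; exact: h.
have E w : Lq q w ^+ 2 = q%:R ^+ 2 * ((n%:R ^+ 2)^-1 * t w ^+ 2 + - (2 * a * Xq q.+1 / n%:R) * t w +
    a ^+ 2 * Xq q.+1 ^+ 2).
  by rewrite LqE -/(t w); field.
have J1 := itgZ (n%:R ^+ 2)^-1 I1.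
have J2 := itgZ (- (2 * a * Xq q.+1 / n%:R)) i2.
have J3 := itgD J1 J2; have J4 := itgD J3 (itg_cst P (a ^+ 2 * Xq q.+1 ^+ 2)).
have J5 := itgZ (q%:R ^+ 2) J4.
split; first by apply: eq_itg J5 => w; rewrite E.
rewrite (eq_Ex P E) ExZ // ler_wpM2l ?sqr_ge0 // ExD //; last exact: itg_cst.
rewrite (ExD J1 J2) (ExZ _ I1) (ExZ _ i2) e2 mulr0 addr0 Ex_cst lerD2r Et.
have kx2 : kap * x <= 2 * psum r (q.+1 + q.+1) by apply: le_trans x2; rewrite ler_piMl.
have -> : 3 / (p * n%:R ^+ 2) * Xq (q.+1 + q.+1) =
   (n%:R ^+ 2)^-1 * ((p * n%:R)^-1 * (3 * psum r (q.+1 + q.+1))).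
  by rewrite /Xq; field; rewrite nn0 gt_eqF.
rewrite ler_pM2l ?invr_gt0 ?exprn_gt0 // ler_pM2l ?invr_gt0 ?mulr_gt0 //.
by move: kx2; set y := kap * x; lra.
Qed.

Let trZ2E w : \tr (Z w * Z w) = (trz w)%:C.
Proof. by rewrite (herm_trW2 hA (hZ w)). Qed.

Let trz0 w : 0 <= trz w.
Proof. by rewrite -ler0c -trZ2E -{2}(hZ w) mxtrace_mulCt_ge0. Qed.

Let mNR : measurable_fun setT (fun w => (~~ N w)%:R : R). Proof. exact: itg_measurable IN. Qed.

Let tr_le m w : `|complex.Re (\tr (A ^+ m * Z w))| <= (1 + trz w) * psum r m.
Proof.
apply: ler_norm_complexRe; apply: (herm_tr1_opb hA) => //.
apply: opb_frob; first by rewrite ler0c addr_ge0.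
rewrite hZ mulmxE trZ2E -rmorphXn lecR expr2; have := trz0 w; set t := trz w => t0.
have tt : 0 <= t * t by rewrite mulr_ge0.
by move: tt t0; lra.
Qed.

Lemma trunc_Lq q : itg P (fun w => (~~ N w)%:R * `|Lq q w|) /\
  Ex P (fun w => (~~ N w)%:R * `|Lq q w|) <= 3 * q%:R * nu * Xq q.+1.
Proof.
pose f w := q%:R * Xq q.+1 * ((~~ N w)%:R * trz w + 2 * (~~ N w)%:R).
have I2 := itgZ 2 IN; have I0 := itgD Itrz I2.
have If : itg P f by exact: itgZ.
have le w : (~~ N w)%:R * `|Lq q w| <= f w.
  have -> : f w = (~~ N w)%:R * (q%:R * ((1 + trz w) * Xq q.+1 + Xq q.+1)) by rewrite /f; ring.
  apply: ler_wpM2l; first by case: (N w).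
  rewrite LqE -mulrA -[q%:R * a * _]mulrA -mulrBr normrM normr_nat ler_wpM2l //.
  apply: le_trans (ler_normB _ _) _; apply: lerD.
    rewrite normrM ger0_norm ?invr_ge0 ?ler0n // /Xq [X in _ <= X]mulrA [X in X <= _]mulrC ler_pM2r ?invr_gt0 //.
  have aX : 0 <= a * Xq q.+1 by apply: mulr_ge0 => //; exact: Xq_ge0.
  by rewrite (ger0_norm aX); apply: ler_piMl => //; exact: Xq_ge0.
have I1 : itg P (fun w => (~~ N w)%:R * `|Lq q w|).
  apply: itg_le If => [|w].
    apply: measurable_funM => //; apply: measurableT_comp => //.
    exact: itg_measurable (Ex_Lq q).1.
  by rewrite ger0_norm // mulr_ge0 //; case: (N w).
split=> //; apply: le_trans (Ex_le I1 If le) _.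
rewrite /f ExZ // [X in _ <= X](_ : _ = q%:R * Xq q.+1 * (nu + 2 * nu)); last by ring.
apply: ler_wpM2l; first by rewrite mulr_ge0.
by rewrite ExD // ExZ //; apply: lerD => //; rewrite ler_pM2l.
Qed.

Lemma trunc_Q1 : itg P (fun w => (~~ N w)%:R * Qq 1 w) /\
  Ex P (fun w => (~~ N w)%:R * Qq 1 w) <= 4 * K ^+ 3 * nu.
Proof.
pose f w := K ^+ 3 * 2 * ((~~ N w)%:R * trz w + (~~ N w)%:R).
have I0 := itgD Itrz IN.
have If : itg P f by exact: itgZ.
have trW2 w : complex.Re (\tr (W w * W w)) <= 2 * trz w + 2 * n%:R.
  have E (x : R) : complex.Re (\tr ((Z w - (x%:C)%:M) * (Z w - (x%:C)%:M))) =
      trz w - 2 * x * complex.Re (\tr (Z w)) + x ^+ 2 * n%:R.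
    have E0 : \tr ((Z w - (x%:C)%:M) * (Z w - (x%:C)%:M)) =
        \tr (Z w * Z w) - x%:C * \tr (Z w) - (x%:C * \tr (Z w) - (x ^+ 2 * n%:R)%:C).
      have tB (M M' : 'M[C]_n) : \tr (M - M') = \tr M - \tr M' by exact: raddfB.
      rewrite mulrBr !mulrBl -!mulmxE !mul_scalar_mx mul_mx_scalar !tB.
      rewrite !mxtraceZ mxtrace_scalar rmorphM rmorphXn rmorph_nat -mulr_natr.
      by move: (\tr (Z w *m Z w)) (\tr (Z w)) => y t; ring.
    have tI : complex.Im (\tr (Z w)) = 0.
      by have := herm_tr1_real hA 0 (hZ w); rewrite expr0 mul1r.
    rewrite E0 (complexE tI) trZ2E -!rmorphM -!rmorphB /=.
    by set z := complex.Re (\tr (Z w)); set v := complex.Re _; ring.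
  have h : 0 <= trz w - 2 * (- a) * complex.Re (\tr (Z w)) + (- a) ^+ 2 * n%:R.
    rewrite -E; set V := Z w - _; have hV : V^t* = V by rewrite trmxC_sub hZ trmxC_scalar.
    by have := mxtrace_mulCt_ge0 V; rewrite hV => /complex_ge0_Re.
  have := E a; rewrite -/(driftW w) -/(W w) => ->.
  have a2 : a ^+ 2 * n%:R <= n%:R by apply: ler_piMl; [exact: ltW | exact: exprn_ile1].
  move: h a2; rewrite sqrrN; set x := a ^+ 2 * _; set y := complex.Re _; lra.
have Q1E w : Qq 1 w = D2 2 1 w / n%:R.
  by rewrite /Qq big_ord_recl !big_ord0 !addr0 mul1r.
have Q1_le w : Qq 1 w <= K ^+ 3 * 2 * (trz w + 1).
  rewrite Q1E ler_pdivrMr //.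
  have h : D2 2 1 w <= K ^+ 3 * complex.Re (\tr (W w * W w)).
    have := herm_tr2_le hA r0 2 1 hK (hW w); rewrite -/(D2 2 1 w) (herm_trW2 hA (hW w)) -rmorphM lecR.
    by move=> h; exact: h.
  apply: le_trans h _.
  rewrite [X in _ <= X](_ : _ = K ^+ 3 * (2 * ((trz w + 1) * n%:R))); last by ring.
  apply: ler_wpM2l; first exact: exprn_ge0.
  apply: le_trans (trW2 w) _; rewrite -mulrDr ler_pM2l // mulrDl mul1r lerD2r ler_peMr //.
  by rewrite ler1n.
have le w : (~~ N w)%:R * Qq 1 w <= f w.
  have -> : f w = (~~ N w)%:R * (K ^+ 3 * 2 * (trz w + 1)) by rewrite /f; ring.
  by apply: ler_wpM2l => //; case: (N w).
have I1 : itg P (fun w => (~~ N w)%:R * Qq 1 w).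
  apply: itg_le If => [|w].
    by apply: measurable_funM => //; exact: itg_measurable (Ex_Qq 1).1.
  by rewrite ger0_norm // mulr_ge0 ?Qq_ge0 //; case: (N w).
split=> //; apply: le_trans (Ex_le I1 If le) _.
rewrite /f (ExZ _ I0) [X in _ <= X](_ : _ = K ^+ 3 * 2 * (nu + nu)); last by ring.
apply: ler_wpM2l; first by rewrite mulr_ge0 // exprn_ge0.
by rewrite (ExD Itrz IN); apply: lerD.
Qed.

Hypothesis mX : forall q, measurable_fun setT (Xq' q).

Let ind w : R := (N w)%:R.
Let ind01 w : 0 <= ind w <= 1. Proof. by rewrite /ind; case: (N w); rewrite ?lexx ler01. Qed.
Let mind : measurable_fun setT ind.
Proof.
rewrite (_ : ind = fun w => if N w then 1 else 0); last by apply/funext => w; rewrite /ind; case: (N w).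
exact: measurable_fun_ifT.
Qed.

Lemma Xq'_bound q w : N w -> `|Xq' q w| <= (2 * K) ^+ q.
Proof.
move=> /stepN[_ _ _ oB]; rewrite /Xq' normrM [`|n%:R^-1|]ger0_norm ?invr_ge0 ?ler0n // ler_pdivrMr //.
apply: ler_norm_complexRe; have := mxtrace_opb1 (opbX q oB) => /le_trans; apply.
by rewrite -rmorphXn -(rmorph_nat (real_complex R) n) -rmorphM /=.
Qed.

Lemma itg_indX q : itg P (fun w => ind w * Xq' q w).
Proof.
apply: itg_le (itg_cst P ((2 * K) ^+ q)) => [|w]; first exact: measurable_funM.
rewrite normrM /ind; case: (boolP (N w)) => [/Xq'_bound h|_]; first by rewrite normr1 mul1r.
by rewrite normr0 mul0r exprn_ge0 // mulr_ge0.
Qed.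

Lemma itg_indX2 q x : itg P (fun w => ind w * (Xq' q w - x) ^+ 2).
Proof.
apply: itg_le (itg_cst P (((2 * K) ^+ q + `|x|) ^+ 2)) => [|w].
  apply: measurable_funM => //; apply: measurable_funX; apply: measurable_funB => //.
rewrite normrM /ind; case: (boolP (N w)) => [/Xq'_bound h|_]; last by rewrite normr0 mul0r sqr_ge0.
rewrite normr1 mul1r normrX lerXn2r ?nnegrE ?addr_ge0 ?exprn_ge0 ?mulr_ge0 //.
by apply: le_trans (ler_normB _ _) _; rewrite lerD2r.
Qed.

Let itg_ind q : itg P (fun w => ind w * (Xq' q w - Xq q)).
Proof.
have I1 : itg P ind.
  apply: itg_le (itg_cst P 1) => // w; have /andP[h1 h2] := ind01 w; by rewrite ger0_norm.
apply: eq_itg (itgB (itg_indX q) (itgZ (Xq q) I1)) => w.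
by rewrite mulrBr [Xq q * _]mulrC.
Qed.

(** The means of [Lq] and [Qq] are known over the whole space, whereas the expansion holds on [N]
    only. Outside [N] the non-negative [Qq] is simply dropped, and [Lq] is paid for by
    [trunc_Lq]. *)
Lemma drift_le q (b : R) : 0 <= b -> (forall w, N w -> `|Xq' q w - Xq q - Lq q w - Qq q w| <= b) ->
  Ex P (fun w => ind w * (Xq' q w - Xq q)) <=
  - (q%:R * a * Xq q.+1) + Q0 q + q%:R ^+ 2 * (2 * delta) * Xq q.+2 + 3 * q%:R * nu * Xq q.+1 + b.
Proof.
move=> b0 H; have [i1 e1'] := Ex_Lq q; have [i2 /andP[_ e2]] := Ex_Qq q; have [i3 e3] := trunc_Lq q.
have I := itgD (itgD i1 i2) (itgD i3 (itg_cst P b)).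
apply: le_trans (Ex_le (itg_ind q) I _) _.
  move=> w; rewrite /ind; case: (boolP (N w)) => [Nw|_] /=.
    rewrite mul1r mul0r add0r; have := ler_norm (Xq' q w - Xq q - Lq q w - Qq q w).
    by have := H w Nw; set x := `|_|; lra.
  rewrite mul0r mul1r; have := Qq_ge0 q w; have := ler_norm (- Lq q w); rewrite normrN.
  by set x := `|_|; lra.
rewrite (ExD (itgD i1 i2) (itgD i3 (itg_cst P b))) (ExD i1 i2) (ExD i3 (itg_cst P b)) Ex_cst e1'.
move: e2 e3; set x := Ex P _; set y := Ex P _; set z := Q0 q; set t := q%:R * a * _.
by set s := 3 * _ * _ * _; set v := _ * _ * Xq q.+2; lra.
Qed.

(** For X_1 the drift must be bounded on both sides, so outside [N] the quadratic part has to be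
    bounded too, by [trunc_Q1]. *)
Lemma drift1 (b : R) : 0 <= b -> (forall w, N w -> `|Xq' 1 w - Xq 1 - Lq 1 w - Qq 1 w| <= b) ->
  `|Ex P (fun w => ind w * (Xq' 1 w - Xq 1))| <=
  Xq 2 * `|Xq 1 - phi| / p + 2 * delta * Xq 3 + 3 * nu * Xq 2 + 4 * K ^+ 3 * nu + b.
Proof.
move=> b0 H; have [i1 e1'] := Ex_Lq 1; have [i2 /andP[e2 e2']] := Ex_Qq 1.
have [i3 e3] := trunc_Lq 1; have [i4 e4] := trunc_Q1.
have I := itgB (itg_ind 1) (itgD i1 i2).
have J := itgD (itgD i3 i4) (itg_cst P b).
have h : `|Ex P (fun w => ind w * (Xq' 1 w - Xq 1)) - Ex P (fun w => Lq 1 w + Qq 1 w)| <=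
    3 * nu * Xq 2 + 4 * K ^+ 3 * nu + b.
  rewrite -(ExB (itg_ind 1) (itgD i1 i2)); apply: le_trans (Ex_norm I) _.
  apply: le_trans (Ex_le (itg_norm I) J _) _.
    move=> w; rewrite /ind; case: (boolP (N w)) => [Nw|_] /=.
      by rewrite mul1r !mul0r !add0r opprD addrA; exact: H.
    rewrite mul0r !mul1r sub0r normrN; apply: le_trans (ler_normD _ _) _.
    by rewrite [`|Qq 1 w|]ger0_norm ?Qq_ge0 // lerDl.
  rewrite (ExD (itgD i3 i4) (itg_cst P b)) (ExD i3 i4) Ex_cst lerD2r; apply: lerD => //.
  by move: e3; rewrite mulr1.
have h2 : `|Ex P (fun w => Lq 1 w + Qq 1 w)| <= Xq 2 * `|Xq 1 - phi| / p + 2 * delta * Xq 3.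
  rewrite (ExD i1 i2) e1'; move: e2 e2'; rewrite /Q0 big_ord_recl !big_ord0 !addr0 expr1n !mul1r.
  have -> : Xq 2 * `|Xq 1 - phi| / p = `|Xq 2 * (Xq 1 - phi) / p|.
    have pi0 : 0 <= p^-1 by rewrite invr_ge0 ltW.
    by rewrite (normrM (Xq 2 * _)) (normrM (Xq 2)) (ger0_norm pi0) (ger0_norm (Xq_ge0 2)).
  have -> : Xq 2 * (Xq 1 - phi) / p = Xq 2 * Xq 1 / p - a * Xq 2 by rewrite /a; ring.
  set x := Ex P _; set y := Xq 2 * Xq 1 / p; set z := a * Xq 2; set t := 2 * delta * _ => h1 h3.
  rewrite (_ : - z + x = (y - z) + (x - y)); last by ring.
  apply: le_trans (ler_normD _ _) _; rewrite lerD2l ger0_norm ?subr_ge0 //.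
  by rewrite lerBlDl.
have := ler_normD (Ex P (fun w => ind w * (Xq' 1 w - Xq 1)) - Ex P (fun w => Lq 1 w + Qq 1 w))
   (Ex P (fun w => Lq 1 w + Qq 1 w)); rewrite subrK => h3.
apply: le_trans h3 _; apply: le_trans (lerD h h2) _.
by rewrite addrC !addrA.
Qed.

Lemma drift_sqr q (b : R) : 0 <= b -> (forall w, N w -> `|Xq' q w - Xq q - Lq q w - Qq q w| <= b) ->
  Ex P (fun w => ind w * (Xq' q w - Xq q) ^+ 2) <=
  3 * (q%:R ^+ 2 * (3 / (p * n%:R ^+ 2) * Xq (q.+1 + q.+1) + a ^+ 2 * Xq q.+1 ^+ 2) +
       (q%:R ^+ 2 * (4 * kw ^+ 2) * Xq q.+2) ^+ 2 + b ^+ 2).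
Proof.
move=> b0 H; have [i1 e1'] := Ex_Lq2 q.
set m := q%:R ^+ 2 * (4 * kw ^+ 2) * Xq q.+2.
have I := itgZ 3 (itgD (itgD i1 (itg_cst P (m ^+ 2))) (itg_cst P (b ^+ 2))).
apply: le_trans (Ex_le (itg_indX2 q (Xq q)) I _) _.
  move=> w; rewrite /ind; case: (boolP (N w)) => [Nw|_] /=; last first.
    by rewrite mul0r mulr_ge0 // !addr_ge0 ?sqr_ge0.
  rewrite mul1r; have := H w Nw; set y := Xq' q w - Xq q - Lq q w - Qq q w => yb.
  have -> : Xq' q w - Xq q = Lq q w + Qq q w + y by rewrite /y; ring.
  have y2 : y ^+ 2 <= b ^+ 2 by rewrite -[y ^+ 2]real_normK ?num_real // lerXn2r ?nnegrE.
  have Q2 : Qq q w ^+ 2 <= m ^+ 2.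
    have Qm := Qq_le q Nw; rewrite lerXn2r ?nnegrE ?Qq_ge0 //; exact: le_trans (Qq_ge0 q w) Qm.
  apply: (@le_trans _ _ (3 * (Lq q w ^+ 2 + Qq q w ^+ 2 + y ^+ 2))); last first.
    by rewrite ler_pM2l //; apply: lerD => //; rewrite lerD2l.
  set x := Lq q w; set z := Qq q w; rewrite -subr_ge0.
  rewrite (_ : _ - _ = (x - z) ^+ 2 + (z - y) ^+ 2 + (x - y) ^+ 2); last by ring.
  by rewrite !addr_ge0 ?sqr_ge0.
rewrite (ExZ _ (itgD (itgD i1 (itg_cst P (m ^+ 2))) (itg_cst P (b ^+ 2)))) ler_pM2l //.
rewrite (ExD (itgD i1 (itg_cst P (m ^+ 2))) (itg_cst P (b ^+ 2))) (ExD i1 (itg_cst P (m ^+ 2))) !Ex_cst.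
by rewrite !lerD2r.
Qed.

(** * The Lyapunov functional and its mean one-step growth *)

Variables (D sD y y' Y : R) (q j : nat).
Hypotheses (qE : q = (2 ^ j.+1)%N) (sD0 : 0 < sD) (DE : D = sD ^+ 2) (KsD : K <= sD).
Hypotheses (y0 : 0 <= y) (yy' : y <= y') (y'Y : y' <= Y) (y'E : y' - y = y * y' / p).
Hypotheses (dK : delta * K ^+ 2 <= p^-1) (nK : nu * K <= p^-1) (e3 : e ^+ 3 <= p^-1).

                                                                                       
                                                                                      
(** The first term pins X_1 to [phi], with a large weight [D]; the second keeps X_2 below the
    comparison value [y]; the third controls the norm of the resolvent through X_q <= n. A value at
    most 1 is the induction hypothesis of the process. *)
Definition lyap : R := D * (Xq 1 - phi) ^+ 2 + Num.max 0 (Xq 2 - y) ^+ 2 + Xq q / n%:R.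
Definition lyap' w : R :=
  D * (Xq' 1 w - phi) ^+ 2 + Num.max 0 (Xq' 2 w - y') ^+ 2 + Xq' q w / n%:R.
Hypothesis lyap1 : lyap <= 1.

Definition lyap_rate : R := 2 * (Y + 1) + 2 * (2 * Y + 1) + (q%:R + q%:R ^+ 2 * (Y + 1) +
  2 * q%:R ^+ 2 + 3 * q%:R + expand_const q).

(** Absolute one-step errors: [err1] and [err2] for the mean increments of X_1 and X_2, the primed
    versions for the mean squared increments. *)
Definition err1 : R := 2 * delta * K ^+ 3 + 3 * nu * K ^+ 2 + 4 * K ^+ 3 * nu + e ^+ 3 * K.
Definition err1' : R := 3 * ((3 / (p * n%:R ^+ 2) * K ^+ 4 + a ^+ 2 * K ^+ 4) +
  (4 * kw ^+ 2 * K ^+ 3) ^+ 2 + (e ^+ 3 * K) ^+ 2).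
Definition rem2 : R := expand_const 2 * e ^+ 3 * (Y + 1).
Definition err2 : R := 8 * delta * K ^+ 4 + 6 * nu * K ^+ 3 + rem2.
Definition err2' : R := 3 * (4 * (3 / (p * n%:R ^+ 2) * K ^+ 6 + a ^+ 2 * K ^+ 6) +
  (16 * kw ^+ 2 * K ^+ 4) ^+ 2 + rem2 ^+ 2).
Definition lyap_err : R := 2 * sD * err1 + D * err1' +
  2 * (err2 + 2 * K * (Y + 1) / (sD * p) + nu * Y ^+ 2) + 2 * err2' + 2 * (Y ^+ 2 / p) ^+ 2 + nu.

Let x1 := Xq 1 - phi.
Let xp := Num.max 0 (Xq 2 - y).
Let xp0 : 0 <= xp. Proof. by rewrite le_max lexx. Qed.
Let Y0 : 0 <= Y. Proof. exact: le_trans (le_trans y0 yy') y'Y. Qed.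
Let D0 : 0 < D. Proof. by rewrite DE exprn_gt0. Qed.
Let Xn0 : 0 <= Xq q / n%:R. Proof. by rewrite divr_ge0 // ltW. Qed.

Let XqK m : Xq m <= K ^+ m.
Proof.
elim: m => [|m IH].
  by rewrite /Xq /psum; under eq_bigr do rewrite expr0; rewrite sumr_const card_ord divff.
by apply: le_trans (XqS m) _; rewrite exprS ler_wpM2l.
Qed.

Let Dx1 : D * x1 ^+ 2 <= 1.
Proof.
apply: le_trans lyap1; rewrite /lyap -/x1 -addrA lerDl addr_ge0 //; exact: sqr_ge0.
Qed.

Let sDx1 : sD * `|x1| <= 1.
Proof.
have s0 : 0 <= sD * `|x1| by apply: mulr_ge0 => //; exact: ltW.
rewrite -(@ler_pXn2r _ 2) ?nnegrE // expr1n exprMn -DE.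
by rewrite real_normK ?num_real.
Qed.

Let Dx1' : D * `|x1| <= sD.
Proof. by rewrite DE expr2 -mulrA ler_piMr // ltW. Qed.

Let Kx1 : K * `|x1| <= 1.
Proof. by apply: le_trans sDx1; rewrite ler_wpM2r. Qed.

Let xp1 : xp <= 1.
Proof.
rewrite -(@ler_pXn2r _ 2) ?nnegrE // expr1n; apply: le_trans lyap1.
rewrite /lyap -/xp -/x1 -addrA addrCA lerDl; apply: addr_ge0 => //.
by rewrite mulr_ge0 ?sqr_ge0 // ltW.
Qed.

Let X2Y : Xq 2 <= Y + 1.
Proof.
have : Xq 2 - y <= xp by rewrite le_max lexx orbT.
by move: xp1 (le_trans yy' y'Y); lra.
Qed.

Let delta0 : 0 <= delta.
Proof. by apply: addr_ge0; [apply: divr_ge0 => //; apply: mulr_ge0; exact: ltW | exact: sqr_ge0]. Qed.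

Let b1 w : N w -> `|Xq' 1 w - Xq 1 - Lq 1 w - Qq 1 w| <= e ^+ 3 * K. Proof. exact: expand1. Qed.
Let e30 : 0 <= e ^+ 3. Proof. exact: exprn_ge0. Qed.
Let ec0 m : 0 <= expand_const m.
Proof. by rewrite /expand_const !addr_ge0 ?mulr_ge0 ?exprn_ge0. Qed.
Let b1_0 : 0 <= e ^+ 3 * K. Proof. exact: mulr_ge0. Qed.
Let rem20 : 0 <= rem2. Proof. by rewrite /rem2 !mulr_ge0 ?ec0 // addr_ge0. Qed.
Let b2 w : N w -> `|Xq' 2 w - Xq 2 - Lq 2 w - Qq 2 w| <= rem2.
Proof.
move=> Nw; apply: le_trans (@expandQ 0 2 w erefl Nw) _.
by rewrite /rem2; apply: ler_wpM2l; [apply: mulr_ge0 => //; exact: ec0 | exact: X2Y].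
Qed.

(** The drift X_2 (X_1 - phi) / p makes (X_1 - phi)^2 grow at relative rate 2 X_2 / p, with X_2 at
    most Y + 1. *)
Let termA : itg P (fun w => ind w * (Xq' 1 w - phi) ^+ 2) /\
  D * Ex P (fun w => ind w * (Xq' 1 w - phi) ^+ 2) <=
  D * x1 ^+ 2 * (1 + 2 * (Y + 1) / p) + 2 * sD * err1 + D * err1'.
Proof.
have I1 := itg_indX2 1 phi; split=> //.
have I2 := itgZ (2 * x1) (itg_ind 1).
have I3 := itgD (itg_cst P (x1 ^+ 2)) (itgD I2 (itg_indX2 1 (Xq 1))).
have h : Ex P (fun w => ind w * (Xq' 1 w - phi) ^+ 2) <= x1 ^+ 2 +
   (2 * x1 * Ex P (fun w => ind w * (Xq' 1 w - Xq 1)) + Ex P (fun w => ind w * (Xq' 1 w - Xq 1) ^+ 2)).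
  apply: le_trans (Ex_le I1 I3 _) _.
    move=> w; rewrite /ind; case: (N w); last by rewrite !mul0r mulr0 !addr0 sqr_ge0.
    by rewrite !mul1r /x1 le_eqVlt; apply/orP; left; apply/eqP; ring.
  by rewrite (ExD (itg_cst P (x1 ^+ 2)) (itgD I2 (itg_indX2 1 (Xq 1)))) (ExD I2 (itg_indX2 1 (Xq 1)))
    Ex_cst (ExZ _ (itg_ind 1)).
have dr := drift1 b1_0 b1; have ds := drift_sqr b1_0 b1.
have ds' : Ex P (fun w => ind w * (Xq' 1 w - Xq 1) ^+ 2) <= err1'.
  apply: le_trans ds _; rewrite /err1' ler_pM2l // expr1n !mul1r lerD2r; apply: lerD.
    apply: lerD; apply: ler_wpM2l.
    - by apply: divr_ge0 => //; apply: mulr_ge0; [exact: ltW | exact: exprn_ge0].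
    - exact: (XqK 4).
    - exact: sqr_ge0.
    rewrite (_ : K ^+ 4 = (K ^+ 2) ^+ 2); last by rewrite -exprM.
    by rewrite lerXn2r ?nnegrE ?exprn_ge0 //; exact: (XqK 2).
  have k4 : 0 <= 4 * kw ^+ 2 by rewrite mulr_ge0 // sqr_ge0.
  rewrite lerXn2r ?nnegrE //; [exact: mulr_ge0|by apply: mulr_ge0 => //; exact: exprn_ge0|].
  by apply: ler_wpM2l => //; exact: (XqK 3).
have dr' : `|Ex P (fun w => ind w * (Xq' 1 w - Xq 1))| <= (Y + 1) * `|x1| / p + err1.
  apply: le_trans dr _; rewrite /err1 !addrA lerD2r; apply: lerD => //; apply: lerD; first apply: lerD.
  - rewrite ler_pM2r ?invr_gt0 //; exact: ler_wpM2r.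
  - by apply: ler_wpM2l; [exact: mulr_ge0 | exact: (XqK 3)].
  by apply: ler_wpM2l; [exact: mulr_ge0 | exact: (XqK 2)].
move: h ds' dr'; set E1 := Ex P (fun w => ind w * (Xq' 1 w - phi) ^+ 2).
set E2 := Ex P (fun w => ind w * (Xq' 1 w - Xq 1)); set E3 := Ex P _ => h ds' dr'.
apply: le_trans (ler_wpM2l (ltW D0) h) _.
have h2 : 2 * x1 * E2 <= 2 * `|x1| * ((Y + 1) * `|x1| / p + err1).
  apply: le_trans (ler_norm _) _; rewrite !normrM normr_nat.
  by apply: ler_wpM2l => //; rewrite mulr_ge0.
have err10 : 0 <= err1.
  by rewrite /err1 !addr_ge0 // !mulr_ge0 ?exprn_ge0 //.
have nx : `|x1| * `|x1| = x1 ^+ 2 by rewrite -expr2 real_normK ?num_real.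
apply: (@le_trans _ _ (D * x1 ^+ 2 + D * (2 * `|x1| * ((Y + 1) * `|x1| / p + err1)) + D * err1')).
  by rewrite -!mulrDr ler_pM2l // -addrA lerD2l; exact: lerD.
rewrite lerD2r.
have -> : D * x1 ^+ 2 + D * (2 * `|x1| * ((Y + 1) * `|x1| / p + err1)) =
  D * x1 ^+ 2 * (1 + 2 * (Y + 1) / p) + 2 * (D * `|x1|) * err1 by rewrite -nx; ring.
by rewrite lerD2l; apply: ler_wpM2r => //; rewrite ler_pM2l.
Qed.

Let Iind : itg P ind.
Proof. by apply: itg_le (itg_cst P 1) => // w; have /andP[h1 h2] := ind01 w; rewrite ger0_norm. Qed.

Let Ex_ind : 1 - nu <= Ex P ind.
Proof.
rewrite (eq_Ex P (g := fun w => 1 - (~~ N w)%:R)); last first.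
  by move=> w; rewrite /ind; case: (N w); rewrite /= ?subr0 ?subrr.
by rewrite (ExB (itg_cst P 1) IN) Ex_cst lerD2l lerN2.
Qed.

(** The increment of [y] is y y' / p, so the excess of X_2 over [y] has drift (X_2^2 - y y') / p up
    to errors. The leftover 2 X_3 (X_1 - phi) / p is an error because [sD] times |X_1 - phi| is at
    most 1 and X_3 <= K X_2. *)
Let termB : itg P (fun w => ind w * Num.max 0 (Xq' 2 w - y') ^+ 2) /\
  Ex P (fun w => ind w * Num.max 0 (Xq' 2 w - y') ^+ 2) <=
  xp ^+ 2 * (1 + 2 * (2 * Y + 1) / p) +
  2 * (err2 + 2 * K * (Y + 1) / (sD * p) + nu * Y ^+ 2) + 2 * err2' + 2 * (Y ^+ 2 / p) ^+ 2.
Proof.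
have mxsq (t : R) : Num.max 0 t ^+ 2 <= t ^+ 2.
  by rewrite /Num.max; case: ifP => // _; rewrite expr0n sqr_ge0.
have I1 : itg P (fun w => ind w * Num.max 0 (Xq' 2 w - y') ^+ 2).
  apply: itg_le (itg_indX2 2 y') => [|w].
    apply: measurable_funM => //; apply: measurable_funX; apply: measurable_maxr => //.
    by apply: measurable_funB.
  have /andP[i0 _] := ind01 w.
  rewrite ger0_norm; last by apply: mulr_ge0 => //; exact: sqr_ge0.
  exact: (ler_wpM2l i0 (mxsq _)).
split=> //; pose dy := y' - y.
have dyE : dy = y * y' / p by [].
have dy0 : 0 <= dy by rewrite subr_ge0.
have dyY : dy <= Y ^+ 2 / p.
  rewrite dyE ler_pM2r ?invr_gt0 // expr2; apply: ler_pM => //; first exact: le_trans yy'.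
  exact: le_trans yy' y'Y.
have pV1 : p^-1 <= 1 by rewrite invf_le1.
have dyY2 : dy <= Y ^+ 2 by apply: le_trans dyY _; rewrite ler_piMr ?sqr_ge0.
have I2 := itgB (itg_ind 2) (itgZ dy Iind).
have I3 := itgZ (2 * xp) I2.
have I4 := itgD (itgZ 2 (itg_indX2 2 (Xq 2))) (itg_cst P (2 * dy ^+ 2)).
have I5 := itgD (itg_cst P (xp ^+ 2)) (itgD I3 I4).
have dr := drift_le rem20 b2; have ds := drift_sqr rem20 b2.
have ds' : Ex P (fun w => ind w * (Xq' 2 w - Xq 2) ^+ 2) <= err2'.
  apply: le_trans ds _; rewrite /err2' ler_pM2l // lerD2r (_ : 2%:R ^+ 2 = 4); last by ring.
  apply: lerD.
    apply: ler_wpM2l => //; apply: lerD; apply: ler_wpM2l.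
    - by apply: divr_ge0 => //; apply: mulr_ge0; [exact: ltW | exact: exprn_ge0].
    - exact: (XqK 6).
    - exact: sqr_ge0.
    rewrite (_ : K ^+ 6 = (K ^+ 3) ^+ 2); last by rewrite -exprM.
    by rewrite lerXn2r ?nnegrE ?exprn_ge0 //; exact: (XqK 3).
  have k4 : 0 <= 16 * kw ^+ 2 by rewrite mulr_ge0 // sqr_ge0.
  rewrite (_ : 4 * (4 * kw ^+ 2) = 16 * kw ^+ 2); last by ring.
  rewrite lerXn2r ?nnegrE //; [exact: mulr_ge0|by apply: mulr_ge0 => //; exact: exprn_ge0|].
  by apply: ler_wpM2l => //; exact: (XqK 4).
have X3x : Xq 3 * `|x1| <= K * (Y + 1) / sD.
  rewrite ler_pdivlMr // -[X in X <= _]mulrA [`|x1| * sD]mulrC.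
  apply: le_trans (_ : _ <= Xq 3 * 1) _; first exact: (ler_wpM2l (Xq_ge0 3) sDx1).
  by rewrite mulr1; apply: le_trans (XqS 2) _; exact: (ler_wpM2l K0 X2Y).
have dr' : Ex P (fun w => ind w * (Xq' 2 w - Xq 2)) <= Xq 2 ^+ 2 / p +
    (err2 + 2 * K * (Y + 1) / (sD * p)).
  apply: le_trans dr _.
  have Q02 : Q0 2 = (2 * (Xq 3 * Xq 1) + Xq 2 * Xq 2) / p.
    by rewrite /Q0 !big_ord_recl !big_ord0 /= !addr0 !add0r.
  have X4 := ler_wpM2l (_ : 0 <= 8 * delta) (XqK 4).
  have X3 := ler_wpM2l (_ : 0 <= 6 * nu) (XqK 3).
  have {}X4 : 8 * delta * Xq 4 <= 8 * delta * K ^+ 4 by apply: X4; exact: mulr_ge0.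
  have {}X3 : 6 * nu * Xq 3 <= 6 * nu * K ^+ 3 by apply: X3; exact: mulr_ge0.
  rewrite Q02 /err2 (_ : 2%:R ^+ 2 * (2 * delta) * Xq 4 = 8 * delta * Xq 4); last by ring.
  rewrite (_ : 3 * 2 * nu * Xq 3 = 6 * nu * Xq 3); last by ring.
  have e1' : - (2 * a * Xq 3) + (2 * (Xq 3 * Xq 1) + Xq 2 * Xq 2) / p =
      Xq 2 ^+ 2 / p + 2 * (Xq 3 * x1) / p by rewrite /x1 /a; ring.
  rewrite e1'; have e2' : 2 * (Xq 3 * x1) / p <= 2 * K * (Y + 1) / (sD * p).
    rewrite [X in _ <= X](_ : _ = 2 * (K * (Y + 1) / sD) / p); last by rewrite invfM; ring.
    rewrite ler_pM2r ?invr_gt0 // ler_pM2l //.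
    apply: le_trans X3x; apply: ler_wpM2l => //; exact: ler_norm.
  move: X3 X4 e2'; set z1 := _ * Xq 4; set z2 := _ * Xq 3; set z3 := 2 * (Xq 3 * _) / p.
  set z4 := 2 * K * _ / _; set z5 := 8 * delta * _; set z6 := 6 * nu * _; lra.
have dr2 : Ex P (fun w => ind w * (Xq' 2 w - Xq 2) - dy * ind w) <=
    (Xq 2 ^+ 2 - y * y') / p + (err2 + 2 * K * (Y + 1) / (sD * p) + nu * Y ^+ 2).
  rewrite (ExB (itg_ind 2) (itgZ dy Iind)) (ExZ _ Iind).
  have h1 : dy * (1 - nu) <= dy * Ex P ind by apply: ler_wpM2l.
  have h2 : dy * nu <= nu * Y ^+ 2 by rewrite mulrC; apply: ler_wpM2l.
  rewrite (_ : (Xq 2 ^+ 2 - y * y') / p = Xq 2 ^+ 2 / p - dy); last by rewrite dyE; ring.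
  move: h1 h2 dr'; rewrite mulrBr mulr1.
  by set z1 := dy * Ex P _; set z2 := dy * nu; set z3 := Ex P _; set z4 := nu * _; set z5 := err2 + _;
    set z6 := _ / p; lra.
apply: le_trans (Ex_le I1 I5 _) _.
  move=> w; rewrite /ind; case: (N w); last first.
    by rewrite !(mul0r, mulr0) subr0 mulr0 !add0r -[0]addr0; apply: lerD;
      rewrite ?mulr_ge0 ?sqr_ge0.
  rewrite !mul1r mulr1.
  have E : Xq' 2 w - y' = (Xq 2 - y) + (Xq' 2 w - Xq 2 - dy) by rewrite /dy; ring.
  have key (x t : R) : Num.max 0 (x + t) ^+ 2 <= Num.max 0 x ^+ 2 + 2 * Num.max 0 x * t + t ^+ 2.
    have [x0|x0] := leP 0 x.
      rewrite (_ : x ^+ 2 + 2 * x * t + t ^+ 2 = (x + t) ^+ 2); [exact: mxsq | by ring].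
    rewrite expr0n mulr0 mul0r !add0r; have [h|h] := leP 0 (x + t); last by rewrite expr0n sqr_ge0.
    by rewrite lerXn2r ?nnegrE //; lra.
  rewrite E; apply: le_trans (key _ _) _; rewrite -/xp -addrA !lerD2l.
  set s := Xq' 2 w - Xq 2; rewrite -subr_ge0.
  by rewrite (_ : _ - _ = (s + dy) ^+ 2); [exact: sqr_ge0 | ring].
rewrite (ExD (itg_cst P (xp ^+ 2)) (itgD I3 I4)) (ExD I3 I4) Ex_cst (ExZ _ I2).
rewrite (ExD (itgZ 2 (itg_indX2 2 (Xq 2))) (itg_cst P (2 * dy ^+ 2))) Ex_cst (ExZ _ (itg_indX2 2 (Xq 2))).
set G := err2 + 2 * K * (Y + 1) / (sD * p) + nu * Y ^+ 2 in dr2 *.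
have G0 : 0 <= G.
  have g1 : 0 <= err2.
    rewrite /err2; apply: addr_ge0 => //; apply: addr_ge0; apply: mulr_ge0; rewrite ?exprn_ge0 //;
      exact: mulr_ge0.
  have g2 : 0 <= 2 * K * (Y + 1) / (sD * p).
    apply: divr_ge0; last by apply: mulr_ge0; exact: ltW.
    by apply: mulr_ge0; [exact: mulr_ge0 | exact: addr_ge0].
  have g3 : 0 <= nu * Y ^+ 2 by apply: mulr_ge0 => //; exact: sqr_ge0.
  by apply: addr_ge0 => //; exact: addr_ge0.
(* Where X_2 > y, the bound y <= y' gives X_2^2 - y y' <= X_2^2 - y^2 = [xp] ([xp] + 2 y). *)
have xpX : xp * (Xq 2 ^+ 2 - y * y') <= xp ^+ 2 * (2 * Y + 1).
  have [x0|x0] := leP (Xq 2 - y) 0.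
    by rewrite (_ : xp = 0) ?mul0r ?expr0n ?mul0r //; apply/max_idPl.
  have xE : xp = Xq 2 - y by apply/max_idPr; exact: ltW.
  rewrite [xp ^+ 2]expr2 -[X in _ <= X]mulrA; apply: ler_wpM2l => //.
  have yy2 : y * y <= y * y' by apply: ler_wpM2l.
  have -> : Xq 2 = y + xp by rewrite xE; ring.
  have z1 : xp * y <= xp * Y by apply: ler_wpM2l => //; exact: le_trans yy' y'Y.
  have z2 : xp * xp <= xp * 1 by apply: ler_wpM2l.
  rewrite -subr_ge0 (_ : _ - _ = 2 * (xp * Y - xp * y) + (xp * 1 - xp * xp) + (y * y' - y * y)).
    apply: addr_ge0; last by rewrite subr_ge0.
    by apply: addr_ge0; [apply: mulr_ge0 => //|]; rewrite subr_ge0.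
  by move: xp => t; ring.
have h1 : 2 * xp * Ex P (fun w => ind w * (Xq' 2 w - Xq 2) - dy * ind w) <=
    xp ^+ 2 * (2 * (2 * Y + 1) / p) + 2 * G.
  apply: le_trans (ler_wpM2l _ dr2) _; first exact: mulr_ge0.
  rewrite mulrDr; apply: lerD.
    rewrite (_ : 2 * xp * (_ / p) = (xp * (Xq 2 ^+ 2 - y * y')) * (2 / p)); last by ring.
    rewrite (_ : xp ^+ 2 * _ = xp ^+ 2 * (2 * Y + 1) * (2 / p)); last by ring.
    by apply: ler_wpM2r => //; rewrite divr_ge0 // ltW.
  by rewrite -mulrA ler_pM2l // ler_piMl.
have h2 : dy ^+ 2 <= (Y ^+ 2 / p) ^+ 2 by rewrite lerXn2r ?nnegrE //; exact: le_trans dyY.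
have t0 : 0 <= 2 :> R by [].
apply: le_trans (lerD (lexx _) (lerD h1 (lerD (ler_wpM2l t0 ds') (ler_wpM2l t0 h2)))) _.
by rewrite le_eqVlt; apply/orP; left; apply/eqP; ring.
Qed.

Let q2 : (2 <= q)%N. Proof. by rewrite qE expnS leq_pmulr // expn_gt0. Qed.

(** Every contribution is proportional to X_q, so there is no absolute error. The dangerous term
    X_(q+1) (X_1 - phi) is at most K X_q |X_1 - phi| <= X_q, thanks to the pinning of X_1; the
    quadratic one is at most X_2 X_q. *)
Let termC : Ex P (fun w => ind w * Xq' q w) <= Xq q * (1 + (q%:R + q%:R ^+ 2 * (Y + 1) +
  2 * q%:R ^+ 2 + 3 * q%:R + expand_const q) / p).
Proof.
have bq0 : 0 <= expand_const q * e ^+ 3 * Xq q.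
  by apply: mulr_ge0 => //; apply: mulr_ge0 => //; exact: ec0.
have dr := drift_le bq0 (fun w => expandQ (w := w) qE).
have -> : Ex P (fun w => ind w * Xq' q w) =
    Ex P (fun w => ind w * (Xq' q w - Xq q)) + Xq q * Ex P ind.
  rewrite -(ExZ _ Iind) -(ExD (itg_ind q) (itgZ (Xq q) Iind)).
  by apply: eq_Ex => w; ring.
have Xi : Xq q * Ex P ind <= Xq q.
  rewrite ler_piMr //; rewrite -[X in _ <= X](Ex_cst P 1); apply: Ex_le => //; first exact: itg_cst.
  by move=> w; have /andP[] := ind01 w.
have Q := Q0_le q2.
have XS := XqS q.
have pi0 : 0 <= p^-1 by rewrite invr_ge0 ltW.
have h1 : - (q%:R * a * Xq q.+1) + Q0 q <= Xq q * (q%:R / p) + Xq q * (q%:R ^+ 2 * (Y + 1) / p).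
  apply: (@le_trans _ _ (q%:R * (Xq q.+1 * x1) / p + q%:R ^+ 2 * (Xq 2 * Xq q) / p)).
    apply: le_trans (_ : _ <= - (q%:R * a * Xq q.+1) +
      ((q%:R * (Xq q.+1 * Xq 1) + q%:R ^+ 2 * (Xq 2 * Xq q)) / p)) _; first by rewrite lerD2l.
    by rewrite le_eqVlt; apply/orP; left; apply/eqP; rewrite /x1 /a; ring.
  apply: lerD.
    rewrite (_ : Xq q * (q%:R / p) = q%:R * Xq q / p); last by ring.
    apply: ler_wpM2r => //; apply: ler_wpM2l => //.
    apply: (@le_trans _ _ (K * Xq q * `|x1|)).
      apply: (@le_trans _ _ (Xq q.+1 * `|x1|)); last exact: (ler_wpM2r (normr_ge0 _) XS).
      by apply: ler_wpM2l => //; exact: ler_norm.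
    by rewrite mulrAC -[X in _ <= X]mul1r; apply: ler_wpM2r.
  rewrite (_ : Xq q * (_ / p) = q%:R ^+ 2 * ((Y + 1) * Xq q) / p); last by ring.
  apply: ler_wpM2r => //; apply: ler_wpM2l; first exact: exprn_ge0.
  exact: ler_wpM2r.
have h2 : q%:R ^+ 2 * (2 * delta) * Xq q.+2 <= Xq q * (2 * q%:R ^+ 2 / p).
  have X2 : Xq q.+2 <= K ^+ 2 * Xq q.
    apply: le_trans (XqS q.+1) _; rewrite expr2 -mulrA; exact: (ler_wpM2l K0 XS).
  have d2 : delta * Xq q.+2 <= p^-1 * Xq q.
    apply: (@le_trans _ _ (delta * (K ^+ 2 * Xq q))); first exact: (ler_wpM2l delta0 X2).
    by rewrite mulrA; apply: ler_wpM2r.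
  rewrite (_ : _ * Xq q.+2 = 2 * q%:R ^+ 2 * (delta * Xq q.+2)); last by ring.
  rewrite (_ : Xq q * _ = 2 * q%:R ^+ 2 * (p^-1 * Xq q)); last by ring.
  by apply: ler_wpM2l => //; apply: mulr_ge0 => //; exact: exprn_ge0.
have h3 : 3 * q%:R * nu * Xq q.+1 <= Xq q * (3 * q%:R / p).
  have d2 : nu * Xq q.+1 <= p^-1 * Xq q.
    apply: (@le_trans _ _ (nu * (K * Xq q))); first exact: (ler_wpM2l nu0 XS).
    by rewrite mulrA; apply: ler_wpM2r.
  rewrite (_ : _ * Xq q.+1 = 3 * q%:R * (nu * Xq q.+1)); last by ring.
  rewrite (_ : Xq q * _ = 3 * q%:R * (p^-1 * Xq q)); last by ring.
  by apply: ler_wpM2l => //; exact: mulr_ge0.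
have h4 : expand_const q * e ^+ 3 * Xq q <= Xq q * (expand_const q / p).
  rewrite (_ : Xq q * _ = expand_const q * p^-1 * Xq q); last by ring.
  apply: ler_wpM2r => //; apply: ler_wpM2l => //; exact: ec0.
apply: le_trans (lerD (le_trans dr (lerD (lerD (lerD h1 h2) h3) h4)) Xi) _.
by rewrite le_eqVlt; apply/orP; left; apply/eqP; ring.
Qed.

(** Outside [N] the functional is replaced by its cap 1, which costs the probability [nu]. The three
    relative rates are simply added in [lyap_rate], each term being non-negative. *)
Lemma lyapunov_step : itg P (fun w => if N w then lyap' w else 1) /\
  Ex P (fun w => if N w then lyap' w else 1) <= lyap * (1 + lyap_rate / p) + lyap_err.
Proof.
have [iA hA1] := termA; have [iB hB1] := termB.
have iC := itgZ n%:R^-1 (itg_indX q).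
have iA' := itgZ D iA.
have I := itgD (itgD (itgD iA' iB) iC) IN.
have E w : D * (ind w * (Xq' 1 w - phi) ^+ 2) + ind w * Num.max 0 (Xq' 2 w - y') ^+ 2 +
   n%:R^-1 * (ind w * Xq' q w) + (~~ N w)%:R = if N w then lyap' w else 1.
  rewrite /ind /lyap'; case: (N w) => /=; last by rewrite !(mul0r, mulr0) !add0r.
  by rewrite !mul1r addr0 [n%:R^-1 * _]mulrC.
split; first exact: eq_itg E I.
rewrite -(eq_Ex P E) (ExD (itgD (itgD iA' iB) iC) IN) (ExD (itgD iA' iB) iC) (ExD iA' iB).
rewrite (ExZ _ iA) (ExZ _ (itg_indX q)).
have hC1 : n%:R^-1 * Ex P (fun w => ind w * Xq' q w) <= Xq q / n%:R * (1 + (q%:R + q%:R ^+ 2 * (Y + 1) +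
  2 * q%:R ^+ 2 + 3 * q%:R + expand_const q) / p).
  by rewrite mulrC [X in _ <= X]mulrAC; apply: ler_wpM2r; [rewrite invr_ge0 ltW | exact: termC].
pose rA := 2 * (Y + 1) / p; pose rB := 2 * (2 * Y + 1) / p.
pose rC := (q%:R + q%:R ^+ 2 * (Y + 1) + 2 * q%:R ^+ 2 + 3 * q%:R + expand_const q) / p.
have rE : lyap_rate / p = rA + rB + rC by rewrite /lyap_rate /rA /rB /rC !mulrDl.
have pi0 : 0 <= p^-1 by rewrite invr_ge0 ltW.
have rA0 : 0 <= rA by apply: mulr_ge0 => //; apply: mulr_ge0 => //; exact: addr_ge0.
have rB0 : 0 <= rB.
  by apply: mulr_ge0 => //; apply: mulr_ge0 => //; apply: addr_ge0 => //; exact: mulr_ge0.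
have rC0 : 0 <= rC.
  apply: mulr_ge0 => //; rewrite !addr_ge0 ?ec0 ?mulr_ge0 ?exprn_ge0 ?addr_ge0 //.
rewrite -/rA in hA1; rewrite -/rB in hB1; rewrite -/rC in hC1.
apply: le_trans (lerD (lerD (lerD hA1 hB1) hC1) EN) _.
rewrite /lyap rE -/x1 -/xp.
have v1 : 0 <= D * x1 ^+ 2 by apply: mulr_ge0; [exact: ltW | exact: sqr_ge0].
have v2 : 0 <= xp ^+ 2 by exact: sqr_ge0.
rewrite /lyap_err.
have m1 := mulr_ge0 v1 rB0; have m2 := mulr_ge0 v1 rC0.
have m3 := mulr_ge0 v2 rA0; have m4 := mulr_ge0 v2 rC0.
have m5 := mulr_ge0 Xn0 rA0; have m6 := mulr_ge0 Xn0 rB0.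
move: m1 m2 m3 m4 m5 m6; set t1 := D * x1 ^+ 2; set t2 := xp ^+ 2; set t3 := Xq q / _.
set u1 := D * err1'; set u2 := 2 * sD * err1; set u3 := 2 * (err2 + _ + _); set u4 := 2 * (_ / p) ^+ 2.
rewrite !mulrDl !mulrDr !mulr1.
move: (t1 * rA) (t1 * rB) (t1 * rC) (t2 * rA) (t2 * rB) (t2 * rC) (t3 * rA) (t3 * rB) (t3 * rC).
by move=> *; lra.
Qed.
End Drift.

Lemma double_integral_groups_le {R : realType} {dT dE : measure_display}
  {T : measurableType dT} {E : measurableType dE} (P : probability T R) (I : finType) (X : I -> T -> E)
  (mX : forall i, measurable_fun [set: T] (X i)) (iX : mutually_independent P X)
  (J K : {set I}) (F : (sigT X J * sigT X K)%type -> \bar R) (G : T -> \bar R) :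
  (forall i, i \in J -> i \notin K) ->
  measurable_fun setT F -> (forall x, 0 <= F x)%E -> measurable_fun setT G ->
  (forall w : T, \int[P]_w' F (w, w') <= G w)%E ->
  (\int[P]_w F (w, w) <= \int[P]_w G w)%E.
Proof.
move=> JK mF F0 mG FG; rewrite (double_integral_groups mX iX JK mF F0).
pose mK := isMeasurableFun.Build _ _ _ _ _ (@measurable_sigT_id _ _ _ _ _ X mX K).
pose fK : {mfun T >-> sigT X K} := HB.pack (sigT_id X K : T -> sigT X K) mK.
apply: ge0_le_integral => //.
- by move=> w _; apply: integral_ge0.
- have m1 := @measurable_inner_integral R _ _ _ T (sigT X J) (sigT X K) P fK F mF F0.
  have := measurableT_comp m1 (@measurable_sigT_id _ _ _ _ _ X mX J).
  apply: eq_measurable_fun => w _ /=.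
  rewrite ge0_integral_pushforward ?preimage_setT //.
  exact/measurableT_comp/pair1_measurable.
Qed.

                            

(** * Measurability of matrix-valued functions and of the inverse *)

Section MatrixMeasurable.
Context {R : realType} {d : measure_display} {T : measurableType d}.
Local Notation C := R[i].

Definition mmeas m n (M : T -> 'M[C]_(m, n)) := forall i j, cmeas (fun w => M w i j).

Lemma cmeas_if (b : T -> bool) (f g : T -> C) : measurable_fun setT b -> cmeas f -> cmeas g ->
  cmeas (fun w => if b w then f w else g w).
Proof.
move=> mb [f1 f2] [g1 g2]; split.
  rewrite (_ : (fun w => _) = (fun w => if b w then complex.Re (f w) else complex.Re (g w))).
    exact: measurable_fun_ifT.
  by apply/funext => w; case: (b w).
rewrite (_ : (fun w => _) = (fun w => if b w then complex.Im (f w) else complex.Im (g w))).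
  exact: measurable_fun_ifT.
by apply/funext => w; case: (b w).
Qed.

Lemma cmeas_inv (f : T -> C) : cmeas f -> cmeas (fun w => (f w)^-1).
Proof.
move=> mf; apply: (eq_cmeas (f := fun w => Num.conj (f w) * ((nsq (f w)) `^ (-1))%:C)).
  move=> w; rewrite powR_inv1 ?nsq_ge0 //.
  have [->|f0] := eqVneq (f w) 0; first by rewrite rmorph0 mul0r invr0.
  apply: (mulfI f0); rewrite mulrA mul_conjC_nsq mulfV // -rmorphM mulfV ?rmorph1 //.
  apply: contraNneq f0 => h; rewrite -mul_conjC_eq0 mul_conjC_nsq h.
  by [].
apply: cmeasM; first exact: cmeas_conj.
by apply: cmeas_real; apply: (measurableT_comp (measurable_powR _)); exact: measurable_nsq.
Qed.

Lemma mmeasM m n p (A : T -> 'M[C]_(m, n)) (B : T -> 'M[C]_(n, p)) :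
  mmeas A -> mmeas B -> mmeas (fun w => A w *m B w).
Proof.
move=> mA mB i j; apply: (eq_cmeas (f := fun w => \sum_k A w i k * B w k j)).
  by move=> w; rewrite mxE.
by apply: cmeas_sum => k; exact: cmeasM.
Qed.

Lemma mmeasD m n (A B : T -> 'M[C]_(m, n)) :
  mmeas A -> mmeas B -> mmeas (fun w => A w + B w).
Proof.
move=> mA mB i j; apply: (eq_cmeas (f := fun w => A w i j + B w i j)); last exact: cmeasD.
by move=> w; rewrite mxE.
Qed.

Lemma mmeas_cst m n (A : 'M[C]_(m, n)) : mmeas (fun=> A).
Proof. by move=> i j; exact: cmeas_cst. Qed.

Lemma mmeasZ m n (c : C) (A : T -> 'M[C]_(m, n)) : mmeas A -> mmeas (fun w => c *: A w).
Proof.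
move=> mA i j; apply: (eq_cmeas (f := fun w => c * A w i j)); first by move=> w; rewrite mxE.
by apply: cmeasM => //; exact: cmeas_cst.
Qed.

Lemma mmeas_sum (I : Type) (s : seq I) m n (A : I -> T -> 'M[C]_(m, n)) :
  (forall i, mmeas (A i)) -> mmeas (fun w => \sum_(i <- s) A i w).
Proof.
move=> mA i j; apply: (eq_cmeas (f := fun w => \sum_(k <- s) A k w i j)).
  by move=> w; rewrite summxE.
by apply: cmeas_sum => k; exact: mA.
Qed.

Lemma mmeasX n (A : T -> 'M[C]_n) k : mmeas A -> mmeas (fun w => A w ^+ k).
Proof.
move=> mA; elim: k => [|k IH]; first exact: mmeas_cst.
rewrite (_ : (fun w => _) = (fun w => A w *m A w ^+ k)); first exact: mmeasM.
by apply/funext => w; rewrite exprS.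
Qed.

Lemma cmeas_tr n (A : T -> 'M[C]_n) : mmeas A -> cmeas (fun w => \tr (A w)).
Proof. by move=> mA; apply: cmeas_sum => i; exact: mA. Qed.

Lemma cmeas_det n (A : T -> 'M[C]_n) : mmeas A -> cmeas (fun w => \det (A w)).
Proof.
move=> mA; apply: cmeas_sum => s; apply: cmeasM; first exact: cmeas_cst.
by apply: cmeas_prod => i; exact: mA.
Qed.

Lemma mmeas_inv n (A : T -> 'M[C]_n) : mmeas A -> mmeas (fun w => invmx (A w)).
Proof.
move=> mA i j; have mdet := cmeas_det mA.
(* [invmx] returns a singular matrix unchanged, whence the case distinction on the determinant. *)
apply: (eq_cmeas (f := fun w => if (complex.Re (\det (A w)) == 0) && (complex.Im (\det (A w)) == 0)
    then A w i j else (\det (A w))^-1 * \adj (A w) i j)).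
  move=> w; have -> : (complex.Re (\det (A w)) == 0) && (complex.Im (\det (A w)) == 0) =
      (\det (A w) == 0) by rewrite eq_complex.
  rewrite /invmx unitmxE unitfE; by case: (_ == 0); rewrite //= [RHS]mxE.
apply: cmeas_if => //.
  by apply: measurable_and; apply: measurable_fun_eqr => //; [exact: mdet.1 | exact: mdet.2].
apply: cmeasM; first exact: cmeas_inv.
apply: (eq_cmeas (f := fun w => (-1) ^+ (j + i) * \det (row' j (col' i (A w))))).
  by move=> w; rewrite mxE.
apply: cmeasM; first exact: cmeas_cst.
apply: cmeas_det => k k'; apply: (eq_cmeas (f := fun w => A w (lift j k) (lift i k'))) => //.
by move=> w; rewrite !mxE.
Qed.

End MatrixMeasurable.

Lemma cmeas_comp {R : realType} (d d' : measure_display) (T : measurableType d) (T' : measurableType d')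
  (f : T -> R[i]) (h : T' -> T) : measurable_fun setT h -> cmeas f -> cmeas (fun w => f (h w)).
Proof. by move=> mh [m1 m2]; split; [exact: (measurableT_comp m1 mh) | exact: (measurableT_comp m2 mh)]. Qed.

(** * The functional of an arbitrary matrix, without eigenvalues *)

Section Functional.
Variables (R : realType) (n : nat) (phi D : R) (q : nat).
Local Notation C := R[i].
Implicit Types (M : 'M[C]_n) (u y : R).

(** Expressed through [invmx] and the trace, hence measurable in [M]; it coincides with [Xq]
    whenever [u] lies above the spectrum. *)
Definition Xf u M m : R := complex.Re (\tr (invmx (u%:C%:M - M) ^+ m)) / n%:R.
Definition Vf u M y : R := D * (Xf u M 1 - phi) ^+ 2 + Num.max 0 (Xf u M 2 - y) ^+ 2 + Xf u M q / n%:R.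

Lemma Xf_Xq u M Pm l m : hermd M Pm l -> (forall i, 0 < u - l i) -> Xf u M m = Xq u l m.
Proof.
move=> hM hl; have ul i : u != l i by rewrite -subr_eq0 gt_eqF.
have [_ hA] := hermd_resolvent hM ul.
by rewrite /Xf (hermd_tr hA).
Qed.

Lemma Xq_ge0 u (l : 'I_n -> R) m : (forall i, 0 < u - l i) -> 0 <= Xq u l m.
Proof. by move=> hl; rewrite divr_ge0 // psum_ge0 // => i; rewrite invr_ge0 ltW. Qed.

Lemma Vf_ge0 u M Pm l y : 0 <= D -> hermd M Pm l -> (forall i, 0 < u - l i) -> 0 <= Vf u M y.
Proof.
move=> D0 hM hl; rewrite /Vf; apply: addr_ge0; first apply: addr_ge0.
- by rewrite mulr_ge0 ?sqr_ge0.
- exact: sqr_ge0.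
by rewrite divr_ge0 // (Xf_Xq _ hM hl) Xq_ge0.
Qed.

Lemma Vf_lyap u M Pm l y : hermd M Pm l -> (forall i, 0 < u - l i) -> Vf u M y = lyap phi u l D y q.
Proof. by move=> hM hl; rewrite /Vf !(Xf_Xq _ hM hl). Qed.

(** A single term of the power sum is at most n X_q <= n^2 <= K^q. *)
Lemma Vf_resolvent_le u M Pm l y (K : R) : (0 < n)%N -> (0 < q)%N -> 0 <= D -> 0 <= K ->
  n%:R ^+ 2 <= K ^+ q -> hermd M Pm l -> (forall i, 0 < u - l i) -> Vf u M y <= 1 ->
  forall i, (u - l i)^-1 <= K.
Proof.
move=> n0 q0 D0 K0 nK hM hl V1 i.
have nR : 0 < n%:R :> R by rewrite ltr0n.
have : Xq u l q / n%:R <= 1.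
  apply: le_trans V1; rewrite /Vf (Xf_Xq q hM hl) lerDr; apply: addr_ge0; last exact: sqr_ge0.
  by rewrite mulr_ge0 ?sqr_ge0.
rewrite ler_pdivrMr // mul1r /Xq ler_pdivrMr // -expr2 => h.
rewrite -(@ler_pXn2r _ q) ?nnegrE ?invr_ge0 ?(ltW (hl i)) //.
apply: le_trans nK; apply: le_trans h; rewrite /psum (bigD1 i) //= lerDl.
by apply: sumr_ge0 => k _; rewrite exprn_ge0 // invr_ge0 ltW.
Qed.

Lemma measurable_Xf (d : measure_display) (T : measurableType d) u (M : T -> 'M[C]_n) m :
  mmeas M -> measurable_fun setT (fun w => Xf u (M w) m).
Proof.
move=> mM; apply: measurable_funM; last exact: measurable_cst.
apply: (cmeas_tr _).1; apply: mmeasX; apply: mmeas_inv; apply: mmeasD; first exact: mmeas_cst.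
rewrite (_ : (fun w => - M w) = (fun w => (-1) *: M w)); first exact: mmeasZ.
by apply/funext => w; rewrite scaleN1r.
Qed.

Lemma measurable_Vf (d : measure_display) (T : measurableType d) u (M : T -> 'M[C]_n) y :
  mmeas M -> measurable_fun setT (fun w => Vf u (M w) y).
Proof.
move=> mM; apply: measurable_funD; last by apply: measurable_funM; [exact: measurable_Xf|].
apply: measurable_funD.
  apply: measurable_funM => //; apply: measurable_funX; apply: measurable_funB => //.
  exact: measurable_Xf.
apply: measurable_funX; apply: measurable_maxr => //; apply: measurable_funB => //.
exact: measurable_Xf.
Qed.

End Functional.

Lemma gronwall (R : realFieldType) (e : nat -> R) (rho err : R) (m : nat) : 0 <= rho -> 0 <= err ->
  (forall j, (j < m)%N -> e j.+1 <= e j * (1 + rho) + err) ->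
  0 <= e 0%N -> e m <= (1 + rho) ^+ m * (e 0%N + m%:R * err).
Proof.
move=> r0 e0 H e00; elim: m H => [|m IH] H; first by rewrite expr0 mul0r addr0 mul1r.
apply: le_trans (H m (ltnSn m)) _.
have {}IH := IH (fun j jm => H j (ltnW jm)).
have p1 : 1 <= (1 + rho) ^+ m.+1 by rewrite exprn_ege1 // lerDl.
apply: (@le_trans _ _ ((1 + rho) ^+ m.+1 * (e 0%N + m%:R * err) + (1 + rho) ^+ m.+1 * err)).
  apply: lerD; last by rewrite ler_peMl.
  rewrite exprSr -mulrA [X in _ <= X]mulrCA mulrC; apply: ler_wpM2l => //.
  by rewrite addr_ge0.
by rewrite -mulrDr -natr1 mulrDl mul1r addrA.
Qed.

(** * The stopped process along the columns *)

Section Process.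
Context {R : realType} {dT : measure_display} {T : measurableType dT}.
Local Notation C := R[i].
Variables (P : probability T R) (kap : R) (d p : nat).
Variable (g : 'I_(d * d) * 'I_p.+1 -> T -> C).
Hypothesis gok : forall e, entry_ok P kap (g e).
Hypothesis gind : mutually_independent P (pairX g).
Hypothesis kap2 : kap * kap = kap.
Hypotheses (kap0 : 0 <= kap) (kap1 : kap <= 1) (d0 : (0 < d)%N).
Local Notation n := (d * d)%N.
Local Notation pR := (p.+1%:R : R).
Variables (sgn u0 tau K nu sD pi L : R) (q jq : nat).
Hypotheses (sgn2 : sgn ^+ 2 = 1) (u01 : 1 < u0) (tau0 : 0 <= tau) (K1 : 1 <= K).
Hypothesis qE : q = (2 ^ jq.+1)%N.
Hypothesis nKq : n%:R ^+ 2 <= K ^+ q.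
Hypotheses (sD0 : 0 < sD) (KsD : K <= sD).
Let D := sD ^+ 2.
Let sc := sgn / Num.sqrt (pR * n%:R).
Definition kzf : R := `|sgn / Num.sqrt (pR * n%:R)| * (16 * tau ^+ 2 + 1).
Let kz := kzf.
Let phi := u0^-1.
Let Y := ((1 + u0 ^+ 2) / 2 - 1)^-1.
Hypothesis L0 : 0 < L.
Hypothesis Hpi : 4 * ((8 * d + 1)%:R ^+ d) ^+ 2 * expR (- tau ^+ 2 / 2) <= pi.
Hypothesis Hnu : 2 * (pR * n%:R)^-1 * (d%:R ^+ 4 * (L * pi + 24 * 2 ^+ 10 / L + pi)) <= nu.
Hypothesis pinu : pi <= nu.
Hypothesis He : 2 * K * (kz + phi / pR) <= 1.
Hypothesis HdK : (2 / (pR * n%:R) + (phi / pR) ^+ 2) * K ^+ 2 <= pR^-1.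
Hypothesis HnK : nu * K <= pR^-1.
Hypothesis He3 : (2 * K * (kz + phi / pR)) ^+ 3 <= pR^-1.

(** The characteristic of the Burgers equation starting at [u0]: for the semicircle of variance j/p
    the Stieltjes transform at this point is constantly 1/u0. It ends at u0 + 1/u0. *)
Definition uj (j : nat) : R := u0 + j%:R * (phi / pR).
                                                                                             
(** Explicit solution of the discrete Riccati equation of [yjS]. It starts at 2 / (1 + u0^2), above
    the initial X_2 = 1/u0^2, and stays below [Y] up to time [p.+1] because u0 > 1. *)
Definition yj (j : nat) : R := ((1 + u0 ^+ 2) / 2 - j%:R / pR)^-1.
Definition Zj (j : nat) (w : T) : 'M[C]_n := colZ g (inord j) sc w.
Definition Sj (j : nat) (w : T) : 'M[C]_n := \sum_(k < j) Zj k w.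
Definition Nj (j : nat) (w : T) : bool := netb g (inord j) tau w.
Definition Vj (j : nat) (w : T) : R := Vf phi D q (uj j) (Sj j w) (yj j).
(** All columns so far have moderate norm and the functional has never exceeded 1. After a failure
    [Psi] is frozen at 1, so its final mean dominates the failure probability. *)
Fixpoint good (j : nat) (w : T) : bool :=
  if j is k.+1 then good k w && Nj k w && (Vj k.+1 w <= 1) else true.
Definition Psi (j : nat) (w : T) : R := if good j w then Vj j w else 1.

Let n0 : (0 < n)%N. Proof. by rewrite muln_gt0 d0. Qed.
Let p0 : 0 < pR. Proof. by rewrite ltr0n. Qed.
Let p1 : 1 <= pR. Proof. by rewrite ler1n. Qed.
Let pn0 : 0 < pR * n%:R. Proof. by rewrite mulr_gt0 // ltr0n. Qed.
Let sc2 : sc ^+ 2 = (pR * n%:R)^-1.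
Proof. by rewrite /sc exprMn sgn2 mul1r exprVn sqr_sqrtr // ltW. Qed.
Let u00 : 0 < u0. Proof. exact: lt_trans u01. Qed.
Let phi0 : 0 <= phi. Proof. by rewrite invr_ge0 ltW. Qed.
Let phi1 : phi <= 1. Proof. by rewrite invf_le1 // ltW. Qed.
Let K0 : 0 <= K. Proof. exact: le_trans K1. Qed.
Let D0 : 0 <= D. Proof. exact: sqr_ge0. Qed.
Let kz0 : 0 <= kz. Proof. by rewrite mulr_ge0 // addr_ge0 // mulr_ge0 // sqr_ge0. Qed.
Let q0 : (0 < q)%N. Proof. by rewrite qE expn_gt0. Qed.
Let c1 : 1 < (1 + u0 ^+ 2) / 2.
Proof.
have : 1 < u0 ^+ 2 by rewrite exprn_egt1.
by set x := u0 ^+ 2; lra.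
Qed.

Let cj j : (j <= p.+1)%N -> 0 < (1 + u0 ^+ 2) / 2 - j%:R / pR /\
  (1 + u0 ^+ 2) / 2 - 1 <= (1 + u0 ^+ 2) / 2 - j%:R / pR.
Proof.
move=> jp; have h : j%:R / pR <= 1 by rewrite ler_pdivrMr // mul1r ler_nat.
by split; [rewrite subr_gt0 (le_lt_trans h) | rewrite lerD2l lerN2].
Qed.

Let yj_ge0 j : (j <= p.+1)%N -> 0 <= yj j. Proof. by move=> /cj[h _]; rewrite invr_ge0 ltW. Qed.
Let yj_leY j : (j <= p.+1)%N -> yj j <= Y.
Proof. by move=> /cj[h1 h2]; rewrite lef_pV2 ?posrE // subr_gt0. Qed.
Let yjS j : (j < p.+1)%N -> yj j.+1 - yj j = yj j * yj j.+1 / pR.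
Proof.
move=> jp; have [h1 _] := cj (ltnW jp); have [h2 _] := cj jp.
rewrite /yj; set a := (1 + u0 ^+ 2) / 2 - j%:R / pR.
have E : (1 + u0 ^+ 2) / 2 - j.+1%:R / pR = a - pR^-1 by rewrite /a -natr1; ring.
rewrite E; rewrite E in h2; have pp : pR != 0 by rewrite gt_eqF.
have a0 : a != 0 by rewrite gt_eqF.
have b0 : a - pR^-1 != 0 by rewrite gt_eqF.
rewrite -[(a - _)^-1 - _](mulfK (mulf_neq0 a0 b0)).
rewrite mulrBl mulrCA [_^-1 * (a - _)]mulVf // mulr1 mulrA mulVf // mul1r opprB addrC subrK.
by rewrite invfM mulrC.
Qed.

Let SjS j w : Sj j.+1 w = Sj j w + Zj j w. Proof. by rewrite /Sj big_ord_recr. Qed.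
Let ujS j : uj j.+1 = uj j + phi / pR. Proof. by rewrite /uj -natr1 mulrDl mul1r addrA. Qed.
Let Zherm j w : (Zj j w)^t* = Zj j w. Proof. exact: colZ_herm. Qed.
Let NZ j w : Nj j w -> opb kz%:C (Zj j w). Proof. exact: colZ_opb. Qed.

(** The process starts from the zero matrix: X_1 equals [phi] exactly, X_2 = phi^2 is below [yj 0],
    and only the term phi^q / n remains. *)
Let inv0 w : (exists Pm l, hermd (Sj 0 w) Pm l /\ forall i, 0 < uj 0 - l i) /\
  0 <= Vj 0 w <= n%:R^-1.
Proof.
have c2 : (1 + u0 ^+ 2) / 2 <= u0 ^+ 2 by move: c1; set x := u0 ^+ 2; lra.
have h0 : hermd (Sj 0 w) 1%:M (fun=> 0).
  rewrite /Sj big_ord0; split; rewrite ?trmx1 ?map_mx1 ?mulmx1 ?mul1mx //.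
  by apply/matrixP => i k; rewrite !mxE mul0rn.
have hl (i : 'I_n) : 0 < uj 0 - 0 by rewrite /uj mul0r addr0 subr0.
split; first by exists 1%:M, (fun=> 0).
rewrite (Vf_ge0 _ _ _ D0 h0 hl) /=.
have X m : Xf (uj 0) (Sj 0 w) m = phi ^+ m.
  rewrite (Xf_Xq m h0 hl) /Xq /psum; under eq_bigr do rewrite subr0 /uj mul0r addr0.
  by rewrite sumr_const card_ord -[_ *+ _]mulr_natr mulfK // pnatr_eq0 -lt0n.
rewrite /Vj /Vf !X expr1 subrr expr0n mulr0 add0r.
have -> : Num.max 0 (phi ^+ 2 - yj 0) = 0.
  apply/max_idPl; rewrite subr_le0 /yj mul0r subr0 /phi exprVn lef_pV2 ?posrE ?exprn_gt0 //; last first.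
    exact: lt_trans c1.
rewrite expr0n add0r -[X in _ <= X]mul1r; apply: ler_wpM2r; first by rewrite invr_ge0.
exact: exprn_ile1.
Qed.

Let nV1 : (n%:R)^-1 <= 1 :> R. Proof. by rewrite invf_le1 ?ltr0n // ler1n. Qed.

Let next j w w' Pm l : hermd (Sj j w) Pm l -> (forall i, 0 < uj j - l i) -> Vj j w <= 1 -> Nj j w' ->
  exists Pm' l', hermd (Sj j w + Zj j w') Pm' l' /\ forall i, 0 < uj j.+1 - l' i.
Proof.
move=> hS hl V1 Nw; rewrite ujS.
have hK := Vf_resolvent_le n0 q0 D0 K0 nKq hS hl V1.
exact: (nextR_pos (Z := Zj j) (N := Nj j) p1 phi0 K1 (@Zherm j) (@NZ j) hS hl hK He Nw).
Qed.

(** A functional at most 1 bounds the resolvent by [K], and by [He] the next increment, barrier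
    advance included, has norm at most 1/(2K); so the spectrum stays below the barrier at every
    step. *)
Lemma good_inv j w : good j w ->
  (exists Pm l, hermd (Sj j w) Pm l /\ forall i, 0 < uj j - l i) /\ Vj j w <= 1.
Proof.
elim: j => [_|j IH].
  by have [h /andP[_ h2]] := inv0 w; split=> //; exact: le_trans h2 nV1.
move=> /= /andP[/andP[/IH[[Pm [l [hS hl]]] V1] Nw] V2]; split=> //.
by rewrite SjS; exact: next hS hl V1 Nw.
Qed.

Let Psi_itv j w : 0 <= Psi j w <= 1.
Proof.
rewrite /Psi; case: (boolP (good j w)) => [/good_inv[[Pm [l [hS hl]]] V1]|_]; last by rewrite ler01 lexx.
by rewrite V1 andbT; exact: (Vf_ge0 _ _ _ D0 hS hl).
Qed.

Section Meas.
Variables (dS : measure_display) (S : measurableType dS) (pr : S -> T) (j : nat).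
Hypothesis mg : forall r k, (k < j)%N -> cmeas (fun w => g (r, inord k) (pr w)).

Lemma mmeas_Sj k : (k <= j)%N -> mmeas (fun w => Sj k (pr w)).
Proof.
move=> kj; apply: mmeas_sum => i x y; apply: cmeas_colZ => r.
exact: mg (leq_trans (ltn_ord i) kj).
Qed.

Lemma measurable_good k : (k <= j)%N -> measurable_fun setT (fun w => good k (pr w)).
Proof.
elim: k => [_|k IH kj]; first exact: measurable_cst.
rewrite /=; apply: measurable_and.
  apply: measurable_and; first exact: IH (ltnW kj).
  by apply: measurable_netb => r; exact: mg.
apply: measurable_fun_ler => //.
exact: (measurable_Vf _ _ _ _ _ (mmeas_Sj kj)).
Qed.
End Meas.

Let mgT (r : 'I_n) k : cmeas (fun w => g (r, inord k) w). Proof. exact: (eo_meas (gok _)). Qed.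

Lemma measurable_goodT j : measurable_fun setT (good j).
Proof. by apply: (measurable_good (pr := id) (j := j)). Qed.

Let measurable_Psi j : measurable_fun setT (Psi j).
Proof.
apply: measurable_fun_ifT => //; first exact: measurable_goodT.
by apply: measurable_Vf; apply: (mmeas_Sj (pr := id) (j := j)).
Qed.

Let itg_Psi j : itg P (Psi j).
Proof.
apply: itg_le (itg_cst P 1) => // w; have /andP[h1 h2] := Psi_itv j w.
by rewrite ger0_norm.
Qed.

Let Ncol j : exists2 nb : R, nb <= nu &
  [/\ itg P (fun w => (~~ Nj j w)%:R * complex.Re (\tr (Zj j w * Zj j w))),
  itg P (fun w => (~~ Nj j w)%:R), Ex P (fun w => (~~ Nj j w)%:R * complex.Re (\tr (Zj j w * Zj j w))) <= nu &
  Ex P (fun w => (~~ Nj j w)%:R) <= nb].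
Proof.
have h1 := le_trans (netb_prob gok gind (inord j) tau0 d0) Hpi.
have mN : measurable_fun setT (Nj j) by exact: (measurable_netbT gok).
have [i1 i2 e2] := trZ2_trunc gok (inord j) sc mN L0 h1.
exists pi => //; split=> //; apply: le_trans e2 _; rewrite sc2; exact: Hnu.
Qed.

Definition rate : R := lyap_rate Y q.
Definition err : R := lyap_err n pR nu kz phi K D sD Y.

Let step_inner j w : (j < p.+1)%N -> good j w ->
  itg P (fun w' => if Nj j w' then Vf phi D q (uj j.+1) (Sj j w + Zj j w') (yj j.+1) else 1) /\
  Ex P (fun w' => if Nj j w' then Vf phi D q (uj j.+1) (Sj j w + Zj j w') (yj j.+1) else 1) <=
  Vj j w * (1 + rate / pR) + err.
Proof.
move=> jp /good_inv[[Pm [l [hS hl]]] V1].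
have hK := Vf_resolvent_le n0 q0 D0 K0 nKq hS hl V1.
have [nb nbnu [i1 i2 e1 e2]] := Ncol j.
have e2' := le_trans e2 nbnu.
have mN : measurable_fun setT (Nj j) by exact: (measurable_netbT gok).
have EZ M : citg P (fun w => \tr (M * Zj j w)) /\ ExC P (fun w => \tr (M * Zj j w)) = 0.
  by split; [exact: (citg_trZ gok) | exact: (ExC_trZ gok gind)].
have EZZ M M' : citg P (fun w => \tr (M * Zj j w * M' * Zj j w)) /\
  ExC P (fun w => \tr (M * Zj j w * M' * Zj j w)) =
  ((pR * n%:R)^-1)%:C * (\tr M * \tr M' + kap%:C * \tr (M *m M'^T)).
  by rewrite -sc2; exact: (trZZ gok gind kap2).
have EZ2 M : citg P (fun w => \tr (M * Zj j w) ^+ 2) /\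
  ExC P (fun w => \tr (M * Zj j w) ^+ 2) =
  ((pR * n%:R)^-1)%:C * (\tr (M * M) + kap%:C * \tr (M *m M^T)).
  by rewrite -sc2; exact: (trZ_sqr gok gind kap2).
have mM : mmeas (fun w' => Sj j w + Zj j w').
  by apply: mmeasD; [exact: mmeas_cst | move=> x y;
    apply: (@cmeas_colZ _ _ _ _ _ g _ _ _ _ id) => r; exact: mgT].
have mX m : measurable_fun setT (Xq' (Zj j) pR phi (uj j) (Sj j w) m).
  by have := measurable_Xf (uj j + phi / pR) m mM.
have yS : yj j <= yj j.+1.
  rewrite -subr_ge0 yjS // divr_ge0 ?mulr_ge0 ?yj_ge0 //; exact: ltnW.
have V1' : lyap phi (uj j) l D (yj j) q <= 1 by rewrite -(Vf_lyap _ _ _ _ hS hl).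
have := lyapunov_step n0 p1 phi0 phi1 kap0 kap1 K1 kz0 (@Zherm j) mN EZ EZZ EZ2 (@NZ j) i1 i2 e1 e2'
  hS hl hK He mX qE sD0 erefl KsD (yj_ge0 (ltnW jp)) yS (yj_leY jp) (yjS jp) HdK HnK He3 V1'.
rewrite /Vj (Vf_lyap _ _ _ _ hS hl) ujS.
by [].
Qed.

Variable ebar : R.
Hypotheses (ebar0 : 0 <= ebar) (errb : err <= ebar).

Let Y0 : 0 <= Y. Proof. by rewrite invr_ge0 subr_ge0 ltW. Qed.

Let rate0 : 0 <= rate.
Proof.
have Y1 : 0 <= Y + 1 by rewrite addr_ge0.
have q2 : 0 <= q%:R ^+ 2 :> R by exact: exprn_ge0.
rewrite /rate /lyap_rate; apply: addr_ge0; last apply: addr_ge0.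
- by rewrite addr_ge0 ?mulr_ge0 // addr_ge0 // mulr_ge0.
- by rewrite !addr_ge0 // mulr_ge0.
by rewrite /expand_const !addr_ge0 ?mulr_ge0 ?exprn_ge0.
Qed.

(** The past is frozen and column [j] is integrated out first, where [step_inner] applies; the past
    being good is what supplies the hypotheses of that bound. *)
Let step_Psi j : (j < p.+1)%N -> Ex P (Psi j.+1) <= Ex P (Psi j) * (1 + rate / pR) + ebar.
Proof.
move=> jp.
(* [J] collects the entries of the columns before [j], and [Kc] those of column [j]. *)
pose J := [set e : 'I_n * 'I_p.+1 | (e.2 < j)%N]%SET.
pose Kc := [set e : 'I_n * 'I_p.+1 | e.2 == inord j]%SET.
have JK e : e \in J -> e \notin Kc.
  rewrite !inE => ej; apply/eqP => ee; move: ej; rewrite ee inordK // ltnn.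
  by [].
pose ST := (sigT (pairX g) J * sigT (pairX g) Kc)%type.
pose pr1 (z : ST) : T := z.1; pose pr2 (z : ST) : T := z.2.
pose F (z : ST) : R :=
  if good j (pr1 z) then (if Nj j (pr2 z) then
     Vf phi D q (uj j.+1) (Sj j (pr1 z) + Zj j (pr2 z)) (yj j.+1) else 1) else 1.
have m1 (r : 'I_n) k : (k < j)%N -> cmeas (fun z : ST => g (r, inord k) (pr1 z)).
  move=> kj; have eJ : (r, inord k) \in J by rewrite inE /= inordK // (ltn_trans kj).
  exact: (cmeas_comp (@measurable_fst _ _ _ _) (csm_g g eJ)).
have m2 (r : 'I_n) : cmeas (fun z : ST => g (r, inord j) (pr2 z)).
  have eK : (r, inord j) \in Kc by rewrite inE.
  exact: (cmeas_comp (@measurable_snd _ _ _ _) (csm_g g eK)).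
have mgood : measurable_fun setT (fun z : ST => good j (pr1 z)).
  exact: (@measurable_good _ _ pr1 j m1 j (leqnn j)).
have mN : measurable_fun setT (fun z : ST => Nj j (pr2 z)).
  exact: (@measurable_netb _ _ _ _ _ g (inord j) tau _ _ pr2 m2).
have mS : mmeas (fun z : ST => Sj j (pr1 z) + Zj j (pr2 z)).
  apply: mmeasD; first exact: (@mmeas_Sj _ _ pr1 j m1 j (leqnn j)).
  by move=> x y; apply: (@cmeas_colZ _ _ _ _ _ g _ _ _ _ pr2) => r; exact: m2.
have mF : measurable_fun setT F.
  apply: measurable_fun_ifT => //; apply: measurable_fun_ifT => //.
  exact: measurable_Vf.
have F0 z : 0 <= F z.
  rewrite /F; case: (boolP (good j (pr1 z))) => // /good_inv[[Pm [l [hS hl]]] V1].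
  case: (boolP (Nj j (pr2 z))) => // Nw.
  have [Pm' [l' [hS' hl']]] := next hS hl V1 Nw.
  exact: (Vf_ge0 _ _ _ D0 hS' hl').
pose G w := Psi j w * (1 + rate / pR) + ebar.
have IG : itg P G.
  apply: itgD; last exact: itg_cst.
  by apply: eq_itg (itgZ (1 + rate / pR) (itg_Psi j)) => w; rewrite mulrC.
have EG : Ex P G = Ex P (Psi j) * (1 + rate / pR) + ebar.
  have IP : itg P (fun w => Psi j w * (1 + rate / pR)).
    by apply: eq_itg (itgZ (1 + rate / pR) (itg_Psi j)) => w; rewrite mulrC.
  rewrite /G (ExD IP (itg_cst P ebar)) Ex_cst; congr (_ + _).
  rewrite [RHS]mulrC -(ExZ _ (itg_Psi j)); apply: eq_Ex => w; exact: mulrC.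
have r1 : 1 <= 1 + rate / pR by rewrite lerDl divr_ge0 // ltW.
have inner (w : T) : (\int[P]_w' (F (w, w'))%:E <= (G w)%:E)%E.
  rewrite /F /G /Psi /=; case: (boolP (good j w)) => gw.
    have [i1 e1] := step_inner jp gw; rewrite ExE // lee_fin; apply: le_trans e1 _.
    by rewrite lerD2l.
  by rewrite integral_cst //= probability_setT mule1 lee_fin mul1r (le_trans r1) // lerDl.
have le1 : (\int[P]_w (F (w, w))%:E <= \int[P]_w (G w)%:E)%E.
  apply: (double_integral_groups_le (measurable_pairX gok) gind JK (F := fun z => (F z)%:E)) => //.
  - exact/measurable_EFinP.
  - by apply/measurable_EFinP; exact: itg_measurable IG.
rewrite -EG -lee_fin -(ExE IG) -(ExE (itg_Psi j.+1)); apply: le_trans le1.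
apply: ge0_le_integral => //.
- by move=> w _; rewrite lee_fin; have /andP[] := Psi_itv j.+1 w.
- by apply/measurable_EFinP; exact: measurable_Psi.
- apply/measurable_EFinP; apply: measurable_fun_ifT => //; first exact: measurable_goodT.
  apply: measurable_fun_ifT => //; first exact: (measurable_netbT gok).
  apply: measurable_Vf; apply: mmeasD; first by apply: (mmeas_Sj (pr := id) (j := j)).
  by move=> x y; apply: (@cmeas_colZ _ _ _ _ _ g _ _ _ _ id) => r; exact: mgT.
(* [F] on the diagonal differs from the next [Psi] only where the functional exceeds 1, and there
   [Psi] is capped at 1. *)
move=> w _; rewrite lee_fin /Psi /F /=.
case: (good j w) => //=; case: (Nj j w) => //=.
rewrite -SjS -/(Vj j.+1 w); case: (leP (Vj j.+1 w) 1) => // h; exact: ltW.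
Qed.

(** [gronwall] over p+1 steps, with (1 + rate / (p+1))^(p+1) <= exp(rate) and the initial value at
    most 1/n. *)
Theorem barrier_prob : Ex P (fun w => (~~ good p.+1 w)%:R) <= expR rate * (n%:R^-1 + pR * ebar).
Proof.
have r0 : 0 <= rate / pR by rewrite divr_ge0 // ltW.
have e00 : 0 <= Ex P (Psi 0) by apply: Ex_ge0 => w; have /andP[] := Psi_itv 0 w.
have := gronwall (e := fun j => Ex P (Psi j)) r0 ebar0 step_Psi e00.
have Ps0 : Ex P (Psi 0) <= n%:R^-1.
  rewrite -[X in _ <= X](Ex_cst P); apply: Ex_le => //; first exact: itg_cst.
  by move=> w; rewrite /Psi /=; have [_ /andP[]] := inv0 w.
have I1 : itg P (fun w => (~~ good p.+1 w)%:R : R).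
  apply: itg_le (itg_cst P 1) => [|w]; last by case: good; rewrite ?normr0 ?normr1.
  rewrite (_ : (fun w => _) = (fun w => if good p.+1 w then 0 else 1)); last first.
    by apply/funext => w; case: good.
  by apply: measurable_fun_ifT => //; exact: measurable_goodT.
have le1 : Ex P (fun w => (~~ good p.+1 w)%:R) <= Ex P (Psi p.+1).
  apply: Ex_le => // w; have /andP[h _] := Psi_itv p.+1 w; move: h; rewrite /Psi.
  by case: good.
move=> h; apply: le_trans le1 _; apply: le_trans h _; apply: ler_pM.
- by rewrite exprn_ge0 // addr_ge0.
- by rewrite addr_ge0 // mulr_ge0.
- apply: (@le_trans _ _ (expR (rate / pR) ^+ p.+1)).
    by rewrite lerXn2r ?nnegrE ?expR_ge0 ?addr_ge0 //; exact: expR_ge1Dx.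
  by rewrite -expRM_natl mulrC divfK // gt_eqF.
by rewrite lerD2r.
Qed.

Lemma good_edge w : good p.+1 w -> exists Pm l, [/\ hermd (Sj p.+1 w) Pm l,
  forall i, l i < u0 + u0^-1 & sD * `|Xq (u0 + u0^-1) l 1 - u0^-1| <= 1].
Proof.
move=> /good_inv[[Pm [l [hS hl]]] V1]; exists Pm, l.
have uE : uj p.+1 = u0 + u0^-1 by rewrite /uj mulrC divfK // gt_eqF.
rewrite -uE; split=> //; first by move=> i; rewrite -subr_gt0.
have X0 : 0 <= Xf (uj p.+1) (Sj p.+1 w) q / n%:R.
  by rewrite (Xf_Xq q hS hl) divr_ge0 // Xq_ge0.
have : D * (Xq (uj p.+1) l 1 - phi) ^+ 2 <= 1.
  apply: le_trans V1; rewrite /Vj /Vf (Xf_Xq 1 hS hl) -addrA lerDl addr_ge0 //; exact: sqr_ge0.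
have s0 : 0 <= sD * `|Xq (uj p.+1) l 1 - phi| by apply: mulr_ge0 => //; exact: ltW.
move=> h; rewrite -(@ler_pXn2r _ 2) ?nnegrE // expr1n exprMn.
by rewrite real_normK ?num_real.
Qed.

End Process.

                                 

(** * Orders of magnitude as integer powers of d^(1/64) *)

Section Growth.
Local Open Scope ring_scope.
Variable R : realType.
Implicit Types (f g : nat -> R) (m k : int).

                                                                   
(** All scales of the proof are integer powers of this quantity. The choice 64 = 2^6 also equals the
    power [q] used for the resolvent: with K = th^4 one gets K^q = d^4 = n^2. *)
Definition th (d : nat) : R := d%:R `^ (64%:R^-1).

Lemma th_exp d : th d ^+ 64 = d%:R.
Proof. by rewrite -powR_mulrn ?powR_ge0 // -powRrM mulVf ?powRr1 // pnatr_eq0. Qed.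

Lemma th_ge1 d : (0 < d)%N -> 1 <= th d.
Proof.
move=> d0; rewrite leNgt; apply/negP => h.
have : th d ^+ 64 < 1 by rewrite exprn_ilt1 // powR_ge0.
by rewrite th_exp ltNge ler1n d0.
Qed.

Lemma th_large (M : R) : exists d0, forall d, (d0 <= d)%N -> M <= th d.
Proof.
pose M' := Num.max M 0; exists (Num.truncn (M' ^+ 64)).+1 => d dd.
have M0 : 0 <= M' by rewrite le_max lexx orbT.
apply: (@le_trans _ _ M'); first by rewrite le_max lexx.
rewrite -(@ler_pXn2r _ 64) ?nnegrE ?powR_ge0 // th_exp.
apply: (@le_trans _ _ (Num.truncn (M' ^+ 64)).+1%:R); last by rewrite ler_nat.
by apply: ltW; exact: truncnS_gt.
Qed.

Definition bO f m := exists (c : R) (d0 : nat), 0 <= c /\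
  forall d, (d0 <= d)%N -> 0 <= f d <= c * th d ^ m.

Lemma thz_le d m k : (0 < d)%N -> m <= k -> th d ^ m <= th d ^ k.
Proof. by move=> d0 mk; rewrite ler_weXz2l // th_ge1. Qed.

Lemma bO_weak f m k : m <= k -> bO f m -> bO f k.
Proof.
move=> mk [c [d0 [c0 H]]]; exists c, (maxn d0 1); split=> // d.
rewrite geq_max => /andP[/H/andP[h1 h2] d1]; rewrite h1 (le_trans h2) // ler_wpM2l //.
exact: thz_le.
Qed.

Lemma bO_le f g m : (exists d0, forall d, (d0 <= d)%N -> 0 <= f d <= g d) -> bO g m -> bO f m.
Proof.
move=> [d1 H1] [c [d0 [c0 H]]]; exists c, (maxn d1 d0); split=> // d.
rewrite geq_max => /andP[/H1/andP[h1 h2] /H/andP[h3 h4]]; rewrite h1 (le_trans h2) //.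
Qed.

Lemma bO_eq f g m : (forall d, f d = g d) -> bO g m -> bO f m.
Proof. by move=> /funext ->. Qed.

Lemma bO_cst (c : R) : 0 <= c -> bO (fun=> c) 0.
Proof. by move=> c0; exists c, 0%N; split=> // d _; rewrite c0 expr0z mulr1 /=. Qed.

Lemma bO_add f g m : bO f m -> bO g m -> bO (fun d => f d + g d) m.
Proof.
move=> [c [d0 [c0 H]]] [c' [d0' [c0' H']]]; exists (c + c'), (maxn d0 d0'); split; first exact: addr_ge0.
move=> d; rewrite geq_max => /andP[/H/andP[h1 h2] /H'/andP[h3 h4]].
by rewrite addr_ge0 // mulrDl lerD.
Qed.

Lemma bO_mulw f g m1 m2 m : m1 + m2 <= m -> bO f m1 -> bO g m2 -> bO (fun d => f d * g d) m.
Proof.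
move=> mm [c [d0 [c0 H]]] [c' [d0' [c0' H']]]; apply: (bO_weak mm).
exists (c * c'), (maxn (maxn d0 d0') 1); split; first exact: mulr_ge0.
move=> d; rewrite !geq_max => /andP[/andP[/H/andP[h1 h2] /H'/andP[h3 h4]] d1].
rewrite mulr_ge0 //= expfzDr; last by rewrite gt_eqF // (lt_le_trans ltr01 (th_ge1 d1)).
by rewrite mulrACA ler_pM.
Qed.

Lemma bO_exp f m (k : nat) : bO f m -> bO (fun d => f d ^+ k) (m * k%:Z).
Proof.
move=> bf; elim: k => [|k IH]; first by rewrite mulr0; exact: bO_cst.
apply: (bO_eq (g := fun d => f d * f d ^+ k)); first by move=> d; rewrite exprS.
by apply: bO_mulw bf IH; rewrite -addn1 PoszD mulrDr mulr1 addrC.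
Qed.

Lemma bO_th (k : nat) : bO (fun d => th d ^+ k) k%:Z.
Proof.
by exists 1, 0%N; split=> // d _; rewrite mul1r lexx andbT exprn_ge0 // powR_ge0.
Qed.

Lemma bO_to0 f m : m <= -1 -> bO f m -> forall eps, 0 < eps -> exists d0, forall d, (d0 <= d)%N -> f d <= eps.
Proof.
move=> m1 /(bO_weak m1)[c [d0 [c0 H]]] eps e0; have [d1 H1] := th_large (c / eps).
exists (maxn (maxn d0 d1) 1) => d; rewrite !geq_max => /andP[/andP[/H/andP[_ h] /H1 h1] d1'].
have t0 : 0 < th d by rewrite (lt_le_trans ltr01 (th_ge1 d1')).
apply: le_trans h _; rewrite exprN1 ler_pdivrMr // mulrC -ler_pdivrMr //.
Qed.

Lemma bO_inv f (k : nat) (c : R) : 0 < c -> (exists d0, forall d, (d0 <= d)%N -> c * th d ^+ k <= f d) ->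
  bO (fun d => (f d)^-1) (- k%:Z).
Proof.
move=> c0 [d0 H]; exists c^-1, (maxn d0 1); split; first by rewrite invr_ge0 ltW.
move=> d; rewrite geq_max => /andP[/H h d1].
have t0 : 0 < th d by rewrite (lt_le_trans ltr01 (th_ge1 d1)).
have ct : 0 < c * th d ^+ k by rewrite mulr_gt0 // exprn_gt0.
have f0 : 0 < f d by exact: lt_le_trans h.
by rewrite invr_ge0 ltW //= -exprnN -invfM lef_pV2 ?posrE.
Qed.

Lemma large2 (Q1 Q2 : nat -> Prop) : (exists d0, forall d, (d0 <= d)%N -> Q1 d) ->
  (exists d0, forall d, (d0 <= d)%N -> Q2 d) -> exists d0, forall d, (d0 <= d)%N -> Q1 d /\ Q2 d.
Proof.
move=> [a H1] [b H2]; exists (maxn a b) => d; rewrite geq_max => /andP[h1 h2].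
by split; [exact: H1 | exact: H2].
Qed.

End Growth.

(** * Choice of parameters and size of the errors *)

Section ScalingRegime.
Local Open Scope ring_scope.
Variables (R : realType) (alpha u0 sgn : R).
Hypotheses (a0 : 0 < alpha) (u01 : 1 < u0) (sgn2 : sgn ^+ 2 = 1).
Local Notation th := (@th R).

Definition pn (d : nat) : nat := Num.truncn (alpha * d%:R ^+ 2).
(** The failure bound of [netb_prob] at tau = th^33. Since tau^2 = th^66 slightly exceeds d = th^64,
    it beats the entropy d log d of the grid while the column matrices keep norm of order
    th^(-62). *)
Definition piN (d : nat) : R := 4 * ((8 * d + 1)%:R ^+ d) ^+ 2 * expR (- (th d ^+ 33) ^+ 2 / 2).
(** The truncation bound of [trZ2_trunc] with L = th^180, plus [piN] so that it also dominates the
    failure probability. *)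
Definition nuN (d : nat) : R := piN d + 2 * ((pn d)%:R * (d * d)%:R)^-1 *
  (d%:R ^+ 4 * (th d ^+ 180 * piN d + 24 * 2 ^+ 10 / th d ^+ 180 + piN d)).
Definition kzN (d : nat) : R := `|sgn / Num.sqrt ((pn d)%:R * (d * d)%:R)| * (16 * (th d ^+ 33) ^+ 2 + 1).

Let d2E d : d%:R ^+ 2 = th d ^+ 128. Proof. by rewrite -th_exp -exprM. Qed.
Let nE d : (d * d)%:R = th d ^+ 128. Proof. by rewrite natrM -expr2 d2E. Qed.

Lemma pn_bounds : exists d0, forall d, (d0 <= d)%N ->
  [/\ (0 < d)%N, (0 < pn d)%N, (pn d)%:R <= alpha * th d ^+ 128 & alpha / 2 * th d ^+ 128 <= (pn d)%:R].
Proof.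
have [d0 H0] := th_large (2 / alpha + 1); exists (maxn d0 1) => d.
rewrite geq_max => /andP[/H0 h d1]; have t1 := th_ge1 R d1.
have t0 : 0 < th d by rewrite (lt_le_trans ltr01 t1).
have x0 : 0 <= alpha * d%:R ^+ 2 by rewrite mulr_ge0 ?sqr_ge0 // ltW.
have /andP[h1 h2] := truncn_itv x0; rewrite -/(pn d) in h1 h2.
have big : 2 <= alpha * d%:R ^+ 2.
  rewrite d2E mulrC -ler_pdivrMr //; apply: (@le_trans _ _ (th d)).
    by apply: le_trans h; rewrite lerDl.
  by rewrite -[X in X <= _]expr1 ler_weXn2l.
have low : alpha / 2 * th d ^+ 128 <= (pn d)%:R.
  by move: h2 big; rewrite -natr1 d2E; set x := (pn d)%:R; set y := th d ^+ 128; lra.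
have lp : 0 < alpha / 2 * th d ^+ 128 by rewrite mulr_gt0 ?exprn_gt0 // divr_gt0.
split=> //; last by rewrite -d2E.
by rewrite -(ltr0n R); exact: lt_le_trans low.
Qed.

Let bOp : bO (fun d => (pn d)%:R : R) 128.
Proof.
apply: (bO_le (g := fun d => alpha * th d ^+ 128)).
  by have [d0 H] := pn_bounds; exists d0 => d /H[_ _ h _]; rewrite h ler0n.
by apply: (bO_mulw (m1 := 0) (m2 := 128)) (bO_th R 128) => //; apply: bO_cst; exact: ltW.
Qed.

Let bOpV : bO (fun d => ((pn d)%:R)^-1 : R) (- 128%:Z).
Proof.
apply: (bO_inv (c := alpha / 2)); first exact: divr_gt0.
by have [d0 H] := pn_bounds; exists d0 => d /H[_ _ _ h].
Qed.

Let bOnV : bO (fun d => ((d * d)%:R)^-1 : R) (- 128%:Z).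
Proof. by apply: (bO_inv (c := 1)) => //; exists 0%N => d _; rewrite mul1r nE. Qed.

Let bOpnV : bO (fun d => ((pn d)%:R * (d * d)%:R)^-1 : R) (- 256%:Z).
Proof.
apply: (bO_eq (g := fun d => ((pn d)%:R)^-1 * ((d * d)%:R)^-1)); first by move=> d; rewrite invfM.
exact: (bO_mulw (m1 := - 128%:Z) (m2 := - 128%:Z)) bOpV bOnV.
Qed.

Let bO_c (c : R) f m : 0 <= c -> bO f m -> bO (fun d => c * f d) m.
Proof. by move=> c0 bf; apply: (bO_mulw (m1 := 0) (m2 := m)) bf; rewrite ?add0r //; exact: bO_cst. Qed.

Let bOpi : bO piN (- 360%:Z).
Proof.
(* 1012 is twice 18 + 128 + 360, the coefficients of the positive part of the final exponent, which
   must stay below th^66 / 2. The crude estimate x <= exp(x) replaces logarithms throughout. *)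
have [d0 H] := th_large (1012 : R); apply: (bO_le (g := fun d => 4 * (th d ^+ 360)^-1)); last first.
  apply: bO_c => //; apply: (bO_inv (c := 1)) => //.
  by exists 0%N => d _; rewrite mul1r.
exists (maxn d0 1) => d; rewrite geq_max => /andP[/H t h1].
have t1 : 1 <= th d by exact: th_ge1.
have t0 : 0 < th d by exact: (lt_le_trans ltr01 t1).
have pi0 : 0 <= piN d by rewrite /piN !mulr_ge0 ?expR_ge0 ?sqr_ge0.
rewrite pi0 /= ler_pdivlMr ?exprn_gt0 // /piN.
set A := (_ ^+ d) ^+ 2; set B := expR _; set E := th d ^+ 360.
rewrite (_ : 4 * A * B * E = 4 * (A * (B * E))); last by rewrite -mulrA -mulrA.
rewrite -[X in _ <= X]mulr1 ler_pM2l // /A /B /E {A B E}.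
have x_le (x : R) : x <= expR x by apply: le_trans (expR_ge1Dx x); rewrite lerDr.
have dE : d%:R = th d ^+ 64 by rewrite th_exp.
have h2 : (8 * d + 1)%:R <= expR (9 + 64 * th d) :> R.
  apply: (@le_trans _ _ (9 * d%:R)).
    by rewrite -natrM ler_nat; lia.
  rewrite expRD dE; apply: ler_pM => //; first by rewrite exprn_ge0 // ltW.
  by rewrite expRM_natl lerXn2r ?nnegrE ?expR_ge0 //; exact: ltW.
have h3 : ((8 * d + 1)%:R ^+ d) ^+ 2 <= expR ((9 + 64 * th d) * (2 * th d ^+ 64)).
  rewrite -exprM (_ : expR _ = expR (9 + 64 * th d) ^+ (d * 2)).
    by rewrite lerXn2r ?nnegrE ?expR_ge0.
  by rewrite -expRM_natl natrM dE; congr expR; move: (th d ^+ 64) (th d) => y x; ring.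
have h4 : th d ^+ 360 <= expR (360 * th d).
  by rewrite expRM_natl lerXn2r ?nnegrE ?expR_ge0 //; exact: ltW.
apply: (@le_trans _ _ (expR ((9 + 64 * th d) * (2 * th d ^+ 64)) * (expR (- (th d ^+ 33) ^+ 2 / 2) *
   expR (360 * th d)))).
  apply: ler_pM => //; first by rewrite mulr_ge0 ?expR_ge0 ?exprn_ge0 // ltW.
  by rewrite ler_pM2l ?expR_gt0.
rewrite -!expRD -[X in _ <= X]expR0 ler_expR.
move: t t0 t1; set x := th d => t t0 t1.
have x64 : 1 <= x ^+ 64 by exact: exprn_ege1.
have -> : (x ^+ 33) ^+ 2 = x * (x * x ^+ 64) by rewrite -exprM -!exprS.
move: x64; set y := x ^+ 64 => y1.
have z1 : y <= x * y by rewrite ler_peMl // (le_trans ler01 y1).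
have z2 : x <= x * y by rewrite ler_peMr // ltW.
have z0 : 0 <= x * y by exact: le_trans (ltW t0) z2.
have z3 := ler_wpM2r z0 t.
rewrite (_ : (9 + 64 * x) * (2 * y) = 18 * y + 128 * (x * y)); last by ring.
move: z1 z2 z3; set z := x * y; set v := x * z; lra.
Qed.

Let bOthV k : bO (fun d => (th d ^+ k)^-1) (- k%:Z).
Proof. by apply: (bO_inv (c := 1)) => //; exists 0%N => d _; rewrite mul1r. Qed.

Let bOnu : bO nuN (- 180%:Z).
Proof.
apply: bO_add; first exact: (bO_weak (m := - 360%:Z)) bOpi.
have b1 : bO (fun d => th d ^+ 180 * piN d) (- 180%:Z).
  exact: (bO_mulw (m1 := 180%:Z) (m2 := - 360%:Z)) (bO_th R 180) bOpi.
have b2 : bO (fun d => 24 * 2 ^+ 10 / th d ^+ 180) (- 180%:Z).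
  by apply: bO_c; [rewrite mulr_ge0 // exprn_ge0 | exact: bOthV].
have b3 : bO piN (- 180%:Z) by exact: (bO_weak (m := - 360%:Z)) bOpi.
have b4 := bO_add (bO_add b1 b2) b3.
have b5 : bO (fun d => (d%:R : R) ^+ 4) 256%:Z.
  by apply: (bO_eq (g := fun d => th d ^+ 256)) (bO_th R 256) => d; rewrite -th_exp -exprM.
have b6 := bO_mulw (m := 76%:Z) (isT : 256%:Z + - 180%:Z <= 76%:Z) b5 b4.
have b7 : bO (fun d => 2 * ((pn d)%:R * (d * d)%:R)^-1 : R) (- 256%:Z) by exact: bO_c.
exact: (bO_mulw (m1 := - 256%:Z) (m2 := 76%:Z)) b7 b6.
Qed.

Let bOkz : bO kzN (- 62%:Z).
Proof.
have s1 : `|sgn| = 1.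
  by apply/eqP; rewrite -(@eqrXn2 _ 2) // expr1n real_normK ?num_real // sgn2.
have b1 : bO (fun d => `|sgn / Num.sqrt ((pn d)%:R * (d * d)%:R)|) (- 128%:Z).
  apply: (bO_eq (g := fun d => (Num.sqrt ((pn d)%:R * (d * d)%:R))^-1)).
    by move=> d; rewrite normrM s1 mul1r ger0_norm // invr_ge0 sqrtr_ge0.
  apply: (bO_inv (c := Num.sqrt (alpha / 2))); first by rewrite sqrtr_gt0 divr_gt0.
  have [d0 H] := pn_bounds; exists d0 => d /H[d1 _ _ h].
  have t0 : 0 <= th d by exact: powR_ge0.
  have x0 : 0 <= th d ^+ 128 by exact: exprn_ge0.
  rewrite nE; move: x0 h; set x := th d ^+ 128 => x0 h.
  have sq (c : R) : 0 <= c -> Num.sqrt c * x = Num.sqrt (c * x * x).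
    by move=> c0; rewrite -mulrA sqrtrM // -[x * x]expr2 sqrtr_sqr ger0_norm.
  rewrite sq; last by rewrite divr_ge0 // ltW.
  by rewrite ler_wsqrtr //; exact: (ler_wpM2r x0 h).
have b2 : bO (fun d => 16 * (th d ^+ 33) ^+ 2 + 1) 66%:Z.
  apply: bO_add; last by apply: (bO_weak (m := 0)) => //; exact: bO_cst.
  by apply: bO_c => //; exact: (bO_exp 2 (bO_th R 33)).
exact: (bO_mulw (m1 := - 128%:Z) (m2 := 66%:Z)) b1 b2.
Qed.

Let phi0 : 0 <= u0^-1. Proof. by rewrite invr_ge0 (le_trans ler01) // ltW. Qed.
Let Y := ((1 + u0 ^+ 2) / 2 - 1)^-1.
Let Y0 : 0 <= Y.
Proof.
rewrite invr_ge0; have : 1 < u0 ^+ 2 by rewrite exprn_egt1.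
by set x := u0 ^+ 2; lra.
Qed.

Let aN d : R := u0^-1 / (pn d)%:R.
Let kwN d : R := kzN d + aN d.
Let eN d : R := 2 * th d ^+ 4 * kwN d.
Let deltaN d : R := 2 / ((pn d)%:R * (d * d)%:R) + aN d ^+ 2.

Let bOa : bO aN (- 128%:Z). Proof. exact: bO_c. Qed.
Let bOkw : bO kwN (- 62%:Z).
Proof. by apply: bO_add => //; exact: (bO_weak (m := - 128%:Z)). Qed.
Let bOe : bO eN (- 58%:Z).
Proof. by apply: (bO_mulw (m1 := 4%:Z) (m2 := - 62%:Z)) => //; apply: bO_c => //; exact: bO_th. Qed.
Let bOe3 : bO (fun d => eN d ^+ 3) (- 174%:Z). Proof. exact: (bO_exp 3 bOe). Qed.
Let bOK (k : nat) : bO (fun d => (th d ^+ 4) ^+ k) (4 * k%:Z). Proof. exact: (bO_exp k (bO_th R 4)). Qed.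
Let bOdelta : bO deltaN (- 256%:Z).
Proof. by apply: bO_add; [exact: bO_c | exact: (bO_exp 2 bOa)]. Qed.

Definition errN d : R := lyap_err (d * d) (pn d)%:R (nuN d) (kzN d) u0^-1 (th d ^+ 4)
  ((th d ^+ 32) ^+ 2) (th d ^+ 32) Y.

(** The point is to get below th^(-128), the order of 1/p, so that p accumulated errors vanish. The
    largest contribution is [2 * sD * err1], of order 32 - 168 = -136. *)
Let bOerr : bO errN (- 129%:Z).
Proof.
have b_e3K : bO (fun d => eN d ^+ 3 * th d ^+ 4) (- 168%:Z).
  exact: (bO_mulw (m1 := - 174%:Z) (m2 := 4%:Z)) bOe3 (bO_th R 4).
have b_err1 : bO (fun d => err1 (d * d) (pn d)%:R (nuN d) (kzN d) u0^-1 (th d ^+ 4)) (- 168%:Z).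
  apply: bO_add => //; apply: bO_add; first apply: bO_add.
  - by apply: (bO_mulw (m1 := - 256%:Z) (m2 := 12%:Z)) (bOK 3) => //; exact: bO_c.
  - by apply: (bO_mulw (m1 := - 180%:Z) (m2 := 8%:Z)) (bOK 2) => //; exact: bO_c.
  by apply: (bO_mulw (m1 := 12%:Z) (m2 := - 180%:Z)) bOnu => //; apply: bO_c => //; exact: (bOK 3).
have b_pn2 : bO (fun d => 3 / ((pn d)%:R * (d * d)%:R ^+ 2) : R) (- 384%:Z).
  apply: (@bO_c 3) => //; apply: (bO_eq (g := fun d => ((pn d)%:R)^-1 * ((d * d)%:R)^-1 ^+ 2)).
    by move=> d; rewrite invfM exprVn.
  exact: (bO_mulw (m1 := - 128%:Z) (m2 := - 256%:Z)) bOpV (bO_exp 2 bOnV).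
have b_a2 : bO (fun d => aN d ^+ 2) (- 256%:Z) by exact: (bO_exp 2 bOa).
have b_kw2 c : 0 <= c -> bO (fun d => c * kwN d ^+ 2) (- 124%:Z).
  by move=> c0; apply: bO_c => //; exact: (bO_exp 2 bOkw).
have b_err1' : bO (fun d => err1' (d * d) (pn d)%:R (kzN d) u0^-1 (th d ^+ 4)) (- 224%:Z).
  rewrite /err1'; apply: bO_c => //; apply: bO_add; first apply: bO_add; first apply: bO_add.
  - exact: (bO_mulw (m1 := - 384%:Z) (m2 := 16%:Z)) b_pn2 (bOK 4).
  - exact: (bO_mulw (m1 := - 256%:Z) (m2 := 16%:Z)) b_a2 (bOK 4).
  - by apply: (bO_exp (m := - 112%:Z) 2); exact: (bO_mulw (m1 := - 124%:Z) (m2 := 12%:Z)) (b_kw2 4 _) (bOK 3).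
  by apply: (bO_weak (m := - 168%:Z * 2%:Z)) => //; exact: (bO_exp 2 b_e3K).
have b_rem2 : bO (fun d => rem2 (pn d)%:R (kzN d) u0^-1 (th d ^+ 4) Y) (- 174%:Z).
  rewrite /rem2; apply: (bO_mulw (m1 := - 174%:Z) (m2 := 0)) => //; last by apply: bO_cst; rewrite addr_ge0.
  by apply: bO_c => //; rewrite /expand_const !addr_ge0 // !mulr_ge0 ?exprn_ge0.
have b_err2 : bO (fun d => err2 (d * d) (pn d)%:R (nuN d) (kzN d) u0^-1 (th d ^+ 4) Y) (- 168%:Z).
  apply: bO_add; last exact: (bO_weak (m := - 174%:Z)) b_rem2.
  apply: bO_add.
    by apply: (bO_mulw (m1 := - 256%:Z) (m2 := 16%:Z)) (bOK 4) => //; exact: bO_c.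
  by apply: (bO_mulw (m1 := - 180%:Z) (m2 := 12%:Z)) (bOK 3) => //; exact: bO_c.
have b_err2' : bO (fun d => err2' (d * d) (pn d)%:R (kzN d) u0^-1 (th d ^+ 4) Y) (- 216%:Z).
  rewrite /err2'; apply: bO_c => //; apply: bO_add; first apply: bO_add.
  - apply: bO_c => //; apply: bO_add.
      exact: (bO_mulw (m1 := - 384%:Z) (m2 := 24%:Z)) b_pn2 (bOK 6).
    exact: (bO_mulw (m1 := - 256%:Z) (m2 := 24%:Z)) b_a2 (bOK 6).
  - by apply: (bO_exp (m := - 108%:Z) 2); exact: (bO_mulw (m1 := - 124%:Z) (m2 := 16%:Z))
      (b_kw2 16 _) (bOK 4).
  by apply: (bO_weak (m := - 174%:Z * 2%:Z)) => //; exact: (bO_exp 2 b_rem2).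
rewrite /errN /lyap_err; apply: bO_add; last by apply: (bO_weak (m := - 180%:Z)).
apply: bO_add; last first.
  apply: bO_c => //; apply: (bO_weak (m := - 128%:Z * 2%:Z)) => //; apply: (bO_exp 2).
  by apply: bO_c => //; exact: exprn_ge0.
apply: bO_add; last by apply: bO_c => //; by apply: (bO_weak (m := - 216%:Z)).
apply: bO_add.
  apply: bO_add.
    by apply: (bO_mulw (m1 := 32%:Z) (m2 := - 168%:Z)) b_err1 => //; apply: bO_c => //; exact: bO_th.
  by apply: (bO_mulw (m1 := 64%:Z) (m2 := - 224%:Z)) b_err1' => //; exact: (bO_exp 2 (bO_th R 32)).
apply: bO_c => //; apply: bO_add; first apply: bO_add.
- by apply: (bO_weak (m := - 168%:Z)).
- apply: (bO_mulw (m1 := 4%:Z) (m2 := - 160%:Z)) => //.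
    apply: (bO_mulw (m1 := 4%:Z) (m2 := 0)) => //; first by apply: bO_c => //; exact: bO_th.
    by apply: bO_cst; rewrite addr_ge0.
  apply: (bO_eq (g := fun d => (th d ^+ 32)^-1 * ((pn d)%:R)^-1)); first by move=> d; rewrite invfM.
  exact: (bO_mulw (m1 := - 32%:Z) (m2 := - 128%:Z)) (bOthV 32) bOpV.
apply: (bO_mulw (m1 := - 180%:Z) (m2 := 0)) => //; apply: bO_cst; exact: exprn_ge0.
Qed.

Let bO_ev f (m : int) (c : R) : 0 < c -> m <= -1 -> bO f m -> exists d0, forall d, (d0 <= d)%N -> f d <= c.
Proof. by move=> c0 m1 bf; exact: (bO_to0 m1 bf c0). Qed.

Lemma barrier_parameters (eps : R) : 0 < eps -> exists d0, forall d, (d0 <= d)%N ->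
  (0 < d)%N /\ (0 < pn d)%N /\
  [/\ 2 * th d ^+ 4 * (kzN d + u0^-1 / (pn d)%:R) <= 1,
      (2 / ((pn d)%:R * (d * d)%:R) + (u0^-1 / (pn d)%:R) ^+ 2) * (th d ^+ 4) ^+ 2 <= (pn d)%:R^-1,
      nuN d * th d ^+ 4 <= (pn d)%:R^-1,
      (2 * th d ^+ 4 * (kzN d + u0^-1 / (pn d)%:R)) ^+ 3 <= (pn d)%:R^-1 &
      [/\ 0 <= errN d, expR (rate u0 (2 ^ 6)) * ((d * d)%:R^-1 + (pn d)%:R * errN d) <= eps,
          piN d <= nuN d & (th d ^+ 32)^-1 <= eps]].
Proof.
move=> e0.
have E1 := bO_ev (ltr01 : 0 < 1) (isT : - 58%:Z <= -1) bOe.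
have E2 := bO_ev (ltr01 : 0 < 1) (isT : - 120%:Z <= -1)
  (bO_mulw (isT : 128%:Z + - 248%:Z <= - 120%:Z) bOp
    (bO_mulw (isT : - 256%:Z + 4 * 2%:Z <= - 248%:Z) bOdelta (bOK 2))).
have E3 := bO_ev (ltr01 : 0 < 1) (isT : - 48%:Z <= -1)
  (bO_mulw (isT : 128%:Z + - 176%:Z <= - 48%:Z) bOp
    (bO_mulw (isT : - 180%:Z + 4%:Z <= - 176%:Z) bOnu (bO_th R 4))).
have E4 := bO_ev (ltr01 : 0 < 1) (isT : - 46%:Z <= -1)
  (bO_mulw (isT : 128%:Z + - 174%:Z <= - 46%:Z) bOp bOe3).
have b5 : bO (fun d => (d * d)%:R^-1 + (pn d)%:R * errN d : R) (-1).
  apply: bO_add; first exact: (bO_weak (m := - 128%:Z)) bOnV.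
  exact: (bO_mulw (m1 := 128%:Z) (m2 := - 129%:Z)) bOp bOerr.
have E5 := bO_ev e0 (lexx _) (bO_c (expR_ge0 (rate u0 (2 ^ 6))) b5).
have E6 := bO_ev e0 (isT : - 32%:Z <= -1) (bOthV 32).
have E7 : exists d0, forall d, (d0 <= d)%N -> 0 <= errN d.
  by have [c [d0 [_ H]]] := bOerr; exists d0 => d /H/andP[].
have [d0 H] := large2 (large2 (large2 pn_bounds E7) (large2 E1 E2)) (large2 (large2 E3 E4) (large2 E5 E6)).
exists d0 => d /H[[[[d1 p1 _ _] e7] [e1 e2]] [[e3 e4] [e5 e6]]].
have p0 : 0 < (pn d)%:R :> R by rewrite ltr0n.
have inv (x : R) : (pn d)%:R * x <= 1 -> x <= (pn d)%:R^-1.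
  by move=> h; rewrite -[X in _ <= X]mulr1 ler_pdivlMl.
split=> //; split=> //; split; [exact: e1 | exact: inv e2 | exact: inv e3 | exact: inv e4 |].
split=> //; rewrite /nuN lerDl.
have pi0 : 0 <= piN d by rewrite /piN !mulr_ge0 ?expR_ge0 ?sqr_ge0.
have t0 : 0 <= th d ^+ 180 by rewrite exprn_ge0 // powR_ge0.
apply: mulr_ge0; first by rewrite mulr_ge0 // invr_ge0 mulr_ge0.
apply: mulr_ge0; first exact: exprn_ge0.
apply: addr_ge0 => //; apply: addr_ge0; first exact: mulr_ge0.
by apply: divr_ge0 => //; apply: mulr_ge0 => //; exact: exprn_ge0.
Qed.
End ScalingRegime.

(** [barrier_prob] and [good_edge] with the parameters instantiated: from some [d] on, uniformly
    over the probability spaces and Gaussian matrices. *)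
Lemma barrier (R : realType) (alpha u0 sgn eps : R) : 0 < alpha -> 1 < u0 -> sgn ^+ 2 = 1 -> 0 < eps ->
  exists d0, forall d, (d0 <= d)%N -> forall (dT : measure_display) (T : measurableType dT)
    (P : probability T R) (kap : R) (p : nat) (g : 'I_(d * d) * 'I_p.+1 -> T -> R[i]),
  p.+1 = Num.truncn (alpha * d%:R ^+ 2) -> (forall e, entry_ok P kap (g e)) ->
  mutually_independent P (pairX g) -> kap * kap = kap -> 0 <= kap -> kap <= 1 ->
  exists gd : T -> bool, [/\ measurable_fun setT gd, Ex P (fun w => (~~ gd w)%:R) <= eps &
    forall w, gd w -> exists Pm l, [/\ hermd (Sj g sgn p.+1 w) Pm l,
      forall i, l i < u0 + u0^-1 & `|Xq (u0 + u0^-1) l 1 - u0^-1| <= eps]].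
Proof.
move=> a0 u01 s2 e0; have [d0 H] := barrier_parameters a0 u01 s2 e0.
exists d0 => d /H[d1 [_ [h1 h2 h3 h4 [h5 h6 h7 h8]]]] dT T P kap p g pE gok gind k2 k0 k1.
rewrite /errN /nuN /kzN in h1 h2 h3 h4 h5 h6 h7.
rewrite /pn -pE in h1 h2 h3 h4 h5 h6 h7.
have t1 := th_ge1 R d1.
have t0 : 0 < th R d by exact: lt_le_trans t1.
have tau0 : 0 <= th R d ^+ 33 by rewrite exprn_ge0 // ltW.
have K1 : 1 <= th R d ^+ 4 by rewrite exprn_ege1.
have sD0 : 0 < th R d ^+ 32 by rewrite exprn_gt0.
have L0 : 0 < th R d ^+ 180 by rewrite exprn_gt0.
have KsD : th R d ^+ 4 <= th R d ^+ 32 by rewrite ler_weXn2l.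
have nKq : (d * d)%:R ^+ 2 <= (th R d ^+ 4) ^+ (2 ^ 6).
  rewrite natrM -th_exp -exprD -!exprM; apply: ler_weXn2l => //.
have Hpi : 4 * ((8 * d + 1)%:R ^+ d) ^+ 2 * expR (- (th R d ^+ 33) ^+ 2 / 2) <= piN R d by [].
have pi0 : 0 <= piN R d by rewrite /piN !mulr_ge0 ?expR_ge0 ?sqr_ge0.
set nu := piN R d + _ in h3 h5 h6 h7.
have Hnu' : 2 * (p.+1%:R * (d * d)%:R)^-1 *
  (d%:R ^+ 4 * (th R d ^+ 180 * piN R d + 24 * 2 ^+ 10 / th R d ^+ 180 + piN R d)) <= nu.
  by rewrite /nu lerDr.
have pr := barrier_prob gok gind k2 k0 k1 d1 s2 u01 tau0 K1 (erefl (2 ^ 6)%N) nKq sD0 KsD L0 Hpi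
  Hnu' h7 h1 h2 h3 h4 h5 (lexx _).
exists (good g sgn u0 (th R d ^+ 33) (th R d ^+ 32) (2 ^ 6) p.+1); split.
- exact: (measurable_goodT gok).
- exact: le_trans pr h6.
move=> w /(good_edge d1 u01 tau0 K1 (erefl (2 ^ 6)%N) nKq sD0 h1)[Pm [l [hS hl hX]]].
exists Pm, l; split=> //; apply: le_trans h8.
by rewrite -[X in _ <= X]mulr1 ler_pdivlMl.
Qed.

(** * From resolvent traces to the edge of the spectrum *)

Lemma resolvent_gap (R : realFieldType) (n : nat) (l : 'I_n -> R) (u v del : R) : (0 < n)%N -> 0 < del ->
  2 < u -> u <= v -> (forall i, l i <= 2 - del) ->
  (\sum_i (u - l i)^-1) / n%:R - (\sum_i (v - l i)^-1) / n%:R <= (v - u) / del ^+ 2.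
Proof.
move=> n0 d0 u2 uv hl; have nR : 0 < n%:R :> R by rewrite ltr0n.
rewrite -mulrBl -sumrB ler_pdivrMr //.
apply: (@le_trans _ _ (\sum_(i < n) (v - u) / del ^+ 2)); last first.
  by rewrite sumr_const card_ord -[X in X <= _]mulr_natr.
apply: ler_sum => i _; have h := hl i.
have ul : del <= u - l i by lra.
have vl : del <= v - l i by lra.
have ul0 : 0 < u - l i by exact: lt_le_trans ul.
have vl0 : 0 < v - l i by exact: lt_le_trans vl.
have -> : (u - l i)^-1 - (v - l i)^-1 = (v - u) / ((u - l i) * (v - l i)).
  by field; rewrite !gt_eqF.
apply: ler_wpM2l; first by rewrite subr_ge0.
rewrite lef_pV2 ?posrE ?mulr_gt0 ?exprn_gt0 // expr2; apply: ler_pM => //; exact: ltW.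
Qed.

(** If the spectrum stayed below 2 - del, the normalised resolvent trace would be Lipschitz with
    constant del^(-2) beyond 2. But u(x) = x + 1/x is stationary at 1, so the two points differ by
    order h^2, while the traces, close to 1/(1+h) and 1/(1+2h), differ by order h. *)
Lemma edge_lower (R : realFieldType) (n : nat) (l : 'I_n -> R) (del h : R) : (0 < n)%N -> 0 < del ->
  0 < h -> h <= 1 -> 3 * h + 2 * h ^+ 2 <= del ^+ 2 / 2 ->
  let u x := x + x^-1 : R in
  `|(\sum_i (u (1 + h) - l i)^-1) / n%:R - (1 + h)^-1| <= h / 25 ->
  `|(\sum_i (u (1 + 2 * h) - l i)^-1) / n%:R - (1 + 2 * h)^-1| <= h / 25 ->
  exists i, 2 - del < l i.
Proof.
move=> n0 d0 h0 h1 hd u H1 H2; apply: contrapT => nE.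
have hl i : l i <= 2 - del by rewrite leNgt; apply/negP => lt; apply: nE; exists i.
set a := 1 + h in H1 *; set b := 1 + 2 * h in H2 *.
have a1 : 1 < a by rewrite /a; lra.
have b1 : 1 < b by rewrite /b; lra.
have an : a != 0 by rewrite gt_eqF // (lt_trans ltr01).
have bn : b != 0 by rewrite gt_eqF // (lt_trans ltr01).
have a0 : 0 < a by lra.
have b0 : 0 < b by lra.
have u2 : 2 < u a.
  rewrite /u -subr_gt0 (_ : a + a^-1 - 2 = (a - 1) ^+ 2 / a); last by field.
  by rewrite divr_gt0 // exprn_gt0 // subr_gt0.
have uvE : u b - u a = h * (a * b - 1) / (a * b).
  rewrite /u (_ : h = b - a); last by rewrite /a /b; ring.
  by field; rewrite an bn.
have ab1 : a * b - 1 = 3 * h + 2 * h ^+ 2 by rewrite /a /b; ring.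
have h2 : 0 < h ^+ 2 by rewrite exprn_gt0.
have ab0 : 0 < a * b by rewrite mulr_gt0.
have uv : u a <= u b.
  rewrite -subr_ge0 uvE divr_ge0 ?(ltW ab0) // mulr_ge0 ?(ltW h0) // ab1.
  by move: h0 h2; set x := h ^+ 2; lra.
have G := resolvent_gap n0 d0 u2 uv hl.
have dab : a^-1 - b^-1 = h / (a * b).
  rewrite (_ : h = b - a); last by rewrite /a /b; ring.
  by field; rewrite an bn.
have d20 : 0 < del ^+ 2 by rewrite exprn_gt0.
have gap : (u b - u a) / del ^+ 2 <= h / (a * b) / 2.
  rewrite uvE ler_pdivrMr // (_ : h * (a * b - 1) / (a * b) = h / (a * b) * (a * b - 1)); last by ring.
  rewrite (_ : h / (a * b) / 2 * _ = h / (a * b) * (del ^+ 2 / 2)); last by ring.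
  by apply: ler_wpM2l; [rewrite divr_ge0 // ltW | rewrite ab1].
(* Half of h/(a b) is at least h/12, larger than the total tolerance 2h/25; this is why the
   hypotheses have h/25. *)
have h6 : h / 6 <= h / (a * b).
  apply: ler_wpM2l; first exact: ltW.
  rewrite lef_pV2 ?posrE //; have h21 : h ^+ 2 <= 1 by rewrite exprn_ile1 // ltW.
  have abE : a * b = 1 + (3 * h + 2 * h ^+ 2) by rewrite -ab1; ring.
  by rewrite abE; move: h21; set x := h ^+ 2; lra.
move: H1 H2 G gap h6 dab; rewrite !ler_norml => /andP[x1 x2] /andP[y1 y2].
set X := _ / n%:R in x1 x2 *; set X' := _ / n%:R in y1 y2 *.
set z := h / (a * b); set v := _ / del ^+ 2; set ia := a^-1; set ib := b^-1.
by move: x1 x2 y1 y2; rewrite -/ia -/ib; lra.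
Qed.

(** One barrier with u0 = 1 + h bounds the spectrum above, and together with a second one at u0 = 1
    + 2h it produces an eigenvalue near 2. Each barrier fails with probability at most eps/2. *)
Lemma edge (R : realType) (alpha sgn del eps : R) : 0 < alpha -> sgn ^+ 2 = 1 -> 0 < del -> 0 < eps ->
  exists d0, forall d, (d0 <= d)%N -> forall (dT : measure_display) (T : measurableType dT)
    (P : probability T R) (kap : R) (p : nat) (g : 'I_(d * d) * 'I_p.+1 -> T -> R[i]),
  p.+1 = Num.truncn (alpha * d%:R ^+ 2) -> (forall e, entry_ok P kap (g e)) ->
  mutually_independent P (pairX g) -> kap * kap = kap -> 0 <= kap -> kap <= 1 ->
  exists gd : T -> bool, [/\ measurable_fun setT gd, Ex P (fun w => (~~ gd w)%:R) <= eps &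
    forall w, gd w -> exists Pm l, [/\ hermd (Sj g sgn p.+1 w) Pm l,
      forall i, l i < 2 + del & exists i, 2 - del < l i]].
Proof.
move=> a0 s2 d0 e0.
(* h <= del^2 / 10 and h <= 1 give 3h + 2h^2 <= 5h <= del^2 / 2, and h <= del turns the barrier
   bound 2 + h into 2 + del. *)
pose h : R := Num.min (Num.min 1 (del ^+ 2 / 10)) (Num.min del 1).
have d20 : 0 < del ^+ 2 by rewrite exprn_gt0.
have h0 : 0 < h by rewrite /h !lt_min ltr01 d0 divr_gt0.
have h1 : h <= 1 by rewrite /h !ge_min lexx.
have h2 : h <= del ^+ 2 / 10 by rewrite /h !ge_min lexx !orbT.
have hdel : h <= del by rewrite /h !ge_min lexx !orbT.
have hh : h ^+ 2 <= h by rewrite expr2 ler_piMl // ltW.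
have hd : 3 * h + 2 * h ^+ 2 <= del ^+ 2 / 2.
  by move: h2 hh; set x := h ^+ 2; set y := del ^+ 2; lra.
pose e := Num.min (eps / 2) (h / 25).
have ee : 0 < e by rewrite lt_min !divr_gt0.
have e1 : e <= eps / 2 by rewrite ge_min lexx.
have e2 : e <= h / 25 by rewrite ge_min lexx orbT.
have u1 : 1 < 1 + h by rewrite ltrDl.
have u2 : 1 < 1 + 2 * h by rewrite ltrDl mulr_gt0.
have [d1 H1] := barrier a0 u1 s2 ee; have [d2 H2] := barrier a0 u2 s2 ee.
exists (maxn (maxn d1 d2) 1) => d; rewrite !geq_max => /andP[/andP[dd1 dd2] dd]
  dT T P kap p g pE gok gind k2 k0 k1.
have [g1 [mg1 E1 G1]] := H1 d dd1 dT T P kap p g pE gok gind k2 k0 k1.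
have [g2 [mg2 E2 G2]] := H2 d dd2 dT T P kap p g pE gok gind k2 k0 k1.
have In (b : T -> bool) : measurable_fun setT b -> itg P (fun w => (~~ b w)%:R).
  move=> mb; apply: (itg_le _ _ (itg_cst P 1)) => [|w]; last by case: (b w); rewrite ?normr0 ?normr1.
  rewrite (_ : (fun w => _) = (fun w => if b w then 0 else 1)); last first.
    by apply/funext => w; case: (b w).
  exact: measurable_fun_ifT.
have m12 : measurable_fun setT (fun w => g1 w && g2 w) by exact: measurable_and.
exists (fun w => g1 w && g2 w); split=> //.
  apply: le_trans (Ex_le (In _ m12) (itgD (In _ mg1) (In _ mg2)) _) _.
    by move=> w; case: (g1 w); case: (g2 w); rewrite /= ?addr0 ?add0r ?lexx ?ler01 // lerDl ler01.
  rewrite (ExD (In _ mg1) (In _ mg2)); apply: le_trans (lerD E1 E2) _.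
  by move: e1; lra.
move=> w /andP[/G1[Pm [l [hS hl hX]]] /G2[Pm' [l' [hS' hl' hX']]]].
exists Pm, l.
have uu : (1 + h) + (1 + h)^-1 <= 2 + h.
  have : (1 + h)^-1 <= 1 by rewrite invf_le1; lra.
  by lra.
have uv : (1 + h) + (1 + h)^-1 <= (1 + 2 * h) + (1 + 2 * h)^-1.
  rewrite -subr_ge0 (_ : _ - _ = h * ((1 + h) * (1 + 2 * h) - 1) / ((1 + h) * (1 + 2 * h))).
    rewrite divr_ge0 //; last by rewrite mulr_ge0 //; lra.
    apply: mulr_ge0; first exact: ltW.
    rewrite (_ : _ - 1 = 3 * h + 2 * h ^+ 2); last by ring.
    by have := sqr_ge0 h; set x := h ^+ 2; lra.
  by field; apply/andP; split; rewrite gt_eqF //; lra.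
split=> //; first by move=> i; have := hl i; lra.
(* The two barriers come with separate diagonalisations of the same matrix; they are reconciled
   through [Xf], which does not mention eigenvalues. *)
have hXl : Xq (1 + 2 * h + (1 + 2 * h)^-1) l' 1 = Xq (1 + 2 * h + (1 + 2 * h)^-1) l 1.
  rewrite -(Xf_Xq 1 hS'); last by move=> i; rewrite subr_gt0.
  by rewrite (Xf_Xq 1 hS) // => i; rewrite subr_gt0; exact: lt_le_trans uv.
rewrite hXl in hX'.
have n0 : (0 < d * d)%N by rewrite muln_gt0 dd.
have XE (u : R) : Xq u l 1 = (\sum_i (u - l i)^-1) / (d * d)%:R.
  by rewrite /Xq /psum; congr (_ / _); apply: eq_bigr => i _; rewrite expr1.
rewrite !XE in hX hX'.
exact: (edge_lower n0 d0 h0 h1 hd (le_trans hX e2) (le_trans hX' e2)).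
Qed.

(** Gives (1 - x)^m <= 1 / (1 + m x), an explicit decay from which a suitable power is found without
    limits. *)
Lemma bernoulli_decay (R : realFieldType) (x : R) (m : nat) : 0 <= x -> x <= 1 ->
  (1 - x) ^+ m * (1 + m%:R * x) <= 1.
Proof.
move=> x0 x1; elim: m => [|m IH]; first by rewrite expr0 mul0r addr0 mulr1.
apply: le_trans IH; rewrite exprS -mulrA mulrCA; apply: ler_wpM2l; first by rewrite exprn_ge0 // subr_ge0.
rewrite -subr_ge0 (_ : _ - _ = m%:R * (x * x) + x * x); last by rewrite -natr1; ring.
by rewrite addr_ge0 ?mulr_ge0.
Qed.

                                                                       

(** * Measurability of the extreme eigenvalues *)

Section Positivity.
Variables (R : realType) (n : nat).
Local Notation C := R[i].

(** Positivity of all eigenvalues becomes a countable union of inequalities between traces of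
    powers, hence a measurable condition requiring no measurable choice of eigenvalues. If all lie
    in [c, u - c], the power sum is at most n (u - c)^(2m), which drops below u^(2m) for large m;
    conversely, one eigenvalue <= 0 already makes the sum too large. *)
Lemma positive_power_sums (l : 'I_n -> R) : (forall i, 0 < l i) <->
  exists u m : nat, \sum_i (u.+1%:R - l i) ^+ (2 * m) < u.+1%:R ^+ (2 * m).
Proof.
split=> [l0|[u [m h]] i]; last first.
  have u0 : 0 < u.+1%:R :> R by rewrite ltr0n.
  rewrite ltNge; apply/negP => li; move: h; apply/negP; rewrite -leNgt.
  apply: (@le_trans _ _ ((u.+1%:R - l i) ^+ (2 * m))).
    by rewrite lerXn2r ?nnegrE ?(ltW u0) //; lra.
  rewrite (bigD1 i) //= lerDl; apply: sumr_ge0 => k _; rewrite exprM exprn_ge0 //; exact: sqr_ge0.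
(* A positive lower bound of all the [l i]; the added 1 keeps it meaningful when there are none. *)
pose c := (\sum_i (l i)^-1 + 1)^-1.
have s0 : 0 <= \sum_i (l i)^-1 by apply: sumr_ge0 => i _; rewrite invr_ge0 ltW.
have c0 : 0 < c by rewrite invr_gt0 (lt_le_trans ltr01) // lerDr.
have cl i : c <= l i.
  rewrite -[l i]invrK lef_pV2 ?posrE ?invr_gt0 //; last by rewrite (lt_le_trans ltr01) // lerDr.
  apply: (@le_trans _ _ (\sum_i (l i)^-1)); last by rewrite lerDl.
  by rewrite (bigD1 i) //= lerDl; apply: sumr_ge0 => k _; rewrite invr_ge0 ltW.
pose u := Num.truncn (\sum_i l i + c).
have u0 : 0 < u.+1%:R :> R by rewrite ltr0n.
have lu i : l i + c <= u.+1%:R.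
  apply: (@le_trans _ _ (\sum_i l i + c)); last by apply: ltW; exact: truncnS_gt.
  by rewrite lerD2r (bigD1 i) //= lerDl; apply: sumr_ge0 => k _; exact: ltW.
have cu : c <= u.+1%:R.
  apply: (@le_trans _ _ (\sum_i l i + c)); last by apply: ltW; exact: truncnS_gt.
  by rewrite lerDr; apply: sumr_ge0 => k _; exact: ltW.
pose x := c / u.+1%:R.
have x0 : 0 < x by rewrite divr_gt0.
have x1 : x <= 1 by rewrite ler_pdivrMr // mul1r.
pose m := Num.truncn (n%:R / x); exists u, m.+1.
have cE : u.+1%:R - c = u.+1%:R * (1 - x) by rewrite /x; field; rewrite gt_eqF.
apply: (@le_lt_trans _ _ (\sum_(i < n) (u.+1%:R * (1 - x)) ^+ (2 * m.+1))).
  apply: ler_sum => i _; rewrite -cE; have := lu i; have := cl i => h1 h2.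
  by rewrite lerXn2r ?nnegrE //; lra.
rewrite sumr_const card_ord -[X in X < _]mulr_natr exprMn -mulrA -[X in _ < X]mulr1 ltr_pM2l ?exprn_gt0 //.
have y0 : 0 <= 1 - x by rewrite subr_ge0.
have B := @bernoulli_decay R x (2 * m.+1) (ltW x0) x1.
have nm : n%:R < (2 * m.+1)%:R * x.
  rewrite -ltr_pdivrMr //; apply: (@lt_le_trans _ _ m.+1%:R); first exact: truncnS_gt.
  by rewrite ler_nat leq_pmull.
have [z|z] := ltP 0 ((1 - x) ^+ (2 * m.+1)); last first.
  by rewrite (le_lt_trans _ ltr01) // mulr_le0_ge0.
apply: lt_le_trans B; rewrite ltr_pM2l //; apply: lt_trans nm _.
by rewrite ltrDr.
Qed.

Variable (d : measure_display) (T : measurableType d) (A : T -> 'M[C]_n) (l : T -> 'I_n -> R).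
Hypothesis mA : mmeas A.
Hypothesis hA : forall w, exists Pm, hermd (A w) Pm (l w).

Lemma measurable_positive : measurable [set w | forall i, 0 < l w i].
Proof.
have -> : [set w | forall i, 0 < l w i] = \bigcup_u \bigcup_m
    [set w | complex.Re (\tr (((u.+1%:R : R)%:C%:M - A w) ^+ (2 * m))) < u.+1%:R ^+ (2 * m)].
  apply/seteqP; split=> [w /positive_power_sums[u [m h]]|w [u _ [m _ h]]].
    exists u => //; exists m => //=; have [Pm hw] := hA w.
    by rewrite (hermd_tr (hermd_shift hw u.+1%:R)).
  apply/positive_power_sums; exists u, m; have [Pm hw] := hA w.
  by move: h => /=; rewrite (hermd_tr (hermd_shift hw u.+1%:R)).
apply: bigcup_measurable => u _; apply: bigcup_measurable => m _.
have mf : measurable_fun setT (fun w => complex.Re (\tr (((u.+1%:R : R)%:C%:M - A w) ^+ (2 * m)))).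
  apply: (cmeas_tr _).1; apply: mmeasX; apply: mmeasD; first exact: mmeas_cst.
  rewrite (_ : (fun w => - A w) = (fun w => (-1) *: A w)); first exact: mmeasZ.
  by apply/funext => w; rewrite scaleN1r.
have mc : measurable_fun setT (fun _ : T => u.+1%:R ^+ (2 * m) : R) by exact: measurable_cst.
have := measurable_fun_ltr mf mc.
by move=> /(_ measurableT [set true] I); rewrite setTI.
Qed.

End Positivity.

Section ExtremeMeasurable.
Variables (R : realType) (n : nat) (d : measure_display) (T : measurableType d).
Local Notation C := R[i].
Variable A : T -> 'M[C]_n.
Hypotheses (n0 : (0 < n)%N) (mA : mmeas A) (hA : forall w, A w \is hermsymmx).

(** Eigenvalues are chosen pointwise, with no measurability of the choice; [measurable_positive]
    sees them only through traces. *)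
Let spec : exists l : T -> 'I_n -> R, forall w, exists Pm, hermd (A w) Pm (l w).
Proof.
have H w : exists l : 'I_n -> R, exists Pm, hermd (A w) Pm l.
  have : (A w)^t* = A w.
    by have /is_hermitianmxP := hA w; rewrite expr0 scale1r => <-.
  by move=> /herm_hermd[Pm [l h]]; exists l, Pm.
by exists (fun w => projT1 (cid (H w))) => w; exact: (projT2 (cid (H w))).
Qed.

Let mA_shift (t s : R) : mmeas (fun w => t%:C%:M - (s%:C%:M - A w)).
Proof.
rewrite (_ : (fun w => _) = (fun w => (t - s)%:C%:M + A w)).
  by apply: mmeasD => //; exact: mmeas_cst.
apply/funext => w; have -> : (t - s)%:C%:M = t%:C%:M - s%:C%:M :> 'M[C]_n.
  by rewrite rmorphB raddfB.
by rewrite opprB addrA [RHS]addrAC.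
Qed.

Let mA_shift1 (t : R) : mmeas (fun w => t%:C%:M - A w).
Proof.
apply: mmeasD; first exact: mmeas_cst.
rewrite (_ : (fun w => - A w) = (fun w => (-1) *: A w)); first exact: mmeasZ.
by apply/funext => w; rewrite scaleN1r.
Qed.

Lemma measurable_lambda_max_lt (t : R) : measurable [set w | lambda_max (A w) < t].
Proof.
have [l hl] := spec.
rewrite (_ : [set w | _] = [set w | forall i, 0 < t - l w i]).
  apply: (measurable_positive (mA_shift1 t)) => w; have [Pm h] := hl w.
  by exists Pm; exact: hermd_shift.
apply/seteqP; split=> w /=; have [Pm h] := hl w; have [e1 e2] := lambda_maxP n0 (hA w).
  by move=> lt i; rewrite subr_gt0; apply: le_lt_trans lt; apply: e2; exact: (hermd_eigen h).
by have [k] := hermd_eigenP h e1; move=> /complexI -> /(_ k); rewrite subr_gt0.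
Qed.

Lemma measurable_lambda_min_gt (t : R) : measurable [set w | t < lambda_min (A w)].
Proof.
have [l hl] := spec.
rewrite (_ : [set w | _] = [set w | forall i, 0 < 0 - (t - l w i)]).
  apply: (measurable_positive (mA_shift 0 t)) => w; have [Pm h] := hl w.
  by exists Pm; exact: hermd_shift (hermd_shift h t) 0.
apply/seteqP; split=> w /=; have [Pm h] := hl w; have [e1 e2] := lambda_minP n0 (hA w).
  move=> lt i; rewrite sub0r opprB subr_gt0; apply: lt_le_trans lt _; apply: e2.
  exact: (hermd_eigen h).
by have [k] := hermd_eigenP h e1; move=> /complexI -> /(_ k); rewrite sub0r opprB subr_gt0.
Qed.

Let archi (x : R) : 0 < x -> exists k : nat, k.+1%:R^-1 < x.
Proof.
move=> x0; exists (Num.truncn x^-1); rewrite -[x]invrK ltf_pV2 ?posrE ?invr_gt0 //.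
by rewrite invrK; exact: truncnS_gt.
Qed.

Lemma measurable_lambda_max_dev (c e : R) : measurable [set w | e < `|lambda_max (A w) - c|].
Proof.
(* Only strict sublevel sets are available so far, so the strict upper deviation is written as a
   countable union of complements. *)
rewrite (_ : [set w | _] = [set w | lambda_max (A w) < c - e] `|`
    \bigcup_k ~` [set w | lambda_max (A w) < c + e + k.+1%:R^-1]).
  apply: measurableU; first exact: measurable_lambda_max_lt.
  by apply: bigcup_measurable => k _; apply: measurableC; exact: measurable_lambda_max_lt.
apply/seteqP; split=> w /=.
  rewrite lter_normr => /orP[h|h]; last by left; lra.
  right; have [k hk] := @archi (lambda_max (A w) - c - e) ltac:(lra); exists k => //=.
  by apply/negP; rewrite -leNgt -lerBrDl opprD addrA; exact: ltW.
case=> [h|[k _ /= /negP]]; rewrite lter_normr; first by apply/orP; right; lra.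
rewrite -leNgt => h; apply/orP; left.
have : 0 < k.+1%:R^-1 :> R by rewrite invr_gt0.
by move: h; set y := k.+1%:R^-1; lra.
Qed.

Lemma measurable_lambda_min_dev (c e : R) : measurable [set w | e < `|lambda_min (A w) - c|].
Proof.
rewrite (_ : [set w | _] = [set w | c + e < lambda_min (A w)] `|`
    \bigcup_k ~` [set w | c - e - k.+1%:R^-1 < lambda_min (A w)]).
  apply: measurableU; first exact: measurable_lambda_min_gt.
  by apply: bigcup_measurable => k _; apply: measurableC; exact: measurable_lambda_min_gt.
apply/seteqP; split=> w /=.
  rewrite lter_normr => /orP[h|h]; first by left; lra.
  right; have [k hk] := @archi (c - e - lambda_min (A w)) ltac:(lra); exists k => //=.
  by apply/negP; rewrite -leNgt lerBrDr -lerBrDl; exact: ltW.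
case=> [h|[k _ /= /negP]]; rewrite lter_normr; first by apply/orP; left; lra.
rewrite -leNgt => h; apply/orP; right.
have : 0 < k.+1%:R^-1 :> R by rewrite invr_gt0.
by move: h; set y := k.+1%:R^-1; lra.
Qed.

End ExtremeMeasurable.

(** * Back to the partial transpose of a Wishart matrix *)

Section WishartEdge.
Variables (R : realType).
Local Notation C := R[i].

Lemma eigenvalue_affine n (Y : 'M[C]_n) (k x : C) : k != 0 ->
  eigenvalue (k *: (Y - 1%:M)) (k * (x - 1)) = eigenvalue Y x.
Proof.
move=> k0; apply/eigenvalueP/eigenvalueP => -[v vE v0]; exists v => //.
  move: vE; rewrite -scalemxAr -scalerA mulmxBr mulmx1 => /(scalerI k0).
  by rewrite scalerBl scale1r => /addIr.
by rewrite -scalemxAr -scalerA mulmxBr mulmx1 vE scalerBl scale1r.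
Qed.

(** The product of [G] with its adjoint is the sum of the rank-one matrices of its columns, and
    partial transposition is linear; so the final state of the process is an affine image of the
    matrix under study. *)
Lemma Sj_partial_transpose (dT : measure_display) (T : measurableType dT) (d p : nat) (sgn : R)
  (G : T -> 'M[C]_(d * d, p.+1)) (w : T) :
  Sj (fun ij w => G w ij.1 ij.2) sgn p.+1 w =
  (sgn * (p.+1%:R / Num.sqrt (p.+1%:R * (d * d)%:R)))%:C *:
    (partial_transpose (p.+1%:R^-1 *: (G w *m (G w)^t*)) - 1%:M).
Proof.
have pn0 : (p.+1%:R : C) != 0 by rewrite pnatr_eq0.
pose g (ij : 'I_(d * d) * 'I_p.+1) (w : T) := G w ij.1 ij.2.
have E : \sum_(k < p.+1) ptm g k w = p.+1%:R *: partial_transpose (p.+1%:R^-1 *: (G w *m (G w)^t*)).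
  have PT (M : 'M[C]_(d * d)) r s : partial_transpose M r s = M (swap_index r s) (swap_index s r).
    by rewrite mxE.
  apply/matrixP => r s; rewrite summxE [RHS]mxE PT.
  have -> : (p.+1%:R^-1 *: (G w *m (G w)^t*)) (swap_index r s) (swap_index s r) =
      p.+1%:R^-1 * \sum_(k < p.+1) G w (swap_index r s) k * Num.conj (G w (swap_index s r) k).
    by rewrite mxE; congr (_ * _); rewrite mxE; apply: eq_bigr => k _; rewrite !mxE.
  by rewrite mulrA mulfV // mul1r; apply: eq_bigr => k _; rewrite mxE.
transitivity (\sum_(k < p.+1) (sgn / Num.sqrt (p.+1%:R * (d * d)%:R))%:C *: (ptm g k w - 1%:M)).
  by rewrite /Sj; apply: eq_bigr => k _; rewrite /Zj /colZ inord_val.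
rewrite -scaler_sumr sumrB E sumr_const card_ord.
rewrite (_ : (1%:M : 'M[C]_(d * d)) *+ p.+1 = p.+1%:R *: 1%:M); last by rewrite scaler_nat.
rewrite -scalerBr scalerA; congr (_ *: _).
by rewrite mulrA -(rmorph_nat (real_complex R)) -rmorphM; congr (_%:C); ring.
Qed.

(** Equal to the square root of p / d^2, hence tending to sqrt(alpha). *)
Definition edge_scale (p d : nat) : R := p%:R / Num.sqrt (p%:R * (d * d)%:R).

Lemma edge_scale_lim (alpha eps : R) : 0 < alpha -> 0 < eps -> exists d0, forall d, (d0 <= d)%N ->
  let p := Num.truncn (alpha * d%:R ^+ 2) in [/\ (0 < d)%N, (0 < p)%N,
   Num.sqrt alpha / 2 <= edge_scale p d & `|(edge_scale p d)^-1 - (Num.sqrt alpha)^-1| <= eps].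
Proof.
move=> a0 e0; set s := Num.sqrt alpha.
have s0 : 0 < s by rewrite sqrtr_gt0.
have s2 : s ^+ 2 = alpha by rewrite sqr_sqrtr // ltW.
(* The two summands make 1/d^2 at most alpha / 2 and at most eps s^3 / 2, the two smallness
   conditions used below. *)
pose M := 2 / alpha + 2 / (eps * s ^+ 3).
have M1 : 0 < 2 / alpha by rewrite divr_gt0.
have M2 : 0 < 2 / (eps * s ^+ 3) by rewrite divr_gt0 // mulr_gt0 // exprn_gt0.
exists (Num.truncn M).+1 => d dM /=; set p := Num.truncn _.
have dR : M < d%:R by apply: lt_le_trans (truncnS_gt M) _; rewrite ler_nat.
have d0 : (0 < d)%N by exact: leq_trans dM.
have d1 : 1 <= d%:R :> R by rewrite ler1n.
have d20 : 0 < d%:R ^+ 2 :> R by rewrite exprn_gt0 // ltr0n.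
have dd : d%:R <= d%:R ^+ 2 :> R by rewrite expr2 ler_peMr.
have nE : (d * d)%:R = d%:R ^+ 2 :> R by rewrite natrM expr2.
have x0 : 0 <= alpha * d%:R ^+ 2 by rewrite mulr_ge0 ?ltW.
have /andP[h1 h2] := truncn_itv x0; rewrite -/p in h1 h2.
set N := d%:R ^+ 2 in d20 dd nE h1 h2 *.
have NM1 : 2 / alpha < N by move: dR dd M1 M2; rewrite /M; lra.
have NM2 : 2 / (eps * s ^+ 3) < N by move: dR dd M1 M2; rewrite /M; lra.
have aN : 2 < alpha * N by rewrite mulrC -ltr_pdivrMr.
rewrite -natr1 in h2.
have p0 : 0 < p%:R :> R by move: h2 aN; set y := p%:R; set z := alpha * N; lra.
set c := edge_scale p d.
have c0 : 0 < c by rewrite divr_gt0 // sqrtr_gt0 mulr_gt0 // nE.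
have c2 : c ^+ 2 = p%:R / N.
  rewrite /c /edge_scale exprMn exprVn sqr_sqrtr ?nE ?mulr_ge0 ?(ltW p0) ?(ltW d20) //.
  by field; rewrite !gt_eqF.
have c2u : c ^+ 2 <= alpha by rewrite c2 ler_pdivrMr.
have c2l : alpha - N^-1 <= c ^+ 2.
  rewrite c2 ler_pdivlMr // mulrBl mulVf ?gt_eqF //.
  by move: h2; set y := p%:R; set z := alpha * N; lra.
have NV : N^-1 <= alpha / 2.
  rewrite -[alpha / 2]invrK lef_pV2 ?posrE ?invr_gt0 ?divr_gt0 // invf_div; exact: ltW.
have cs : c <= s by rewrite -(@ler_pXn2r _ 2) ?nnegrE ?(ltW c0) ?(ltW s0) // s2.
have sc : s / 2 <= c.
  rewrite -(@ler_pXn2r _ 2) ?nnegrE ?(ltW c0) ?divr_ge0 ?(ltW s0) // exprMn s2 exprVn.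
  by move: c2l NV; set y := c ^+ 2; set z := N^-1; rewrite (_ : 2 ^+ 2 = 4 :> R); [lra | ring].
split=> //; first by rewrite -(ltr0n R).
have cn : c != 0 by rewrite gt_eqF.
have sn : s != 0 by rewrite gt_eqF.
have scn : s + c != 0 by rewrite gt_eqF // addr_gt0.
have E : c^-1 - s^-1 = (s ^+ 2 - c ^+ 2) / ((s + c) * (c * s)) by field; rewrite cn sn scn.
have q0 : 0 < (s + c) * (c * s) by apply: mulr_gt0; [exact: addr_gt0 | exact: mulr_gt0].
rewrite E s2 ger0_norm; last by rewrite divr_ge0 ?(ltW q0) // subr_ge0.
rewrite ler_pdivrMr //; apply: (@le_trans _ _ N^-1); first by move: c2l; lra.
have s30 : 0 < s ^+ 3 by rewrite exprn_gt0.
have pos : 0 < eps * (s ^+ 3 / 2) by rewrite mulr_gt0 // divr_gt0.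
have NVe : N^-1 <= eps * (s ^+ 3 / 2).
  rewrite -[X in _ <= X]invrK lef_pV2 ?posrE ?invr_gt0 //.
  rewrite (_ : (eps * (s ^+ 3 / 2))^-1 = 2 / (eps * s ^+ 3)); first exact: ltW.
  by field; rewrite !gt_eqF.
apply: le_trans NVe _.
rewrite ler_pM2l // (_ : s ^+ 3 / 2 = s * (s / 2 * s)); last by ring.
apply: ler_pM => //; first exact: ltW.
- by rewrite !mulr_ge0 ?invr_ge0 ?(ltW s0).
- by rewrite lerDl ltW.
by rewrite ler_pM2r.
Qed.

Lemma scaled_edge (alpha eps c t : R) : 0 < alpha -> 0 < eps -> Num.sqrt alpha / 2 <= c ->
  `|c^-1 - (Num.sqrt alpha)^-1| <= eps / 4 -> `|c * t - 2| <= eps * Num.sqrt alpha / 8 ->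
  `|t - 2 / Num.sqrt alpha| <= eps.
Proof.
set s := Num.sqrt alpha => a0 e0 sc h1 h2.
have s0 : 0 < s by rewrite sqrtr_gt0.
have c0 : 0 < c by apply: lt_le_trans sc; rewrite divr_gt0.
have -> : t - 2 / s = c^-1 * (c * t - 2) + 2 * (c^-1 - s^-1) by field; rewrite !gt_eqF.
apply: le_trans (ler_normD _ _) _; rewrite !normrM normr_nat ger0_norm ?invr_ge0 ?(ltW c0) //.
have h3 : c^-1 * `|c * t - 2| <= eps / 4.
  rewrite ler_pdivrMl //; apply: le_trans h2 _.
  rewrite (_ : eps * s / 8 = s / 2 * (eps / 4)); last by field.
  by apply: ler_wpM2r => //; rewrite divr_ge0 // ltW.
by move: h1 h3; set x := `|_|; set y := c^-1 * _; lra.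
Qed.

Lemma prob_le_Ex (dT : measure_display) (T : measurableType dT) (P : probability T R)
  (gd : T -> bool) (E : set T) (eta : R) : measurable_fun setT gd -> measurable E ->
  (forall w, E w -> ~~ gd w) -> Ex P (fun w => (~~ gd w)%:R) <= eta -> (P E <= eta%:E)%E.
Proof.
move=> mg mE Egd h.
have mgR : measurable_fun setT (fun w => (~~ gd w)%:R : R).
  rewrite (_ : (fun w => _) = (fun w => if gd w then 0 else 1)); last first.
    by apply/funext => w; case: (gd w).
  exact: measurable_fun_ifT.
have I1 : itg P (fun w => (~~ gd w)%:R).
  by apply: (itg_le mgR _ (itg_cst P 1)) => w; case: (gd w); rewrite ?normr0 ?normr1.
apply: (@le_trans _ _ (\int[P]_w ((~~ gd w)%:R : R)%:E)%E); last by rewrite ExE // lee_fin.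
have -> : P E = (\int[P]_w (\1_E w : R)%:E)%E by rewrite integral_indic // setIT.
apply: ge0_le_integral.
- exact: measurableT.
- by move=> w _; rewrite lee_fin indicE ler0n.
- by apply/measurable_EFinP; exact: measurable_indic.
- exact/measurable_EFinP.
move=> w _; rewrite lee_fin indicE; case: (boolP (w \in E)) => [|_]; last by case: (gd w).
by rewrite inE => /Egd ->.
Qed.

Lemma affine_spectrum n (Y Pm : 'M[C]_n) (k : R) (l : 'I_n -> R) : k != 0 ->
  hermd (k%:C *: (Y - 1%:M)) Pm l ->
  (forall x : R, eigenvalue Y x%:C -> exists i, l i = k * (x - 1)) /\
  (forall i, eigenvalue Y (1 + l i / k)%:C).
Proof.
move=> k0 h; have kC : k%:C != 0 :> C by rewrite (inj_eq (@complexI R)).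
have E (x : R) : (k * (x - 1))%:C = k%:C * (x%:C - 1) :> C by rewrite rmorphM rmorphB rmorph1.
split=> [x ex|i].
  have : eigenvalue (k%:C *: (Y - 1%:M)) (k * (x - 1))%:C by rewrite E eigenvalue_affine.
  by move=> /(hermd_eigenP h)[j /complexI ->]; exists j.
rewrite -(eigenvalue_affine _ _ kC) -E (_ : k * _ = l i); first exact: (hermd_eigen h).
by field.
Qed.

(** With sign 1, the eigenvalues of the final sum are c (x - 1) for x in the spectrum of [Y], and
    its top near 2 locates the largest x. With sign -1 they are c (1 - x), and the top near 2
    locates the smallest. Deviations lie in the failure event of [edge], of mean at most [eta]. *)
Lemma wishart_edge (kind : entry_kind) (alpha eps eta : R) : 0 < alpha -> 0 < eps -> 0 < eta ->
  exists d0, forall d, (d0 <= d)%N -> (0 < d)%N /\ (1 <= Num.truncn (alpha * d%:R ^+ 2))%N /\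
  forall (dT : measure_display) (T : measurableType dT) (P : probability T R) (W : T -> 'M[C]_(d * d)),
  is_wishart kind P (Num.truncn (alpha * d%:R ^+ 2)) W ->
  (P [set w | (eps < `|lambda_max (partial_transpose (W w)) - (1 + 2 / Num.sqrt alpha)|)%R] <= eta%:E)%E /\
  (P [set w | (eps < `|lambda_min (partial_transpose (W w)) - (1 - 2 / Num.sqrt alpha)|)%R] <= eta%:E)%E.
Proof.
move=> a0 e0 t0; set s := Num.sqrt alpha.
have s0 : 0 < s by rewrite sqrtr_gt0.
have del0 : 0 < eps * s / 8 by rewrite divr_gt0 // mulr_gt0.
have sg1 : (1 : R) ^+ 2 = 1 by rewrite expr1n.
have sg2 : (-1 : R) ^+ 2 = 1 by rewrite sqrrN expr1n.
have e4 : 0 < eps / 4 by rewrite divr_gt0.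
have [d1 H1] := edge a0 sg1 del0 t0; have [d2 H2] := edge a0 sg2 del0 t0.
have [d3 H3] := edge_scale_lim a0 e4.
exists (maxn (maxn d1 d2) d3) => d; rewrite !geq_max => /andP[/andP[dd1 dd2] /H3].
move=> [d0 p0 c1 c2]; split=> //; split=> // dT T P W.
move: p0 c1 c2; case pE : (Num.truncn (alpha * d%:R ^+ 2)) => [//|p] _ c1 c2 wW.
have [G gG WE] := wW.
pose g (ij : 'I_(d * d) * 'I_p.+1) (w : T) := G w ij.1 ij.2.
have [gok gind] := gaussian_matrix_entries gG.
have k2 : kind_kap R kind * kind_kap R kind = kind_kap R kind.
  by case: (kind) => /=; rewrite ?mulr1 ?mulr0.
have k0 : 0 <= kind_kap R kind by case: (kind) => /=.
have k1 : kind_kap R kind <= 1 by case: (kind) => /=.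
have [g1 [mg1 E1 G1]] := H1 d dd1 dT T P _ p g (esym pE) gok gind k2 k0 k1.
have [g2 [mg2 E2 G2]] := H2 d dd2 dT T P _ p g (esym pE) gok gind k2 k0 k1.
pose Y w := partial_transpose (W w).
have n0 : (0 < d * d)%N by rewrite muln_gt0 d0.
have hY w : Y w \is hermsymmx.
  by apply: partial_transpose_hermitian; exact: (wishart_hermitian w wW).
have mY : mmeas Y.
  move=> r q; apply: (eq_cmeas (f := fun w => p.+1%:R^-1 *
      \sum_(k < p.+1) g (swap_index r q, k) w * Num.conj (g (swap_index q r, k) w))).
    move=> w; rewrite [RHS]mxE /block_entry WE mxE; congr (_ * _).
    by rewrite mxE; apply: eq_bigr => k _; rewrite !mxE.
  apply: cmeasM; first exact: cmeas_cst.
  apply: cmeas_sum => k; apply: cmeasM; first exact: (eo_meas (gok (_, _))).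
  by apply: cmeas_conj; exact: (eo_meas (gok (_, _))).
set c := edge_scale p.+1 d in c1 c2.
have c0 : 0 < c by apply: lt_le_trans c1; rewrite divr_gt0.
have SE sgn w : Sj g sgn p.+1 w = (sgn * c)%:C *: (Y w - 1%:M).
  by rewrite /Y WE; exact: Sj_partial_transpose.
split.
  apply: (prob_le_Ex mg1 (measurable_lambda_max_dev n0 mY hY _ _)) E1.
  move=> w /= dev; apply/negP => /G1[Pm [l [hS hl [i0 hi]]]]; move: dev; apply/negP; rewrite -leNgt.
  rewrite SE mul1r in hS; have [A1 A2] := affine_spectrum (lt0r_neq0 c0) hS.
  have [x1 x2] := lambda_maxP n0 (hY w); move: x1 x2; rewrite -/(Y w); set x := lambda_max _ => x1 x2.
  have [i lE] := A1 _ x1; have h1 := hl i; have h2 := x2 _ (A2 i0).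
  have h3 : l i0 <= c * (x - 1) by rewrite mulrC -ler_pdivrMr // lerBrDl.
  rewrite opprD addrA; apply: (scaled_edge a0 e0 c1 c2); rewrite ler_norml -/s.
  by move: h1 hi h3; rewrite lE; set y := c * _; set z := eps * s / 8; lra.
apply: (prob_le_Ex mg2 (measurable_lambda_min_dev n0 mY hY _ _)) E2.
move=> w /= dev; apply/negP => /G2[Pm [l [hS hl [i0 hi]]]]; move: dev; apply/negP; rewrite -leNgt.
rewrite SE mulN1r in hS.
have cN : - c != 0 by rewrite oppr_eq0 lt0r_neq0.
have [A1 A2] := affine_spectrum cN hS.
have [x1 x2] := lambda_minP n0 (hY w); move: x1 x2; rewrite -/(Y w); set x := lambda_min _ => x1 x2.
have [i lE] := A1 _ x1; have h1 := hl i; have h2 := x2 _ (A2 i0).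
have h3 : l i0 <= c * (1 - x).
  rewrite mulrC -ler_pdivrMr //; move: h2; rewrite invrN mulrN; set y := l i0 / c; lra.
have lE' : l i = c * (1 - x) by rewrite lE; ring.
rewrite -normrN (_ : - _ = (1 - x) - 2 / s); last by ring.
apply: (scaled_edge a0 e0 c1 c2); rewrite ler_norml -/s.
by move: h1 hi h3; rewrite lE'; set y := c * _; set z := eps * s / 8; lra.
Qed.

End WishartEdge.

Theorem theorem2 (R : realType) (kind : entry_kind) (alpha : R)
    (alpha_gt0 : 0 < alpha)
    (disp : nat -> measure_display) (T : forall d : nat, measurableType (disp d))
    (P : forall d : nat, probability (T d) R)
    (W : forall d : nat, T d -> 'M[R[i]]_(d * d))
    (W_wishart : forall d : nat, (0 < d)%N ->
      (1 <= Num.truncn (alpha * d%:R ^+ 2))%N ->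
      is_wishart kind (P d) (Num.truncn (alpha * d%:R ^+ 2)) (W d)) :
  forall eps : R, 0 < eps ->
    (P d [set w : T d |
       eps < `|lambda_max (partial_transpose (W d w)) - (1 + 2 / Num.sqrt alpha)|]
       @[d --> \oo] --> (0%R)%:E) /\
    (P d [set w : T d |
       eps < `|lambda_min (partial_transpose (W d w)) - (1 - 2 / Num.sqrt alpha)|]
       @[d --> \oo] --> (0%R)%:E).
Proof.
move=> eps e0.
(* For non-negative extended reals, eventual bounds by every positive [eta] give finiteness from
   some index on and convergence to 0. *)
have cvg0 (x : nat -> \bar R) : (forall d, 0 <= x d)%E ->
    (forall eta : R, 0 < eta -> exists d0, forall d, (d0 <= d)%N -> (x d <= eta%:E)%E) ->
    x d @[d --> \oo] --> (0%R)%:E.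
  move=> x0 H; have fin d0 (eta : R) : (forall d, (d0 <= d)%N -> (x d <= eta%:E)%E) ->
      forall d, (d0 <= d)%N -> x d \is a fin_num.
    by move=> h d /h h1; rewrite ge0_fin_numE // (le_lt_trans h1) // ltry.
  apply/fine_cvgP; split.
    have [d0 H0] := H 1 ltr01; exists d0 => // d /= dd; exact: (fin _ _ H0).
  apply/cvgr0Pnorm_le => eta t0; have [d0 H0] := H _ t0; exists d0 => // d /= dd.
  rewrite ger0_norm ?fine_ge0 // -lee_fin fineK; first exact: H0.
  exact: (fin _ _ H0).
split; apply: cvg0 => [d|eta t0]; try exact: measure_ge0.
  have [d0 H] := wishart_edge kind alpha_gt0 e0 t0; exists d0 => d /H[d1 [p1 Hd]].
  exact: (Hd _ _ _ _ (W_wishart d d1 p1)).1.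
have [d0 H] := wishart_edge kind alpha_gt0 e0 t0; exists d0 => d /H[d1 [p1 Hd]].
exact: (Hd _ _ _ _ (W_wishart d d1 p1)).2.
Qed.
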